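(* Let $k\ge1$ and $0\le h<k$ be integers with $\gcd(h,k)=1$, let $Z\in\mathbb{C}$ with $\mathrm{Re}(Z)>0$, and let $z\in\mathbb{R}$ with $|kz|<\frac14$. Then \begin{multline*} \mathcal{U}_1\left(z;\frac hk+\frac{iZ}{k}\right) = -i\, \chi(M_{h,k})^{-1} (iZ)^{-\frac12}\Bigg( f_{3k}(z;-Z) \,\mathcal{U}_1\left(\frac{z}{iZ};\frac{[-h]_k}{k}+\frac{i}{kZ}\right)\\ + \frac12 f_k(z;Z) \frac{\mathcal{C}^*\left(\frac{z}{iZ}; \frac{[-h]_k}{k}+\frac{i}{kZ}\right)}{\eta\left(\frac{[-h]_k}{k}+\frac{i}{kZ}\right)} \mathcal{E}_{\frac{[-h]_k}{k}}\left(\frac{2z}{iZ};\frac{[-h]_k}{k}+\frac{i}{kZ}\right)\Bigg). \end{multline*}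
   Context: For $\tau=\tau_1+i\tau_2\in\mathbb{H}$, $z=z_1+iz_2\in\mathbb{C}$, $q=e^{2\pi i\tau}$, $\zeta=e^{2\pi iz}$, $(a;q)_\infty=\prod_{j\ge0}(1-aq^j)$. Define $\eta(\tau):=q^{\frac1{24}}(q;q)_\infty$, $\mathcal{C}^*(z;\tau):=q^{-\frac1{24}}\frac{(q;q)_\infty}{(\zeta q;q)_\infty(\zeta^{-1}q;q)_\infty}$, $\vartheta(z;\tau):=i\sum_{m\in\mathbb{Z}+\frac12}(-1)^{m-\frac12}q^{\frac{m^2}2}\zeta^m$, $\psi(z;\tau):=i\sum_{m\in\mathbb{Z}+\frac12}\mathrm{sgn}(m+\frac{z_2}{\tau_2})(-1)^{m-\frac12}q^{\frac{m^2}2}\zeta^m$, and $\mathcal{U}_1(z;\tau):=-\frac{i\mathcal{C}^*(z;\tau)}{2\eta(\tau)}(\vartheta(2z;\tau)+\psi(2z;\tau))$. Let $f_\nu(z;\tau):=\frac{\sin(\pi z)}{\sinh(\frac{\pi z}{\tau})}e^{\frac{\pi\nu z^2}{\tau}}$. For $\frac ac\in\mathbb{Q}$, $\mathcal{E}_{\frac ac}(z;\tau):=e^{-\frac{\pi iaz_2^2}{c\tau_2^2}}\int_{\frac ac}^{\tau+i\infty+\varepsilon}e^{\frac{\pi iz_2^2\mathfrak{z}}{\tau_2^2}}\frac{\sum_{m\in\mathbb{Z}+\frac12}(-1)^{m-\frac12}(m+\frac{z_2}{\tau_2})e^{\pi i(m^2\mathfrak{z}+2m(z+(\mathfrak{z}-\tau)\frac{z_2}{\tau_2}))}}{\sqrt{i(\mathfrak{z}-\tau)}}d\mathfrak{z}$,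 where $\varepsilon>0$ is small and the path from $\frac ac$ to $i\infty$ ends along $\tau+\varepsilon+i\mathbb{R}$, avoiding the branch cut $\tau+i[0,\infty)$; principal branches are used throughout. $\chi$ is the eta multiplier: $\chi\begin{pmatrix}a&b\\c&d\end{pmatrix}:=\left(\frac{d}{|c|}\right)e^{\frac{\pi i}{12}((a+d)c-bd(c^2-1)-3c)}$ for $c$ odd, $\left(\frac cd\right)e^{\frac{\pi i}{12}(ac(1-d^2)+d(b-c+3)-3)}$ for $c$ even. $[-h]_k\in\{0,\dots,k-1\}$ satisfies $-h[-h]_k\equiv1\pmod k$, and $M_{h,k}:=\begin{pmatrix}[-h]_k&-\frac{h[-h]_k+1}{k}\\ k&-h\end{pmatrix}$. *)

(* Defs.v *)
From mathcomp Require prime.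
From Stdlib Require Import Reals ZArith List.
From Coquelicot Require Import Coquelicot.

Open Scope R_scope.

(** * Elementary complex functions *)

Definition Cexp (w : C) : C :=
  (exp (Re w) * cos (Im w), exp (Re w) * sin (Im w)).

Definition Csin (w : C) : C := ((Cexp (Ci * w) - Cexp (- (Ci * w))) / (2 * Ci))%C.

Definition Csinh (w : C) : C := ((Cexp w - Cexp (- w)) / 2)%C.

(* Principal argument, with values in (-PI, PI]. *)
Definition Carg (w : C) : R :=
  if Rlt_dec (Im w) 0 then - acos (Re w / Cmod w) else acos (Re w / Cmod w).

Definition Clog (w : C) : C := (ln (Cmod w), Carg w).

Definition Cpower (w s : C) : C := Cexp (s * Clog w)%C.

Definition Csqrt (w : C) : C := Cpower w (RtoC (/ 2)).

(** * Infinite sums and products *)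

Definition CLim_seq (u : nat -> C) : C :=
  (real (Lim_seq (fun n => Re (u n))), real (Lim_seq (fun n => Im (u n)))).

Definition CSeries (u : nat -> C) : C :=
  (Series (fun n => Re (u n)), Series (fun n => Im (u n))).

Definition sumZ (u : Z -> C) : C :=
  (CSeries (fun n => u (Z.of_nat n)) + CSeries (fun n => u (- 1 - Z.of_nat n)%Z))%C.

(* Sum of (-1)^(m - 1/2) u(m) over m in Z + 1/2, where m = l + 1/2. *)
Definition alt_half_sum (u : R -> C) : C :=
  sumZ (fun l : Z => RtoC (powerRZ (-1) l) * u (IZR l + / 2)%R)%C.

Fixpoint qpoch_partial (a q : C) (n : nat) : C :=
  match n with
  | O => RtoC 1
  | S n => (qpoch_partial a q n * (1 - a * q ^ n))%C
  end.

Definition qpoch (a q : C) : C := CLim_seq (qpoch_partial a q).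

(** * The functions eta, C*, theta, psi, U_1 and f_nu *)

(* [e2pi x r] is q^r for x = tau and zeta^r for x = z. *)
Definition e2pi (x : C) (r : R) : C := Cexp (2 * PI * Ci * r * x)%C.

Definition eta (tau : C) : C :=
  let q := e2pi tau 1 in (e2pi tau (/ 24)%R * qpoch q q)%C.

Definition Cstar (z tau : C) : C :=
  let q := e2pi tau 1 in
  (e2pi tau (- / 24)%R *
   (qpoch q q / (qpoch (e2pi z 1 * q) q * qpoch (e2pi z (-1)%R * q) q)))%C.

Definition vartheta (z tau : C) : C :=
  (Ci * alt_half_sum (fun m => e2pi tau (m ^ 2 / 2)%R * e2pi z m))%C.

Definition psi (z tau : C) : C :=
  (Ci * alt_half_sum (fun m =>
     RtoC (sign (m + Im z / Im tau)%R) * e2pi tau (m ^ 2 / 2)%R * e2pi z m))%C.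

Definition U1 (z tau : C) : C :=
  (- (Ci * Cstar z tau / (2 * eta tau)) * (vartheta (2 * z) tau + psi (2 * z) tau))%C.

(* The singularity of sin(pi z) / sinh(pi z / tau) at z = 0 is removable, with
   value tau; the division by zero has to be replaced by that value. *)
Definition f_nu (nu : R) (z tau : C) : C :=
  if Ceq_dec z 0 then tau
  else (Csin (PI * z) / Csinh (PI * z / tau) * Cexp (PI * nu * (z * z) / tau))%C.

(** * The integral E_{a/c} *)

(* A path gamma : (0, +oo) -> H from the real point x to i*oo, which ends along
   tau + eps + i R and avoids the branch cut tau + i [0, +oo).  It is of class
   C^1 and gamma' may vanish, so piecewise smooth paths are covered after a
   change of parameter.  The approach to x is non-tangential, without which
   convergence at the cusp is not guaranteed. *)
Definition is_E_path (x : R) (tau : C) (gamma : R -> C) : Prop :=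
  filterlim gamma (at_right 0) (locally (RtoC x)) /\
  (exists K : R,
     at_right 0 (fun t => Cmod (gamma t - RtoC x)%C <= K * Im (gamma t))) /\
  (forall t : R, 0 < t ->
     ex_derive (fun s => Re (gamma s)) t /\
     ex_derive (fun s => Im (gamma s)) t /\
     continuous (Derive (fun s => Re (gamma s))) t /\
     continuous (Derive (fun s => Im (gamma s))) t) /\
  (forall t : R, 0 < t -> 0 < Im (gamma t)) /\
  (forall t : R, 0 < t -> ~ (Re (gamma t) = Re tau /\ Im tau <= Im (gamma t))) /\
  (exists eps T : R, 0 < eps /\ forall t : R, T <= t -> Re (gamma t) = Re tau + eps) /\
  is_lim (fun t => Im (gamma t)) p_infty p_infty.

Definition path_integral (g : C -> C) (gamma : R -> C) : C :=
  RInt_gen (V := C_R_CompleteNormedModule)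
    (fun t => (g (gamma t) *
               (Derive (fun s => Re (gamma s)) t, Derive (fun s => Im (gamma s)) t))%C)
    (at_right 0) (Rbar_locally p_infty).

Definition E_integrand (z tau w : C) : C :=
  let r := Im z / Im tau in
  (Cexp (PI * Ci * r ^ 2 * w) *
   (alt_half_sum (fun m =>
      RtoC (m + r)%R * Cexp (PI * Ci * (m ^ 2 * w + 2 * m * (z + (w - tau) * r))))
    / Csqrt (Ci * (w - tau))))%C.

(* E_{a/c}(z; tau) computed along gamma; its value is independent of the choice
   of gamma subject to [is_E_path (a / c) tau gamma]. *)
Definition E_cusp (a c : Z) (gamma : R -> C) (z tau : C) : C :=
  let r := Im z / Im tau in
  (Cexp (- (PI * Ci * (IZR a / IZR c) * r ^ 2)) *
   path_integral (E_integrand z tau) gamma)%C.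

(** * The eta multiplier *)

Definition legendre (a : Z) (p : nat) : Z :=
  if Z.eqb (a mod Z.of_nat p) 0 then 0%Z
  else if existsb (fun x => Z.eqb ((Z.of_nat x * Z.of_nat x - a) mod Z.of_nat p) 0)
                  (seq 0 p)
  then 1%Z else (-1)%Z.

Definition jacobi (a : Z) (n : nat) : Z :=
  fold_right (fun pe acc => (legendre a (fst pe) ^ Z.of_nat (snd pe) * acc)%Z) 1%Z
             (prime.prime_decomp n).

(* The symbol (a/n) for odd n of either sign, with (a/-1) = -1 for a < 0 and
   (a/-1) = 1 for a >= 0. *)
Definition kronecker (a n : Z) : Z :=
  ((if andb (Z.ltb a 0) (Z.ltb n 0) then -1 else 1) * jacobi a (Z.abs_nat n))%Z.

Record mat2 : Type := Mat2 { ma : Z; mb : Z; mc : Z; md : Z }.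

Definition chi (M : mat2) : C :=
  let (a, b, c, d) := M in
  if Z.odd c then
    (IZR (kronecker d (Z.abs c)) *
     Cexp (PI * Ci / 12 * IZR ((a + d) * c - b * d * (c ^ 2 - 1) - 3 * c)))%C
  else
    (IZR (kronecker c d) *
     Cexp (PI * Ci / 12 * IZR (a * c * (1 - d ^ 2) + d * (b - c + 3) - 3)))%C.

(* [is_neg_inv h k h'] means h' = [-h]_k. *)
Definition is_neg_inv (h k h' : Z) : Prop :=
  (0 <= h' < k)%Z /\ (k | - h * h' - 1)%Z.

(* M_{h,k}, with h' = [-h]_k; the division by k is exact. *)
Definition Mhk (h k h' : Z) : mat2 :=
  Mat2 h' (- ((h * h' + 1) / k)) k (- h).

(* Main.v *)
(** Up to the factor C*/(2 eta), U_1 is a theta series plus its companion twisted by sgn.  The factor C*/eta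
    transforms by the Jacobi triple product, the inversion of theta and the eta multiplier; the latter is
    followed down the Euclidean algorithm, its Jacobi symbol obeying quadratic reciprocity.  For the twisted
    series, replace sgn by the error function: as a function of the square root s of i(w - tau'), the derivative
    of the sum of E(i n s) exp(-pi n^2 ..) is again a theta series, and the integrand of E_{a/c} is the pull-back
    of this derivative along the path.  So E_{a/c} is a difference of two limits of error-function sums.  At the
    i oo end the limit is the sgn-twisted series at tau'.  At the cusp, theta inversion carries the sum to one
    over the dual variable, whose limit is the sgn-twisted series at tau.  The condition |kz| < 1/4 makes the
    shift n = m - 2kz harmless: sgn n = sgn m. *)

Require Import Defs.
From HB Require structures.
From mathcomp Require ssreflect ssrfun ssrbool eqtype ssrnat seq div choice fintype bigop prime
  binomial ssralg poly zmodp zify.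
From Stdlib Require Import Reals ZArith Lra Lia.
From Coquelicot Require Import Coquelicot.

(** * Quadratic reciprocity for the Jacobi symbol *)

(** Convergence and path independence of the integral both come from an explicit primitive: [Erf] is
    complex differentiable with derivative exp(-pi w^2), so the error-function sum along any
    admissible path is, up to a constant, a primitive of the integrand, and only its two end limits
    matter. The limit L of [Erf] is an unknown until theta inversion is available: Fourier
    uniqueness gives inversion with a factor 2L, and using it twice at the fixed point y = 1 forces
    4L^2 = 1. The obstacle is the cusp. There the Gaussian parameter tp - s^2 of the sum tends to 0
    and no summable majorant survives; the dual sum keeps a fixed Gaussian factor while only the
    arguments of [Erf] move, and the non-tangential approach keeps them in a sector inside |arg| <
    pi/4, where [Erf] tends to 1/2. Eta inversion is extracted from theta(tau; 3 tau) and theta(1/3;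
    tau) by the triple product, and eta and theta carry one common constant through the Euclidean
    algorithm. Branches of square roots are settled by signs of real and imaginary parts, and
    exponents in [chi] by congruences modulo 24. *)

Module QuadraticReciprocity.

Import structures ssreflect ssrfun ssrbool eqtype ssrnat seq div choice fintype bigop prime
  binomial ssralg poly zmodp zify.
Import GRing.Theory.
Local Open Scope nat_scope.

Set Implicit Arguments.
Unset Strict Implicit.
Unset Printing Implicit Defensive.

(** * Squares in F_p, Euler's criterion, the lemmas of Gauss and Eisenstein *)

Section OddPrime.

Variables (p k : nat).
Hypothesis p_pr : prime p.
Hypothesis pE : p = k.*2.+1.

Local Open Scope ring_scope.

Lemma Fp_nat_eq0 (n : nat) : ((n%:R : 'F_p) == 0) = (p %| n)%N.
Proof. by rewrite -(dvdn_pcharf (pchar_Fp p_pr)). Qed.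

Lemma Fp_nat_inj (m n : nat) : (m < p)%N -> (n < p)%N -> m%:R = n%:R :> 'F_p -> m = n.
Proof.
move=> mp np /(congr1 val); rewrite /= !val_Fp_nat // !modn_small //.
Qed.

(** With p = 2k + 1, the classes of 1, ..., k represent the units up to sign, so each nonzero square
    is listed exactly once. *)
Definition sq_list := [seq (i.+1)%:R ^+ 2 : 'F_p | i <- iota 0 k].

Lemma sq_list_uniq : uniq sq_list.
Proof.
rewrite map_inj_in_uniq ?iota_uniq // => i j.
rewrite !mem_iota !add0n /= => ik jk /eqP.
rewrite eqf_sqr => /orP[] /eqP E.
- suff [] : i.+1 = j.+1 by [].
  apply: Fp_nat_inj E; rewrite pE -addnn ltnS.
  + exact: leq_trans ik (leq_addl _ _).
  + exact: leq_trans jk (leq_addl _ _).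
- exfalso; have := Fp_nat_eq0 (i.+1 + j.+1); rewrite natrD E addNr eqxx => /esym /dvdn_leq.
  move=> /(_ isT); rewrite pE -addnn leqNgt => /negP; apply.
  by rewrite ltnS; apply: leq_add.
Qed.

Lemma fermat_Fp (x : 'F_p) : x != 0 -> x ^+ k.*2 = 1.
Proof.
move=> x0.
have E : x ^+ p = x.
  have -> : x = (nat_of_ord x)%:R by rewrite natr_Zp.
  by rewrite -natrX -(Fp_nat_mod p_pr) fermat_little // Fp_nat_mod.
by apply: (mulfI x0); rewrite mulr1 -exprS -pE.
Qed.

(** By Fermat the k listed squares are roots of X^k - 1, which has at most k roots in a field; a
    further root x would make k + 1 of them. *)
Lemma euler_square (x : 'F_p) : x != 0 -> (x ^+ k == 1) = (x \in sq_list).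
Proof.
move=> x0; apply/eqP/idP => [E|]; last first.
  case/mapP=> i; rewrite mem_iota add0n /= => ik Ex.
  rewrite {1}Ex -exprM mul2n fermat_Fp // Fp_nat_eq0.
  apply/negP => /dvdn_leq => /(_ isT); rewrite pE leqNgt => /negP; apply.
  by rewrite ltnS -addnn; apply: leq_trans ik (leq_addl _ _).
have k0 : (0 < k)%N by case: (k) pE p_pr => // ->.
apply/negPn/negP => xn.
pose P : {poly 'F_p} := 'X^k - 1.
have sP : size P = k.+1 by rewrite size_XnsubC.
have P0 : P != 0 by rewrite -size_poly_eq0 sP.
have := @max_poly_roots _ P (x :: sq_list) P0.
rewrite /= xn sq_list_uniq sP size_map size_iota => /(_ _ isT).
rewrite ltnn => H; suff : false by []; apply: H.
rewrite /root /P !hornerE E subrr eqxx /=.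
apply/allP=> y /mapP[i]; rewrite mem_iota add0n /= => ik ->.
rewrite /root !hornerE -exprM mul2n fermat_Fp ?subrr // Fp_nat_eq0.
apply/negP => /dvdn_leq => /(_ isT); rewrite pE leqNgt => /negP; apply.
by rewrite ltnS -addnn; apply: leq_trans ik (leq_addl _ _).
Qed.

Lemma euler_sign (x : 'F_p) : x != 0 -> x ^+ k = (-1) ^+ (x \notin sq_list).
Proof.
move=> x0; rewrite -euler_square //.
have : (x ^+ k) ^+ 2 == 1 ^+ 2 by rewrite -exprM muln2 fermat_Fp // expr1n.
rewrite eqf_sqr; case/orP=> /eqP ->; first by rewrite eqxx.
case: eqP => //= E; by rewrite -E.
Qed.

(** Signs are computed as powers of -1 in F_p; since p is odd, 1 and -1 differ there and the
    parities can be read off. *)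
Lemma Fp_signr_inj (b c : bool) : (-1) ^+ b = (-1) ^+ c :> 'F_p -> b = c.
Proof.
have H : (1 : 'F_p) != -1.
  rewrite -subr_eq0 opprK -(natrD _ 1 1) Fp_nat_eq0; apply/negP => /dvdn_leq => /(_ isT).
  by rewrite pE; case: (k) pE p_pr => // ->.
by case: b; case: c => //= /eqP; rewrite ?expr1 ?expr0 ?(negPf H) // eq_sym (negPf H).
Qed.

Variable a : nat.
Hypothesis pa : ~~ (p %| a)%N.

(** Least absolute residues: [r i] is a(i+1) reduced modulo p, [big i] says that it exceeds p/2, and
    [s i] is the distance to the nearest multiple of p, so that a(i+1) is plus or minus [s i] modulo
    p. *)
Let r (i : nat) := (a * i.+1 %% p)%N.
Let big (i : nat) := (k < r i)%N.
Let s (i : nat) := (if big i then p - r i else r i)%N.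

Let r_gt0 i : (i < k)%N -> (0 < r i)%N.
Proof.
move=> ik; rewrite lt0n; apply/negP; rewrite -/(dvdn p _) Euclid_dvdM // (negPf pa) /=.
move=> /dvdn_leq => /(_ isT); rewrite pE leqNgt => /negP; apply.
by rewrite ltnS -addnn; apply: leq_trans ik (leq_addl _ _).
Qed.

Let r_ltp i : (r i < p)%N. Proof. by rewrite ltn_mod prime_gt0. Qed.

Let s_bound i : (i < k)%N -> (0 < s i <= k)%N.
Proof.
move=> ik; rewrite /s /big; case: (ltnP k (r i)) => H; last by rewrite r_gt0.
rewrite subn_gt0 r_ltp /= pE leq_subLR -addnn -addSn leq_add2r; exact: H.
Qed.

Let s_sign i : (s i)%:R = (-1) ^+ big i * (a * i.+1)%:R :> 'F_p.
Proof.
have E : (r i)%:R = (a * i.+1)%:R :> 'F_p by rewrite /r Fp_nat_mod.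
rewrite /s -E; case: (big i); rewrite ?expr0 ?mul1r // expr1 mulN1r natrB; last exact: ltnW.
by rewrite (pcharf0 (pchar_Fp p_pr)) sub0r.
Qed.

(** Squaring removes the unknown sign: equal values of [s] give equal squares of i+1 and j+1, and
    those are distinct by [sq_list_uniq]. *)
Let s_inj i j : (i < k)%N -> (j < k)%N -> s i = s j -> i = j.
Proof.
move=> ik jk E.
have := congr1 (fun n => n%:R ^+ 2 : 'F_p) E; rewrite /= !s_sign !exprMn !sqrr_sign !mul1r !natrM !exprMn => /mulfI H.
have a0 : (a%:R : 'F_p) ^+ 2 != 0 by rewrite expf_neq0 // Fp_nat_eq0.
have := H a0 => H2.
have := sq_list_uniq; rewrite /sq_list => /(@uniqP _ 0) => U.
suff : i = j by []. apply: U; rewrite ?inE ?size_map ?size_iota //.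
by rewrite !(nth_map 0) ?size_iota // !nth_iota.
Qed.

Lemma gauss_perm : perm_eq [seq s i | i <- iota 0 k] [seq i.+1 | i <- iota 0 k].
Proof.
have -> : [seq i.+1 | i <- iota 0 k] = iota 1 k by exact: (esym (iotaDl 1 0 k)).
apply: uniq_perm; last first.
- apply: (uniq_min_size _ _ _).2.
  + rewrite map_inj_in_uniq ?iota_uniq // => i j; rewrite !mem_iota !add0n /=; exact: s_inj.
  + move=> x /mapP[i]; rewrite mem_iota add0n /= => ik ->; rewrite mem_iota add1n ltnS; exact: s_bound.
  + by rewrite size_map !size_iota.
- exact: iota_uniq.
- rewrite map_inj_in_uniq ?iota_uniq // => i j; rewrite !mem_iota !add0n /=; exact: s_inj.
Qed.

(** Multiply the congruences between a(i+1) and its signed residue over all i: by [gauss_perm] both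
    sides contain k!, a unit, which cancels and leaves a^k equal to the product of the signs. *)
Lemma gauss_lemma : a%:R ^+ k = (-1) ^+ (\sum_(i <- iota 0 k) big i)%N :> 'F_p.
Proof.
have i0 i : (i < k)%N -> (i.+1)%:R != 0 :> 'F_p.
  move=> ik; rewrite Fp_nat_eq0; apply/negP => /dvdn_leq => /(_ isT).
  rewrite pE leqNgt => /negP; apply.
  by rewrite ltnS -addnn; apply: leq_trans ik (leq_addl _ _).
have E : \prod_(i <- iota 0 k) (s i)%:R = \prod_(i <- iota 0 k) (i.+1)%:R :> 'F_p.
  have := perm_big (op := *%R) (F := fun n : nat => n%:R : 'F_p) (P := xpredT) (x := 1) _ gauss_perm.
  by rewrite !big_map.
have N0 : \prod_(i <- iota 0 k) (i.+1)%:R != 0 :> 'F_p.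
  rewrite prodf_seq_neq0; apply/allP => i; rewrite mem_iota add0n /= => ik; exact: i0.
move: E; rewrite (eq_bigr (fun i => (-1) ^+ big i * a%:R * (i.+1)%:R)); last first.
  by move=> i _; rewrite s_sign natrM mulrA.
rewrite !big_split /= -{2}[\prod_(i <- _) (i.+1)%:R]mul1r => /(mulIf N0).
rewrite prodrXr big_const_seq count_predT size_iota iter_mulr_1 => E.
have /(congr1 (fun z => (-1) ^+ (\sum_(i <- iota 0 k) big i)%N * z)) := E.
by rewrite mulrA mulr1 -expr2 sqrr_sign mul1r.
Qed.

(** As a and p are odd, division of a(i+1) by p says modulo 2 that i+1 is the sum of the quotient,
    [s i] and [big i]. In the sum over i the residues [s i] cancel against the i+1 by
    [gauss_perm]. *)
Lemma eisenstein_lemma : odd a ->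
  odd (\sum_(i <- iota 0 k) big i) = odd (\sum_(i <- iota 0 k) (a * i.+1 %/ p)).
Proof.
move=> aodd.
have podd : odd p by rewrite pE /= odd_double.
have H i : odd (i.+1) = odd (a * i.+1 %/ p) (+) odd (s i) (+) big i.
  have -> : odd i.+1 = odd (a * i.+1) by rewrite oddM aodd.
  rewrite {1}(divn_eq (a * i.+1) p) oddD oddM podd andbT -addbA; congr (_ (+) _).
  rewrite /s -/(r i); case: (big i); last by rewrite addbF.
  by rewrite oddB ?podd ?(ltnW (r_ltp i)) // addbT; case: odd.
have Hs : (\sum_(i <- iota 0 k) s i = \sum_(i <- iota 0 k) i.+1)%N.
  have := perm_big (op := addn) (F := fun n : nat => n) (P := xpredT) (x := 0%N) _ gauss_perm.
  by rewrite !big_map.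
have S : odd (\sum_(i <- iota 0 k) i.+1) =
   odd (\sum_(i <- iota 0 k) (a * i.+1 %/ p)) (+) odd (\sum_(i <- iota 0 k) s i) (+)
   odd (\sum_(i <- iota 0 k) big i).
  elim: (iota 0 k) => [|i t IH]; first by rewrite !big_nil.
  rewrite !big_cons !oddD IH H oddb.
  by do 3! case: (odd (\sum_(i <- _) _)); do 2! case: odd; case: (big i).
move: S; rewrite Hs; by do 3! case: (odd _).
Qed.

End OddPrime.

(** Eisenstein's count: the two sums count the lattice points of a k by l rectangle below and above
    the line through the origin and (p, q), and coprimality keeps every such point off the line. *)
Lemma lattice_count (k l : nat) : coprime k.*2.+1 l.*2.+1 ->
  \sum_(i <- iota 0 k) (l.*2.+1 * i.+1 %/ k.*2.+1) + \sum_(j <- iota 0 l) (k.*2.+1 * j.+1 %/ l.*2.+1) = k * l.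
Proof.
set p := k.*2.+1; set q := l.*2.+1 => cpq.
have cnt (F m : nat) : F <= m -> F = \sum_(j <- iota 0 m) (j < F).
  move=> Fm; rewrite -(subnKC Fm) iotaD big_cat /= add0n.
  rewrite (eq_big_seq (fun=> 1)); last by move=> j; rewrite mem_iota add0n /= => ->.
  rewrite [X in _ + X](eq_big_seq (fun=> 0)).
    by rewrite !big_const_seq !count_predT !size_iota iter_addn_0 mul1n iter_addn_0 mul0n addn0.
  by move=> j; rewrite mem_iota => /andP[Fj _]; rewrite ltnNge Fj.
have lo (k' l' i : nat) : i < k' -> l'.*2.+1 * i.+1 %/ k'.*2.+1 <= l'.
  move=> ik; rewrite -ltnS ltn_divLR //.
  apply: (@leq_ltn_trans (l'.*2.+1 * k')); first by rewrite leq_mul2l ik.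
  lia.
have -> : \sum_(i <- iota 0 k) (q * i.+1 %/ p) =
    \sum_(i <- iota 0 k) \sum_(j <- iota 0 l) (p * j.+1 <= q * i.+1).
  apply: eq_big_seq => i; rewrite mem_iota add0n /= => ik.
  rewrite [LHS](cnt _ l (lo _ _ _ ik)); apply: eq_bigr => j _.
  by rewrite leq_divRL // mulnC.
have -> : \sum_(j <- iota 0 l) (p * j.+1 %/ q) =
    \sum_(j <- iota 0 l) \sum_(i <- iota 0 k) (q * i.+1 <= p * j.+1).
  apply: eq_big_seq => j; rewrite mem_iota add0n /= => jl.
  rewrite [LHS](cnt _ k (lo _ _ _ jl)); apply: eq_bigr => i _.
  by rewrite leq_divRL // mulnC.
rewrite [X in _ + X]exchange_big -big_split /=.

rewrite (eq_big_seq (fun i => l)); last first.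
  move=> i; rewrite mem_iota add0n /= => ik.
  rewrite -big_split /= (eq_bigr (fun=> 1)).
    by rewrite big_const_seq count_predT size_iota iter_addn_0 mul1n.
  move=> j _; case: (ltngtP (q * i.+1) (p * j.+1)) => // E.
  (* A tie would be a lattice point on the line: it makes p divide i + 1, although i + 1 <= k <
     p. *)
  have : p %| q * i.+1 by rewrite E dvdn_mulr.
  rewrite Gauss_dvdr // => /dvdn_leq => /(_ isT); rewrite /p; lia.
by rewrite big_const_seq count_predT size_iota iter_addn_0 mulnC.
Qed.

(** Lets the product over prime factors in [jacobi] be treated as a big operator, with reindexing
    and splitting. *)
HB.instance Definition _ := Monoid.isComLaw.Build BinNums.Z BinInt.Z.one BinInt.Z.mul
  BinInt.Z.mul_assoc BinInt.Z.mul_comm BinInt.Z.mul_1_l.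


(** * The Legendre symbol *)

Definition sgn (b : bool) : Z := if b then (-1)%Z else 1%Z.

Lemma sgn_addb (b c : bool) : sgn (b (+) c) = (sgn b * sgn c)%Z.
Proof. by case: b; case: c. Qed.

Lemma existsb_ext (f g : nat -> bool) (l : seq nat) : f =1 g -> List.existsb f l = List.existsb g l.
Proof. by move=> fg; elim: l => //= x l ->; rewrite fg. Qed.

Lemma legendre_mod (a : Z) (p : nat) : legendre a p = legendre (a mod Z.of_nat p) p.
Proof.
rewrite /legendre Zmod_mod; case: Z.eqb => //.
by congr (if _ then _ else _); apply: existsb_ext => x; rewrite Zminus_mod_idemp_r.
Qed.

Lemma Zof_modn (m p : nat) : 0 < p -> Z.of_nat (m %% p) = (Z.of_nat m mod Z.of_nat p)%Z.
Proof.
move=> p0; apply: (Z.mod_unique_pos _ _ (Z.of_nat (m %/ p))).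
  have := ltn_pmod m p0; lia.
by rewrite {1}(divn_eq m p) Nat2Z.inj_add Nat2Z.inj_mul Z.mul_comm.
Qed.

Lemma existsb_squareE (a p : nat) : 0 < p ->
  List.existsb (fun x => Z.eqb ((Z.of_nat x * Z.of_nat x - Z.of_nat a) mod Z.of_nat p) 0) (List.seq 0 p)
  = has (fun x => x * x == a %[mod p]) (iota 0 p).
Proof.
move=> p0.
have -> : List.seq 0 p = iota 0 p by elim: (p) 0 => //= n IH m; rewrite IH.
elim: (iota 0 p) => //= x l ->; congr (_ || _).
have E1 : Z.of_nat ((x * x) %% p) = ((Z.of_nat x * Z.of_nat x) mod Z.of_nat p)%Z by rewrite Zof_modn // Nat2Z.inj_mul.
have E2 := Zof_modn a p0.
apply/idP/eqP => [/Z.eqb_eq /Z.cong_iff_0|/(congr1 Z.of_nat)].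
  by rewrite -E1 -E2 => /Nat2Z.inj.
by rewrite E1 E2 => /Z.cong_iff_0 /Z.eqb_eq ->.
Qed.

Section LegendrePrime.

Variables (p k : nat).
Hypothesis p_pr : prime p.
Hypothesis pE : p = k.*2.+1.

Local Open Scope ring_scope.

(** Ties the search over 0, ..., p-1 in the definition of the symbol to membership in [sq_list],
    where Euler's criterion and Gauss's lemma apply. *)
Lemma legendreE (a : nat) : ~~ (p %| a)%nat ->
  legendre (Z.of_nat a) p = sgn ((a%:R : 'F_p) \notin sq_list p k).
Proof.
move=> pa; rewrite /legendre existsb_squareE ?prime_gt0 //.
have -> : Z.eqb (Z.of_nat a mod Z.of_nat p) 0 = false.
  apply/negP => /Z.eqb_eq; rewrite -Zof_modn ?prime_gt0 // => E.
  by case/negP: pa; apply/eqP; lia.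
have a0 : (a%:R : 'F_p) != 0 by rewrite (Fp_nat_eq0 p_pr).
suff -> : has (fun x : nat => x * x == a %[mod p])%nat (iota 0 p) = ((a%:R : 'F_p) \in sq_list p k) by case: (_ \in _).
have cong (x : nat) : (x * x == a %[mod p])%nat = ((x%:R : 'F_p) ^+ 2 == a%:R).
  rewrite -natrX -mulnn; apply/eqP/eqP => [E|/(congr1 (@nat_of_ord _))].
    by rewrite -(Fp_nat_mod p_pr (x * x)) E Fp_nat_mod.
  by rewrite !(val_Fp_nat p_pr).
apply/hasP/mapP => [[x _]|[i]].
  rewrite cong => /eqP E.
  have : (a%:R : 'F_p) \in sq_list p k.
    rewrite -(euler_square p_pr pE) // -E -exprM mul2n (fermat_Fp p_pr pE) //.
    by apply/eqP => x0; move: a0; rewrite -E x0 expr0n eqxx.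
  by case/mapP=> i ik Ei; exists i.
rewrite mem_iota add0n /= => ik Ea; exists i.+1.
  rewrite mem_iota add0n /= pE ltnS -addnn; exact: leq_trans ik (leq_addl _ _).
by rewrite cong Ea.
Qed.

Lemma legendre_dvd (a : nat) : (p %| a)%nat -> legendre (Z.of_nat a) p = 0%Z.
Proof.
move=> pa; rewrite /legendre; suff -> : Z.eqb (Z.of_nat a mod Z.of_nat p) 0 = true by [].
by apply/Z.eqb_eq; rewrite -Zof_modn ?prime_gt0 // (eqP pa).
Qed.

Lemma legendreM_nat (a b : nat) :
  legendre (Z.of_nat (a * b)) p = (legendre (Z.of_nat a) p * legendre (Z.of_nat b) p)%Z.
Proof.
case: (boolP (p %| a)%nat) => pa; first by rewrite (legendre_dvd (dvdn_mulr b pa)) (legendre_dvd pa).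
case: (boolP (p %| b)%nat) => pb; first by rewrite (legendre_dvd (dvdn_mull a pb)) (legendre_dvd pb) Z.mul_0_r.
have pab : ~~ (p %| a * b)%nat by rewrite Euclid_dvdM // negb_or pa pb.
rewrite !legendreE // -sgn_addb; congr sgn.
apply: (Fp_signr_inj p_pr pE).
rewrite -(euler_sign p_pr pE) ?(Fp_nat_eq0 p_pr) // natrM exprMn.
by rewrite !(euler_sign p_pr pE) ?(Fp_nat_eq0 p_pr) // signr_addb.
Qed.

Lemma legendreM (a b : Z) : legendre (a * b) p = (legendre a p * legendre b p)%Z.
Proof.
have p0 : (0 < Z.of_nat p)%Z by have := prime_gt0 p_pr; lia.
rewrite legendre_mod (legendre_mod a) (legendre_mod b) Zmult_mod -legendre_mod.
have := Z.mod_pos_bound a _ p0; have := Z.mod_pos_bound b _ p0.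
set a' := (a mod _)%Z; set b' := (b mod _)%Z => Hb Ha.
have -> : a' = Z.of_nat (Z.to_nat a') by lia.
have -> : b' = Z.of_nat (Z.to_nat b') by lia.
by rewrite -legendreM_nat Nat2Z.inj_mul.
Qed.

Lemma legendre_1 : legendre 1 p = 1%Z.
Proof.
have H : legendre 1 p = (legendre 1 p * legendre 1 p)%Z by rewrite -legendreM.
have : legendre (Z.of_nat 1) p <> 0%Z.
  rewrite legendreE; first by case: (_ \notin _).
  by rewrite dvdn1; apply/eqP => p1; move: p_pr; rewrite p1.
move=> /= H1; nia.
Qed.

Lemma legendre_m1 : legendre (-1) p = sgn (odd k).
Proof.
have p0 := prime_gt0 p_pr; have p1 := prime_gt1 p_pr.
have -> : legendre (-1) p = legendre (Z.of_nat p.-1) p.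
  rewrite legendre_mod [RHS]legendre_mod; congr legendre.
  have -> : Z.of_nat p.-1 = (-1 + 1 * Z.of_nat p)%Z by lia.
  by rewrite Z_mod_plus_full.
have pp : ~~ (p %| p.-1)%nat.
  by apply/negP => /dvdn_leq; lia.
rewrite legendreE //; congr sgn; apply: (Fp_signr_inj p_pr pE).
rewrite -(euler_sign p_pr pE) ?(Fp_nat_eq0 p_pr) // signr_odd.
suff -> : (p.-1)%:R = -1 :> 'F_p by [].
apply/eqP; rewrite -subr_eq0 opprK -(natrD _ _ 1) addn1 prednK // (Fp_nat_eq0 p_pr) dvdnn //.
Qed.

End LegendrePrime.

(** Euler's criterion, Gauss's lemma and Eisenstein's lemma turn each symbol into the parity of one
    of the two sums of [lattice_count]. *)
Lemma legendre_reciprocity (p q k l : nat) : prime p -> prime q -> p != q ->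
  p = k.*2.+1 -> q = l.*2.+1 ->
  (legendre (Z.of_nat q) p * legendre (Z.of_nat p) q)%Z = sgn (odd (k * l)).
Proof.
move=> p_pr q_pr pq pE qE.
have pq' : ~~ (p %| q) by rewrite dvdn_prime2.
have qp' : ~~ (q %| p) by rewrite dvdn_prime2 // eq_sym.
rewrite (legendreE p_pr pE pq') (legendreE q_pr qE qp') -sgn_addb; congr sgn.
have cpq : coprime k.*2.+1 l.*2.+1 by rewrite -pE -qE prime_coprime.
rewrite -(lattice_count cpq) oddD -pE -qE; congr (_ (+) _).
- apply: (Fp_signr_inj p_pr pE).
  rewrite -(euler_sign p_pr pE) ?(Fp_nat_eq0 p_pr) // (gauss_lemma p_pr pE pq') -signr_odd.
  by rewrite (eisenstein_lemma p_pr pE pq') // qE /= odd_double.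
- apply: (Fp_signr_inj q_pr qE).
  rewrite -(euler_sign q_pr qE) ?(Fp_nat_eq0 q_pr) // (gauss_lemma q_pr qE qp') -signr_odd.
  by rewrite (eisenstein_lemma q_pr qE qp') // pE /= odd_double.
Qed.

(** * The Jacobi symbol *)

Lemma jacobi_primes (a : Z) (n : nat) :
  jacobi a n = \big[BinInt.Z.mul/BinInt.Z.one]_(p <- primes n) (legendre a p ^ Z.of_nat (logn p n))%Z.
Proof.
rewrite /jacobi prime_decompE unlock /=.
by elim: (primes n) => //= p s ->.
Qed.

(** Primes not dividing n enter with exponent 0, so the products for m, n and mn can be written over
    one common range and multiplied factor by factor. *)
Lemma jacobi_range (a : Z) (n N : nat) : 0 < n -> n < N ->
  jacobi a n = \big[BinInt.Z.mul/BinInt.Z.one]_(0 <= p < N | prime p) (legendre a p ^ Z.of_nat (logn p n))%Z.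
Proof.
move=> n0 nN; rewrite jacobi_primes.
have P : perm_eq (primes n) [seq p <- index_iota 0 N | p \in primes n].
  apply: uniq_perm; rewrite ?primes_uniq ?filter_uniq ?iota_uniq // => p.
  rewrite mem_filter mem_index_iota /=; case E: (p \in primes n) => //=.
  move: E; rewrite mem_primes => /and3P[_ _ pn]; symmetry.
  exact: leq_ltn_trans (dvdn_leq n0 pn) nN.
rewrite (perm_big _ P) big_filter big_mkcond [RHS]big_mkcond; apply: eq_bigr => p _.
rewrite mem_primes n0 /=; case: (boolP (prime p)) => //= p_pr.
case: (boolP (p %| n)) => // pn.
by rewrite (_ : logn p n = 0) //; apply/eqP; rewrite -leqn0 leqNgt logn_gt0 mem_primes p_pr n0.
Qed.

Lemma jacobi_mul_bottom (a : Z) (m n : nat) : 0 < m -> 0 < n ->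
  jacobi a (m * n) = (jacobi a m * jacobi a n)%Z.
Proof.
move=> m0 n0; have mn0 : 0 < m * n by rewrite muln_gt0 m0.
rewrite !(@jacobi_range _ _ (m * n).+1) // ?ltnS ?leq_pmulr ?leq_pmull //.
rewrite -big_split; apply: eq_bigr => p p_pr /=.
by rewrite lognM // Nat2Z.inj_add Z.pow_add_r //; lia.
Qed.

Lemma jacobi_eq (a b : Z) (n : nat) :
  (forall p, prime p -> p %| n -> legendre a p = legendre b p) -> jacobi a n = jacobi b n.
Proof.
move=> H; rewrite !jacobi_primes; apply: eq_big_seq => p.
by rewrite mem_primes => /and3P[p_pr _ pn]; rewrite H.
Qed.

Lemma odd_half (n : nat) : odd n -> n = n./2.*2.+1.
Proof. by move=> o; rewrite -[LHS]odd_double_half o. Qed.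

Lemma jacobi_mul_top (a b : Z) (n : nat) : odd n ->
  jacobi (a * b) n = (jacobi a n * jacobi b n)%Z.
Proof.
move=> no; rewrite !jacobi_primes -big_split; apply: eq_big_seq => p /=.
rewrite mem_primes => /and3P[p_pr _ pn].
by rewrite (legendreM p_pr (odd_half (dvdn_odd pn no))) Z.pow_mul_l.
Qed.

Lemma jacobi_prime (a : Z) (p : nat) : prime p -> jacobi a p = legendre a p.
Proof.
move=> p_pr; rewrite jacobi_primes primes_prime // big_seq1 logn_prime // eqxx.
exact: Z.pow_1_r.
Qed.

Lemma jacobi_1 (a : Z) : jacobi a 1 = 1%Z.
Proof. by []. Qed.

(** For m = 2u+1 and n = 2v+1 one has (mn-1)/2 = 2uv + u + v, so the exponent occurring in the value
    at -1 and in reciprocity is additive modulo 2. *)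
Lemma odd_half_mul (m n : nat) : odd m -> odd n -> odd (m * n)./2 = odd m./2 (+) odd n./2.
Proof.
move=> mo no; rewrite {1}(odd_half mo) {1}(odd_half no).
set u := m./2; set v := n./2.
have -> : u.*2.+1 * v.*2.+1 = ((u * v).*2 + u + v).*2.+1 by lia.
by rewrite -[_.*2.+1]/(true + _) half_bit_double !oddD odd_double.
Qed.

Lemma odd_prime_ind (P : nat -> Prop) : P 1 ->
  (forall p n, prime p -> odd p -> odd n -> P n -> P (p * n)) -> forall n, odd n -> P n.
Proof.
move=> P1 PM n; elim/ltn_ind: n => n IH no.
case: (ltngtP n 1) => [|n1|->]; [by case: n no {IH}| |exact: P1].
have p_pr := pdiv_prime n1; have := pdiv_dvd n => /dvdnP[m nE].
have : odd m && odd (pdiv n) by rewrite -oddM -nE.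
case/andP=> mo po; rewrite nE mulnC; apply: PM => //; apply: IH => //.
rewrite [X in _ < X]nE ltn_Pmulr ?prime_gt1 //; by case: m mo {nE}.
Qed.

Lemma jacobi_m1 (n : nat) : odd n -> jacobi (-1) n = sgn (odd n./2).
Proof.
move: n; apply: odd_prime_ind => // p n p_pr po no IH.
have n0 : 0 < n by case: (n) no.
rewrite (jacobi_mul_bottom _ (prime_gt0 p_pr) n0) IH jacobi_prime // odd_half_mul // sgn_addb.
by rewrite (legendre_m1 p_pr (odd_half po)).
Qed.

Lemma jacobi_one_top (n : nat) : odd n -> jacobi 1 n = 1%Z.
Proof.
move: n; apply: odd_prime_ind => // p n p_pr po no IH.
have n0 : 0 < n by case: (n) no.
by rewrite (jacobi_mul_bottom _ (prime_gt0 p_pr) n0) IH jacobi_prime // (legendre_1 p_pr (odd_half po)).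
Qed.

(** Both sides are multiplicative in m and in n, so an induction over the prime factors of n, and
    inside it one over those of m, reduces the law to two distinct odd primes. *)
Theorem jacobi_reciprocity_nat (m n : nat) : odd m -> odd n -> coprime m n ->
  (jacobi (Z.of_nat m) n * jacobi (Z.of_nat n) m)%Z = sgn (odd m./2 && odd n./2).
Proof.
move=> mo no; move: n no m mo.
apply: odd_prime_ind => [m mo _|q n q_pr qo no IH m mo].
  by rewrite jacobi_1 jacobi_one_top // andbF.
have n0 : 0 < n by case: (n) no.
have m0 : 0 < m by case: (m) mo.
rewrite coprimeMr => /andP[cq cn].
rewrite (jacobi_mul_bottom _ (prime_gt0 q_pr) n0) Nat2Z.inj_mul jacobi_mul_top //.
rewrite odd_half_mul // andb_addr sgn_addb -(IH m mo cn).
suff <- : (jacobi (Z.of_nat m) q * jacobi (Z.of_nat q) m)%Z = sgn (odd m./2 && odd q./2) by ring.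
move: m mo {m0 cn} cq.
apply: odd_prime_ind => [_|p m p_pr po mo IHm].
  by rewrite jacobi_1 jacobi_one_top.
have m0 : 0 < m by case: (m) mo.
rewrite coprimeMl => /andP[cp cm].
rewrite (jacobi_mul_bottom _ (prime_gt0 p_pr) m0) Nat2Z.inj_mul jacobi_mul_top //.
rewrite odd_half_mul // andb_addl sgn_addb -(IHm cm) (jacobi_prime _ p_pr) (jacobi_prime (Z.of_nat p) q_pr).
have pq : p != q by apply/eqP => E; move: cp; rewrite E /coprime gcdnn; case: (q) q_pr => // -[].
rewrite andbC -oddM -(legendre_reciprocity q_pr p_pr _ (odd_half qo) (odd_half po)); last by rewrite eq_sym.
by ring.
Qed.

Lemma jacobi_period (a t : Z) (n : nat) : jacobi (a + t * Z.of_nat n) n = jacobi a n.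
Proof.
apply: jacobi_eq => p p_pr /dvdnP[m ->].
rewrite legendre_mod [RHS]legendre_mod; congr legendre.
by rewrite Nat2Z.inj_mul Z.mul_assoc Z_mod_plus_full.
Qed.

(** Translates the parity of (n-1)/2 into the residue test modulo 4 in which the multiplier
    computations are carried out. *)
Lemma sgn_half (n : Z) : (0 < n)%Z -> Z.odd n = true ->
  odd (Z.abs_nat n) /\ odd (Z.abs_nat n)./2 = (n mod 4 =? 3)%Z.
Proof.
move=> n0 no; have E : (n = Z.of_nat (Z.abs_nat n))%Z by lia.
have := Z.div_mod n 4 ltac:(lia); have := Z.mod_pos_bound n 4 ltac:(lia).
have := Zodd_bool_iff n; rewrite no => -[/(_ erefl) /Zodd_ex [u uE] _].
set r := (n mod 4)%Z; set v := (n / 4)%Z => r4 nv.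
have [r1|r3] : (r = 1 \/ r = 3)%Z by lia.
- have -> : Z.abs_nat n = ((Z.to_nat v).*2).*2.+1 by lia.
  by rewrite /= odd_double uphalf_double odd_double r1.
- have -> : Z.abs_nat n = ((Z.to_nat v).*2.+1).*2.+1 by lia.
  by rewrite /= !odd_double uphalf_double /= odd_double r3.
Qed.

Theorem jacobi_opp (a n : Z) : (0 < n)%Z -> Z.odd n = true ->
  jacobi (- a) (Z.abs_nat n) = ((if n mod 4 =? 3 then -1 else 1) * jacobi a (Z.abs_nat n))%Z.
Proof.
move=> n0 no; have [o h] := sgn_half n0 no.
have -> : (- a = -1 * a)%Z by ring.
by rewrite jacobi_mul_top // jacobi_m1 // h.
Qed.

Theorem jacobi_reciprocity (m n : Z) : (0 < n)%Z -> Z.odd n = true -> (0 < m)%Z -> Z.odd m = true ->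
  Z.gcd m n = 1%Z ->
  jacobi m (Z.abs_nat n) = ((if (m mod 4 =? 3) && (n mod 4 =? 3) then -1 else 1) * jacobi n (Z.abs_nat m))%Z.
Proof.
move=> n0 no m0 mo g; have [no' hn] := sgn_half n0 no; have [mo' hm] := sgn_half m0 mo.
have c : coprime (Z.abs_nat m) (Z.abs_nat n).
  have D (u : Z) : (0 < u)%Z -> gcdn (Z.abs_nat m) (Z.abs_nat n) %| Z.abs_nat u ->
      (Z.of_nat (gcdn (Z.abs_nat m) (Z.abs_nat n)) | u)%Z.
    move=> u0 /dvdnP[w E]; exists (Z.of_nat w); rewrite -Nat2Z.inj_mul; lia.
  have := Z.gcd_greatest _ _ _ (D m m0 (dvdn_gcdl _ _)) (D n n0 (dvdn_gcdr _ _)).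
  rewrite g => /Z.divide_1_r; rewrite /coprime; move: (gcdn _ _) => d H; apply/eqP; lia.
have := jacobi_reciprocity_nat mo' no' c; rewrite hm hn /sgn.
have -> : Z.of_nat (Z.abs_nat m) = m by lia.
have -> : Z.of_nat (Z.abs_nat n) = n by lia.
set x := jacobi m _; set y := jacobi n _.
(* The product of the two symbols is 1 or -1, a unit of Z; hence so is each symbol, and it may be
   moved across the equation. *)
have K (u : Z) : (u * y = 1)%Z -> (y = 1 \/ y = -1)%Z by move=> uy; apply/Z.divide_1_r; exists u.
case: andb => E.
- have Y : (y = 1 \/ y = -1)%Z by apply: (K (- x)%Z); lia.
  by case: Y => y1; rewrite y1 in E *; lia.
- by case: (K x E) => y1; rewrite y1 in E *; lia.
Qed.

Theorem jacobi_periodic (a t n : Z) : (0 < n)%Z ->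
  jacobi (a + t * n) (Z.abs_nat n) = jacobi a (Z.abs_nat n).
Proof. by move=> n0; rewrite -{1}(jacobi_period a t (Z.abs_nat n)); congr jacobi; lia. Qed.

End QuadraticReciprocity.

Import QuadraticReciprocity.

Open Scope R_scope.

(** * Complex numbers and the exponential function *)

Lemma C_ext (x y : C) : Re x = Re y -> Im x = Im y -> x = y.
Proof. destruct x, y; simpl; intros; subst; reflexivity. Qed.

Lemma Re_mult (x y : C) : Re (x * y)%C = Re x * Re y - Im x * Im y.
Proof. reflexivity. Qed.
Lemma Im_mult (x y : C) : Im (x * y)%C = Re x * Im y + Im x * Re y.
Proof. reflexivity. Qed.

Ltac Ccomp := apply C_ext; unfold Re, Im; simpl; try ring.

Lemma Cexp_plus (x y : C) : Cexp (x + y) = (Cexp x * Cexp y)%C.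
Proof.
  unfold Cexp; apply C_ext; unfold Re, Im; simpl;
  rewrite exp_plus, ?cos_plus, ?sin_plus; ring.
Qed.

Lemma Cexp_0 : Cexp 0 = 1%C.
Proof. unfold Cexp; simpl; rewrite exp_0, cos_0, sin_0; Ccomp. Qed.

Lemma Cmod_Cexp (x : C) : Cmod (Cexp x) = exp (Re x).
Proof.
  unfold Cexp, Cmod; simpl.
  replace (_ + _) with (exp (Re x) * exp (Re x) * (Rsqr (sin (Im x)) + Rsqr (cos (Im x))))
    by (unfold Rsqr; ring).
  rewrite sin2_cos2, Rmult_1_r. apply sqrt_square. left; apply exp_pos.
Qed.

Lemma Cexp_neq_0 (x : C) : Cexp x <> 0%C.
Proof. apply Cmod_gt_0. rewrite Cmod_Cexp. apply exp_pos. Qed.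

Lemma Cexp_opp (x : C) : Cexp (- x) = (/ Cexp x)%C.
Proof.
  assert (H : (Cexp x * Cexp (- x) = 1)%C).
  { rewrite <- Cexp_plus, <- Cexp_0. f_equal. ring. }
  pose proof (Cexp_neq_0 x) as Hx.
  replace (Cexp (- x)) with ((/ Cexp x) * (Cexp x * Cexp (- x)))%C by (field; exact Hx).
  rewrite H. ring.
Qed.

Lemma Cexp_R (x : R) : Cexp (RtoC x) = RtoC (exp x).
Proof. unfold Cexp, RtoC; simpl. rewrite cos_0, sin_0. f_equal; ring. Qed.

Lemma Cexp_INR (n : nat) (x : C) : Cexp (INR n * x) = (Cexp x ^ n)%C.
Proof.
  induction n as [|n IH].
  - simpl. replace (0 * x)%C with (RtoC 0) by ring. exact Cexp_0.
  - rewrite S_INR, RtoC_plus, Cmult_plus_distr_r, Cexp_plus, IH, Cmult_1_l.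
    simpl. ring.
Qed.

Lemma Cexp_PI : Cexp (PI * Ci) = (-(1))%C.
Proof.
  unfold Cexp. simpl. replace (PI * 0 - 0 * 1) with 0 by ring.
  replace (PI * 1 + 0 * 0) with PI by ring. rewrite exp_0, cos_PI, sin_PI. Ccomp.
Qed.

Lemma Cexp_PI_nat (n : nat) : Cexp (INR n * (PI * Ci)) = RtoC ((-1) ^ n).
Proof. rewrite Cexp_INR, Cexp_PI, RtoC_pow, <- RtoC_opp. reflexivity. Qed.

Lemma Cexp_PI_IZR (n : Z) : Cexp (IZR n * (PI * Ci)) = RtoC (powerRZ (-1) n).
Proof.
  destruct (Z_le_gt_dec 0 n) as [H|H].
  - rewrite <- (Z2Nat.id n H), <- INR_IZR_INZ, <- pow_powerRZ. apply Cexp_PI_nat.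
  - replace n with (- Z.of_nat (Z.to_nat (- n)))%Z by lia.
    set (k := Z.to_nat _).
    rewrite opp_IZR, RtoC_opp, <- INR_IZR_INZ.
    replace (- INR k * (PI * Ci))%C with (- (INR k * (PI * Ci)))%C by ring.
    rewrite Cexp_opp, Cexp_PI_nat, <- RtoC_inv by (apply pow_nonzero; lra). f_equal.
    rewrite powerRZ_neg', <- pow_powerRZ. reflexivity.
Qed.

Lemma Cexp_2PI_IZR (n : Z) : Cexp (2 * PI * Ci * IZR n) = 1%C.
Proof.
  replace (2 * PI * Ci * IZR n)%C with (IZR n * (PI * Ci) + IZR n * (PI * Ci))%C by ring.
  rewrite Cexp_plus, Cexp_PI_IZR, <- RtoC_mult, <- powerRZ_mult. f_equal.
  replace (-1 * -1) with 1 by ring. apply powerRZ_R1.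
Qed.

Lemma Re_le_Cmod (x : C) : Re x <= Cmod x.
Proof. eapply Rle_trans; [apply Rle_abs|apply re_le_Cmod]. Qed.

Lemma im_le_Cmod (x : C) : Rabs (Im x) <= Cmod x.
Proof. eapply Rle_trans; [apply Rmax_r|apply Rmax_Cmod]. Qed.

Lemma Cmod_le_Rabs_plus (x : C) : Cmod x <= Rabs (Re x) + Rabs (Im x).
Proof.
  replace x with (Re x + Ci * Im x)%C at 1 by Ccomp.
  eapply Rle_trans; [apply Cmod_triangle|].
  rewrite Cmod_mult, Cmod_Ci, !Cmod_R. lra.
Qed.

Lemma Cmod_minus_sym (x y : C) : Cmod (x - y) = Cmod (y - x).
Proof. rewrite <- (Cmod_opp (x - y)). f_equal. ring. Qed.

Lemma Cmod_triangle_minus (x y : C) : Cmod (x - y) <= Cmod x + Cmod y.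
Proof. unfold Cminus. rewrite <- (Cmod_opp y). apply Cmod_triangle. Qed.

Lemma Cmod_triangle_inv (x y : C) : Cmod x - Cmod y <= Cmod (x - y).
Proof.
  pose proof (Cmod_triangle (x - y) y) as H.
  replace (x - y + y)%C with x in H by ring. lra.
Qed.

(** * Derivatives of complex functions of a real variable *)

(** Kept componentwise so that the real mean value theorem and the real derivative rules apply to
    each part; [cderiv_eps] gives the equivalent form with the modulus. *)
Definition cderiv (f : R -> C) (x : R) (l : C) : Prop :=
  is_derive (fun t => Re (f t)) x (Re l) /\ is_derive (fun t => Im (f t)) x (Im l).

Lemma cderiv_ext_loc (f g : R -> C) (x : R) (l : C) :
  locally x (fun t => f t = g t) -> cderiv f x l -> cderiv g x l.
Proof.
  intros H [H1 H2]; split.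
  - apply (is_derive_ext_loc (fun t => Re (f t))); [|exact H1].
    revert H; apply filter_imp. intros t ->; reflexivity.
  - apply (is_derive_ext_loc (fun t => Im (f t))); [|exact H2].
    revert H; apply filter_imp. intros t ->; reflexivity.
Qed.

Lemma cderiv_ext (f g : R -> C) (x : R) (l : C) :
  (forall t, f t = g t) -> cderiv f x l -> cderiv g x l.
Proof. intros H; apply cderiv_ext_loc. apply filter_forall; exact H. Qed.

Lemma cderiv_RtoC (f : R -> R) (x l : R) :
  is_derive f x l -> cderiv (fun t => RtoC (f t)) x (RtoC l).
Proof.
  intros H; split; [exact H|].
  change (is_derive (fun _ : R => 0) x 0). auto_derive; reflexivity.
Qed.

Lemma cderiv_const (c : C) (x : R) : cderiv (fun _ => c) x 0%C.
Proof.
  split; [change (is_derive (fun _ : R => Re c) x 0)|change (is_derive (fun _ : R => Im c) x 0)];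
  auto_derive; reflexivity.
Qed.

Lemma cderiv_id (x : R) : cderiv (fun t => RtoC t) x 1%C.
Proof. apply cderiv_RtoC. auto_derive; reflexivity. Qed.

Lemma is_derive_R_plus (f g : R -> R) (x l m : R) :
  is_derive f x l -> is_derive g x m -> is_derive (fun t => f t + g t) x (l + m).
Proof. intros F G. exact (is_derive_plus f g x l m F G). Qed.

Lemma is_derive_R_opp (f : R -> R) (x l : R) :
  is_derive f x l -> is_derive (fun t => - f t) x (- l).
Proof. intros F. exact (is_derive_opp f x l F). Qed.

Lemma is_derive_R_mult (f g : R -> R) (x l m : R) :
  is_derive f x l -> is_derive g x m -> is_derive (fun t => f t * g t) x (l * g x + f x * m).
Proof. intros F G. exact (is_derive_mult f g x l m F G Rmult_comm). Qed.

Lemma cderiv_plus (f g : R -> C) (x : R) (l m : C) :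
  cderiv f x l -> cderiv g x m -> cderiv (fun t => f t + g t)%C x (l + m)%C.
Proof.
  intros [F1 F2] [G1 G2]; split.
  - exact (is_derive_R_plus _ _ _ _ _ F1 G1).
  - exact (is_derive_R_plus _ _ _ _ _ F2 G2).
Qed.

Lemma cderiv_opp (f : R -> C) (x : R) (l : C) :
  cderiv f x l -> cderiv (fun t => - f t)%C x (- l)%C.
Proof.
  intros [F1 F2]; split.
  - exact (is_derive_R_opp _ _ _ F1).
  - exact (is_derive_R_opp _ _ _ F2).
Qed.

Lemma cderiv_minus (f g : R -> C) (x : R) (l m : C) :
  cderiv f x l -> cderiv g x m -> cderiv (fun t => f t - g t)%C x (l - m)%C.
Proof. intros F G. apply cderiv_plus; [exact F|apply cderiv_opp; exact G]. Qed.

Lemma cderiv_mult (f g : R -> C) (x : R) (l m : C) :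
  cderiv f x l -> cderiv g x m -> cderiv (fun t => f t * g t)%C x (l * g x + f x * m)%C.
Proof.
  intros [F1 F2] [G1 G2]. split.
  - replace (Re (l * g x + f x * m)%C) with ((Re l * Re (g x) + Re (f x) * Re m)
       + - (Im l * Im (g x) + Im (f x) * Im m)) by (unfold Re, Im; simpl; ring).
    exact (is_derive_R_plus _ _ _ _ _ (is_derive_R_mult _ _ _ _ _ F1 G1)
      (is_derive_R_opp _ _ _ (is_derive_R_mult _ _ _ _ _ F2 G2))).
  - replace (Im (l * g x + f x * m)%C) with ((Re l * Im (g x) + Re (f x) * Im m)
       + (Im l * Re (g x) + Im (f x) * Re m)) by (unfold Re, Im; simpl; ring).
    exact (is_derive_R_plus _ _ _ _ _ (is_derive_R_mult _ _ _ _ _ F1 G2)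
      (is_derive_R_mult _ _ _ _ _ F2 G1)).
Qed.

Lemma cderiv_scal (c : C) (f : R -> C) (x : R) (l : C) :
  cderiv f x l -> cderiv (fun t => c * f t)%C x (c * l)%C.
Proof.
  intros F. pose proof (cderiv_mult _ _ _ _ _ (cderiv_const c x) F) as H.
  replace (c * l)%C with (0 * f x + c * l)%C by ring. exact H.
Qed.

Lemma cderiv_exp (f : R -> C) (x : R) (l : C) :
  cderiv f x l -> cderiv (fun t => Cexp (f t)) x (l * Cexp (f x))%C.
Proof.
  assert (K : forall (a b : R -> R) la lb, is_derive a x la -> is_derive b x lb ->
    is_derive (fun t => exp (a t) * cos (b t)) x
      (la * (exp (a x) * cos (b x)) - lb * (exp (a x) * sin (b x))) /\
    is_derive (fun t => exp (a t) * sin (b t)) x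
      (la * (exp (a x) * sin (b x)) + lb * (exp (a x) * cos (b x)))).
  { intros a b la lb A B. split; auto_derive; try (repeat split; eexists; eassumption);
    change (Derive (fun t => a t) x) with (Derive a x);
    change (Derive (fun t => b t) x) with (Derive b x);
    rewrite (is_derive_unique a x la A), (is_derive_unique b x lb B); ring. }
  intros [F1 F2]. destruct (K _ _ _ _ F1 F2) as [K1 K2]. split.
  - replace (Re (l * Cexp (f x))%C) with (Re l * (exp (Re (f x)) * cos (Im (f x)))
      - Im l * (exp (Re (f x)) * sin (Im (f x)))) by (unfold Cexp, Re, Im; simpl; ring).
    exact K1.
  - replace (Im (l * Cexp (f x))%C) with (Re l * (exp (Re (f x)) * sin (Im (f x)))
      + Im l * (exp (Re (f x)) * cos (Im (f x)))) by (unfold Cexp, Re, Im; simpl; ring).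
    exact K2.
Qed.

Lemma cderiv_eps (f : R -> C) (x : R) (l : C) :
  cderiv f x l <->
  forall eps, 0 < eps -> exists delta, 0 < delta /\
    forall h, Rabs h < delta -> Cmod (f (x + h) - f x - h * l) <= eps * Rabs h.
Proof.
  split.
  - intros [F1 F2] eps Heps.
    apply is_derive_Reals in F1; apply is_derive_Reals in F2.
    destruct (F1 (eps / 2)) as [d1 D1]; [lra|]. destruct (F2 (eps / 2)) as [d2 D2]; [lra|].
    exists (Rmin d1 d2). split; [apply Rmin_pos; apply cond_pos|].
    intros h Hh. destruct (Req_dec h 0) as [->|Hh0].
    { replace (x + 0) with x by ring. replace (_ - _)%C with (RtoC 0) by ring.
      rewrite Cmod_0, Rabs_R0. lra. }
    eapply Rle_trans; [apply Cmod_le_Rabs_plus|].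
    pose proof (D1 h Hh0 (Rlt_le_trans _ _ _ Hh (Rmin_l _ _))) as E1.
    pose proof (D2 h Hh0 (Rlt_le_trans _ _ _ Hh (Rmin_r _ _))) as E2.
    assert (Hp : 0 < Rabs h) by (apply Rabs_pos_lt; exact Hh0).
    apply (Rmult_lt_compat_r (Rabs h)) in E1; [|exact Hp].
    apply (Rmult_lt_compat_r (Rabs h)) in E2; [|exact Hp].
    rewrite <- Rabs_mult in E1, E2.
    replace (Re (f (x + h)%R - f x - h * l)%C)
      with (((Re (f (x + h)) - Re (f x)) / h - Re l) * h)
      by (unfold Re, Im; simpl; field; exact Hh0).
    replace (Im (f (x + h)%R - f x - h * l)%C)
      with (((Im (f (x + h)) - Im (f x)) / h - Im l) * h)
      by (unfold Re, Im; simpl; field; exact Hh0).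
    lra.
  - intros H. split; apply is_derive_Reals; intros eps Heps.
    + destruct (H (eps / 2)) as [d [Hd D]]; [lra|]. exists (mkposreal d Hd).
      intros h Hh0 Hh. specialize (D h Hh).
      assert (Hp : 0 < Rabs h) by (apply Rabs_pos_lt; exact Hh0).
      apply Rmult_lt_reg_r with (Rabs h); [exact Hp|]. rewrite <- Rabs_mult.
      pose proof (re_le_Cmod (f (x + h)%R - f x - h * l)%C) as E.
      replace (Re (f (x + h)%R - f x - h * l)%C)
        with (((Re (f (x + h)) - Re (f x)) / h - Re l) * h) in E
        by (unfold Re, Im; simpl; field; exact Hh0).
      nra.
    + destruct (H (eps / 2)) as [d [Hd D]]; [lra|]. exists (mkposreal d Hd).
      intros h Hh0 Hh. specialize (D h Hh).
      assert (Hp : 0 < Rabs h) by (apply Rabs_pos_lt; exact Hh0).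
      apply Rmult_lt_reg_r with (Rabs h); [exact Hp|]. rewrite <- Rabs_mult.
      pose proof (im_le_Cmod (f (x + h)%R - f x - h * l)%C) as E.
      replace (Im (f (x + h)%R - f x - h * l)%C)
        with (((Im (f (x + h)) - Im (f x)) / h - Im l) * h) in E
        by (unfold Re, Im; simpl; field; exact Hh0).
      nra.
Qed.

Lemma cderiv_bounded (f : R -> C) (x : R) (l : C) :
  cderiv f x l -> exists delta, 0 < delta /\
    forall h, Rabs h < delta -> Cmod (f (x + h) - f x) <= (Cmod l + 1) * Rabs h.
Proof.
  intros F. apply (proj1 (cderiv_eps _ _ _)) with (eps := 1) in F; [|lra].
  destruct F as [d [Hd D]]. exists d; split; [exact Hd|]. intros h Hh.
  specialize (D h Hh).
  replace (f (x + h)%R - f x)%C with ((f (x + h)%R - f x - h * l) + h * l)%C by ring.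
  eapply Rle_trans; [apply Cmod_triangle|]. rewrite Cmod_mult, Cmod_R. lra.
Qed.

(** * Complex differentiability *)

Definition Cdiff (f : C -> C) (z l : C) : Prop :=
  forall eps, 0 < eps -> exists delta, 0 < delta /\
    forall h, Cmod h < delta -> Cmod (f (z + h)%C - f z - l * h)%C <= eps * Cmod h.

Lemma cderiv_comp (f : C -> C) (g : R -> C) (x : R) (l m : C) :
  Cdiff f (g x) l -> cderiv g x m -> cderiv (fun t => f (g t)) x (l * m)%C.
Proof.
  intros F G. apply cderiv_eps. intros eps Heps.
  destruct (cderiv_bounded _ _ _ G) as [d1 [Hd1 D1]].
  pose proof (Cmod_ge_0 l) as Hl. pose proof (Cmod_ge_0 m) as Hm.
  destruct (F (eps / 2 / (Cmod m + 1))) as [d2 [Hd2 D2]].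
  { apply Rdiv_lt_0_compat; lra. }
  destruct (proj1 (cderiv_eps _ _ _) G (eps / 2 / (Cmod l + 1))) as [d3 [Hd3 D3]].
  { apply Rdiv_lt_0_compat; lra. }
  exists (Rmin (Rmin d1 d3) (d2 / (Cmod m + 1))). split.
  { repeat apply Rmin_pos; try assumption. apply Rdiv_lt_0_compat; lra. }
  intros h Hh.
  assert (H1 : Rabs h < d1) by (eapply Rlt_le_trans; [exact Hh|]; eapply Rle_trans; [apply Rmin_l|apply Rmin_l]).
  assert (H3 : Rabs h < d3) by (eapply Rlt_le_trans; [exact Hh|]; eapply Rle_trans; [apply Rmin_l|apply Rmin_r]).
  assert (H2 : Rabs h < d2 / (Cmod m + 1)) by (eapply Rlt_le_trans; [exact Hh|]; apply Rmin_r).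
  specialize (D1 h H1). specialize (D3 h H3).
  assert (H4 : Cmod (g (x + h) - g x) < d2).
  { eapply Rle_lt_trans; [exact D1|].
    apply (Rmult_lt_compat_l (Cmod m + 1)) in H2; [|lra].
    replace ((Cmod m + 1) * (d2 / (Cmod m + 1))) with d2 in H2 by (field; lra). exact H2. }
  specialize (D2 _ H4).
  replace (g x + (g (x + h)%R - g x))%C with (g (x + h)) in D2 by ring.
  replace (f (g (x + h)%R) - f (g x) - h * (l * m))%C with
    ((f (g (x + h)%R) - f (g x) - l * (g (x + h)%R - g x)) + l * (g (x + h)%R - g x - h * m))%C by ring.
  eapply Rle_trans; [apply Cmod_triangle|]. rewrite Cmod_mult.
  assert (A1 : Cmod (f (g (x + h)%R) - f (g x) - l * (g (x + h)%R - g x)) <= eps / 2 * Rabs h).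
  { eapply Rle_trans; [exact D2|].
    replace (eps / 2 * Rabs h) with (eps / 2 / (Cmod m + 1) * ((Cmod m + 1) * Rabs h)) by (field; lra).
    apply Rmult_le_compat_l; [|exact D1]. left; apply Rdiv_lt_0_compat; lra. }
  assert (A2 : Cmod l * Cmod (g (x + h)%R - g x - h * m) <= eps / 2 * Rabs h).
  { apply Rle_trans with ((Cmod l + 1) * (eps / 2 / (Cmod l + 1) * Rabs h)).
    - apply Rmult_le_compat; [lra|apply Cmod_ge_0|lra|exact D3].
    - right; field; lra. }
  lra.
Qed.

Lemma Cdiff_inv (z : C) : z <> 0%C -> Cdiff Cinv z (- / (z * z))%C.
Proof.
  intros Hz eps Heps.
  assert (Hm : 0 < Cmod z) by (apply Cmod_gt_0; exact Hz).
  set (a := Cmod z) in *.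
  exists (Rmin (a / 2) (eps * (a * a * a) / 2)). split.
  { apply Rmin_pos; [lra|]. assert (0 < eps * (a * a * a)) by (repeat apply Rmult_lt_0_compat; assumption). lra. }
  intros h Hh.
  assert (H1 : Cmod h < a / 2) by (eapply Rlt_le_trans; [exact Hh|apply Rmin_l]).
  assert (H2 : Cmod h < eps * (a * a * a) / 2) by (eapply Rlt_le_trans; [exact Hh|apply Rmin_r]).
  assert (H3 : a / 2 <= Cmod (z + h)).
  { pose proof (Cmod_triangle_inv z (- h)) as E. rewrite Cmod_opp in E.
    replace (z - - h)%C with (z + h)%C in E by ring. fold a in E. lra. }
  assert (Hzh : (z + h)%C <> 0%C) by (apply Cmod_gt_0; lra).
  replace (/ (z + h) - / z - - / (z * z) * h)%C with (h * h / (z * z * (z + h)))%C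
    by (field; split; assumption).
  rewrite Cmod_div by (repeat apply Cmult_neq_0; assumption).
  rewrite !Cmod_mult. fold a.
  assert (P : 0 < a * a * Cmod (z + h)) by (repeat apply Rmult_lt_0_compat; lra).
  apply Rmult_le_reg_r with (a * a * Cmod (z + h)); [exact P|].
  unfold Rdiv. rewrite Rmult_assoc, Rinv_l by lra.
  pose proof (Cmod_ge_0 h).
  rewrite Rmult_1_r, (Rmult_comm eps), Rmult_assoc. apply Rmult_le_compat_l; [assumption|].
  apply Rle_trans with (eps * (a * a * (a / 2))); [lra|].
  apply Rmult_le_compat_l; [lra|]. apply Rmult_le_compat_l; [nra|exact H3].
Qed.

Lemma cderiv_inv (f : R -> C) (x : R) (l : C) :
  f x <> 0%C -> cderiv f x l -> cderiv (fun t => / f t)%C x (- l / (f x * f x))%C.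
Proof.
  intros H F. replace (- l / (f x * f x))%C with (- / (f x * f x) * l)%C by (field; exact H).
  apply cderiv_comp; [apply Cdiff_inv; exact H|exact F].
Qed.

Lemma cderiv_continuous (f : R -> C) (x : R) (l : C) :
  cderiv f x l -> forall eps, 0 < eps -> exists delta, 0 < delta /\
    forall t, Rabs (t - x) < delta -> Cmod (f t - f x) <= eps.
Proof.
  intros F eps Heps. destruct (cderiv_bounded _ _ _ F) as [d [Hd D]].
  pose proof (Cmod_ge_0 l).
  exists (Rmin d (eps / (Cmod l + 1))). split.
  { apply Rmin_pos; [assumption|]. apply Rdiv_lt_0_compat; lra. }
  intros t Ht. specialize (D (t - x) (Rlt_le_trans _ _ _ Ht (Rmin_l _ _))).
  replace (x + (t - x)) with t in D by ring.
  eapply Rle_trans; [exact D|].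
  pose proof (Rlt_le_trans _ _ _ Ht (Rmin_r _ _)) as H2.
  apply (Rmult_lt_compat_l (Cmod l + 1)) in H2; [|lra].
  replace ((Cmod l + 1) * (eps / (Cmod l + 1))) with eps in H2 by (field; lra). lra.
Qed.

(* Componentwise mean value inequality, hence the factor 2. *)
Lemma cderiv_mvt (f : R -> C) (df : R -> C) (a b M : R) (l : C) :
  a <= b ->
  (forall x, a <= x <= b -> cderiv f x (df x)) ->
  (forall x, a <= x <= b -> Cmod (df x - l) <= M) ->
  Cmod (f b - f a - (b - a) * l) <= 2 * M * (b - a).
Proof.
  intros Hab F B.
  assert (K : forall (g : R -> R) (dg : R -> R) c,
    (forall x, a <= x <= b -> is_derive g x (dg x)) ->
    (forall x, a <= x <= b -> Rabs (dg x - c) <= M) ->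
    Rabs (g b - g a - (b - a) * c) <= M * (b - a)).
  { intros g dg c G D.
    destruct (MVT_gen g a b dg) as [x [Hx E]].
    - intros x. rewrite Rmin_left, Rmax_right by exact Hab. intros Hx. apply G; lra.
    - intros x. rewrite Rmin_left, Rmax_right by exact Hab. intros Hx.
      apply derivable_continuous_pt. exists (dg x). apply is_derive_Reals, G, Hx.
    - rewrite Rmin_left, Rmax_right in Hx by exact Hab.
      rewrite E. replace (dg x * (b - a) - (b - a) * c) with ((dg x - c) * (b - a)) by ring.
      rewrite Rabs_mult, (Rabs_right (b - a)) by lra.
      apply Rmult_le_compat_r; [lra|]. apply D, Hx. }
  eapply Rle_trans; [apply Cmod_le_Rabs_plus|].
  assert (A1 := K (fun t => Re (f t)) (fun t => Re (df t)) (Re l)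
    (fun x Hx => proj1 (F x Hx))
    (fun x Hx => Rle_trans _ _ _ (re_le_Cmod (df x - l)%C) (B x Hx))).
  assert (A2 := K (fun t => Im (f t)) (fun t => Im (df t)) (Im l)
    (fun x Hx => proj2 (F x Hx))
    (fun x Hx => Rle_trans _ _ _ (im_le_Cmod (df x - l)%C) (B x Hx))).
  replace (Re (f b - f a - (b - a) * l)%C) with (Re (f b) - Re (f a) - (b - a) * Re l)
    by (unfold Re, Im; simpl; ring).
  replace (Im (f b - f a - (b - a) * l)%C) with (Im (f b) - Im (f a) - (b - a) * Im l)
    by (unfold Re, Im; simpl; ring).
  lra.
Qed.

Lemma cderiv_zero_const (f : R -> C) (a b : R) :
  a <= b -> (forall x, a <= x <= b -> cderiv f x 0%C) -> f b = f a.
Proof.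
  intros Hab F.
  assert (H : Cmod (f b - f a - (b - a) * 0) <= 2 * 0 * (b - a)).
  { apply cderiv_mvt with (df := fun _ => 0%C); [exact Hab|exact F|].
    intros x _. replace (0 - 0)%C with (RtoC 0) by ring. rewrite Cmod_0; lra. }
  assert (E : (f b - f a = 0)%C).
  { apply Cmod_eq_0. apply Rle_antisym; [|apply Cmod_ge_0].
    replace (f b - f a)%C with (f b - f a - (b - a) * 0)%C by ring. lra. }
  replace (f b) with (f b - f a + f a)%C by ring. rewrite E. ring.
Qed.

Lemma cderiv_unique (f : R -> C) (x : R) (l m : C) :
  cderiv f x l -> cderiv f x m -> l = m.
Proof.
  intros [A1 A2] [B1 B2]. apply C_ext.
  - rewrite <- (is_derive_unique _ _ _ A1). apply is_derive_unique, B1.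
  - rewrite <- (is_derive_unique _ _ _ A2). apply is_derive_unique, B2.
Qed.

Lemma cderiv_eq (f : R -> C) (x : R) (l m : C) : l = m -> cderiv f x l -> cderiv f x m.
Proof. intros ->; trivial. Qed.

Lemma cderiv_linear (z h : C) (x : R) : cderiv (fun t => z + t * h)%C x h.
Proof.
  apply cderiv_eq with (0 + (1 * h + x * 0))%C; [ring|].
  apply cderiv_plus; [apply cderiv_const|apply cderiv_mult; [apply cderiv_id|apply cderiv_const]].
Qed.

Lemma cderiv_scal_id (h : C) (x : R) : cderiv (fun t => t * h)%C x h.
Proof.
  apply cderiv_eq with (1 * h + x * 0)%C; [ring|].
  apply cderiv_mult; [apply cderiv_id|apply cderiv_const].
Qed.

Lemma Cminus_0_r (a : C) : (a - 0)%C = a.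
Proof. ring. Qed.

(** * Absolutely convergent complex series *)

Definition csummable (u : nat -> C) : Prop := ex_series (fun n => Cmod (u n)).

Lemma ex_series_scal_R (c : R) (a : nat -> R) : ex_series a -> ex_series (fun n => c * a n).
Proof. intros H. exact (ex_series_scal_l c a H). Qed.

Lemma csummable_le (u : nat -> C) (a : nat -> R) :
  (forall n, Cmod (u n) <= a n) -> ex_series a -> csummable u.
Proof.
  intros H Ha. apply (ex_series_le (K := R_AbsRing) (V := R_CompleteNormedModule) _ a); [|exact Ha].
  intros n. unfold norm; simpl. unfold abs; simpl. rewrite Rabs_right; [apply H|].
  apply Rle_ge, Cmod_ge_0.
Qed.

Lemma csummable_Re (u : nat -> C) : csummable u -> ex_series (fun n => Re (u n)).
Proof.
  intros H. apply (ex_series_le (K := R_AbsRing) (V := R_CompleteNormedModule) _ (fun n => Cmod (u n))); [|exact H].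
  intros n. apply re_le_Cmod.
Qed.

Lemma csummable_Im (u : nat -> C) : csummable u -> ex_series (fun n => Im (u n)).
Proof.
  intros H. apply (ex_series_le (K := R_AbsRing) (V := R_CompleteNormedModule) _ (fun n => Cmod (u n))); [|exact H].
  intros n. apply im_le_Cmod.
Qed.

Lemma CSeries_ext (u v : nat -> C) : (forall n, u n = v n) -> CSeries u = CSeries v.
Proof. intros H. unfold CSeries. f_equal; apply Series_ext; intros n; rewrite H; reflexivity. Qed.

Lemma csummable_ext (u v : nat -> C) : (forall n, u n = v n) -> csummable u -> csummable v.
Proof. intros H. apply ex_series_ext. intros n; rewrite H; reflexivity. Qed.

Lemma csummable_plus (u v : nat -> C) :
  csummable u -> csummable v -> csummable (fun n => u n + v n)%C.
Proof.
  intros Hu Hv. apply csummable_le with (fun n => Cmod (u n) + Cmod (v n)).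
  - intros n; apply Cmod_triangle.
  - apply (ex_series_plus (V := R_NormedModule) _ _ Hu Hv).
Qed.

Lemma csummable_scal (c : C) (u : nat -> C) :
  csummable u -> csummable (fun n => c * u n)%C.
Proof.
  intros Hu. apply csummable_le with (fun n => Cmod c * Cmod (u n)).
  - intros n; rewrite Cmod_mult; apply Rle_refl.
  - apply (ex_series_scal_l (Cmod c) _ Hu).
Qed.

Lemma csummable_opp (u : nat -> C) : csummable u -> csummable (fun n => - u n)%C.
Proof. apply ex_series_ext. intros n; rewrite Cmod_opp; reflexivity. Qed.

Lemma csummable_minus (u v : nat -> C) :
  csummable u -> csummable v -> csummable (fun n => u n - v n)%C.
Proof. intros Hu Hv. apply csummable_plus; [exact Hu|apply csummable_opp; exact Hv]. Qed.

Lemma CSeries_plus (u v : nat -> C) : csummable u -> csummable v ->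
  CSeries (fun n => u n + v n)%C = (CSeries u + CSeries v)%C.
Proof.
  intros Hu Hv. apply C_ext.
  - apply (Series_plus _ _ (csummable_Re _ Hu) (csummable_Re _ Hv)).
  - apply (Series_plus _ _ (csummable_Im _ Hu) (csummable_Im _ Hv)).
Qed.

Lemma CSeries_scal (c : C) (u : nat -> C) : csummable u ->
  CSeries (fun n => c * u n)%C = (c * CSeries u)%C.
Proof.
  intros Hu. pose proof (csummable_Re _ Hu) as H1. pose proof (csummable_Im _ Hu) as H2.
  apply C_ext; simpl.
  - change (Series (fun n => Re c * Re (u n) - Im c * Im (u n)) =
      Re c * Series (fun n => Re (u n)) - Im c * Series (fun n => Im (u n))).
    rewrite Series_minus by first [exact (ex_series_scal_l _ _ H1)|exact (ex_series_scal_l _ _ H2)].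
    rewrite !Series_scal_l; reflexivity.
  - change (Series (fun n => Re c * Im (u n) + Im c * Re (u n)) =
      Re c * Series (fun n => Im (u n)) + Im c * Series (fun n => Re (u n))).
    rewrite Series_plus by first [exact (ex_series_scal_l _ _ H1)|exact (ex_series_scal_l _ _ H2)].
    rewrite !Series_scal_l; reflexivity.
Qed.

Lemma CSeries_opp (u : nat -> C) : CSeries (fun n => - u n)%C = (- CSeries u)%C.
Proof. apply C_ext; apply Series_opp. Qed.

Lemma CSeries_minus (u v : nat -> C) : csummable u -> csummable v ->
  CSeries (fun n => u n - v n)%C = (CSeries u - CSeries v)%C.
Proof.
  intros Hu Hv. unfold Cminus. rewrite CSeries_plus; [|exact Hu|apply csummable_opp; exact Hv].
  rewrite CSeries_opp; reflexivity.
Qed.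

Lemma CSeries_bound (u : nat -> C) : csummable u ->
  Cmod (CSeries u) <= 2 * Series (fun n => Cmod (u n)).
Proof.
  intros Hu. eapply Rle_trans; [apply Cmod_le_Rabs_plus|].
  assert (K : forall v : nat -> R, (forall n, Rabs (v n) <= Cmod (u n)) ->
     Rabs (Series v) <= Series (fun n => Cmod (u n))).
  { intros v Hv. eapply Rle_trans.
    - apply Series_Rabs.
      apply (ex_series_le (K := R_AbsRing) (V := R_CompleteNormedModule) _ (fun n => Cmod (u n)));
        [|exact Hu].
      intros n. unfold norm; simpl; unfold abs; simpl. rewrite Rabs_Rabsolu. apply Hv.
    - apply Series_le; [|exact Hu]. intros n; split; [apply Rabs_pos|apply Hv]. }
  pose proof (K (fun n => Re (u n)) (fun n => re_le_Cmod (u n))).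
  pose proof (K (fun n => Im (u n)) (fun n => im_le_Cmod (u n))).
  simpl in *. lra.
Qed.

Lemma CSeries_bound_le (u : nat -> C) (a : nat -> R) :
  (forall n, Cmod (u n) <= a n) -> ex_series a -> Cmod (CSeries u) <= 2 * Series a.
Proof.
  intros H Ha. eapply Rle_trans; [apply CSeries_bound; eapply csummable_le; eassumption|].
  apply Rmult_le_compat_l; [lra|]. apply Series_le; [|exact Ha].
  intros n; split; [apply Cmod_ge_0|apply H].
Qed.

Fixpoint csum (u : nat -> C) (n : nat) : C :=
  match n with O => 0%C | S n => (csum u n + u n)%C end.

Lemma csum_ext (u v : nat -> C) (n : nat) :
  (forall j, (j < n)%nat -> u j = v j) -> csum u n = csum v n.
Proof.
  induction n as [|n IH]; intros H; simpl; [reflexivity|].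
  rewrite IH by (intros; apply H; lia). rewrite H by lia. reflexivity.
Qed.

Lemma csummable_shift (u : nat -> C) (N : nat) :
  csummable u -> csummable (fun n => u (N + n)%nat).
Proof.
  intros H. apply (ex_series_incr_n (fun n => Cmod (u n)) N), H.
Qed.

Lemma CSeries_split (u : nat -> C) (N : nat) : csummable u ->
  CSeries u = (csum u N + CSeries (fun n => u (N + n)%nat))%C.
Proof.
  intros Hu. induction N as [|N IH].
  - change (CSeries u = 0 + CSeries u)%C. ring.
  - rewrite IH. simpl csum. rewrite <- Cplus_assoc. f_equal.
    pose proof (csummable_shift _ N Hu) as Hs.
    assert (E : forall v : nat -> C, csummable v -> CSeries v = (v 0%nat + CSeries (fun n => v (S n)))%C).
    { intros v Hv. apply C_ext; simpl.
      - apply (Series_incr_1 _ (csummable_Re _ Hv)).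
      - apply (Series_incr_1 _ (csummable_Im _ Hv)). }
    rewrite E by exact Hs. rewrite Nat.add_0_r. f_equal. apply CSeries_ext. intros n. f_equal. lia.
Qed.

Lemma CSeries_finite (u : nat -> C) (N : nat) :
  (forall n, (N <= n)%nat -> u n = 0%C) -> csummable u /\ CSeries u = csum u N.
Proof.
  intros H.
  assert (Hz : is_series (fun _ : nat => 0) 0).
  { pose proof (is_series_scal_l 0 _ _ (is_series_geom 0 ltac:(rewrite Rabs_R0; lra))) as G.
    rewrite Rmult_0_l in G. revert G. apply is_series_ext.
    intros n. apply Rmult_0_l. }
  assert (Hu : csummable u).
  { apply (ex_series_incr_n (fun n => Cmod (u n)) N). exists 0. revert Hz. apply is_series_ext.
    intros n. rewrite H by lia. rewrite Cmod_0; reflexivity. }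
  split; [exact Hu|]. rewrite (CSeries_split u N Hu).
  assert (E : CSeries (fun n => u (N + n)%nat) = 0%C).
  { apply C_ext; simpl; apply is_series_unique; revert Hz; apply is_series_ext;
    intros n; rewrite H by lia; reflexivity. }
  rewrite E. ring.
Qed.

Lemma ex_series_tail (a : nat -> R) (eps : R) : ex_series a -> 0 < eps ->
  exists N, Rabs (Series (fun n => a (N + n)%nat)) < eps.
Proof.
  intros Ha He. pose proof (Series_correct _ Ha) as H.
  change (is_lim_seq (sum_n a) (Series a)) in H.
  apply is_lim_seq_spec in H. destruct (H (mkposreal _ He)) as [N HN].
  exists (S N). specialize (HN N (Nat.le_refl _)). simpl in HN.
  rewrite (Series_incr_n a (S N)) in HN by (lia || exact Ha).
  simpl pred in HN. rewrite <- sum_n_Reals in HN.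
  rewrite <- Rabs_Ropp. eapply Rle_lt_trans; [|exact HN]. right. f_equal. ring.
Qed.

(** * Limits of complex-valued functions along a filter *)

Section filter_limit.

Context {T : Type} (F : (T -> Prop) -> Prop) {FF : Filter F}.

Definition climit (f : T -> C) (l : C) : Prop :=
  forall eps, 0 < eps -> F (fun t => Cmod (f t - l) <= eps).

Lemma climit_const (c : C) : climit (fun _ => c) c.
Proof.
  intros eps He. apply filter_forall. intros _.
  replace (c - c)%C with (RtoC 0) by ring. rewrite Cmod_0; lra.
Qed.

Lemma climit_ext (f g : T -> C) (l : C) :
  F (fun t => f t = g t) -> climit f l -> climit g l.
Proof.
  intros H Hf eps He. generalize (filter_and _ _ H (Hf eps He)). apply filter_imp.
  intros t [<- ?]; assumption.
Qed.

Lemma climit_plus (f g : T -> C) (l m : C) :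
  climit f l -> climit g m -> climit (fun t => f t + g t)%C (l + m)%C.
Proof.
  intros Hf Hg eps He. assert (He2 : 0 < eps / 2) by lra.
  generalize (filter_and _ _ (Hf _ He2) (Hg _ He2)).
  apply filter_imp. intros t [A B].
  replace (f t + g t - (l + m))%C with ((f t - l) + (g t - m))%C by ring.
  eapply Rle_trans; [apply Cmod_triangle|]. lra.
Qed.

Lemma climit_scal (c : C) (f : T -> C) (l : C) :
  climit f l -> climit (fun t => c * f t)%C (c * l)%C.
Proof.
  intros Hf eps He. pose proof (Cmod_ge_0 c).
  assert (He2 : 0 < eps / (Cmod c + 1)) by (apply Rdiv_lt_0_compat; lra).
  generalize (Hf _ He2).
  apply filter_imp. intros t A.
  replace (c * f t - c * l)%C with (c * (f t - l))%C by ring. rewrite Cmod_mult.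
  apply Rle_trans with ((Cmod c + 1) * (eps / (Cmod c + 1))); [|right; field; lra].
  apply Rmult_le_compat; [lra|apply Cmod_ge_0|lra|exact A].
Qed.

Lemma climit_bounded (f : T -> C) (l : C) :
  climit f l -> F (fun t => Cmod (f t) <= Cmod l + 1).
Proof.
  intros Hf. generalize (Hf 1 Rlt_0_1). apply filter_imp. intros t A.
  replace (f t) with ((f t - l) + l)%C by ring.
  eapply Rle_trans; [apply Cmod_triangle|]. lra.
Qed.

Lemma climit_mult (f g : T -> C) (l m : C) :
  climit f l -> climit g m -> climit (fun t => f t * g t)%C (l * m)%C.
Proof.
  intros Hf Hg eps He. pose proof (Cmod_ge_0 l). pose proof (Cmod_ge_0 m).
  assert (He1 : 0 < eps / 2 / (Cmod m + 1)) by (repeat apply Rdiv_lt_0_compat; lra).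
  assert (He2 : 0 < eps / 2 / (Cmod l + 1)) by (repeat apply Rdiv_lt_0_compat; lra).
  generalize (filter_and _ _ (climit_bounded _ _ Hf) (filter_and _ _ (Hf _ He1) (Hg _ He2))).
  apply filter_imp. intros t [B [A1 A2]].
  replace (f t * g t - l * m)%C with (f t * (g t - m) + (f t - l) * m)%C by ring.
  eapply Rle_trans; [apply Cmod_triangle|]. rewrite !Cmod_mult.
  assert (Cmod (f t) * Cmod (g t - m) <= eps / 2).
  { apply Rle_trans with ((Cmod l + 1) * (eps / 2 / (Cmod l + 1))); [|right; field; lra].
    apply Rmult_le_compat; try apply Cmod_ge_0; assumption. }
  assert (Cmod (f t - l) * Cmod m <= eps / 2).
  { apply Rle_trans with ((eps / 2 / (Cmod m + 1)) * (Cmod m + 1)); [|right; field; lra].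
    apply Rmult_le_compat; try apply Cmod_ge_0; [assumption|lra]. }
  lra.
Qed.

Lemma climit_csum (f : T -> nat -> C) (g : nat -> C) (N : nat) :
  (forall n, climit (fun t => f t n) (g n)) -> climit (fun t => csum (f t) N) (csum g N).
Proof.
  intros H. induction N as [|N IH]; simpl; [apply climit_const|apply climit_plus; auto].
Qed.

(** Dominated convergence for series: under a common majorant the tails beyond N are uniformly
    small, and only finitely many terms have to converge. *)
Lemma climit_CSeries (f : T -> nat -> C) (g : nat -> C) (a : nat -> R) :
  ex_series a -> (forall n, Cmod (g n) <= a n) ->
  F (fun t => forall n, Cmod (f t n) <= a n) ->
  (forall n, climit (fun t => f t n) (g n)) ->
  climit (fun t => CSeries (f t)) (CSeries g).
Proof.
  intros Ha Hg Hf Hl eps He.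
  (* [CSeries_bound_le] costs a factor 2 and two tails occur, which brings eps/8 up to eps/2. *)
  destruct (ex_series_tail a (eps / 8) Ha) as [N HN]; [lra|].
  assert (He2 : 0 < eps / 2) by lra.
  generalize (filter_and _ _ Hf (climit_csum f g N Hl _ He2)).
  apply filter_imp. intros t [B L].
  rewrite (CSeries_split (f t) N) by (eapply csummable_le; eassumption).
  rewrite (CSeries_split g N) by (eapply csummable_le; eassumption).
  assert (Ha' : ex_series (fun n => a (N + n)%nat)) by (apply (ex_series_incr_n a N), Ha).
  pose proof (CSeries_bound_le (fun n => f t (N + n)%nat) _ (fun n => B (N + n)%nat) Ha') as B1.
  pose proof (CSeries_bound_le (fun n => g (N + n)%nat) _ (fun n => Hg (N + n)%nat) Ha') as B2.
  pose proof (Rle_abs (Series (fun n => a (N + n)%nat))) as B3.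
  set (p := csum (f t) N) in *. set (q := csum g N) in *.
  set (p' := CSeries (fun n => f t (N + n)%nat)) in *.
  set (q' := CSeries (fun n => g (N + n)%nat)) in *.
  replace (p + p' - (q + q'))%C with ((p - q) + (p' - q'))%C by ring.
  eapply Rle_trans; [apply Cmod_triangle|].
  pose proof (Cmod_triangle_minus p' q'). lra.
Qed.

End filter_limit.

Lemma climit_unique {T : Type} (F : (T -> Prop) -> Prop) {FF : ProperFilter F}
  (f : T -> C) (l m : C) : climit F f l -> climit F f m -> l = m.
Proof.
  intros H1 H2. destruct (Ceq_dec l m) as [E|E]; [exact E|exfalso].
  assert (P : 0 < Cmod (l - m)).
  { apply Cmod_gt_0. intros K. apply E.
    replace l with (l - m + m)%C by ring. rewrite K; ring. }
  assert (P3 : 0 < Cmod (l - m) / 3) by lra.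
  destruct (filter_ex _ (filter_and _ _ (H1 _ P3) (H2 _ P3))) as [t [A B]].
  pose proof (Cmod_triangle_minus (f t - m) (f t - l)) as K.
  replace (f t - m - (f t - l))%C with (l - m)%C in K by ring. lra.
Qed.

Lemma climit_csum_CSeries (u : nat -> C) : csummable u ->
  climit eventually (fun N => csum u N) (CSeries u).
Proof.
  intros Hu eps He. destruct (ex_series_tail _ (eps / 2) Hu) as [N HN]; [lra|].
  exists N. intros M HM.
  rewrite (CSeries_split u M Hu).
  replace (csum u M - _)%C with (- CSeries (fun n => u (M + n)%nat))%C by ring.
  rewrite Cmod_opp.
  eapply Rle_trans; [apply CSeries_bound, csummable_shift, Hu|].
  assert (E : Series (fun n => Cmod (u (M + n)%nat)) <= Series (fun n => Cmod (u (N + n)%nat))).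
  { assert (Hs : ex_series (fun n => Cmod (u (N + n)%nat))) by (apply (csummable_shift u N Hu)).
    destruct (Nat.eq_dec M N) as [->|HMN]; [lra|].
    rewrite (Series_incr_n (fun n => Cmod (u (N + n)%nat)) (M - N)); [|lia|exact Hs].
    rewrite (Series_ext (fun k => Cmod (u (N + (M - N + k))%nat)) (fun k => Cmod (u (M + k)%nat)))
      by (intros k; do 2 f_equal; lia).
    assert (0 <= sum_f_R0 (fun n => Cmod (u (N + n)%nat)) (pred (M - N))).
    { apply cond_pos_sum. intros; apply Cmod_ge_0. }
    lra. }
  pose proof (Rle_abs (Series (fun n => Cmod (u (N + n)%nat)))). lra.
Qed.

Lemma cderiv_csum (F f : nat -> R -> C) (x : R) (N : nat) :
  (forall n, cderiv (F n) x (f n x)) ->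
  cderiv (fun t => csum (fun n => F n t) N) x (csum (fun n => f n x) N).
Proof.
  intros H. induction N as [|N IH]; simpl; [apply cderiv_const|apply cderiv_plus; auto].
Qed.

(** Through the mean value inequality the majorant [A] of the derivatives bounds the increments of
    all terms uniformly. This gives summability at neighbouring points and a small tail; the finite
    part is differentiated term by term. *)
Lemma cderiv_CSeries (F f : nat -> R -> C) (A : nat -> R) (x r : R) :
  0 < r -> ex_series A -> csummable (fun n => F n x) ->
  (forall n t, Rabs (t - x) < r -> cderiv (F n) t (f n t) /\ Cmod (f n t) <= A n) ->
  cderiv (fun t => CSeries (fun n => F n t)) x (CSeries (fun n => f n x)).
Proof.
  intros Hr HA HF D.
  assert (Hxr : Rabs (x - x) < r) by (rewrite Rminus_diag, Rabs_R0; lra).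
  assert (M : forall n h, Rabs h < r -> Cmod (F n (x + h) - F n x) <= 2 * A n * Rabs h).
  { intros n h Hh.
    destruct (Rle_dec 0 h) as [Hp|Hp].
    - pose proof (cderiv_mvt (F n) (f n) x (x + h) (A n) 0%C) as K.
      replace (F n (x + h)%R - F n x)%C with (F n (x + h)%R - F n x - ((x + h)%R - x) * 0)%C by ring.
      rewrite Rabs_right in * by lra.
      replace (2 * A n * h) with (2 * A n * (x + h - x)) by ring.
      apply K; [lra| |].
      + intros y Hy. apply D. apply Rabs_def1; lra.
      + intros y Hy. replace (f n y - 0)%C with (f n y) by ring. apply D. apply Rabs_def1; lra.
    - pose proof (cderiv_mvt (F n) (f n) (x + h) x (A n) 0%C) as K.
      rewrite Cmod_minus_sym.
      replace (F n x - F n (x + h)%R)%C with (F n x - F n (x + h)%R - (x - (x + h)%R) * 0)%C by ring.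
      rewrite Rabs_left in * by lra.
      replace (2 * A n * - h) with (2 * A n * (x - (x + h))) by ring.
      apply K; [lra| |].
      + intros y Hy. apply D. apply Rabs_def1; lra.
      + intros y Hy. replace (f n y - 0)%C with (f n y) by ring. apply D. apply Rabs_def1; lra. }
  assert (Hf : csummable (fun n => f n x)) by (eapply csummable_le; [intros n; apply (D n x Hxr)|exact HA]).
  assert (HFh : forall h, Rabs h < r -> csummable (fun n => F n (x + h))).
  { intros h Hh.
    apply (csummable_ext (fun n => F n x + (F n (x + h)%R - F n x))%C); [intros n; ring|].
    apply csummable_plus; [exact HF|].
    apply csummable_le with (fun n => Rabs h * (2 * A n)).
    - intros n. rewrite Rmult_comm. apply M, Hh.
    - apply ex_series_scal_R, ex_series_scal_R, HA. }
  apply cderiv_eps. intros eps He.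
  destruct (ex_series_tail A (eps / 16) HA) as [N HN]; [lra|].
  assert (He2 : 0 < eps / 2) by lra.
  destruct (proj1 (cderiv_eps _ _ _) (cderiv_csum F f x N (fun n => proj1 (D n x Hxr))) _ He2)
    as [d [Hd Hs]].
  exists (Rmin d r). split; [apply Rmin_pos; assumption|].
  intros h Hh.
  assert (Hhd : Rabs h < d) by (eapply Rlt_le_trans; [exact Hh|apply Rmin_l]).
  assert (Hhr : Rabs h < r) by (eapply Rlt_le_trans; [exact Hh|apply Rmin_r]).
  rewrite (CSeries_split _ N (HFh h Hhr)), (CSeries_split _ N HF), (CSeries_split _ N Hf).
  assert (HA' : ex_series (fun n => A (N + n)%nat)) by (apply (ex_series_incr_n A N), HA).
  assert (T1 : Cmod (CSeries (fun n => F (N + n)%nat (x + h)%R - F (N + n)%nat x)%C)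
     <= 2 * (Rabs h * (2 * Series (fun n => A (N + n)%nat)))).
  { rewrite <- (Series_scal_l 2), <- (Series_scal_l (Rabs h)). apply CSeries_bound_le.
    - intros n. rewrite (Rmult_comm (Rabs h)). apply M, Hhr.
    - apply ex_series_scal_R, ex_series_scal_R, HA'. }
  rewrite CSeries_minus in T1
    by (apply (csummable_shift (fun n => F n _) N); [apply HFh, Hhr||exact HF]).
  assert (T2 : Cmod (CSeries (fun n => f (N + n)%nat x)) <= 2 * Series (fun n => A (N + n)%nat)).
  { apply CSeries_bound_le; [|exact HA']. intros n; apply (D _ x Hxr). }
  specialize (Hs h Hhd).
  pose proof (Rle_abs (Series (fun n => A (N + n)%nat))) as B3.
  pose proof (Rabs_pos h) as B4.
  match goal with |- Cmod (?a + ?b - (?c + ?d) - _ * (?e + ?g)) <= _ =>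
    replace (a + b - (c + d) - h * (e + g))%C with ((a - c - h * e) + ((b - d) - h * g))%C by ring end.
  eapply Rle_trans; [apply Cmod_triangle|].
  eapply Rle_trans; [apply Rplus_le_compat; [exact Hs|apply Cmod_triangle_minus]|].
  rewrite Cmod_mult, Cmod_R.
  assert (T3 : Rabs h * Cmod (CSeries (fun n => f (N + n)%nat x)) <= Rabs h * (eps / 8)).
  { apply Rmult_le_compat_l; [exact B4|lra]. }
  assert (T4 : Rabs h * (2 * Series (fun n => A (N + n)%nat)) <= Rabs h * (eps / 8)).
  { apply Rmult_le_compat_l; [exact B4|lra]. }
  nra.
Qed.

(** * Gaussian majorants *)

Lemma exp_le_mono (x y : R) : x <= y -> exp x <= exp y.
Proof. intros [H| ->]; [left; apply exp_increasing, H|right; reflexivity]. Qed.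

Lemma exp_INR (n : nat) (x : R) : exp (INR n * x) = exp x ^ n.
Proof.
  induction n as [|n IH]; [simpl; rewrite Rmult_0_l; apply exp_0|].
  rewrite S_INR, Rmult_plus_distr_r, exp_plus, IH, Rmult_1_l. simpl; ring.
Qed.

Lemma gauss_majorant (delta B : R) : 0 < delta ->
  exists A : nat -> R, ex_series A /\
    forall (n : nat) (m : R), INR n <= Rabs m <= INR n + 1 ->
      (1 + Rabs m) ^ 2 * exp (- delta * m ^ 2 + B * Rabs m) <= A n.
Proof.
  (* A quarter of delta m^2 absorbs the linear term, a quarter the polynomial weight, and the
     remaining half yields the geometric series, since n <= m^2. *)
  intros Hd. set (K := 2 * (1 + 4 / delta) * exp (B ^ 2 / delta)).
  exists (fun n => K * exp (- (delta / 2)) ^ n). split.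
  - apply ex_series_scal_R. apply ex_series_geom. rewrite Rabs_right by (left; apply exp_pos).
    rewrite <- exp_0. apply exp_increasing. lra.
  - intros n m Hm. set (t := Rabs m) in *.
    assert (Ht : 0 <= t) by apply Rabs_pos.
    replace (m ^ 2) with (t ^ 2) by (unfold t; rewrite pow2_abs; reflexivity).
    assert (H1 : t ^ 2 <= 4 / delta * exp (delta / 4 * t ^ 2)).
    { pose proof (exp_ineq1_le (delta / 4 * t ^ 2)) as E.
      apply (Rmult_le_compat_l (4 / delta)) in E; [|left; apply Rdiv_lt_0_compat; lra].
      replace (4 / delta * (1 + delta / 4 * t ^ 2)) with (4 / delta + t ^ 2) in E by (field; lra).
      assert (0 < 4 / delta) by (apply Rdiv_lt_0_compat; lra). lra. }
    assert (H2 : 1 <= exp (delta / 4 * t ^ 2)).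
    { pose proof (exp_ineq1_le (delta / 4 * t ^ 2)).
      pose proof (Rmult_le_pos (delta / 4) (t ^ 2) ltac:(lra) (pow2_ge_0 t)). lra. }
    assert (H3 : (1 + t) ^ 2 <= 2 * (1 + 4 / delta) * exp (delta / 4 * t ^ 2)).
    { pose proof (pow2_ge_0 (t - 1)).
      replace (2 * (1 + 4 / delta) * exp (delta / 4 * t ^ 2)) with
        (2 * exp (delta / 4 * t ^ 2) + 2 * (4 / delta * exp (delta / 4 * t ^ 2))) by ring. nra. }
    assert (H4 : - delta * t ^ 2 + B * t <= B ^ 2 / delta + (- (delta / 4 * t ^ 2) + INR n * - (delta / 2))).
    { assert (E : B * t <= delta / 4 * t ^ 2 + B ^ 2 / delta).
      { apply Rmult_le_reg_r with delta; [lra|].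
        replace ((delta / 4 * t ^ 2 + B ^ 2 / delta) * delta) with ((delta * t / 2) ^ 2 + B ^ 2) by (field; lra).
        pose proof (pow2_ge_0 (delta * t / 2 - B)). nra. }
      assert (INR n <= t ^ 2).
      { destruct n as [|n]; [simpl; nra|]. pose proof (pos_INR n). rewrite S_INR in *. nra. }
      nra. }
    apply exp_le_mono in H4.
    apply Rle_trans with (2 * (1 + 4 / delta) * exp (delta / 4 * t ^ 2)
      * exp (B ^ 2 / delta + (- (delta / 4 * t ^ 2) + INR n * - (delta / 2)))).
    + apply Rmult_le_compat; [nra|left; apply exp_pos|exact H3|exact H4].
    + right. rewrite !exp_plus, (exp_Ropp (delta / 4 * t ^ 2)), exp_INR.
      unfold K. field. split; [|lra]. pose proof (exp_pos (delta / 4 * t ^ 2)). lra.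
Qed.

(** * Sums over half-integers *)

Definition half (n : nat) : R := INR n + / 2.

Lemma half_pos (n : nat) : 0 < half n.
Proof. unfold half. pose proof (pos_INR n). lra. Qed.

(** The terms m = n + 1/2 and m = -(n + 1/2) of the alternating sum, paired: they belong to l = n
    and l = -1 - n, of opposite parity, whence the minus sign. *)
Definition half_term (u : R -> C) (n : nat) : C :=
  ((-1) ^ n * (u (half n) - u (- half n)%R))%C.

Lemma Cmod_sign (n : nat) : Cmod ((-1) ^ n)%C = 1.
Proof. rewrite Cmod_pow, Cmod_R, Rabs_left by lra. replace (- -1) with 1 by ring. apply pow1. Qed.

Definition half_summable (u : R -> C) : Prop :=
  csummable (fun n => u (half n)) /\ csummable (fun n => u (- half n)).

Lemma half_summable_le (u : R -> C) (a : nat -> R) : ex_series a ->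
  (forall n m, INR n <= Rabs m <= INR n + 1 -> Cmod (u m) <= a n) -> half_summable u.
Proof.
  intros Ha H. split; apply csummable_le with a; try exact Ha; intros n; apply H.
  - pose proof (half_pos n). rewrite Rabs_right by lra. unfold half; lra.
  - pose proof (half_pos n). rewrite Rabs_Ropp, Rabs_right by lra. unfold half; lra.
Qed.

Lemma half_term_bound (u : R -> C) (a : nat -> R) :
  (forall n m, INR n <= Rabs m <= INR n + 1 -> Cmod (u m) <= a n) ->
  forall n, Cmod (half_term u n) <= 2 * a n.
Proof.
  intros H n. unfold half_term. rewrite Cmod_mult, Cmod_sign, Rmult_1_l.
  eapply Rle_trans; [apply Cmod_triangle_minus|].
  pose proof (half_pos n).
  assert (Cmod (u (half n)) <= a n) by (apply H; rewrite Rabs_right by lra; unfold half; lra).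
  assert (Cmod (u (- half n)) <= a n)
    by (apply H; rewrite Rabs_Ropp, Rabs_right by lra; unfold half; lra).
  lra.
Qed.

Lemma half_term_summable (u : R -> C) : half_summable u -> csummable (half_term u).
Proof.
  intros [H1 H2]. unfold half_term.
  apply csummable_le with (fun n => Cmod (u (half n)) + Cmod (u (- half n))).
  - intros n. rewrite Cmod_mult, Cmod_sign, Rmult_1_l. apply Cmod_triangle_minus.
  - apply (ex_series_plus (V := R_NormedModule) _ _ H1 H2).
Qed.

Lemma alt_half_sum_CSeries (u : R -> C) : half_summable u ->
  alt_half_sum u = CSeries (half_term u).
Proof.
  intros [H1 H2]. unfold alt_half_sum, sumZ.
  assert (K : forall n v, Cmod (RtoC ((-1) ^ n) * v)%C = Cmod v).
  { intros n v. rewrite Cmod_mult, RtoC_pow, Cmod_sign. ring. }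
  rewrite <- CSeries_plus.
  - apply CSeries_ext. intros n. rewrite <- pow_powerRZ.
    replace (-1 - Z.of_nat n)%Z with (- Z.of_nat (S n))%Z by lia.
    rewrite powerRZ_neg', <- pow_powerRZ, opp_IZR, <- !INR_IZR_INZ.
    unfold half_term. replace (- INR (S n) + / 2) with (- half n) by (rewrite S_INR; unfold half; lra).
    fold (half n).
    replace (/ (-1) ^ S n) with (- (-1) ^ n).
    + rewrite RtoC_opp, RtoC_pow. ring.
    + apply Rmult_eq_reg_r with ((-1) ^ S n); [|apply pow_nonzero; lra].
      rewrite Rinv_l by (apply pow_nonzero; lra). simpl.
      replace (- (-1) ^ n * (-1 * (-1) ^ n)) with (((-1) * (-1)) ^ n) by (rewrite Rpow_mult_distr; ring).
      replace (-1 * -1) with 1 by ring. apply pow1.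
  - revert H1. apply ex_series_ext. intros n. rewrite <- pow_powerRZ, K.
    rewrite <- INR_IZR_INZ. reflexivity.
  - revert H2. apply ex_series_ext. intros n.
    replace (-1 - Z.of_nat n)%Z with (- Z.of_nat (S n))%Z by lia.
    rewrite powerRZ_neg', <- pow_powerRZ, opp_IZR, <- !INR_IZR_INZ.
    replace (- INR (S n) + / 2) with (- half n) by (rewrite S_INR; unfold half; lra).
    rewrite Cmod_mult, RtoC_inv by (apply pow_nonzero; lra).
    rewrite Cmod_inv.
    + rewrite RtoC_pow, Cmod_sign, Rinv_1. symmetry; apply Rmult_1_l.
    + intros E. apply RtoC_inj in E. revert E. apply pow_nonzero; lra.
Qed.

Lemma half_summable_ext (u v : R -> C) : (forall m, u m = v m) -> half_summable u -> half_summable v.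
Proof.
  intros H [A B]; split; [revert A|revert B]; apply csummable_ext; intros n; apply H.
Qed.

Lemma half_term_ext (u v : R -> C) (n : nat) : (forall m, u m = v m) -> half_term u n = half_term v n.
Proof. intros H. unfold half_term. rewrite !H. reflexivity. Qed.

Lemma Cmod_gauss (al be ga : C) (m delta B G : R) :
  delta <= Re al -> Rabs (Re be) <= B -> Re ga <= G ->
  Cmod (Cexp (- al * m ^ 2 + be * m + ga)) <= exp G * exp (- delta * m ^ 2 + B * Rabs m).
Proof.
  intros H1 H2 H3. rewrite Cmod_Cexp, <- exp_plus. apply exp_le_mono.
  replace (Re (- al * m ^ 2 + be * m + ga)%C) with (- Re al * m ^ 2 + Re be * m + Re ga)
    by (unfold Re, Im; simpl; ring).
  assert (Re be * m <= B * Rabs m).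
  { eapply Rle_trans; [apply Rle_abs|]. rewrite Rabs_mult.
    apply Rmult_le_compat_r; [apply Rabs_pos|exact H2]. }
  nra.
Qed.

(** The majorant depends only on bounds for the real parts of the coefficients, so it stays valid
    while a modular parameter varies along a path. *)
Lemma gauss_family_majorant (delta B G : R) : 0 < delta ->
  exists A : nat -> R, ex_series A /\
    forall (al be ga : C) (n : nat) (m : R), delta <= Re al -> Rabs (Re be) <= B -> Re ga <= G ->
      INR n <= Rabs m <= INR n + 1 ->
      (1 + Rabs m) ^ 2 * Cmod (Cexp (- al * m ^ 2 + be * m + ga)) <= A n.
Proof.
  intros Hd. destruct (gauss_majorant delta B Hd) as [A [HA H]].
  exists (fun n => exp G * A n). split; [apply ex_series_scal_R, HA|].
  intros al be ga n m H1 H2 H3 Hm.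
  apply Rle_trans with (exp G * ((1 + Rabs m) ^ 2 * exp (- delta * m ^ 2 + B * Rabs m))).
  - replace (exp G * _) with ((1 + Rabs m) ^ 2 * (exp G * exp (- delta * m ^ 2 + B * Rabs m))) by ring.
    apply Rmult_le_compat_l; [apply pow2_ge_0|]. apply Cmod_gauss; assumption.
  - apply Rmult_le_compat_l; [left; apply exp_pos|]. apply H, Hm.
Qed.

Lemma gauss_half_summable (al be ga : C) (p : R -> C) : 0 < Re al ->
  (forall m, Cmod (p m) <= (1 + Rabs m) ^ 2) ->
  half_summable (fun m => p m * Cexp (- al * m ^ 2 + be * m + ga))%C.
Proof.
  intros Ha Hp.
  destruct (gauss_family_majorant (Re al) (Rabs (Re be)) (Re ga) Ha) as [A [HA H]].
  apply half_summable_le with A; [exact HA|]. intros n m Hm.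
  rewrite Cmod_mult. eapply Rle_trans; [|apply (H al be ga n m); try apply Rle_refl; exact Hm].
  apply Rmult_le_compat_r; [apply Cmod_ge_0|apply Hp].
Qed.

(** * The complex error function *)

Definition erf_integrand (w : C) (l : R) : C := (w * Cexp (- PI * l ^ 2 * (w * w)))%C.

(** The integral of exp(-pi t^2) from 0 to w along the segment t = l w, that is erf(sqrt(pi) w)/2.
    It is therefore 2 Erf, and not Erf, that approaches the sign function. *)
Definition Erf (w : C) : C :=
  (RInt (fun l => Re (erf_integrand w l)) 0 1, RInt (fun l => Im (erf_integrand w l)) 0 1).

Ltac cont2d :=
  repeat first
   [ apply continuity_2d_pt_const | apply continuity_2d_pt_id1 | apply continuity_2d_pt_id2
   | apply continuity_2d_pt_plus | apply continuity_2d_pt_minus | apply continuity_2d_pt_mult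
   | apply continuity_2d_pt_opp
   | apply (continuity_1d_2d_pt_comp exp); [apply derivable_continuous_pt, derivable_pt_exp|]
   | apply (continuity_1d_2d_pt_comp cos); [apply continuity_cos|]
   | apply (continuity_1d_2d_pt_comp sin); [apply continuity_sin|] ].

Lemma cderiv_erf_integrand_r (w : C) (l : R) :
  cderiv (fun l => l * Cexp (- PI * l ^ 2 * (w * w)))%C l
    ((1 - 2 * PI * l ^ 2 * (w * w)) * Cexp (- PI * l ^ 2 * (w * w)))%C.
Proof.
  pose proof (cderiv_mult _ _ _ _ _ (cderiv_id l)
    (cderiv_exp _ _ _ (cderiv_mult _ _ _ _ _ (cderiv_scal (- PI)%C _ _ _ (cderiv_mult _ _ _ _ _
      (cderiv_id l) (cderiv_id l))) (cderiv_const (w * w)%C l)))) as H.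
  match type of H with cderiv ?f _ ?d => match goal with |- cderiv ?g _ ?e =>
    replace e with d; [apply (cderiv_ext f g); [|exact H]|] end end.
  - intros t. simpl. do 2 f_equal. ring.
  - simpl. replace (- PI * (l * l) * (w * w))%C with (- PI * (l * (l * 1)) * (w * w))%C by ring. ring.
Qed.

Lemma cderiv_erf_integrand_l (z h : C) (t l : R) :
  cderiv (fun t => erf_integrand (z + t * h) l) t
    (h * ((1 - 2 * PI * l ^ 2 * ((z + t * h) * (z + t * h)))
       * Cexp (- PI * l ^ 2 * ((z + t * h) * (z + t * h)))))%C.
Proof.
  pose proof (cderiv_linear z h t) as K.
  pose proof (cderiv_mult _ _ _ _ _ K (cderiv_exp _ _ _ (cderiv_scal (- PI * l ^ 2)%C _ _ _
    (cderiv_mult _ _ _ _ _ K K)))) as H.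
  match type of H with cderiv ?f _ ?d => match goal with |- cderiv ?g _ ?e =>
    replace e with d; [exact H|] end end.
  ring.
Qed.

(** Differentiation under the integral sign: the derivative of the integrand along the line is
    itself the l-derivative of h l exp(-pi l^2 (z + x h)^2), so the integral collapses to the
    boundary term at l = 1. *)
Lemma cderiv_Erf_line (z h : C) (x : R) :
  cderiv (fun t => Erf (z + t * h)) x (h * Cexp (- PI * ((z + x * h) * (z + x * h))))%C.
Proof.
  set (D := fun t l : R => (h * ((1 - 2 * PI * l ^ 2 * ((z + t * h) * (z + t * h)))
       * Cexp (- PI * l ^ 2 * ((z + t * h) * (z + t * h)))))%C).
  set (P := fun l : R => (h * (l * Cexp (- PI * l ^ 2 * ((z + x * h) * (z + x * h)))))%C).
  assert (HP : forall l, cderiv P l (D x l)).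
  { intros l. apply cderiv_scal. apply cderiv_erf_integrand_r. }
  assert (E : (h * Cexp (- PI * ((z + x * h) * (z + x * h))))%C = (P 1 - P 0)%C).
  { unfold P. replace (- PI * 1 ^ 2 * ((z + x * h) * (z + x * h)))%C
      with (- PI * ((z + x * h) * (z + x * h)))%C by ring. ring. }
  rewrite E.
  assert (K : forall p : C -> R, (p = Re \/ p = Im) ->
     is_derive (fun t : R => RInt (fun l => p (erf_integrand (z + t * h) l)) 0 1) x (p (P 1 - P 0)%C)).
  { intros p Hp.
    assert (Hd : forall t l, is_derive (fun t : R => p (erf_integrand (z + t * h) l)) t (p (D t l))).
    { intros t l. destruct (cderiv_erf_integrand_l z h t l). destruct Hp; subst p; assumption. }
    assert (HP' : forall l, is_derive (fun l : R => p (P l)) l (p (D x l))).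
    { intros l. destruct (HP l). destruct Hp; subst p; assumption. }
    assert (C2 : forall t l, continuity_2d_pt (fun t l : R => p (D t l)) t l).
    { intros t l. unfold D, Cexp. destruct Hp; subst p; unfold Re, Im; simpl; cont2d. }
    assert (C2' : forall t l, continuity_2d_pt (fun t l : R => p (erf_integrand (z + t * h) l)) t l).
    { intros t l. unfold erf_integrand, Cexp. destruct Hp; subst p; unfold Re, Im; simpl; cont2d. }
    assert (C1 : forall (f : R -> R -> R) t l, continuity_2d_pt f t l -> continuous (f t) l).
    { intros f t l Hc. apply continuity_2d_pt_filterlim in Hc.
      apply (filterlim_comp R (R * R) R (fun y => (t, y)) (fun q => f (fst q) (snd q))
         (locally l) (locally (t, l)) (locally (f t l))); [|exact Hc].
      apply filterlim_pair_loc || idtac.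
      intros Q [d Hd2]. exists d. intros y Hy. apply Hd2. split; [apply ball_center|exact Hy]. }
    replace (p (P 1 - P 0)%C) with (RInt (fun l => Derive (fun t : R => p (erf_integrand (z + t * h) l)) x) 0 1).
    - apply (is_derive_RInt_param (fun t l : R => p (erf_integrand (z + t * h) l)) 0 1 x).
      + apply filter_forall. intros t l _. eexists; apply Hd.
      + intros l _. apply (continuity_2d_pt_ext (fun t l : R => p (D t l))); [|apply C2].
        intros t l'. symmetry. apply is_derive_unique, Hd.
      + apply filter_forall. intros t. apply (ex_RInt_continuous (V := R_CompleteNormedModule)).
        intros l _. apply (C1 (fun t l : R => p (erf_integrand (z + t * h) l))), C2'.
    - rewrite (RInt_ext _ (fun l => p (D x l))).
      + apply is_RInt_unique.
        replace (p (P 1 - P 0)%C) with (minus (p (P 1)) (p (P 0))).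
        * apply (is_RInt_derive (V := R_CompleteNormedModule) (fun l => p (P l))).
          -- intros l _; apply HP'.
          -- intros l _. apply (C1 (fun t l : R => p (D t l))), C2.
        * destruct Hp; subst p; reflexivity.
      + intros l _. apply is_derive_unique, Hd. }
  split; [apply (K Re)|apply (K Im)]; auto.
Qed.

Lemma Cexp_cont_0 (eps : R) : 0 < eps -> exists delta, 0 < delta /\
  forall h, Cmod h < delta -> Cmod (Cexp h - 1) <= eps.
Proof.
  intros He. exists (Rmin 1 (eps / 6)). split; [apply Rmin_pos; lra|].
  intros h Hh.
  assert (Hh1 : Cmod h < 1) by (eapply Rlt_le_trans; [exact Hh|apply Rmin_l]).
  assert (Hh2 : Cmod h < eps / 6) by (eapply Rlt_le_trans; [exact Hh|apply Rmin_r]).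
  assert (K : Cmod (Cexp (1%R * h) - Cexp (0%R * h) - (1 - 0)%R * 0) <= 2 * (3 * Cmod h) * (1 - 0)).
  { rewrite RtoC_minus. apply (cderiv_mvt (fun t => Cexp (t * h)) (fun t => h * Cexp (t * h))%C); [lra| |].
    - intros x _. apply (cderiv_exp (fun t => t * h)%C), cderiv_scal_id.
    - intros x Hx. replace (h * Cexp (x * h) - 0)%C with (h * Cexp (x * h))%C by ring.
      rewrite Cmod_mult, Cmod_Cexp, Rmult_comm. apply Rmult_le_compat_r; [apply Cmod_ge_0|].
      apply Rle_trans with (exp 1); [|apply exp_le_3]. apply exp_le_mono.
      replace (Re (x * h)%C) with (x * Re h) by (unfold Re, Im; simpl; ring).
      pose proof (Re_le_Cmod h). pose proof (Cmod_ge_0 h). nra. }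
  replace (Cexp h - 1)%C with (Cexp (1%R * h) - Cexp (0%R * h) - (1 - 0)%R * 0)%C; [lra|].
  replace (0%R * h)%C with (RtoC 0) by ring. rewrite Cexp_0.
  replace (1%R * h)%C with h by ring. ring.
Qed.

(** The derivative along the segment from z to z + h stays close to h exp(-pi z^2), so the mean
    value inequality upgrades directional derivatives to complex differentiability. *)
Lemma Cdiff_Erf (z : C) : Cdiff Erf z (Cexp (- PI * (z * z)))%C.
Proof.
  intros eps He.
  set (G := Cexp (- PI * (z * z))%C).
  pose proof (Cmod_ge_0 G) as HG. pose proof (Cmod_ge_0 z) as Hz. pose proof PI_RGT_0 as Hpi.
  destruct (Cexp_cont_0 (eps / 2 / (Cmod G + 1))) as [d [Hd D]].
  { repeat apply Rdiv_lt_0_compat; lra. }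
  exists (Rmin 1 (d / (PI * (2 * Cmod z + 1)))). split.
  { apply Rmin_pos; [lra|]. apply Rdiv_lt_0_compat; [lra|]. apply Rmult_lt_0_compat; lra. }
  intros h Hh. pose proof (Cmod_ge_0 h) as Hh0.
  assert (Hh1 : Cmod h < 1) by (eapply Rlt_le_trans; [exact Hh|apply Rmin_l]).
  assert (Hh2 : PI * (2 * Cmod z + 1) * Cmod h < d).
  { assert (Hp : 0 < PI * (2 * Cmod z + 1)) by (apply Rmult_lt_0_compat; lra).
    pose proof (Rlt_le_trans _ _ _ Hh (Rmin_r _ _)) as E.
    apply (Rmult_lt_compat_l _ _ _ Hp) in E.
    replace (PI * (2 * Cmod z + 1) * (d / (PI * (2 * Cmod z + 1)))) with d in E by (field; lra). exact E. }
  replace (Erf (z + h) - Erf z - G * h)%C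
    with (Erf (z + 1%R * h) - Erf (z + 0%R * h) - (1%R - 0%R) * (h * G))%C.
  2: { replace (z + 1%R * h)%C with (z + h)%C by ring. replace (z + 0%R * h)%C with z by ring. ring. }
  replace (eps * Cmod h) with (2 * (Cmod h * (eps / 2)) * (1 - 0)) by field.
  apply (cderiv_mvt (fun t => Erf (z + t * h))
    (fun x => h * Cexp (- PI * ((z + x * h) * (z + x * h))))%C); [lra|intros x _; apply cderiv_Erf_line|].
  intros x Hx.
  set (k := (- PI * (2 * x * z * h + x ^ 2 * (h * h)))%C).
  replace (h * Cexp (- PI * ((z + x * h) * (z + x * h))) - h * G)%C with (h * (G * (Cexp k - 1)))%C.
  2: { replace (- PI * ((z + x * h) * (z + x * h)))%C with (- PI * (z * z) + k)%C by (unfold k; ring).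
       rewrite Cexp_plus. fold G. ring. }
  rewrite !Cmod_mult. apply Rmult_le_compat_l; [exact Hh0|].
  assert (Hk : Cmod (Cexp k - 1) <= eps / 2 / (Cmod G + 1)).
  { apply D. eapply Rle_lt_trans; [|exact Hh2]. unfold k.
    rewrite Cmod_mult, Cmod_opp, Cmod_R, (Rabs_right PI) by lra.
    rewrite Rmult_assoc. apply Rmult_le_compat_l; [lra|].
    eapply Rle_trans; [apply Cmod_triangle|]. rewrite !Cmod_mult, Cmod_pow, !Cmod_R.
    rewrite (Rabs_right 2), (Rabs_right x) by lra.
    assert (x * Cmod z * Cmod h <= 1 * Cmod z * Cmod h) by (repeat apply Rmult_le_compat_r; lra).
    assert (x ^ 2 * (Cmod h * Cmod h) <= 1 * (1 * Cmod h)).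
    { apply Rmult_le_compat; [nra|nra|nra|]. apply Rmult_le_compat_r; lra. }
    nra. }
  apply Rle_trans with ((Cmod G + 1) * (eps / 2 / (Cmod G + 1))); [|right; field; lra].
  apply Rmult_le_compat; [lra|apply Cmod_ge_0|lra|exact Hk].
Qed.

Lemma cderiv_Erf (g : R -> C) (x : R) (l : C) : cderiv g x l ->
  cderiv (fun t => Erf (g t)) x (Cexp (- PI * (g x * g x)) * l)%C.
Proof. apply cderiv_comp, Cdiff_Erf. Qed.

Lemma Erf_0 : Erf 0 = 0%C.
Proof.
  unfold Erf. apply C_ext; simpl; rewrite (RInt_ext _ (fun _ => 0)).
  - rewrite RInt_const. apply Rmult_0_r.
  - intros x _. unfold erf_integrand, Re; simpl. ring.
  - rewrite RInt_const. apply Rmult_0_r.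
  - intros x _. unfold erf_integrand, Im; simpl. ring.
Qed.

Lemma Erf_opp (w : C) : Erf (- w) = (- Erf w)%C.
Proof.
  assert (H : (Erf (1%R * w) + Erf (- (1%R * w)) = Erf (0%R * w) + Erf (- (0%R * w)))%C).
  { apply (cderiv_zero_const (fun t => Erf (t * w) + Erf (- (t * w)))%C 0 1); [lra|].
    intros x _.
    pose proof (cderiv_scal_id w x) as K.
    pose proof (cderiv_plus _ _ _ _ _ (cderiv_Erf _ _ _ K) (cderiv_Erf _ _ _ (cderiv_opp _ _ _ K))) as H.
    match type of H with cderiv _ _ ?d => replace (RtoC 0) with d; [exact H|] end.
    simpl. replace (- (x * w) * - (x * w))%C with (x * w * (x * w))%C by ring. ring. }
  replace (0%R * w)%C with (RtoC 0) in H by ring. replace (- 0)%C with (RtoC 0) in H by ring.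
  rewrite Erf_0 in H. replace (1%R * w)%C with w in H by ring.
  replace (Erf (- w)) with (Erf w + Erf (- w) - Erf w)%C by ring. rewrite H. ring.
Qed.

(** * Principal square roots *)

Lemma Cmod_sqr (w : C) : Cmod w ^ 2 = Re w ^ 2 + Im w ^ 2.
Proof. apply Cmod2_alt. Qed.

Lemma Carg_bounds (w : C) : - PI <= Carg w <= PI.
Proof.
  unfold Carg. pose proof (acos_bound (Re w / Cmod w)). pose proof PI_RGT_0.
  destruct (Rlt_dec (Im w) 0); lra.
Qed.

Lemma Cexp_Clog (w : C) : w <> 0%C -> Cexp (Clog w) = w.
Proof.
  intros Hw. assert (Hm : 0 < Cmod w) by (apply Cmod_gt_0; exact Hw).
  pose proof (Cmod_sqr w) as Hs.
  assert (Hb : -1 <= Re w / Cmod w <= 1).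
  { pose proof (re_le_Cmod w) as H. apply Rabs_le_between in H.
    split; apply Rmult_le_reg_r with (Cmod w); try exact Hm; unfold Rdiv; rewrite Rmult_assoc, Rinv_l; lra. }
  assert (Hsin : sin (acos (Re w / Cmod w)) = Rabs (Im w) / Cmod w).
  { rewrite sin_acos by exact Hb.
    replace (1 - Rsqr (Re w / Cmod w)) with (Rsqr (Rabs (Im w) / Cmod w)).
    - apply sqrt_Rsqr. apply Rdiv_le_0_compat; [apply Rabs_pos|exact Hm].
    - unfold Rsqr. replace (Rabs (Im w) / Cmod w * (Rabs (Im w) / Cmod w))
        with (Rabs (Im w) ^ 2 / Cmod w ^ 2) by (field; lra).
      rewrite pow2_abs. replace (Im w ^ 2) with (Cmod w ^ 2 - Re w ^ 2) by lra. field; lra. }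
  unfold Cexp, Clog, Carg. simpl. rewrite exp_ln by exact Hm.
  apply C_ext; simpl.
  - destruct (Rlt_dec (Im w) 0); rewrite ?cos_neg, cos_acos by exact Hb; field; lra.
  - destruct (Rlt_dec (Im w) 0); rewrite ?sin_neg, Hsin.
    + rewrite Rabs_left by assumption. field; lra.
    + rewrite Rabs_right by lra. field; lra.
Qed.

Lemma Cpower_opp (w s : C) : Cpower w (- s) = (/ Cpower w s)%C.
Proof. unfold Cpower. rewrite <- Cexp_opp. f_equal. ring. Qed.

Lemma Csqrt_sqr (w : C) : w <> 0%C -> (Csqrt w * Csqrt w)%C = w.
Proof.
  intros Hw. rewrite <- (Cexp_Clog w Hw) at 3. unfold Csqrt, Cpower. rewrite <- Cexp_plus. f_equal.
  rewrite <- Cmult_plus_distr_r, <- RtoC_plus.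
  replace (/ 2 + / 2) with 1 by field. ring.
Qed.

(** The complement of the branch cut of the principal logarithm. *)
Definition slit (w : C) : Prop := ~ (Im w = 0 /\ Re w <= 0).

Lemma slit_neq_0 (w : C) : slit w -> w <> 0%C.
Proof. intros H ->. apply H. simpl; lra. Qed.

Lemma Csqrt_Re_pos (w : C) : slit w -> 0 < Re (Csqrt w).
Proof.
  intros Hs. pose proof (slit_neq_0 _ Hs) as Hw.
  assert (Hm : 0 < Cmod w) by (apply Cmod_gt_0; exact Hw).
  pose proof (Carg_bounds w) as Hb. pose proof PI_RGT_0 as Hpi.
  unfold Csqrt, Cpower, Cexp.
  replace (Im (RtoC (/ 2) * Clog w)%C) with (Carg w / 2) by (unfold Clog, Re, Im; simpl; field).
  simpl. apply Rmult_lt_0_compat; [apply exp_pos|].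
  apply cos_gt_0.
  - cut (Carg w <> - PI); [intros; lra|]. intros E.
    pose proof (Cexp_Clog w Hw) as L. apply Hs. rewrite <- L. unfold Cexp, Clog; simpl.
    rewrite E, cos_neg, sin_neg, sin_PI, cos_PI. pose proof (exp_pos (ln (Cmod w))). split; lra.
  - cut (Carg w <> PI); [intros; lra|]. intros E.
    pose proof (Cexp_Clog w Hw) as L. apply Hs. rewrite <- L. unfold Cexp, Clog; simpl.
    rewrite E, sin_PI, cos_PI. pose proof (exp_pos (ln (Cmod w))). split; lra.
Qed.

(** The two roots of w differ by sign and at most one has positive real part. Branches of roots of
    inverses, products and rotations are settled through this criterion rather than through
    arguments. *)
Lemma Csqrt_unique (s w : C) : 0 < Re s -> (s * s)%C = w -> s = Csqrt w.
Proof.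
  intros Hs E.
  assert (Hw : slit w).
  { intros [A B]. rewrite <- E in A, B. rewrite Im_mult in A. rewrite Re_mult in B.
    assert (Im s = 0) by nra. nra. }
  pose proof (Csqrt_Re_pos w Hw) as Hc. pose proof (Csqrt_sqr w (slit_neq_0 _ Hw)) as E2.
  set (c := Csqrt w) in *.
  assert (P : ((s - c) * (s + c) = 0)%C).
  { replace ((s - c) * (s + c))%C with (s * s - c * c)%C by ring. rewrite E, E2. ring. }
  assert (N : (s + c)%C <> 0%C).
  { intros Z. apply (f_equal Re) in Z. simpl in Z. unfold Re in *; simpl in *. lra. }
  destruct (Ceq_dec (s - c) 0) as [Z|Z].
  - replace s with (s - c + c)%C by ring. rewrite Z. ring.
  - exfalso. apply (Cmult_neq_0 _ _ Z N), P.
Qed.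

(** With s and c the roots of w + h and w one has (s - c)(s + c) = h; both real parts are positive,
    so s + c stays away from 0. *)
Lemma Cdiff_Csqrt (w : C) : slit w -> Cdiff Csqrt w (/ (2 * Csqrt w))%C.
Proof.
  intros Hw eps He.
  pose proof (Csqrt_Re_pos w Hw) as Hc.
  pose proof (Csqrt_sqr w (slit_neq_0 _ Hw)) as E.
  set (c := Csqrt w) in *. set (a := Re c) in *.
  assert (Hm : 0 < Cmod w) by (apply Cmod_gt_0, slit_neq_0, Hw).
  assert (Ha2 : 0 < a * a) by nra.
  assert (Hca : a <= Cmod c) by apply Re_le_Cmod.
  assert (Hsl : exists d, 0 < d /\ forall h, Cmod h < d -> slit (w + h)).
  { destruct (Req_dec (Im w) 0) as [I|I].
    - assert (0 < Re w) by (destruct (Rle_dec (Re w) 0); [exfalso; apply Hw; auto|lra]).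
      exists (Re w). split; [assumption|]. intros h Hh [_ B].
      pose proof (re_le_Cmod h) as K. apply Rabs_le_between in K.
      unfold Re in *; simpl in *. lra.
    - exists (Rabs (Im w)). split; [apply Rabs_pos_lt, I|]. intros h Hh [B _].
      pose proof (im_le_Cmod h) as K. unfold Im in *; simpl in *.
      replace (snd h) with (- snd w) in K by lra. rewrite Rabs_Ropp in K. lra. }
  destruct Hsl as [d [Hd Hsl]].
  exists (Rmin d (eps * (2 * a * a * a))). split.
  { apply Rmin_pos; [assumption|]. assert (0 < 2 * a * a * a) by nra. nra. }
  intros h Hh. pose proof (Cmod_ge_0 h) as Hh0.
  pose proof (Hsl h (Rlt_le_trans _ _ _ Hh (Rmin_l _ _))) as Hwh.
  pose proof (Rlt_le_trans _ _ _ Hh (Rmin_r _ _)) as Hh2.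
  pose proof (Csqrt_Re_pos _ Hwh) as Hs.
  pose proof (Csqrt_sqr _ (slit_neq_0 _ Hwh)) as E2.
  set (s := Csqrt (w + h)) in *.
  assert (Hsc : a <= Cmod (s + c)).
  { eapply Rle_trans; [|apply Re_le_Cmod]. change (a <= Re s + Re c). fold a. lra. }
  assert (N : (s + c)%C <> 0%C) by (apply Cmod_gt_0; lra).
  assert (Nc : c <> 0%C) by (apply Cmod_gt_0; lra).
  assert (Eh : h = ((s - c) * (s + c))%C).
  { replace ((s - c) * (s + c))%C with (s * s - c * c)%C by ring. rewrite E, E2. ring. }
  assert (Es : (s - c)%C = (h / (s + c))%C).
  { rewrite Eh at 1. field. exact N. }
  assert (R1 : (s - c - / (2 * c) * h)%C = (- (h * h) / (2 * c * ((s + c) * (s + c))))%C).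
  { transitivity (h / (s + c) - / (2 * c) * h)%C; [rewrite <- Es; reflexivity|].
    transitivity (- (h * (s - c)) / (2 * c * (s + c)))%C.
    - field. split; [|exact Nc || exact N]. exact N || exact Nc.
    - rewrite Es. field. split; assumption. }
  rewrite R1. assert (N2 : RtoC 2 <> 0%C) by (intros Z; apply RtoC_inj in Z; lra).
  rewrite Cmod_div by (repeat apply Cmult_neq_0; assumption).
  rewrite Cmod_opp, !Cmod_mult, Cmod_R, Rabs_right by lra.
  assert (P : 2 * a * (a * a) <= 2 * Cmod c * (Cmod (s + c) * Cmod (s + c))).
  { apply Rmult_le_compat; [lra|apply Rmult_le_pos; lra|lra|]. apply Rmult_le_compat; lra. }
  assert (P0 : 0 < 2 * a * (a * a)) by nra.
  apply Rmult_le_reg_r with (2 * Cmod c * (Cmod (s + c) * Cmod (s + c))); [lra|].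
  unfold Rdiv. rewrite Rmult_assoc, Rinv_l, Rmult_1_r by lra.
  apply Rle_trans with (Cmod h * (eps * (2 * a * (a * a)))).
  - apply Rmult_le_compat_l; [exact Hh0|]. lra.
  - replace (Cmod h * (eps * (2 * a * (a * a)))) with (eps * Cmod h * (2 * a * (a * a))) by ring.
    apply Rmult_le_compat_l; [|exact P]. apply Rmult_le_pos; lra.
Qed.

Lemma Re_pos_slit (w : C) : 0 < Re w -> slit w.
Proof. intros H [_ K]. lra. Qed.

Lemma Re_inv_pos (w : C) : 0 < Re w -> 0 < Re (/ w)%C.
Proof.
  intros H. unfold Cinv, Re; simpl. apply Rdiv_lt_0_compat; [exact H|].
  unfold Re in H. nra.
Qed.

(** * The limit of the error function in a sector *)

Lemma Erf_real (x : R) : Erf x = RtoC (Re (Erf x)).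
Proof.
  apply C_ext; [reflexivity|]. simpl. rewrite (RInt_ext _ (fun _ => 0)).
  - rewrite RInt_const. apply Rmult_0_r.
  - intros l _. unfold erf_integrand, Cexp, Im; simpl.
    match goal with |- _ * (_ * sin ?e) + _ = _ => replace e with 0 by ring end.
    rewrite sin_0. ring.
Qed.

Lemma is_derive_Erf_real (x : R) : is_derive (fun t => Re (Erf (RtoC t))) x (exp (- PI * x ^ 2)).
Proof.
  pose proof (proj1 (cderiv_Erf _ _ _ (cderiv_id x))) as H.
  replace (exp (- PI * x ^ 2)) with (Re (Cexp (- PI * (x * x)) * 1)%C); [exact H|].
  replace (- PI * (x * x))%C with (RtoC (- PI * x ^ 2)).
  - rewrite Cexp_R. unfold Re; simpl. ring.
  - rewrite RtoC_mult, RtoC_opp. simpl. rewrite !RtoC_mult. ring.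
Qed.

Lemma derive_nonneg_incr (f df : R -> R) (a b : R) : a <= b ->
  (forall x, is_derive f x (df x)) -> (forall x, a <= x <= b -> 0 <= df x) -> f a <= f b.
Proof.
  intros Hab D P. destruct (MVT_gen f a b df) as [c [Hc E]].
  - intros x _; apply D.
  - intros x _. apply derivable_continuous_pt. exists (df x). apply is_derive_Reals, D.
  - rewrite Rmin_left, Rmax_right in Hc by exact Hab. specialize (P c Hc). nra.
Qed.

(** Erf increases on the real line and is bounded there through arctan, because exp(-pi t^2) <= 1/(1
    + t^2). The value of the limit is left open and found in [erf_limit_value]. *)
Lemma Erf_real_limit : exists L : R, 0 < L /\
  forall eps, 0 < eps -> exists X, forall x, X <= x -> Cmod (Erf x - L) <= eps.
Proof.
  set (E := fun x : R => Re (Erf x)).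
  assert (Mono : forall a b, a <= b -> E a <= E b).
  { intros a b Hab. apply (derive_nonneg_incr E (fun x => exp (- PI * x ^ 2))); [exact Hab| |].
    - exact is_derive_Erf_real.
    - intros x _. left; apply exp_pos. }
  assert (Bd : forall x, 0 <= x -> E x <= PI / 2).
  { intros x Hx.
    assert (K : atan 0 - E 0 <= atan x - E x).
    { apply (derive_nonneg_incr (fun t => atan t - E t) (fun t => / (1 + t ^ 2) - exp (- PI * t ^ 2))); [exact Hx| |].
      - intros t. apply (is_derive_minus (V := R_NormedModule) atan E t).
        + apply is_derive_Reals. apply derivable_pt_lim_atan.
        + apply is_derive_Erf_real.
      - intros t _. replace (- PI * t ^ 2) with (- (PI * t ^ 2)) by ring. rewrite exp_Ropp.
        pose proof (exp_ineq1_le (PI * t ^ 2)). pose proof PI2_1. pose proof (pow2_ge_0 t).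
        assert (/ exp (PI * t ^ 2) <= / (1 + t ^ 2)) by (apply Rinv_le_contravar; nra). lra. }
    rewrite atan_0 in K. unfold E in K at 1. rewrite Erf_0 in K. simpl in K.
    pose proof (atan_bound x). lra. }
  assert (Ex : ex_finite_lim_seq (fun n => E (INR n))).
  { apply ex_finite_lim_seq_incr with (PI / 2).
    - intros n. apply Mono. rewrite S_INR; lra.
    - intros n. apply Bd, pos_INR. }
  destruct Ex as [L HL]. exists L.
  assert (Up : forall x, E x <= L).
  { intros x. destruct (INR_unbounded x) as [n Hn].
    apply Rle_trans with (E (INR n)); [apply Mono; lra|].
    apply (is_lim_seq_incr_compare _ _ HL). intros k. apply Mono. rewrite S_INR; lra. }
  split.
  - apply Rlt_le_trans with (E 1); [|apply Up].
    destruct (MVT_gen E 0 1 (fun x => exp (- PI * x ^ 2))) as [c [_ H]].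
    + intros x _; apply is_derive_Erf_real.
    + intros x _. apply derivable_continuous_pt. eexists. apply is_derive_Reals, is_derive_Erf_real.
    + unfold E in H at 2. rewrite Erf_0 in H. simpl in H. pose proof (exp_pos (- PI * c ^ 2)). simpl in *. lra.
  - intros eps He. apply is_lim_seq_spec in HL. destruct (HL (mkposreal _ He)) as [N HN].
    exists (INR N). intros x Hx. specialize (HN N (Nat.le_refl _)). simpl in HN.
    rewrite Erf_real, <- RtoC_minus, Cmod_R. fold (E x).
    pose proof (Mono _ _ Hx). pose proof (Up x). rewrite Rabs_left1 by lra.
    apply Rabs_def2 in HN. lra.
Qed.

(** For delta > 0 this keeps |arg w| away from pi/4, where exp(-pi w^2) ceases to decay. *)
Definition sector (delta : R) (w : C) : Prop := 0 < Re w /\ delta * Cmod w ^ 2 <= Re (w * w)%C.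

(** On the vertical segment from Re w to w the real part of the square is at least Re(w^2), so the
    derivative of Erf is exponentially small there. *)
Lemma Erf_sector_vs_real (delta : R) (w : C) : 0 < delta -> sector delta w ->
  Cmod (Erf w - Erf (Re w)) <= 2 / (delta * Cmod w) /\ Cmod w <= 2 * Re w.
Proof.
  intros Hd [Hr Hs]. pose proof PI2_1 as Hpi.
  pose proof (Re_le_Cmod w) as Hm. pose proof (Cmod_sqr w) as H2. rewrite Re_mult in Hs.
  split.
  2: { assert (Cmod w ^ 2 <= 2 * Re w ^ 2) by nra. nra. }
  set (x := Re w) in *. set (y := Im w) in *.
  assert (K : Cmod (Erf (x + 1%R * (Ci * y)) - Erf (x + 0%R * (Ci * y)) - (1 - 0)%R * 0)
     <= 2 * (Cmod w * exp (- (PI * delta * Cmod w ^ 2))) * (1 - 0)).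
  { rewrite RtoC_minus.
    apply (cderiv_mvt (fun t => Erf (x + t * (Ci * y)))
      (fun t => (Ci * y) * Cexp (- PI * ((x + t * (Ci * y)) * (x + t * (Ci * y)))))%C); [lra| |].
    - intros t _. apply cderiv_Erf_line.
    - intros t Ht. rewrite Cminus_0_r.
      rewrite !Cmod_mult, Cmod_Ci, Cmod_R, Rmult_1_l, Cmod_Cexp.
      apply Rmult_le_compat; [apply Rabs_pos|left; apply exp_pos|apply im_le_Cmod|].
      apply exp_le_mono.
      replace (Re (- PI * ((x + t * (Ci * y)) * (x + t * (Ci * y))))%C) with (- PI * (x ^ 2 - t ^ 2 * y ^ 2))
        by (unfold Re, Im; simpl; ring).
      assert (t ^ 2 * y ^ 2 <= 1 * y ^ 2) by (apply Rmult_le_compat_r; [apply pow2_ge_0|nra]).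
      nra. }
  replace (Erf w - Erf x)%C with (Erf (x + 1%R * (Ci * y)) - Erf (x + 0%R * (Ci * y)) - (1 - 0)%R * 0)%C.
  - eapply Rle_trans; [exact K|].
    assert (P : 0 < Cmod w) by lra. set (m := Cmod w) in *.
    assert (P2 : 0 < delta * m ^ 2) by (apply Rmult_lt_0_compat; nra).
    rewrite exp_Ropp.
    assert (/ exp (PI * delta * m ^ 2) <= / (delta * m ^ 2)).
    { apply Rinv_le_contravar; [exact P2|]. pose proof (exp_ineq1_le (PI * delta * m ^ 2)). nra. }
    replace (2 / (delta * m)) with (2 * (m * / (delta * m ^ 2)) * (1 - 0)) by (field; lra).
    apply Rmult_le_compat_r; [lra|]. apply Rmult_le_compat_l; [lra|]. apply Rmult_le_compat_l; lra.
  - replace (x + 1%R * (Ci * y))%C with w by (unfold x, y; Ccomp).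
    replace (x + 0%R * (Ci * y))%C with (RtoC x) by ring. ring.
Qed.

Lemma Erf_sector_limit (L : R) :
  (forall eps, 0 < eps -> exists X, forall x : R, X <= x -> Cmod (Erf x - L) <= eps) ->
  forall delta eps, 0 < delta -> 0 < eps -> exists X, forall w, sector delta w -> X <= Cmod w ->
    Cmod (Erf w - L) <= eps.
Proof.
  intros H delta eps Hd He. destruct (H (eps / 2)) as [X HX]; [lra|].
  exists (Rmax (2 * X) (4 / (delta * eps))). intros w Hs Hw.
  destruct (Erf_sector_vs_real delta w Hd Hs) as [A B].
  assert (H1 : 2 * X <= Cmod w) by (eapply Rle_trans; [apply Rmax_l|exact Hw]).
  assert (H2 : 4 / (delta * eps) <= Cmod w) by (eapply Rle_trans; [apply Rmax_r|exact Hw]).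
  specialize (HX (Re w) ltac:(lra)).
  assert (P : 0 < Cmod w).
  { eapply Rlt_le_trans; [|exact H2]. apply Rdiv_lt_0_compat; [lra|]. apply Rmult_lt_0_compat; lra. }
  assert (C1 : 2 / (delta * Cmod w) <= eps / 2).
  { apply Rmult_le_reg_r with (delta * Cmod w); [apply Rmult_lt_0_compat; lra|].
    unfold Rdiv at 1. rewrite Rmult_assoc, Rinv_l by (assert (0 < delta * Cmod w) by (apply Rmult_lt_0_compat; lra); lra).
    apply (Rmult_le_compat_l (delta * eps / 2)) in H2; [|assert (0 < delta * eps) by (apply Rmult_lt_0_compat; lra); lra].
    replace (delta * eps / 2 * (4 / (delta * eps))) with 2 in H2 by (field; lra). lra. }
  replace (Erf w - L)%C with ((Erf w - Erf (Re w)) + (Erf (Re w) - L))%C by ring.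
  eapply Rle_trans; [apply Cmod_triangle|]. lra.
Qed.

(** * Termwise differentiation of sums over half-integers *)

Lemma cderiv_half_sum (G g : R -> R -> C) (A : nat -> R) (x r : R) :
  0 < r -> ex_series A -> half_summable (G x) ->
  (forall t, Rabs (t - x) < r -> forall n m, INR n <= Rabs m <= INR n + 1 ->
     cderiv (fun t => G t m) t (g t m) /\ Cmod (g t m) <= A n) ->
  cderiv (fun t => CSeries (half_term (G t))) x (CSeries (half_term (g x))).
Proof.
  intros Hr HA HG D.
  apply (cderiv_CSeries (fun n t => half_term (G t) n) (fun n t => half_term (g t) n)
    (fun n => 2 * A n) x r Hr).
  - apply ex_series_scal_R, HA.
  - apply half_term_summable, HG.
  - intros n t Ht. split.
    + pose proof (half_pos n). unfold half_term. apply cderiv_scal. apply cderiv_minus.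
      * apply (D t Ht n (half n)). rewrite Rabs_right by lra. unfold half; lra.
      * apply (D t Ht n (- half n)). rewrite Rabs_Ropp, Rabs_right by lra. unfold half; lra.
    + apply half_term_bound. intros k m Hm. apply (D t Ht k m Hm).
Qed.

Lemma cmvt_bound (f df : R -> C) (M x : R) :
  (forall t, Rabs t <= Rabs x -> cderiv f t (df t) /\ Cmod (df t) <= M) ->
  Cmod (f x - f 0) <= 2 * M * Rabs x.
Proof.
  intros D. destruct (Rle_dec 0 x) as [Hp|Hp].
  - rewrite Rabs_right in * by lra.
    replace (f x - f 0)%C with (f x - f 0 - (x - 0%R) * 0)%C by ring.
    replace (2 * M * x) with (2 * M * (x - 0)) by ring.
    apply (cderiv_mvt f df); [lra| |]; intros t Ht; rewrite ?Cminus_0_r; apply D;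
    apply Rabs_le; lra.
  - rewrite Rabs_left in * by lra. rewrite Cmod_minus_sym.
    replace (f 0 - f x)%C with (f 0 - f x - (0%R - x) * 0)%C by ring.
    replace (2 * M * - x) with (2 * M * (0 - x)) by ring.
    apply (cderiv_mvt f df); [lra| |]; intros t Ht; rewrite ?Cminus_0_r; apply D;
    apply Rabs_le; lra.
Qed.

(** Since every term vanishes at 0, the majorant of the derivatives bounds the terms as well and
    summability follows from it. *)
Lemma cderiv_half_sum_0 (G g : R -> R -> C) (x : R) :
  (forall r, exists A, ex_series A /\ forall t, Rabs t < r -> forall n m, INR n <= Rabs m <= INR n + 1 ->
     cderiv (fun t => G t m) t (g t m) /\ Cmod (g t m) <= A n) ->
  (forall m, G 0 m = 0%C) ->
  half_summable (G x) /\ cderiv (fun t => CSeries (half_term (G t))) x (CSeries (half_term (g x))).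
Proof.
  intros D G0. destruct (D (Rabs x + 1)) as [A [HA HD]].
  assert (HG : half_summable (G x)).
  { apply half_summable_le with (fun n => 2 * Rabs x * A n); [apply ex_series_scal_R, HA|].
    intros n m Hm.
    replace (G x m) with (G x m - G 0 m)%C by (rewrite G0; ring).
    replace (2 * Rabs x * A n) with (2 * A n * Rabs x) by ring.
    apply (cmvt_bound (fun t => G t m) (fun t => g t m)). intros t Ht. apply HD; [lra|exact Hm]. }
  split; [exact HG|].
  apply (cderiv_half_sum G g A x 1); [lra|exact HA|exact HG|].
  intros t Ht n m Hm. apply HD; [|exact Hm].
  pose proof (Rabs_triang (t - x) x) as K. replace (t - x + x) with t in K by ring. lra.
Qed.

(** * Uniqueness of Fourier coefficients for antiperiodic functions *)

(** Vanishing integral over the period [-1/2, 1/2], expressed by a primitive with equal end values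
    so that Fourier coefficients are handled through derivatives alone. *)
Definition zero_mean (g : R -> C) : Prop :=
  exists Q, (forall x, cderiv Q x (g x)) /\ Q (1 / 2) = Q (- (1 / 2)).

Lemma zero_mean_plus (f g : R -> C) : zero_mean f -> zero_mean g -> zero_mean (fun x => f x + g x)%C.
Proof.
  intros [P [HP EP]] [Q [HQ EQ]]. exists (fun x => P x + Q x)%C. split.
  - intros x; apply cderiv_plus; auto.
  - rewrite EP, EQ; reflexivity.
Qed.

Lemma zero_mean_scal (c : C) (f : R -> C) : zero_mean f -> zero_mean (fun x => c * f x)%C.
Proof.
  intros [P [HP EP]]. exists (fun x => c * P x)%C. split.
  - intros x; apply cderiv_scal; auto.
  - rewrite EP; reflexivity.
Qed.

Lemma zero_mean_ext (f g : R -> C) : (forall x, f x = g x) -> zero_mean f -> zero_mean g.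
Proof.
  intros H [P [HP EP]]. exists P; split; [|exact EP]. intros x; rewrite <- H; apply HP.
Qed.

Lemma cos_Cexp (x : R) : RtoC (cos x) = ((Cexp (Ci * x) + Cexp (- (Ci * x))) / 2)%C.
Proof.
  unfold Cexp. Ccomp; replace (0 * x - 1 * 0) with 0 by ring; replace (0 * 0 + 1 * x) with x by ring;
  rewrite ?Ropp_0, exp_0, ?cos_neg, ?sin_neg; field.
Qed.

(** Writing one cosine as two exponentials shifts j by one in both directions. When all cosines are
    used up, the parity condition makes j odd, and exp(i pi j x) is one of the half-integral
    frequencies of the hypothesis. *)
Lemma zero_mean_cos_pow (D : R -> C) :
  (forall p : Z, zero_mean (fun x => D x * Cexp (- (2 * PI * Ci * (IZR p + / 2)%R * x)))%C) ->
  forall (N : nat) (j : Z), Z.odd (Z.of_nat N + j) = true ->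
    zero_mean (fun x => D x * cos (PI * x) ^ N * Cexp (Ci * PI * IZR j * x))%C.
Proof.
  intros H N. induction N as [|N IH]; intros j Hj.
  - rewrite Z.add_0_l in Hj. apply Z.odd_spec in Hj. destruct Hj as [p ->].
    apply (zero_mean_ext _ _ ) with (2 := H (- p - 1)%Z).
    intros x. replace (cos (PI * x) ^ 0)%C with (RtoC 1) by reflexivity.
    rewrite Cmult_1_r. do 2 f_equal.
    rewrite minus_IZR, opp_IZR, plus_IZR, mult_IZR.
    replace (- IZR p - 1 + / 2)%R with (- (2 * IZR p + 1) / 2)%R by field.
    rewrite RtoC_div, RtoC_opp by lra. field.
  - rewrite Nat2Z.inj_succ in Hj.
    assert (H1 : Z.odd (Z.of_nat N + (j + 1)) = true) by (rewrite <- Hj; f_equal; lia).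
    assert (H2 : Z.odd (Z.of_nat N + (j - 1)) = true).
    { replace (Z.of_nat N + (j - 1))%Z with (Z.of_nat N + (j + 1) + 2 * (-1))%Z by ring.
      rewrite Z.odd_add_mul_2. exact H1. }
    apply (zero_mean_ext (fun x => / 2 * (D x * cos (PI * x) ^ N * Cexp (Ci * PI * IZR (j + 1) * x)
       + D x * cos (PI * x) ^ N * Cexp (Ci * PI * IZR (j - 1) * x)))%C).
    + intros x. simpl. rewrite (cos_Cexp (PI * x)).
      replace (Ci * PI * IZR (j + 1) * x)%C with (Ci * PI * IZR j * x + Ci * (PI * x)%R)%C
        by (rewrite plus_IZR, RtoC_plus, RtoC_mult; ring).
      replace (Ci * PI * IZR (j - 1) * x)%C with (Ci * PI * IZR j * x + - (Ci * (PI * x)%R))%C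
        by (rewrite minus_IZR, RtoC_minus, RtoC_mult; ring).
      rewrite !Cexp_plus. field.
    + apply zero_mean_scal, zero_mean_plus; apply IH; assumption.
Qed.

(* The kernel [cos (PI x) ^ (2N+1)] concentrates at [0] on [-1/2, 1/2]. *)
Lemma zero_mean_vanish (D : R -> C) (M : R) :
  (forall x, Rabs x <= 1 / 2 -> Cmod (D x) <= M) ->
  (forall eps, 0 < eps -> exists delta, 0 < delta /\
     forall x, Rabs x < delta -> Cmod (D x - D 0) <= eps) ->
  (forall N : nat, zero_mean (fun x => D x * cos (PI * x) ^ (2 * N + 1))%C) ->
  D 0 = 0%C.
Proof.
  intros HM HC HZ. destruct (Ceq_dec (D 0) 0) as [E|E]; [exact E|exfalso].
  assert (Hrho : 0 < Cmod (D 0)) by (apply Cmod_gt_0; exact E).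
  set (rho := Cmod (D 0) ^ 2).
  assert (Hr2 : 0 < rho) by (unfold rho; nra).
  (* Multiplication by the conjugate makes the value at 0 real and positive, so the argument can run
     on the real part. *)
  set (c := Cconj (D 0)).
  assert (Hc : Cmod c = Cmod (D 0)) by apply Cmod_conj.
  assert (Hc0 : Re (c * D 0)%C = rho).
  { unfold rho. rewrite Cmod_sqr. unfold c, Cconj, Re, Im; simpl. ring. }
  set (d := fun x => Re (c * D x)%C).
  assert (Hd0 : exists del, 0 < del < 1 / 4 /\ forall x, Rabs x <= 2 * del -> rho / 2 <= d x).
  { destruct (HC (Cmod (D 0) / 2)) as [e [He H]]; [lra|].
    exists (Rmin (1 / 8) (e / 4)). split.
    - split; [apply Rmin_pos; lra|]. pose proof (Rmin_l (1 / 8) (e / 4)); lra.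
    - intros x Hx. pose proof (Rmin_r (1 / 8) (e / 4)).
      specialize (H x ltac:(lra)).
      assert (K : Rabs (Re (c * (D x - D 0))%C) <= rho / 2).
      { eapply Rle_trans; [apply re_le_Cmod|]. rewrite Cmod_mult, Hc. unfold rho. nra. }
      unfold d. replace (c * D x)%C with (c * D 0 + c * (D x - D 0))%C by ring.
      rewrite re_plus || idtac.
      change (rho / 2 <= Re (c * D 0)%C + Re (c * (D x - D 0))%C). rewrite Hc0.
      apply Rabs_le_between in K. lra. }
  destruct Hd0 as [del [Hdel Hd]].
  set (M' := Cmod (D 0) * Rabs M).
  assert (HdM : forall x, Rabs x <= 1 / 2 -> Rabs (d x) <= M').
  { intros x Hx. unfold d, M'. eapply Rle_trans; [apply re_le_Cmod|].
    rewrite Cmod_mult, Hc. apply Rmult_le_compat_l; [lra|].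
    eapply Rle_trans; [apply HM, Hx|apply Rle_abs]. }
  assert (HM' : 0 <= M') by (unfold M'; pose proof (Rabs_pos M); nra).
  pose proof PI_RGT_0 as Hpi.
  set (k0 := cos (PI * del)). set (k1 := cos (PI * (2 * del))).
  assert (Hk1 : 0 < k1) by (apply cos_gt_0; nra).
  assert (Hk01 : k1 < k0) by (apply cos_decreasing_1; nra).
  (* The interval |x| <= del contributes at least 2 del (rho/2) k0^P, the region beyond 2 del loses
     at most M' k1^P, and the total is 0. As k1 < k0, this fails for large N. *)
  assert (Ineq : forall N : nat, 2 * del * (rho / 2) * k0 ^ (2 * N + 1) <= M' * k1 ^ (2 * N + 1)).
  { intros N. destruct (HZ N) as [Q [HQ EQ]].
    set (P := (2 * N + 1)%nat) in *.
    set (q := fun x => Re (c * Q x)%C).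
    assert (Hq : forall x, is_derive q x (d x * cos (PI * x) ^ P)).
    { intros x. pose proof (proj1 (cderiv_scal c _ _ _ (HQ x))) as K.
      replace (d x * cos (PI * x) ^ P) with (Re (c * (D x * RtoC (cos (PI * x)) ^ P))%C); [exact K|].
      rewrite <- RtoC_pow. unfold d, Re, Im; simpl. ring. }
    assert (Hcos : forall x, Rabs x <= 1 / 2 -> 0 <= cos (PI * x)).
    { intros x Hx. apply Rabs_le_between in Hx. apply cos_ge_0; nra. }
    assert (Hceven : forall x, cos (PI * x) = cos (PI * Rabs x)).
    { intros x. unfold Rabs. destruct (Rcase_abs x); [|reflexivity].
      replace (PI * - x) with (- (PI * x)) by ring. rewrite cos_neg; reflexivity. }
    assert (Low : forall x, Rabs x <= 1 / 2 -> - (M' * k1 ^ P) <= d x * cos (PI * x) ^ P).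
    { intros x Hx. destruct (Rle_dec (Rabs x) (2 * del)) as [Hs|Hs].
      - assert (0 <= d x * cos (PI * x) ^ P).
        { apply Rmult_le_pos; [|apply pow_le, Hcos, Hx]. specialize (Hd x Hs). lra. }
        assert (0 <= M' * k1 ^ P) by (apply Rmult_le_pos; [exact HM'|apply pow_le; lra]). lra.
      - assert (cos (PI * x) ^ P <= k1 ^ P).
        { apply pow_incr. split; [apply Hcos, Hx|]. rewrite Hceven. unfold k1.
          left. apply cos_decreasing_1; nra. }
        pose proof (HdM x Hx) as K. apply Rabs_le_between in K.
        pose proof (pow_le _ P (Hcos x Hx)). nra. }
    assert (Mid : forall x, Rabs x <= del -> rho / 2 * k0 ^ P <= d x * cos (PI * x) ^ P).
    { intros x Hx. apply Rmult_le_compat; [lra|apply pow_le; lra|apply Hd; lra|].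
      apply pow_incr. split; [lra|]. rewrite Hceven. unfold k0.
      destruct (Req_dec (Rabs x) del) as [-> |Hne]; [lra|].
      left. pose proof (Rabs_pos x). apply cos_decreasing_1; nra. }
    assert (Mono : forall a b K, a <= b -> (forall x, a <= x <= b -> K <= d x * cos (PI * x) ^ P) ->
       K * (b - a) <= q b - q a).
    { intros a b K Hab HK.
      destruct (MVT_gen q a b (fun x => d x * cos (PI * x) ^ P)) as [z [Hz Ez]].
      - intros x _; apply Hq.
      - intros x _. apply derivable_continuous_pt. eexists. apply is_derive_Reals, Hq.
      - rewrite Rmin_left, Rmax_right in Hz by exact Hab. rewrite Ez.
        apply Rmult_le_compat_r; [lra|apply HK, Hz]. }
    pose proof (Mono (- (1 / 2)) (- del) (- (M' * k1 ^ P)) ltac:(lra)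
      (fun x Hx => Low x ltac:(apply Rabs_le; lra))) as I1.
    pose proof (Mono (- del) del (rho / 2 * k0 ^ P) ltac:(lra)
      (fun x Hx => Mid x ltac:(apply Rabs_le; lra))) as I2.
    pose proof (Mono del (1 / 2) (- (M' * k1 ^ P)) ltac:(lra)
      (fun x Hx => Low x ltac:(apply Rabs_le; lra))) as I3.
    assert (E0 : q (1 / 2) = q (- (1 / 2))) by (unfold q; rewrite EQ; reflexivity).
    assert (0 <= M' * k1 ^ P) by (apply Rmult_le_pos; [exact HM'|apply pow_le; lra]).
    nra. }
  assert (Hq : 0 <= k1 / k0 < 1).
  { split; [apply Rdiv_le_0_compat; lra|]. apply Rmult_lt_reg_r with k0; [lra|].
    unfold Rdiv. rewrite Rmult_assoc, Rinv_l; lra. }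
  destruct (pow_lt_1_zero (k1 / k0) ltac:(rewrite Rabs_right; lra) (2 * del * (rho / 2) / (M' + 1)))
    as [N HN].
  { apply Rdiv_lt_0_compat; nra. }
  specialize (HN (2 * N + 1)%nat ltac:(lia)). specialize (Ineq N).
  rewrite Rabs_right in HN by (apply Rle_ge, pow_le; lra).
  unfold Rdiv at 1 in HN. rewrite Rpow_mult_distr, pow_inv in HN.
  set (P := (2 * N + 1)%nat) in *.
  assert (Hp0 : 0 < k0 ^ P) by (apply pow_lt; lra).
  assert (Hp1 : 0 < k1 ^ P) by (apply pow_lt; lra).
  apply (Rmult_lt_compat_r ((M' + 1) * k0 ^ P)) in HN; [|nra].
  replace (k1 ^ P * / k0 ^ P * ((M' + 1) * k0 ^ P)) with ((M' + 1) * k1 ^ P) in HN by (field; lra).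
  replace (2 * del * (rho / 2) / (M' + 1) * ((M' + 1) * k0 ^ P)) with (2 * del * (rho / 2) * k0 ^ P) in HN
    by (field; lra).
  nra.
Qed.

(** * Poisson summation for the odd theta function *)

(** The points r(N + b) are asymptotic to the ray through r, which lies in a sector because Re(r^2)
    = Re y > 0. *)
Lemma erf_line_limit (L : R) (y r b : C) :
  (forall eps, 0 < eps -> exists X, forall x : R, X <= x -> Cmod (Erf x - L) <= eps) ->
  0 < Re y -> 0 < Re r -> (r * r)%C = y ->
  climit eventually (fun N => Erf (r * (INR N + b))) L.
Proof.
  intros HL Hy Hr Er eps He.
  assert (Hy0 : 0 < Cmod y) by (pose proof (Re_le_Cmod y); lra).
  assert (Hr0 : 0 < Cmod r) by (pose proof (Re_le_Cmod r); lra).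
  pose proof (Cmod_ge_0 b) as Hb.
  (* For large n one has |r(n + b)|^2 <= 4 |y| n^2 and Re((r(n + b))^2) >= Re y n^2 / 2; delta is
     the quotient of the two bounds. *)
  set (delta := Re y / (8 * Cmod y)).
  assert (Hd : 0 < delta) by (apply Rdiv_lt_0_compat; lra).
  destruct (Erf_sector_limit L HL delta eps Hd He) as [X HX].
  destruct (INR_unbounded (Cmod b + Rabs X / Cmod r + 6 * Cmod y * Cmod b / Re y
    + Cmod r * Cmod b / Re r)) as [N0 HN0].
  exists N0. intros N HN.
  assert (HN1 : INR N0 <= INR N) by (apply le_INR, HN).
  assert (P1 : 0 <= Rabs X / Cmod r) by (apply Rdiv_le_0_compat; [apply Rabs_pos|exact Hr0]).
  assert (P2 : 0 <= 6 * Cmod y * Cmod b / Re y) by (apply Rdiv_le_0_compat; nra).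
  assert (P3 : 0 <= Cmod r * Cmod b / Re r) by (apply Rdiv_le_0_compat; nra).
  set (n := INR N) in *.
  assert (Hn1 : Rabs X < Cmod r * (n - Cmod b)).
  { replace (Rabs X) with (Cmod r * (Rabs X / Cmod r)) by (field; lra).
    apply Rmult_lt_compat_l; lra. }
  assert (Hn2 : 6 * Cmod y * Cmod b < Re y * n).
  { replace (6 * Cmod y * Cmod b) with (Re y * (6 * Cmod y * Cmod b / Re y)) by (field; lra).
    apply Rmult_lt_compat_l; lra. }
  assert (Hn3 : Cmod r * Cmod b < Re r * n).
  { replace (Cmod r * Cmod b) with (Re r * (Cmod r * Cmod b / Re r)) by (field; lra).
    apply Rmult_lt_compat_l; lra. }
  assert (Hn4 : Cmod b < n) by lra.
  apply HX.
  - split.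
    + replace (Re (r * (n + b))%C) with (Re r * n + Re (r * b)%C) by (unfold Re, Im; simpl; ring).
      pose proof (re_le_Cmod (r * b)%C) as K. rewrite Cmod_mult in K.
      apply Rabs_le_between in K. lra.
    + rewrite Cmod_mult.
      replace (r * (n + b) * (r * (n + b)))%C with (y * (n ^ 2)%R + y * (2 * n * b + b * b))%C.
      2: { rewrite <- Er. simpl. rewrite !RtoC_mult. ring. }
      change (delta * (Cmod r * Cmod (n + b)) ^ 2 <=
        Re (y * (n ^ 2)%R)%C + Re (y * (2 * n * b + b * b))%C).
      pose proof (re_le_Cmod (y * (2 * n * b + b * b))%C) as K.
      rewrite Cmod_mult in K. apply Rabs_le_between in K.
      assert (K2 : Cmod (2 * n * b + b * b) <= 3 * n * Cmod b).
      { eapply Rle_trans; [apply Cmod_triangle|]. rewrite !Cmod_mult, !Cmod_R, !Rabs_right by lra. nra. }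
      assert (K3 : Cmod y * Cmod (2 * n * b + b * b) <= Re y * n ^ 2 / 2).
      { apply Rle_trans with (Cmod y * (3 * n * Cmod b)); [apply Rmult_le_compat_l; lra|].
        replace (Cmod y * (3 * n * Cmod b)) with (n * (6 * Cmod y * Cmod b) / 2) by field.
        replace (Re y * n ^ 2 / 2) with (n * (Re y * n) / 2) by field.
        apply Rmult_le_compat_r; [lra|]. apply Rmult_le_compat_l; lra. }
      replace (Re (y * (n ^ 2)%R)%C) with (Re y * n ^ 2) by (unfold Re, Im; simpl; ring).
      assert (K4 : (Cmod r * Cmod (n + b)) ^ 2 <= Cmod y * (4 * n ^ 2)).
      { rewrite Rpow_mult_distr.
        replace (Cmod r ^ 2) with (Cmod y) by (rewrite <- Er, Cmod_mult; ring).
        apply Rmult_le_compat_l; [lra|].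
        replace (4 * n ^ 2) with ((2 * n) ^ 2) by ring. apply pow_incr. split; [apply Cmod_ge_0|].
        eapply Rle_trans; [apply Cmod_triangle|]. rewrite Cmod_R, Rabs_right; lra. }
      assert (K5 : delta * (Cmod r * Cmod (n + b)) ^ 2 <= Re y * n ^ 2 / 2).
      { apply Rle_trans with (delta * (Cmod y * (4 * n ^ 2))).
        - apply Rmult_le_compat_l; lra.
        - right. unfold delta. field. lra. }
      lra.
  - rewrite Cmod_mult. apply Rle_trans with (Rabs X); [apply Rle_abs|].
    apply Rle_trans with (Cmod r * (n - Cmod b)); [lra|].
    apply Rmult_le_compat_l; [lra|].
    pose proof (Cmod_triangle_inv n (- b)) as K. rewrite Cmod_opp, Cmod_R, Rabs_right in K by lra.
    replace (n - - b)%C with (n + b)%C in K by ring. exact K.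
Qed.

Lemma Cexp_half_half (p : Z) (n : nat) :
  Cexp (2 * PI * Ci * (IZR p + / 2)%R * half n) = (Ci * (powerRZ (-1) p * (-1) ^ n))%C.
Proof.
  replace (2 * PI * Ci * (IZR p + / 2)%R * half n)%C with
    (2 * PI * Ci * IZR (p * Z.of_nat n) + IZR p * (PI * Ci) + INR n * (PI * Ci) + (PI / 2)%R * Ci)%C.
  - rewrite !Cexp_plus, Cexp_2PI_IZR, Cexp_PI_IZR, Cexp_PI_nat, <- RtoC_pow.
    replace (Cexp ((PI / 2)%R * Ci)) with Ci; [ring|].
    unfold Cexp. Ccomp; replace (PI / 2 * 0 - 0 * 1) with 0 by ring;
    replace (PI / 2 * 1 + 0 * 0) with (PI / 2) by ring; rewrite exp_0, ?cos_PI2, ?sin_PI2; ring.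
  - rewrite mult_IZR, <- INR_IZR_INZ. unfold half.
    rewrite !RtoC_plus, !RtoC_mult, RtoC_div, RtoC_inv by lra. field.
Qed.

Lemma sign_sqr (n : nat) : ((-1) ^ n * (-1) ^ n = 1)%C.
Proof. rewrite <- Cpow_mult_l. replace (-1 * -1)%C with (RtoC 1) by Ccomp. rewrite <- RtoC_pow, pow1. reflexivity. Qed.

Lemma Cinv_unique (x y : C) : (x * y = 1)%C -> (/ x = y)%C.
Proof.
  intros H. assert (Hx : x <> 0%C).
  { intros ->. apply (f_equal Re) in H. unfold Re in H; simpl in H. lra. }
  transitivity (/ x * (x * y))%C; [rewrite H; ring|field; exact Hx].
Qed.

Lemma CSeries_single (u : nat -> C) (j : nat) : (forall n, n <> j -> u n = 0%C) -> CSeries u = u j.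
Proof.
  intros H. destruct (CSeries_finite u (S j)) as [_ E]; [intros n Hn; apply H; lia|].
  rewrite E. simpl csum.
  assert (K : forall N, (N <= j)%nat -> csum u N = 0%C).
  { induction N as [|N IH]; intros HN; [reflexivity|]. simpl. rewrite IH, H by lia. ring. }
  rewrite K by lia. ring.
Qed.

Section inversion.

Variables (L : R) (y a : C).
Hypothesis HL : forall eps, 0 < eps -> exists X, forall x : R, X <= x -> Cmod (Erf x - L) <= eps.
Hypothesis Hy : 0 < Re y.

Let r := Csqrt y.

Let Hr : 0 < Re r. Proof. apply Csqrt_Re_pos, Re_pos_slit, Hy. Qed.
Let Hy0 : y <> 0%C. Proof. apply slit_neq_0, Re_pos_slit, Hy. Qed.
Let Er : (r * r)%C = y. Proof. apply Csqrt_sqr, Hy0. Qed.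
Let Hr0 : r <> 0%C. Proof. apply slit_neq_0, Re_pos_slit, Hr. Qed.

(** The terms of the two sides of the inversion formula, translated by a real Fourier variable x;
    [e] is the character against which both sides are tested. *)
Let F (x m : R) : C := Cexp (- PI * y * ((m + (a + x)) * (m + (a + x)))).
Let T (x m : R) : C := Cexp (- (PI / y) * m ^ 2 + 2 * PI * Ci * (a + x) * m).

Let e (mu x : R) : C := Cexp (- (2 * PI * Ci * mu * x)).

Lemma F_majorant (rad : R) : exists A, ex_series A /\ forall t, Rabs t < rad -> forall n m,
  INR n <= Rabs m <= INR n + 1 -> Cmod (F t m) <= A n.
Proof.
  pose proof PI_RGT_0 as Hpi.
  set (B := 2 * PI * Cmod y * (Cmod a + Rabs rad)).
  set (G := PI * Cmod y * (Cmod a + Rabs rad) ^ 2).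
  destruct (gauss_family_majorant (PI * Re y) B G) as [A [HA H]]; [nra|].
  exists A; split; [exact HA|]. intros t Ht n m Hm.
  assert (Hat : Cmod (a + t) <= Cmod a + Rabs rad).
  { eapply Rle_trans; [apply Cmod_triangle|]. rewrite Cmod_R. pose proof (Rle_abs rad). lra. }
  unfold F.
  replace (- PI * y * ((m + (a + t)) * (m + (a + t))))%C with
    (- (PI * y) * m ^ 2 + (- (2 * PI * y * (a + t))) * m + (- (PI * y * ((a + t) * (a + t)))))%C by ring.
  eapply Rle_trans; [|apply (H (PI * y)%C (- (2 * PI * y * (a + t)))%C (- (PI * y * ((a + t) * (a + t))))%C n m)].
  - rewrite <- (Rmult_1_l (Cmod _)) at 1. apply Rmult_le_compat_r; [apply Cmod_ge_0|].
    pose proof (Rabs_pos m). nra.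
  - right. unfold Re, Im; simpl; ring.
  - eapply Rle_trans; [apply re_le_Cmod|].
    rewrite Cmod_opp, !Cmod_mult, !Cmod_R, (Rabs_right 2), (Rabs_right PI) by lra.
    unfold B. apply Rmult_le_compat_l; [|exact Hat].
    pose proof (Cmod_ge_0 y). nra.
  - eapply Rle_trans; [apply Re_le_Cmod|].
    rewrite Cmod_opp, !Cmod_mult, !Cmod_R, (Rabs_right PI) by lra.
    unfold G. pose proof (Cmod_ge_0 y). pose proof (Cmod_ge_0 (a + t)). apply Rmult_le_compat_l; nra.
  - exact Hm.
Qed.

Lemma T_majorant : exists A, ex_series A /\ forall t n m,
  INR n <= Rabs m <= INR n + 1 -> Cmod (T t m) <= A n.
Proof.
  pose proof PI_RGT_0 as Hpi.
  pose proof (Re_inv_pos y Hy) as Hyi.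
  destruct (gauss_family_majorant (PI * Re (/ y)%C) (2 * PI * Rabs (Im a)) 0) as [A [HA H]]; [nra|].
  exists A; split; [exact HA|]. intros t n m Hm. unfold T.
  replace (- (PI / y) * m ^ 2 + 2 * PI * Ci * (a + t) * m)%C with
    (- (PI * / y) * m ^ 2 + (2 * PI * Ci * (a + t)) * m + 0)%C by (field; exact Hy0).
  eapply Rle_trans; [|apply (H (PI * / y)%C (2 * PI * Ci * (a + t))%C 0%C n m)].
  - rewrite <- (Rmult_1_l (Cmod _)) at 1. apply Rmult_le_compat_r; [apply Cmod_ge_0|].
    pose proof (Rabs_pos m). nra.
  - right. unfold Re, Im; simpl; ring.
  - replace (Re (2 * PI * Ci * (a + t))%C) with (2 * PI * - Im a) by (unfold Re, Im; simpl; ring).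
    rewrite !Rabs_mult, Rabs_Ropp, (Rabs_right 2), (Rabs_right PI) by lra. lra.
  - simpl. lra.
  - exact Hm.
Qed.

(** Boundedness and continuity at 0, the two analytic inputs of [zero_mean_vanish]. *)
Lemma half_sum_continuous_0 (G g : R -> R -> C) (A : nat -> R) : ex_series A ->
  (forall x m, cderiv (fun t => G t m) x (g x m)) ->
  (forall t, Rabs t < 1 -> forall n m, INR n <= Rabs m <= INR n + 1 -> Cmod (G t m) <= A n) ->
  (forall t, Rabs t <= 1 / 2 -> Cmod (CSeries (half_term (G t))) <= 2 * Series (fun n => 2 * A n)) /\
  climit (locally 0) (fun t => CSeries (half_term (G t))) (CSeries (half_term (G 0))).
Proof.
  intros HA D M.
  assert (HA2 : ex_series (fun n => 2 * A n)) by (apply ex_series_scal_R, HA).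
  split.
  - intros t Ht. apply CSeries_bound_le; [|exact HA2].
    apply half_term_bound. intros n m Hm. apply M; [lra|exact Hm].
  - apply (climit_CSeries (locally 0) (fun t => half_term (G t)) _ (fun n => 2 * A n) HA2).
    + apply half_term_bound. intros n m Hm. apply M; [rewrite Rabs_R0; lra|exact Hm].
    + exists (mkposreal 1 Rlt_0_1). intros t Ht. apply half_term_bound. intros n m Hm.
      apply M; [|exact Hm]. change (Rabs (t - 0) < 1) in Ht. rewrite Rminus_0_r in Ht. exact Ht.
    + intros n eps He. unfold half_term.
      assert (K : cderiv (fun t => (-1) ^ n * (G t (half n) - G t (- half n)%R))%C 0
        ((-1) ^ n * (g 0 (half n) - g 0%R (- half n)%R))%C).
      { apply cderiv_scal, cderiv_minus; apply D. }
      destruct (cderiv_continuous _ _ _ K eps He) as [d [Hd H]].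
      exists (mkposreal d Hd). intros t Ht. apply H. exact Ht.
Qed.

(** After completing the square each term has an error function as primitive, and the increments
    over [-1/2, 1/2] for consecutive m join up: the sum telescopes to the values of Erf at the two
    ends of a line, which differ by 2L. *)
Lemma poisson_coefficient_left (p : Z) : let mu := IZR p + / 2 in
  exists Q, (forall x, cderiv Q x (CSeries (half_term (F x)) * e mu x)%C) /\
    (Q (1 / 2)%R - Q (- (1 / 2))%R)%C =
      (Ci * powerRZ (-1) p * Cexp (- (PI / y) * mu ^ 2 + 2 * PI * Ci * a * mu) * (2 * L / r))%C.
Proof.
  intros mu.
  (* The centre obtained by completing the square in m + x; the correction i mu / y is due to the
     character. *)
  set (b := (a + Ci * mu / y)%C).
  set (ka := Cexp (- (PI / y) * mu ^ 2 + 2 * PI * Ci * a * mu)).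
  set (K := fun m : R => (Cexp (2 * PI * Ci * mu * m) * ka)%C).
  (* The primitive is normalised to vanish at x = 0, as [cderiv_half_sum_0] requires. *)
  set (P := fun x m : R => (K m / r * (Erf (r * (m + x + b)) - Erf (r * (m + b))))%C).
  set (g := fun x m : R => (F x m * e mu x)%C).
  assert (D : forall x m, cderiv (fun t => P t m) x (g x m)).
  { intros x m.
    assert (D1 : cderiv (fun t => r * (m + t + b))%C x r).
    { apply cderiv_eq with (r * (0 + 1 + 0))%C; [ring|].
      apply cderiv_scal, cderiv_plus; [apply cderiv_plus|]; try apply cderiv_const. apply cderiv_id. }
    eapply cderiv_eq; [|apply cderiv_scal, cderiv_minus; [apply (cderiv_Erf _ _ _ D1)|apply cderiv_const]].
    unfold g, F, e, K, ka. rewrite Cminus_0_r.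
    replace (r * (m + x + b) * (r * (m + x + b)))%C with (y * ((m + x + b) * (m + x + b)))%C
      by (rewrite <- Er; ring).
    match goal with |- (?p * ?q / r * (?s * r) = _)%C => transitivity (s * (p * q))%C; [field; exact Hr0|] end.
    rewrite <- !Cexp_plus. f_equal. unfold b.
    replace (Ci * mu / y)%C with (Ci * (mu / y))%C by (field; exact Hy0).
    assert (EC : (Ci * Ci = -(1))%C) by Ccomp.
    match goal with |- ?lhs = ?rhs => transitivity (rhs + (Ci * Ci + 1) * (- (PI / y) * mu ^ 2))%C end.
    - field. exact Hy0.
    - rewrite EC. ring. }
  assert (Maj : forall rad, exists A, ex_series A /\ forall t, Rabs t < rad -> forall n m,
     INR n <= Rabs m <= INR n + 1 -> cderiv (fun t => P t m) t (g t m) /\ Cmod (g t m) <= A n).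
  { intros rad. destruct (F_majorant rad) as [A [HA H]].
    exists A; split; [exact HA|]. intros t Ht n m Hm. split; [apply D|].
    unfold g, e. rewrite Cmod_mult.
    assert (E1 : Cmod (Cexp (- (2 * PI * Ci * mu * t))) = 1).
    { rewrite Cmod_Cexp. replace (Re _) with 0 by (unfold Re, Im; simpl; ring). apply exp_0. }
    rewrite E1, Rmult_1_r. apply H; assumption. }
  assert (P0 : forall m, P 0 m = 0%C).
  { intros m. unfold P. replace (m + 0%R + b)%C with (m + b)%C by ring. ring. }
  exists (fun x => CSeries (half_term (P x))). split.
  - intros x. destruct (cderiv_half_sum_0 P g x Maj P0) as [HS HD].
    eapply cderiv_eq; [|exact HD].
    rewrite Cmult_comm, <- CSeries_scal.
    + apply CSeries_ext. intros n. unfold half_term, g. ring.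
    + apply half_term_summable.
      apply half_summable_ext with (fun m => 1 * Cexp (- (PI * y) * m ^ 2 + (- (2 * PI * y * (a + x))) * m
         + (- (PI * y * ((a + x) * (a + x))))))%C.
      * intros m. unfold F. rewrite Cmult_1_l. f_equal. ring.
      * apply gauss_half_summable.
        -- replace (Re (PI * y)%C) with (PI * Re y) by (unfold Re, Im; simpl; ring).
           pose proof PI_RGT_0. nra.
        -- intros m. rewrite Cmod_1. pose proof (Rabs_pos m). nra.
  - destruct (cderiv_half_sum_0 P g (1 / 2) Maj P0) as [HS1 _].
    destruct (cderiv_half_sum_0 P g (- (1 / 2)) Maj P0) as [HS2 _].
    rewrite <- CSeries_minus by (apply half_term_summable; assumption).
    set (c := (Ci * powerRZ (-1) p * ka / r)%C).
    set (E := fun s : C => Erf (r * (s + b))).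
    (* The phase exp(2 pi i mu m) is plus or minus i (-1)^(p+n); it cancels the alternating sign,
       and only then do neighbouring windows telescope. *)
    assert (Tel : forall N, csum (fun n => half_term (P (1 / 2)%R) n - half_term (P (- (1 / 2))%R) n)%C N
        = (c * (E (INR N) - E (- INR N)))%C).
    { induction N as [|N IH].
      - simpl csum. replace (- INR 0)%C with (RtoC (INR 0)) by (simpl; ring). ring.
      - simpl csum. rewrite IH. unfold half_term, P.
        assert (K1 : K (half N) = (Ci * (powerRZ (-1) p * (-1) ^ N) * ka)%C)
          by (unfold K, mu; rewrite Cexp_half_half; reflexivity).
        assert (K2 : K (- half N) = (- (Ci * (powerRZ (-1) p * (-1) ^ N)) * ka)%C).
        { unfold K, mu. f_equal. rewrite RtoC_opp.
          replace (2 * PI * Ci * (IZR p + / 2)%R * - half N)%C with (- (2 * PI * Ci * (IZR p + / 2)%R * half N))%C by ring.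
          rewrite Cexp_opp, Cexp_half_half.
          set (s := (powerRZ (-1) p * (-1) ^ N)%C).
          assert (Hs : (s * s = 1)%C).
          { unfold s. transitivity ((powerRZ (-1) p * powerRZ (-1) p)%R * ((-1) ^ N * (-1) ^ N))%C;
              [rewrite RtoC_mult; ring|].
            rewrite sign_sqr, <- powerRZ_mult. replace (-1 * -1) with 1 by ring.
            rewrite powerRZ_R1. ring. }
          assert (Hi : (Ci * s * - (Ci * s) = 1)%C).
          { transitivity (- (Ci * Ci) * (s * s))%C; [ring|]. rewrite Hs. Ccomp. }
          apply Cinv_unique, Hi. }
        rewrite K1, K2.
        assert (A1 : (half N + (1 / 2)%R + b)%C = (INR (S N) + b)%C).
        { rewrite <- RtoC_plus. do 2 f_equal. unfold half. rewrite S_INR. field. }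
        assert (A2 : (half N + (- (1 / 2))%R + b)%C = (INR N + b)%C).
        { rewrite <- RtoC_plus. do 2 f_equal. unfold half. field. }
        assert (A3 : ((- half N)%R + (1 / 2)%R + b)%C = (- INR N + b)%C).
        { rewrite <- RtoC_plus, <- RtoC_opp. do 2 f_equal. unfold half. field. }
        assert (A4 : ((- half N)%R + (- (1 / 2))%R + b)%C = (- INR (S N) + b)%C).
        { rewrite <- RtoC_plus, <- RtoC_opp. do 2 f_equal. unfold half. rewrite S_INR. field. }
        rewrite A1, A2, A3, A4. unfold E, c.
        match goal with |- ?lhs = ?rhs => transitivity (rhs + (((-1) ^ N * (-1) ^ N) - 1) *
          (Ci * powerRZ (-1) p * ka / r * (Erf (r * (INR (S N) + b)) - Erf (r * (INR N + b))
           + Erf (r * (- INR N + b)) - Erf (r * (- INR (S N) + b)))))%C end.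
        + field. exact Hr0.
        + rewrite sign_sqr. ring. }
    pose proof (climit_csum_CSeries _ (csummable_minus _ _ (half_term_summable _ HS1)
      (half_term_summable _ HS2))) as Lim.
    assert (Lim2 : climit eventually
       (csum (fun n => half_term (P (1 / 2)%R) n - half_term (P (- (1 / 2))%R) n)%C) (c * (L + L))%C).
    { apply (climit_ext eventually) with (fun N => c * (E (INR N) + -(1) * E (- INR N)))%C.
      - apply filter_forall. intros N. rewrite Tel. ring.
      - apply (climit_scal eventually), (climit_plus eventually).
        + apply (erf_line_limit L y); assumption.
        + apply (climit_ext eventually) with (fun N => Erf (r * (INR N + - b))).
          * apply filter_forall. intros N. unfold E.
            replace (r * (- INR N + b))%C with (- (r * (INR N + - b)))%C by ring.
            rewrite Erf_opp. ring.
          * apply (erf_line_limit L y); assumption. }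
    rewrite (climit_unique eventually _ _ _ Lim Lim2). unfold c. field. exact Hr0.
Qed.

(** For m different from mu the difference m - mu is a nonzero integer and the exponential has zero
    mean over a period; only the term m = mu survives. *)
Lemma poisson_coefficient_right (p : Z) : let mu := IZR p + / 2 in
  exists Q, (forall x, cderiv Q x (CSeries (half_term (T x)) * e mu x)%C) /\
    (Q (1 / 2)%R - Q (- (1 / 2))%R)%C =
      (powerRZ (-1) p * Cexp (- (PI / y) * mu ^ 2 + 2 * PI * Ci * a * mu))%C.
Proof.
  intros mu.
  set (ka := fun m : R => Cexp (- (PI / y) * m ^ 2 + 2 * PI * Ci * a * m)).
  set (om := fun m : R => (2 * PI * Ci * (m - mu))%C).
  set (P := fun x m : R => if Req_dec_T m mu then (x * ka m)%C
     else (ka m / om m * (Cexp (x * om m) - 1))%C).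
  set (g := fun x m : R => (T x m * e mu x)%C).
  assert (Eg : forall x m, g x m = (ka m * Cexp (x * om m))%C).
  { intros x m. unfold g, T, e, ka, om. rewrite <- !Cexp_plus. f_equal. ring. }
  assert (Hom : forall m, m <> mu -> om m <> 0%C).
  { intros m Hm. unfold om. rewrite <- RtoC_minus. pose proof PI_RGT_0.
    repeat apply Cmult_neq_0.
    - intros Z; apply RtoC_inj in Z; lra.
    - intros Z; apply RtoC_inj in Z; lra.
    - intros Z. apply (f_equal Im) in Z. unfold Im in Z; simpl in Z. lra.
    - intros Z; apply RtoC_inj in Z; lra. }
  assert (D : forall x m, cderiv (fun t => P t m) x (g x m)).
  { intros x m. rewrite Eg. unfold P. destruct (Req_dec_T m mu) as [Em|Em].
    - eapply cderiv_eq; [|apply cderiv_scal_id].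
      unfold om. rewrite Em. replace (x * (2 * PI * Ci * (mu - mu)))%C with (RtoC 0) by ring.
      rewrite Cexp_0. ring.
    - eapply cderiv_eq; [|apply cderiv_scal, cderiv_minus;
        [apply cderiv_exp, cderiv_scal_id|apply cderiv_const]].
      cbv beta. field. apply Hom, Em. }
  assert (Maj : forall rad, exists A, ex_series A /\ forall t, Rabs t < rad -> forall n m,
     INR n <= Rabs m <= INR n + 1 -> cderiv (fun t => P t m) t (g t m) /\ Cmod (g t m) <= A n).
  { intros rad. destruct T_majorant as [A [HA H]].
    exists A; split; [exact HA|]. intros t Ht n m Hm. split; [apply D|].
    unfold g, e. rewrite Cmod_mult.
    assert (E1 : Cmod (Cexp (- (2 * PI * Ci * mu * t))) = 1).
    { rewrite Cmod_Cexp. replace (Re _) with 0 by (unfold Re, Im; simpl; ring). apply exp_0. }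
    rewrite E1, Rmult_1_r. apply H; assumption. }
  assert (P0 : forall m, P 0 m = 0%C).
  { intros m. unfold P. destruct (Req_dec_T m mu); [ring|].
    replace (0%R * om m)%C with (RtoC 0) by ring. rewrite Cexp_0. ring. }
  exists (fun x => CSeries (half_term (P x))). split.
  - intros x. destruct (cderiv_half_sum_0 P g x Maj P0) as [HS HD].
    eapply cderiv_eq; [|exact HD].
    rewrite Cmult_comm, <- CSeries_scal.
    + apply CSeries_ext. intros n. unfold half_term, g. ring.
    + apply half_term_summable.
      apply half_summable_ext with (fun m => 1 * Cexp (- (PI / y) * m ^ 2 + (2 * PI * Ci * (a + x)) * m + 0))%C.
      * intros m. unfold T. rewrite Cmult_1_l. f_equal. ring.
      * apply gauss_half_summable.
        -- replace (Re (PI / y)%C) with (PI * Re (/ y)%C) by (unfold Re, Im; simpl; ring).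
           pose proof PI_RGT_0. pose proof (Re_inv_pos y Hy). nra.
        -- intros m. rewrite Cmod_1. pose proof (Rabs_pos m). nra.
  - destruct (cderiv_half_sum_0 P g (1 / 2) Maj P0) as [HS1 _].
    destruct (cderiv_half_sum_0 P g (- (1 / 2)) Maj P0) as [HS2 _].
    rewrite <- CSeries_minus by (apply half_term_summable; assumption).
    assert (Pd : forall m, (exists q : Z, m = IZR q + / 2) ->
       (P (1 / 2)%R m - P (- (1 / 2))%R m)%C = if Req_dec_T m mu then ka m else 0%C).
    { intros m [q Eq]. unfold P. destruct (Req_dec_T m mu) as [Em|Em].
      - rewrite RtoC_opp, RtoC_div by lra. field.
      - replace ((1 / 2)%R * om m)%C with ((- (1 / 2))%R * om m + 2 * PI * Ci * IZR (q - p))%C.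
        + rewrite Cexp_plus, Cexp_2PI_IZR. field. apply Hom, Em.
        + unfold om. rewrite Eq. unfold mu. rewrite minus_IZR, !RtoC_plus, RtoC_opp, RtoC_minus, RtoC_div by lra.
          field. }
    assert (Hh1 : forall n, exists q : Z, half n = IZR q + / 2).
    { intros n. exists (Z.of_nat n). rewrite <- INR_IZR_INZ. reflexivity. }
    assert (Hh2 : forall n, exists q : Z, - half n = IZR q + / 2).
    { intros n. exists (- Z.of_nat n - 1)%Z. rewrite minus_IZR, opp_IZR, <- INR_IZR_INZ. unfold half. field. }
    (* The pair of index j contains mu: as half j when p >= 0, as -half j otherwise. *)
    set (j := if Z_le_dec 0 p then Z.to_nat p else Z.to_nat (- p - 1)).
    assert (U : forall n, (half_term (P (1 / 2)%R) n - half_term (P (- (1 / 2))%R) n)%C =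
       ((-1) ^ n * ((if Req_dec_T (half n) mu then ka (half n) else 0)
          - (if Req_dec_T (- half n) mu then ka (- half n)%R else 0)))%C).
    { intros n. rewrite <- (Pd (half n) (Hh1 n)), <- (Pd (- half n) (Hh2 n)). unfold half_term. ring. }
    rewrite (CSeries_ext _ _ U).
    rewrite (CSeries_single _ j).
    + pose proof (half_pos j) as Hj. unfold j in *. destruct (Z_le_dec 0 p) as [Hp|Hp].
      * assert (Ej : half (Z.to_nat p) = mu) by (unfold half, mu; rewrite INR_IZR_INZ, Z2Nat.id by lia; reflexivity).
        rewrite Ej in *. destruct (Req_dec_T mu mu) as [_|K]; [|congruence].
        destruct (Req_dec_T (- mu) mu) as [K|_]; [lra|].
        rewrite Cminus_0_r, <- RtoC_pow, pow_powerRZ, Z2Nat.id by lia. reflexivity.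
      * assert (Ej : half (Z.to_nat (- p - 1)) = - mu).
        { unfold half, mu; rewrite INR_IZR_INZ, Z2Nat.id, minus_IZR, opp_IZR by lia. field. }
        rewrite Ej in *. rewrite Ropp_involutive. destruct (Req_dec_T mu mu) as [_|K]; [|congruence].
        destruct (Req_dec_T (- mu) mu) as [K|_]; [lra|].
        rewrite <- RtoC_pow, pow_powerRZ, Z2Nat.id by lia.
        replace (- p - 1)%Z with (- (p + 1))%Z by lia.
        rewrite powerRZ_neg', powerRZ_add by lra.
        unfold ka. replace (powerRZ (-1) 1) with (-1) by (simpl; ring).
        rewrite RtoC_inv, RtoC_mult by (apply Rmult_integral_contrapositive; split; [apply powerRZ_NOR; lra|lra]).
        assert (Hs : (powerRZ (-1) p * powerRZ (-1) p = 1)%C).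
        { rewrite <- RtoC_mult, <- powerRZ_mult. replace (-1 * -1) with 1 by ring. rewrite powerRZ_R1. reflexivity. }
        rewrite (Cinv_unique (powerRZ (-1) p * (-1))%C (- powerRZ (-1) p)%C).
        -- ring.
        -- transitivity (powerRZ (-1) p * powerRZ (-1) p)%C; [ring|exact Hs].
    + intros n Hn.
      destruct (Req_dec_T (half n) mu) as [K|K1]; [|destruct (Req_dec_T (- half n) mu) as [K|K2]; [|ring]].
      * exfalso. apply Hn. unfold half, mu in K. rewrite INR_IZR_INZ in K.
        assert (Z.of_nat n = p) by (apply eq_IZR; lra). subst p. unfold j.
        destruct (Z_le_dec 0 (Z.of_nat n)); lia.
      * exfalso. apply Hn. unfold half, mu in K. rewrite INR_IZR_INZ in K.
        assert (- Z.of_nat n - 1 = p)%Z by (apply eq_IZR; rewrite minus_IZR, opp_IZR; lra). subst p. unfold j.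
        destruct (Z_le_dec 0 (- Z.of_nat n - 1)); lia.
Qed.

(** The difference of the two sides, as a function of x, has vanishing Fourier coefficients at all
    half-integral frequencies and is continuous at 0, so [zero_mean_vanish] applies. *)
Theorem half_poisson_aux :
  CSeries (half_term (F 0)) = (2 * L / r * Ci * CSeries (half_term (T 0)))%C.
Proof.
  set (k := (2 * L / r * Ci)%C).
  set (D := fun x => (CSeries (half_term (F x)) - k * CSeries (half_term (T x)))%C).
  assert (Z : forall p : Z, zero_mean (fun x => D x * Cexp (- (2 * PI * Ci * (IZR p + / 2)%R * x)))%C).
  { intros p. destruct (poisson_coefficient_left p) as [Q1 [D1 E1]].
    destruct (poisson_coefficient_right p) as [Q2 [D2 E2]].
    exists (fun x => Q1 x - k * Q2 x)%C. split.
    - intros x. eapply cderiv_eq; [|apply cderiv_minus; [apply D1|apply cderiv_scal, D2]].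
      unfold D, e. ring.
    - match goal with |- ?lhs = ?rhs => transitivity (lhs - rhs + rhs)%C; [ring|] end.
      replace (Q1 (1 / 2)%R - k * Q2 (1 / 2)%R - (Q1 (- (1 / 2))%R - k * Q2 (- (1 / 2))%R))%C
        with ((Q1 (1 / 2)%R - Q1 (- (1 / 2))%R) - k * (Q2 (1 / 2)%R - Q2 (- (1 / 2))%R))%C by ring.
      rewrite E1, E2. unfold k. field. exact Hr0. }
  destruct (F_majorant 1) as [A1 [HA1 M1]]. destruct T_majorant as [A2 [HA2 M2]].
  destruct (half_sum_continuous_0 F (fun x m => - PI * y * (2 * (m + (a + x))) * F x m)%C A1 HA1)
    as [B1 L1]; [|exact M1|].
  { intros x m. unfold F.
    assert (K : cderiv (fun t => m + (a + t))%C x 1%C).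
    { apply cderiv_eq with (0 + (0 + 1))%C; [ring|].
      apply cderiv_plus, cderiv_plus; try apply cderiv_const; apply cderiv_id. }
    eapply cderiv_eq; [|apply cderiv_exp, cderiv_scal, (cderiv_mult _ _ _ _ _ K K)]. cbv beta. ring. }
  destruct (half_sum_continuous_0 T (fun x m => 2 * PI * Ci * m * T x m)%C A2 HA2)
    as [B2 L2]; [|intros t _; exact (M2 t)|].
  { intros x m. unfold T.
    eapply cderiv_eq; [|apply cderiv_exp, cderiv_plus; [apply cderiv_const|]].
    2: { apply (cderiv_ext (fun t => 2 * PI * Ci * m * (a + t * 1))%C); [intros t; ring|].
         apply cderiv_scal, cderiv_linear. }
    cbv beta. ring. }
  assert (D0 : D 0 = 0%C).
  { apply (zero_mean_vanish D (2 * Series (fun n => 2 * A1 n) + Cmod k * (2 * Series (fun n => 2 * A2 n)))).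
    - intros x Hx. unfold D. eapply Rle_trans; [apply Cmod_triangle_minus|]. rewrite Cmod_mult.
      apply Rplus_le_compat; [apply B1, Hx|]. apply Rmult_le_compat_l; [apply Cmod_ge_0|apply B2, Hx].
    - intros eps He.
      pose proof (climit_plus _ _ _ _ _ L1 (climit_scal _ (- k)%C _ _ L2) eps He) as [d H].
      exists d; split; [apply cond_pos|]. intros x Hx.
      assert (Hb : ball (0 : R) d x) by (change (Rabs (x - 0) < d); rewrite Rminus_0_r; exact Hx).
      eapply Rle_trans; [|exact (H x Hb)]. right. f_equal. unfold D. ring.
    - intros N. apply (zero_mean_ext (fun x => D x * cos (PI * x) ^ (2 * N + 1) * Cexp (Ci * PI * IZR 0 * x))%C).
      + intros x. replace (Ci * PI * IZR 0 * x)%C with (RtoC 0) by ring. rewrite Cexp_0. ring.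
      + apply zero_mean_cos_pow; [exact Z|]. rewrite Z.add_0_r.
        replace (Z.of_nat (2 * N + 1)) with (1 + 2 * Z.of_nat N)%Z by lia.
        rewrite Z.odd_add_mul_2. reflexivity. }
  unfold D in D0. match type of D0 with (?u - ?v)%C = _ => replace u with (u - v + v)%C by ring end.
  rewrite D0. ring.
Qed.

End inversion.

(** At y = 1 two inversions return G with the factor 4L^2, so 4L^2 = 1 unless G vanishes
    identically; the latter contradicts the nonzero Fourier coefficient of
    [poisson_coefficient_left]. *)
Lemma erf_limit_value (L : R) :
  0 < L -> (forall eps, 0 < eps -> exists X, forall x : R, X <= x -> Cmod (Erf x - L) <= eps) ->
  L = / 2.
Proof.
  intros L0 HL.
  set (G := fun a : C => CSeries (half_term (fun m => Cexp (- PI * ((m + a) * (m + a)))))).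
  assert (H1 : 0 < Re 1) by (simpl; lra).
  assert (S1 : Csqrt 1 = 1%C) by (symmetry; apply Csqrt_unique; [exact H1|ring]).
  assert (Summ : forall a, csummable (half_term (fun m => Cexp (- PI * ((m + a) * (m + a)))))).
  { intros a. apply half_term_summable.
    apply half_summable_ext with (fun m => 1 * Cexp (- PI * m ^ 2 + (- (2 * PI * a)) * m + (- PI * (a * a))))%C.
    - intros m. rewrite Cmult_1_l. f_equal. ring.
    - apply gauss_half_summable.
      + simpl. apply PI_RGT_0.
      + intros m. rewrite Cmod_1. pose proof (Rabs_pos m). nra. }
  assert (Odd : forall a, G (- a)%C = (- G a)%C).
  { intros a. unfold G. rewrite <- CSeries_opp. apply CSeries_ext. intros n. unfold half_term.
    rewrite !RtoC_opp.
    replace ((half n + - a) * (half n + - a))%C with ((- half n + a) * (- half n + a))%C by ring.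
    replace ((- half n + - a) * (- half n + - a))%C with ((half n + a) * (half n + a))%C by ring. ring. }
  assert (Inv : forall a, G a = (2 * L * Ci * Cexp (- PI * (a * a)) * G (- (Ci * a)))%C).
  { intros a. pose proof (half_poisson_aux L 1 a HL H1) as K. cbv zeta in K.
    rewrite S1 in K. unfold G. rewrite <- Cmult_assoc, <- CSeries_scal by apply Summ.
    etransitivity; [|etransitivity; [exact K|]].
    - apply CSeries_ext. intros n. unfold half_term. do 3 f_equal; f_equal; ring.
    - f_equal; [field|]. apply CSeries_ext. intros n.
      assert (EE : forall m : R, Cexp (- (PI / 1) * m ^ 2 + 2 * PI * Ci * (a + 0) * m) =
        (Cexp (- PI * (a * a)) * Cexp (- PI * ((m + - (Ci * a)) * (m + - (Ci * a)))))%C).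
      { intros m. rewrite <- Cexp_plus. f_equal. assert (EC : (Ci * Ci = -(1))%C) by Ccomp.
        match goal with |- ?lhs = ?rhs => transitivity (rhs + (Ci * Ci + 1) * (PI * (a * a)))%C end;
          [field|rewrite EC; ring]. }
      rewrite (half_term_ext _ _ n EE). unfold half_term. ring. }
  assert (Twice : forall a, G a = (4 * L ^ 2 * G a)%C).
  { intros a. rewrite (Inv a) at 1. rewrite (Inv (- (Ci * a))%C).
    assert (EC : (Ci * Ci = -(1))%C) by Ccomp.
    replace (- (Ci * - (Ci * a)))%C with (- a)%C by (transitivity ((Ci * Ci) * a)%C; [rewrite EC|]; ring).
    replace (- PI * (- (Ci * a) * - (Ci * a)))%C with (- (- PI * (a * a)))%C
      by (transitivity (- PI * (Ci * Ci) * (a * a))%C; [rewrite EC|]; ring).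
    rewrite Odd, Cexp_opp.
    transitivity (- (Ci * Ci) * 4 * L ^ 2 * G a)%C; [|rewrite EC; ring].
    field. apply Cexp_neq_0. }
  destruct (Req_dec (4 * L ^ 2) 1) as [E|E]; [nra|exfalso].
  assert (Z : forall a, G a = 0%C).
  { intros a. specialize (Twice a).
    assert (P : ((4 * L ^ 2 - 1)%R * G a = 0)%C).
    { rewrite RtoC_minus, RtoC_mult, RtoC_pow.
      replace ((4 * L ^ 2 - 1) * G a)%C with (4 * L ^ 2 * G a - G a)%C by ring. rewrite <- Twice. ring. }
    destruct (Ceq_dec (G a) 0) as [K|K]; [exact K|exfalso].
    apply (Cmult_neq_0 (4 * L ^ 2 - 1)%R (G a)); [|exact K|exact P].
    intros K2. apply RtoC_inj in K2. lra. }
  destruct (poisson_coefficient_left L 1 0 HL H1 0) as [Q [DQ EQ]].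
  assert (E0 : (Q (1 / 2)%R - Q (- (1 / 2))%R = 0)%C).
  { rewrite (cderiv_zero_const Q (- (1 / 2)) (1 / 2)); [ring|lra|].
    intros x _. eapply cderiv_eq; [|apply DQ].
    replace (CSeries _) with (G x); [rewrite Z; ring|].
    unfold G. apply CSeries_ext. intros n. unfold half_term. do 3 f_equal; f_equal; ring. }
  rewrite EQ, S1 in E0. revert E0.
  assert (NL : RtoC L <> 0%C) by (intros K; apply RtoC_inj in K; lra).
  assert (N2 : RtoC 2 <> 0%C) by (intros K; apply RtoC_inj in K; lra).
  assert (N1 : RtoC 1 <> 0%C) by (intros K; apply RtoC_inj in K; lra).
  assert (NI : Ci <> 0%C) by (intros K; apply (f_equal Im) in K; unfold Im in K; simpl in K; lra).
  repeat apply Cmult_neq_0; try assumption.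
  apply Cexp_neq_0.
  apply Cmod_gt_0. rewrite Cmod_inv, Cmod_1, Rinv_1; [lra|exact N1].
Qed.

Theorem Erf_sector_half (delta eps : R) : 0 < delta -> 0 < eps ->
  exists X, forall w, sector delta w -> X <= Cmod w -> Cmod (Erf w - (/ 2)%R) <= eps.
Proof.
  destruct Erf_real_limit as [L [L0 HL]]. rewrite <- (erf_limit_value L L0 HL).
  apply Erf_sector_limit, HL.
Qed.

Theorem half_poisson (y a : C) : 0 < Re y ->
  CSeries (half_term (fun m => Cexp (- PI * y * ((m + a) * (m + a))))) =
  (Ci / Csqrt y * CSeries (half_term (fun m => Cexp (- (PI / y) * m ^ 2 + 2 * PI * Ci * a * m))))%C.
Proof.
  intros Hy. destruct Erf_real_limit as [L [L0 HL]].
  pose proof (half_poisson_aux L y a HL Hy) as K. cbv zeta in K.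
  rewrite (erf_limit_value L L0 HL) in K.
  etransitivity; [|etransitivity; [exact K|]].
  - apply CSeries_ext. intros n. apply half_term_ext. intros m. f_equal. ring.
  - rewrite RtoC_inv by lra. f_equal.
    + field. apply slit_neq_0, Re_pos_slit, Csqrt_Re_pos, Re_pos_slit, Hy.
    + apply CSeries_ext. intros n. apply half_term_ext. intros m. f_equal. ring.
Qed.

(** * The theta function: inversion and translation *)

Definition theta_term (z tau : C) (m : R) : C := Cexp (PI * Ci * tau * m ^ 2 + 2 * PI * Ci * z * m).

Lemma theta_term_summable (z tau : C) : 0 < Im tau -> half_summable (theta_term z tau).
Proof.
  intros H.
  apply half_summable_ext with (fun m => 1 * Cexp (- (- (PI * Ci * tau)) * m ^ 2 + (2 * PI * Ci * z) * m + 0))%C.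
  - intros m. unfold theta_term. rewrite Cmult_1_l. f_equal. ring.
  - apply gauss_half_summable.
    + replace (Re _) with (PI * Im tau) by (unfold Re, Im; simpl; ring). pose proof PI_RGT_0. nra.
    + intros m. rewrite Cmod_1. pose proof (Rabs_pos m). nra.
Qed.

Lemma vartheta_CSeries (z tau : C) : 0 < Im tau ->
  vartheta z tau = (Ci * CSeries (half_term (theta_term z tau)))%C.
Proof.
  intros H. unfold vartheta.
  assert (E : forall m, theta_term z tau m = (e2pi tau (m ^ 2 / 2) * e2pi z m)%C).
  { intros m. unfold e2pi, theta_term. rewrite <- Cexp_plus. f_equal.
    rewrite RtoC_div, RtoC_pow by lra. field. }
  rewrite alt_half_sum_CSeries.
  - f_equal. apply CSeries_ext. intros n. apply half_term_ext. intros m. symmetry; apply E.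
  - apply half_summable_ext with (theta_term z tau); [exact E|]. apply theta_term_summable, H.
Qed.

Lemma theta_sum_opp (z tau : C) :
  CSeries (half_term (theta_term (- z) tau)) = (- CSeries (half_term (theta_term z tau)))%C.
Proof.
  rewrite <- CSeries_opp. apply CSeries_ext. intros n. unfold half_term, theta_term.
  replace (2 * PI * Ci * - z * half n)%C with (2 * PI * Ci * z * (- half n)%R)%C by (rewrite RtoC_opp; ring).
  replace (2 * PI * Ci * - z * (- half n)%R)%C with (2 * PI * Ci * z * half n)%C by (rewrite RtoC_opp; ring).
  replace ((- half n)%R ^ 2)%C with (half n ^ 2)%C by (rewrite RtoC_opp; ring). ring.
Qed.

(** The eighth root of unity through which sqrt(-i w) is expressed by sqrt(w) on the upper
    half-plane. *)
Definition zeta8 : C := Cexp (PI * Ci / 4).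

Lemma zeta8_sqr : (zeta8 * zeta8 = Ci)%C.
Proof.
  unfold zeta8. rewrite <- Cexp_plus.
  replace (PI * Ci / 4 + PI * Ci / 4)%C with ((PI / 2)%R * Ci)%C by (rewrite RtoC_div by lra; field).
  unfold Cexp. Ccomp; replace (PI / 2 * 0 - 0 * 1) with 0 by ring;
    replace (PI / 2 * 1 + 0 * 0) with (PI / 2) by ring; rewrite exp_0, ?cos_PI2, ?sin_PI2; ring.
Qed.

Lemma zeta8_neq_0 : zeta8 <> 0%C.
Proof. apply Cexp_neq_0. Qed.

Lemma zeta8_value : exists a, 0 < a /\ zeta8 = (a, a).
Proof.
  exists (cos (PI / 4)). split; [apply cos_gt_0; pose proof PI_RGT_0; lra|].
  unfold zeta8, Cexp.
  replace (PI * Ci / 4)%C with (0, PI / 4)%R.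
  - simpl. rewrite exp_0, sin_PI4, cos_PI4, Rmult_1_l. reflexivity.
  - apply C_ext; unfold Re, Im; simpl; field.
Qed.

Lemma Csqrt_upper (w : C) : 0 < Im w -> 0 < Re (Csqrt w) /\ 0 < Im (Csqrt w).
Proof.
  intros H. assert (Hs : slit w) by (intros [K _]; lra).
  pose proof (Csqrt_Re_pos w Hs) as H1. split; [exact H1|].
  pose proof (f_equal Im (Csqrt_sqr w (slit_neq_0 _ Hs))) as E. rewrite Im_mult in E.
  set (a := Re (Csqrt w)) in *. set (b := Im (Csqrt w)) in *. nra.
Qed.

Lemma Csqrt_rotate (w : C) : 0 < Im w -> Csqrt (- Ci * w) = (Csqrt w / zeta8)%C.
Proof.
  intros H. destruct (Csqrt_upper w H) as [H1 H2]. destruct zeta8_value as [a [Ha Ea]].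
  symmetry. apply Csqrt_unique.
  - rewrite Ea. revert H1 H2. generalize (Csqrt w). intros [p q] H1 H2.
    unfold Cdiv, Cinv, Re, Im in *; simpl in *.
    replace (p * (a / (a * (a * 1) + a * (a * 1))) - q * (- a / (a * (a * 1) + a * (a * 1))))
      with ((p + q) / (2 * a)) by (field; nra).
    apply Rdiv_lt_0_compat; lra.
  - assert (Hw : w <> 0%C) by (intros Z; rewrite Z in H; simpl in H; lra).
    transitivity (Csqrt w * Csqrt w / (zeta8 * zeta8))%C; [field; apply zeta8_neq_0|].
    rewrite zeta8_sqr, (Csqrt_sqr w Hw). Ccomp; field.
Qed.

Lemma Cinv_Re_Im (w : C) : (/ w)%C = (Re w / (Re w ^ 2 + Im w ^ 2), - Im w / (Re w ^ 2 + Im w ^ 2)).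
Proof. reflexivity. Qed.

Lemma upper_neq_0 (w : C) : 0 < Im w -> w <> 0%C.
Proof. intros H Z; rewrite Z in H; simpl in H; lra. Qed.

Lemma Im_opp_inv_pos (w : C) : 0 < Im w -> 0 < Im (- / w)%C.
Proof.
  intros H. rewrite Cinv_Re_Im. unfold Im at 1; simpl fst; simpl snd.
  unfold Copp; simpl. replace (- (- Im w / _)) with (Im w / (Re w ^ 2 + Im w ^ 2)) by (simpl; field; nra).
  apply Rdiv_lt_0_compat; nra.
Qed.

(** [half_poisson] at y = i/tau with shift z: completing the square produces the exponential factor,
    and the oddness of theta absorbs the sign of z/tau. *)
Lemma vartheta_inversion (z tau : C) : 0 < Im tau ->
  vartheta (z / tau) (- / tau) =
  (Csqrt tau / (zeta8 * zeta8 * zeta8) * Cexp (PI * Ci * z * z / tau) * vartheta z tau)%C.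
Proof.
  intros H. pose proof (upper_neq_0 _ H) as Ht. pose proof (Im_opp_inv_pos _ H) as H'.
  assert (Hi : Ci <> 0%C) by (apply upper_neq_0; simpl; lra).
  assert (EC : (Ci * Ci = -(1))%C) by Ccomp.
  rewrite !vartheta_CSeries by assumption.
  set (y := (Ci / tau)%C).
  assert (Hy : 0 < Re y).
  { replace (Re y) with (Im (- / tau)%C) by (unfold y, Re, Im; simpl; ring). exact H'. }
  pose proof (half_poisson y z Hy) as P.
  assert (E1 : CSeries (half_term (fun m => Cexp (- PI * y * ((m + z) * (m + z))))) =
     (Cexp (- (PI * Ci * z * z / tau)) * CSeries (half_term (theta_term (- (z / tau)) (- / tau))))%C).
  { rewrite <- CSeries_scal by (apply half_term_summable, theta_term_summable; exact H').
    apply CSeries_ext. intros n.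
    rewrite (half_term_ext _ (fun m => Cexp (- (PI * Ci * z * z / tau)) * theta_term (- (z / tau)) (- / tau) m)%C).
    - unfold half_term. ring.
    - intros m. unfold theta_term. rewrite <- Cexp_plus. f_equal. unfold y. field. exact Ht. }
  assert (E2 : CSeries (half_term (fun m => Cexp (- (PI / y) * m ^ 2 + 2 * PI * Ci * z * m))) =
     CSeries (half_term (theta_term z tau))).
  { apply CSeries_ext. intros n. apply half_term_ext. intros m. unfold theta_term. f_equal. f_equal.
    unfold y. transitivity ((Ci * Ci) * (PI * tau / Ci) * m ^ 2)%C; [rewrite EC|]; field; repeat split; assumption. }
  rewrite E1, E2, theta_sum_opp in P.
  assert (E3 : (/ Csqrt y)%C = (Csqrt tau / zeta8)%C).
  { rewrite <- Csqrt_rotate by exact H.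
    pose proof (Csqrt_Re_pos y (Re_pos_slit _ Hy)) as Hs.
    apply Csqrt_unique; [apply Re_inv_pos, Hs|].
    transitivity (/ (Csqrt y * Csqrt y))%C; [field; apply slit_neq_0, Re_pos_slit, Hs|].
    rewrite Csqrt_sqr by (apply slit_neq_0, Re_pos_slit, Hy).
    unfold y. transitivity (- (Ci * Ci) * (tau / Ci))%C; [rewrite EC|]; field; repeat split; assumption. }
  replace (Ci / Csqrt y)%C with (Ci * / Csqrt y)%C in P by reflexivity. rewrite E3 in P.
  set (S1 := CSeries (half_term (theta_term (z / tau) (- / tau)))) in *.
  set (S2 := CSeries (half_term (theta_term z tau))) in *.
  set (e := (PI * Ci * z * z / tau)%C) in *.
  assert (E4 : S1 = (- Cexp e * (Cexp (- e) * - S1))%C).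
  { rewrite Cexp_opp. field. apply Cexp_neq_0. }
  rewrite E4, P. transitivity (Csqrt tau * Cexp e * S2 / zeta8)%C.
  - transitivity (- (Ci * Ci) * (Csqrt tau * Cexp e * S2 / zeta8))%C; [|rewrite EC]; field; exact zeta8_neq_0.
  - rewrite zeta8_sqr. field. split; [exact zeta8_neq_0|exact Hi].
Qed.

Lemma vartheta_translation (z tau : C) : 0 < Im tau -> vartheta z (tau + 1) = (zeta8 * vartheta z tau)%C.
Proof.
  intros H. assert (H' : 0 < Im (tau + 1)%C) by (unfold Im in *; simpl; lra).
  rewrite !vartheta_CSeries by assumption.
  replace (zeta8 * (Ci * CSeries (half_term (theta_term z tau))))%C
    with (Ci * (zeta8 * CSeries (half_term (theta_term z tau))))%C by ring.
  f_equal. rewrite <- CSeries_scal by (apply half_term_summable, theta_term_summable; exact H).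
  apply CSeries_ext. intros n.
  assert (K : forall m : R, (m ^ 2 = half n ^ 2) -> theta_term z (tau + 1) m = (zeta8 * theta_term z tau m)%C).
  { intros m Hm. unfold theta_term, zeta8.
    (* (n + 1/2)^2 = n(n + 1) + 1/4, and n(n + 1) is even. *)
    assert (Em : exists k : Z, m ^ 2 = 2 * IZR k + / 4).
    { destruct (Nat.Even_or_Odd n) as [[k Hk]|[k Hk]].
      - exists (Z.of_nat (k * (2 * k + 1))). rewrite Hm. unfold half. rewrite Hk, <- INR_IZR_INZ.
        rewrite !mult_INR, plus_INR, mult_INR. simpl. field.
      - exists (Z.of_nat ((2 * k + 1) * (k + 1))). rewrite Hm. unfold half. rewrite Hk, <- INR_IZR_INZ.
        rewrite mult_INR, !plus_INR, mult_INR. simpl. field. }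
    destruct Em as [k Ek].
    replace (PI * Ci * (tau + 1) * m ^ 2 + 2 * PI * Ci * z * m)%C with
      ((2 * PI * Ci * IZR k) + (PI * Ci / 4 + (PI * Ci * tau * m ^ 2 + 2 * PI * Ci * z * m)))%C.
    - rewrite Cexp_plus, Cexp_2PI_IZR, Cexp_plus. ring.
    - rewrite <- !RtoC_pow, Ek, RtoC_plus, RtoC_mult, RtoC_inv by lra. field. }
  unfold half_term. rewrite !K by ring. ring.
Qed.

(** * Infinite products *)

Lemma CLim_seq_climit (u : nat -> C) (l : C) : climit eventually u l -> CLim_seq u = l.
Proof.
  intros H. apply C_ext; unfold CLim_seq; simpl.
  - rewrite (is_lim_seq_unique (fun n => Re (u n)) (Re l)); [reflexivity|].
    apply is_lim_seq_spec. intros eps. destruct (H (eps / 2)) as [N HN]; [pose proof (cond_pos eps); lra|].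
    exists N. intros n Hn. eapply Rle_lt_trans; [apply (re_le_Cmod (u n - l)%C)|].
    specialize (HN n Hn). pose proof (cond_pos eps). lra.
  - rewrite (is_lim_seq_unique (fun n => Im (u n)) (Im l)); [reflexivity|].
    apply is_lim_seq_spec. intros eps. destruct (H (eps / 2)) as [N HN]; [pose proof (cond_pos eps); lra|].
    exists N. intros n Hn. eapply Rle_lt_trans; [apply (im_le_Cmod (u n - l)%C)|].
    specialize (HN n Hn). pose proof (cond_pos eps). lra.
Qed.

Section qpoch_convergence.

Variables (a q : C).
Hypothesis Hq : Cmod q < 1.

Lemma qpoch_partial_bound : exists B, 0 < B /\ forall n, Cmod (qpoch_partial a q n) <= B.
Proof.
  set (x := Cmod q) in *. assert (Hx : 0 <= x) by apply Cmod_ge_0.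
  pose proof (Cmod_ge_0 a) as Ha.
  exists (exp (Cmod a / (1 - x))). split; [apply exp_pos|].
  assert (K : forall n, Cmod (qpoch_partial a q n) <= exp (Cmod a * (1 - x ^ n) / (1 - x))).
  { induction n as [|n IH].
    - simpl. rewrite Cmod_1. replace (Cmod a * (1 - 1) / (1 - x)) with 0 by (field; lra). rewrite exp_0. lra.
    - simpl qpoch_partial. rewrite Cmod_mult.
      replace (Cmod a * (1 - x ^ S n) / (1 - x)) with (Cmod a * (1 - x ^ n) / (1 - x) + Cmod a * x ^ n)
        by (simpl; field; lra).
      rewrite exp_plus. apply Rmult_le_compat; try apply Cmod_ge_0; [exact IH|].
      eapply Rle_trans; [apply Cmod_triangle_minus|].
      rewrite Cmod_1, Cmod_mult, Cmod_pow. fold x. apply exp_ineq1_le. }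
  intros n. eapply Rle_trans; [apply K|]. apply exp_le_mono.
  apply Rmult_le_compat_r; [left; apply Rinv_0_lt_compat; lra|].
  pose proof (pow_le x n Hx). nra.
Qed.

(** The increments of the partial products are dominated by a geometric series; this makes the
    componentwise [Lim_seq] in [qpoch] a genuine limit. *)
Lemma qpoch_climit : climit eventually (qpoch_partial a q) (qpoch a q).
Proof.
  set (x := Cmod q) in *. assert (Hx : 0 <= x) by apply Cmod_ge_0.
  destruct qpoch_partial_bound as [B [HB Bd]].
  set (d := fun n => (qpoch_partial a q (S n) - qpoch_partial a q n)%C).
  assert (Hd : csummable d).
  { apply csummable_le with (fun n => (B * Cmod a) * x ^ n).
    - intros n. unfold d. simpl.
      replace (qpoch_partial a q n * (1 - a * q ^ n) - qpoch_partial a q n)%C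
        with (- (qpoch_partial a q n * a * q ^ n))%C by ring.
      rewrite Cmod_opp, !Cmod_mult, Cmod_pow. fold x.
      apply Rmult_le_compat_r; [apply pow_le, Hx|].
      apply Rmult_le_compat_r; [apply Cmod_ge_0|apply Bd].
    - apply ex_series_scal_R, ex_series_geom. rewrite Rabs_right; lra. }
  assert (L : climit eventually (qpoch_partial a q) (CSeries d + 1)%C).
  { apply (climit_ext eventually) with (fun n => csum d n + 1)%C.
    - apply filter_forall. induction x0 as [|n IH]; simpl; [ring|].
      replace (csum d n) with (csum d n + 1 - 1)%C by ring. rewrite IH. unfold d. simpl. ring.
    - apply (climit_plus eventually); [apply climit_csum_CSeries, Hd|apply (climit_const eventually)]. }
  unfold qpoch. rewrite (CLim_seq_climit _ _ L). exact L.
Qed.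

End qpoch_convergence.

(** For 0 <= t <= x < 1 one has 1 - t >= exp(-t/(1 - x)); with t = x^(j+1) the exponents add up to
    x/(1 - x)^2. *)
Lemma qpoch_self_lower (q : C) : Cmod q < 1 ->
  exists c, 0 < c /\ forall n, c <= Cmod (qpoch_partial q q n).
Proof.
  intros Hq. set (x := Cmod q) in *. assert (Hx : 0 <= x) by apply Cmod_ge_0.
  exists (exp (- (x / (1 - x) ^ 2))). split; [apply exp_pos|].
  assert (K : forall n, exp (- (x * (1 - x ^ n) / (1 - x) ^ 2)) <= Cmod (qpoch_partial q q n)).
  { induction n as [|n IH].
    - simpl. rewrite Cmod_1. replace (- (x * (1 - 1) / ((1 - x) * ((1 - x) * 1)))) with 0 by (field; lra).
      rewrite exp_0. lra.
    - simpl qpoch_partial. rewrite Cmod_mult.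
      replace (- (x * (1 - x ^ S n) / (1 - x) ^ 2)) with
        (- (x * (1 - x ^ n) / (1 - x) ^ 2) + - (x ^ S n / (1 - x))) by (simpl; field; lra).
      rewrite exp_plus. apply Rmult_le_compat; try (left; apply exp_pos); [exact IH|].
      set (t := x ^ S n).
      assert (Ht : 0 <= t <= x).
      { unfold t. split; [apply pow_le, Hx|]. simpl. rewrite <- (Rmult_1_r x) at 3.
        apply Rmult_le_compat_l; [exact Hx|]. rewrite <- (pow1 n). apply pow_incr. lra. }
      apply Rle_trans with (1 - t).
      + rewrite exp_Ropp. apply Rle_trans with (/ (1 + t / (1 - x))).
        * apply Rinv_le_contravar; [|apply exp_ineq1_le].
          assert (0 <= t / (1 - x)) by (apply Rdiv_le_0_compat; lra). lra.
        * replace (/ (1 + t / (1 - x))) with ((1 - x) / (1 - x + t)) by (field; lra).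
          apply Rmult_le_reg_r with (1 - x + t); [lra|].
          unfold Rdiv. rewrite Rmult_assoc, Rinv_l by lra. nra.
      + pose proof (Cmod_triangle_inv 1 (q * q ^ n)) as T. rewrite Cmod_1, Cmod_mult, Cmod_pow in T.
        exact T. }
  intros n. eapply Rle_trans; [|apply K]. apply exp_le_mono. apply Ropp_le_contravar.
  apply Rmult_le_compat_r; [left; apply Rinv_0_lt_compat; nra|]. pose proof (pow_le x n Hx). nra.
Qed.

Lemma qpoch_self_neq_0 (q : C) : Cmod q < 1 -> qpoch q q <> 0%C.
Proof.
  intros Hq E. destruct (qpoch_self_lower q Hq) as [c [Hc H]].
  destruct (qpoch_climit q q Hq (c / 2)) as [N HN]; [lra|].
  specialize (HN N (Nat.le_refl _)). rewrite E, Cminus_0_r in HN. specialize (H N). lra.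
Qed.

(** * The Jacobi triple product *)

Fixpoint triangular (n : nat) : nat := match n with O => O | S n => (triangular n + S n)%nat end.

Lemma triangular_INR (n : nat) : 2 * INR (triangular n) = INR n * (INR n + 1).
Proof. induction n as [|n IH]; [simpl; ring|]. cbn [triangular]. rewrite plus_INR, S_INR. lra. Qed.

Section finite_triple_product.

Variables (q x xi : C).
Hypothesis Hx : (x * xi = 1)%C.
Hypothesis Hne : forall n, (1 - q * q ^ n)%C <> 0%C.

Let P (n : nat) : C := qpoch_partial q q n.

Lemma qpoch_self_partial_neq_0 (n : nat) : P n <> 0%C.
Proof.
  induction n as [|n IH].
  - intros Z. apply RtoC_inj in Z. lra.
  - apply Cmult_neq_0; [exact IH|apply Hne].
Qed.

(** The Gaussian binomial coefficient of 2N + 1 over N - l. *)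
Definition qbin (N l : nat) : C :=
  if le_dec l N then (P (2 * N + 1) / (P (N - l) * P (N + l + 1)))%C else 0%C.

(** With x = zeta^(1/2) this is zeta^(l+1/2) - zeta^(-l-1/2), the two theta terms paired in
    [half_term]. *)
Definition spow (l : nat) : C := (x ^ (2 * l + 1) - xi ^ (2 * l + 1))%C.

Definition coef (N l : nat) : C := ((-1) ^ l * qbin N l * q ^ triangular l)%C.

Lemma spow_rec_0 : ((x * x + xi * xi) * spow 0 = spow 1 - spow 0)%C.
Proof.
  unfold spow; simpl.
  transitivity (x * x * x - xi * xi * xi + (x * xi) * xi - (x * xi) * x)%C; [ring|]. rewrite Hx. ring.
Qed.

Lemma spow_rec_S (l : nat) : ((x * x + xi * xi) * spow (S l) = spow (S (S l)) + spow l)%C.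
Proof.
  unfold spow.
  replace (2 * S (S l) + 1)%nat with (S (S (S (S (2 * l + 1))))) by lia.
  replace (2 * S l + 1)%nat with (S (S (2 * l + 1))) by lia.
  set (k := (2 * l + 1)%nat). simpl Cpow.
  transitivity (x * (x * (x * (x * x ^ k))) - xi * (xi * (xi * (xi * xi ^ k)))
     + (x * xi) * (x * xi) * (x ^ k - xi ^ k))%C; [ring|]. rewrite Hx. ring.
Qed.

(** Values at index l - 1, extended to l = 0 by antisymmetry under l -> -1 - l, under which [spow]
    changes sign. *)
Let pred_coef (c : nat -> C) (l : nat) : C := match l with O => (- c O)%C | S l => c l end.
Let pred_spow (l : nat) : C := match l with O => (- spow O)%C | S l => spow l end.

Lemma summation_by_parts (c : nat -> C) (M : nat) :
  csum (fun l => (x * x + xi * xi) * (c l * spow l))%C M =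
  (csum (fun l => (c (S l) + pred_coef c l) * spow l) M + pred_coef c M * spow M - c M * pred_spow M)%C.
Proof.
  induction M as [|M IH].
  - simpl. ring.
  - simpl csum. rewrite IH.
    replace ((x * x + xi * xi) * (c M * spow M))%C with (c M * ((x * x + xi * xi) * spow M))%C by ring.
    destruct M as [|M]; simpl.
    + rewrite spow_rec_0. ring.
    + rewrite spow_rec_S. ring.
Qed.

Lemma qbin_next (N l : nat) : (l <= N)%nat ->
  (qbin N (S l) * (1 - q * q ^ (N + l + 1)) = qbin N l * (1 - q ^ (N - l)))%C.
Proof.
  intros Hl. unfold qbin. destruct (le_dec l N); [|lia].
  pose proof (qpoch_self_partial_neq_0 (N - l)) as N1.
  pose proof (qpoch_self_partial_neq_0 (N + l + 1)) as N2.
  destruct (le_dec (S l) N) as [H|H].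
  - replace (N + S l + 1)%nat with (S (N + l + 1)) by lia.
    replace (N - l)%nat with (S (N - S l)) in * by lia.
    pose proof (qpoch_self_partial_neq_0 (N - S l)) as N3.
    pose proof (Hne (N - S l)) as M1. pose proof (Hne (N + l + 1)) as M2.
    change (P (S (N + l + 1))) with (P (N + l + 1) * (1 - q * q ^ (N + l + 1)))%C.
    change (P (S (N - S l))) with (P (N - S l) * (1 - q * q ^ (N - S l)))%C.
    change (q ^ S (N - S l))%C with (q * q ^ (N - S l))%C.
    field. repeat split; assumption.
  - replace (N - l)%nat with 0%nat by lia. change (q ^ 0)%C with (RtoC 1). ring.
Qed.

Lemma qbin_up (N l : nat) : (l <= N)%nat ->
  (qbin (S N) l * ((1 - q * q ^ (N - l)) * (1 - q * q ^ (N + l + 1))) =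
   qbin N l * ((1 - q * q ^ (2 * N + 1)) * (1 - q * q ^ (2 * N + 2))))%C.
Proof.
  intros Hl. unfold qbin. destruct (le_dec l N); [|lia]. destruct (le_dec l (S N)); [|lia].
  replace (2 * S N + 1)%nat with (S (S (2 * N + 1))) by lia.
  replace (S N - l)%nat with (S (N - l)) by lia.
  replace (S N + l + 1)%nat with (S (N + l + 1)) by lia.
  replace (2 * N + 2)%nat with (S (2 * N + 1)) by lia.
  pose proof (qpoch_self_partial_neq_0 (N - l)) as N1.
  pose proof (qpoch_self_partial_neq_0 (N + l + 1)) as N2.
  pose proof (Hne (N - l)) as M1. pose proof (Hne (N + l + 1)) as M2.
  change (P (S (S (2 * N + 1)))) with
    (P (2 * N + 1) * (1 - q * q ^ (2 * N + 1)) * (1 - q * q ^ (S (2 * N + 1))))%C.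
  change (P (S (N + l + 1))) with (P (N + l + 1) * (1 - q * q ^ (N + l + 1)))%C.
  change (P (S (N - l))) with (P (N - l) * (1 - q * q ^ (N - l)))%C.
  field. repeat split; assumption.
Qed.

Lemma Cmult_cancel_r (a b c : C) : c <> 0%C -> (a * c = b * c)%C -> a = b.
Proof.
  intros Hc H. transitivity (a * c / c)%C; [field; exact Hc|]. rewrite H. field; exact Hc.
Qed.

Lemma qbin_diag (N : nat) : qbin N N = 1%C.
Proof.
  unfold qbin. destruct (le_dec N N); [|lia].
  rewrite Nat.sub_diag. replace (N + N + 1)%nat with (2 * N + 1)%nat by lia.
  change (P 0) with (RtoC 1). field. apply qpoch_self_partial_neq_0.
Qed.

Lemma pow_add_C (u : C) (n m : nat) : (u ^ (n + m) = u ^ n * u ^ m)%C.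
Proof. induction n as [|n IH]; simpl; [ring|rewrite IH; ring]. Qed.

(** The Pascal rule for Gaussian binomials in the form belonging to one further pair of factors. It
    follows from the ratios of neighbouring coefficients in [qbin_up] and [qbin_next] after clearing
    denominators. *)
Lemma coef_rec (N l : nat) : (l <= S N)%nat ->
  coef (S N) l = ((1 + q ^ (2 * N + 2)) * coef N l
     - q ^ (N + 1) * (coef N (S l) + pred_coef (coef N) l))%C.
Proof.
  intros Hl.
  assert (Pw : (q ^ (2 * N + 1) = q ^ (N - l) * q ^ (N + l + 1) \/ l = S N)%C).
  { destruct (Nat.eq_dec l (S N)) as [H|H]; [right; exact H|left].
    rewrite <- pow_add_C. f_equal. lia. }
  assert (E2 : (q ^ (2 * N + 2) = q * q ^ (2 * N + 1))%C) by (replace (2 * N + 2)%nat with (S (2 * N + 1)) by lia; reflexivity).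
  destruct (Nat.eq_dec l (S N)) as [->|H].
  - unfold coef. cbn [pred_coef]. unfold pred_coef. rewrite !qbin_diag.
    assert (Z1 : qbin N (S N) = 0%C) by (unfold qbin; destruct (le_dec (S N) N); [lia|reflexivity]).
    assert (Z2 : qbin N (S (S N)) = 0%C) by (unfold qbin; destruct (le_dec (S (S N)) N); [lia|reflexivity]).
    rewrite Z1, Z2. cbn [triangular]. rewrite pow_add_C.
    replace (N + 1)%nat with (S N) by lia. simpl. ring.
  - destruct Pw as [Pw|]; [|contradiction]. assert (HlN : (l <= N)%nat) by lia.
    pose proof (Hne (N - l)) as M1. pose proof (Hne (N + l + 1)) as M2.
    pose proof (qbin_up N l HlN) as U. pose proof (qbin_next N l HlN) as X.
    rewrite Pw in E2. rewrite E2, Pw in U. rewrite E2. clear E2 Pw.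
    assert (EN : (q ^ (N + 1) * q ^ S l = q * q ^ (N + l + 1))%C).
    { rewrite <- pow_add_C. replace (N + 1 + S l)%nat with (S (N + l + 1)) by lia. reflexivity. }
    apply (Cmult_cancel_r _ _ ((1 - q * q ^ (N - l)) * (1 - q * q ^ (N + l + 1)))%C);
      [apply Cmult_neq_0; assumption|].
    destruct l as [|l].
    + unfold coef. cbn [pred_coef]. unfold pred_coef. cbn [triangular].
      rewrite Nat.add_0_r, Nat.sub_0_r in *. simpl (_ ^ 0)%C.
      assert (EV : (q ^ (N + 1) = q * q ^ N)%C) by (rewrite Nat.add_1_r; reflexivity).
      rewrite EV in *. simpl Cpow in *. simpl (0 + 1)%nat.
      set (u := (q ^ N)%C) in *. set (b1 := qbin N 1) in *. set (b0 := qbin N 0) in *.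
      transitivity (qbin (S N) 0 * ((1 - q * u) * (1 - q * (q * u))))%C; [simpl; ring|].
      rewrite U.
      transitivity ((1 + q * (u * (q * u))) * b0 * ((1 - q * u) * (1 - q * (q * u)))
         + q * u * b0 * ((1 - q * u) * (1 - q * (q * u)))
         + q * u * q * (1 - q * u) * (b1 * (1 - q * (q * u))))%C; [rewrite X; ring|simpl; ring].
    + unfold coef. unfold pred_coef.
      pose proof (qbin_next N l ltac:(lia)) as Y.
      replace (N - l)%nat with (S (N - S l)) in Y by lia.
      replace (q * q ^ (N + l + 1))%C with (q ^ (N + S l + 1))%C in Y
        by (replace (N + S l + 1)%nat with (S (N + l + 1)) by lia; reflexivity).
      change (q ^ S (N - S l))%C with (q * q ^ (N - S l))%C in Y.
      assert (EN' : (q ^ (N + 1) * q ^ triangular l = q * q ^ (N - S l) * q ^ triangular (S l))%C).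
      { cbn [triangular]. change (q * q ^ (N - S l))%C with (q ^ S (N - S l))%C.
        rewrite <- !pow_add_C. f_equal. lia. }
      assert (ET : (q ^ (N + 1) * q ^ triangular (S (S l)) = q * q ^ (N + S l + 1) * q ^ triangular (S l))%C).
      { change (triangular (S (S l))) with (triangular (S l) + S (S l))%nat.
        change (q * q ^ (N + S l + 1))%C with (q ^ S (N + S l + 1))%C.
        rewrite <- !pow_add_C. f_equal. lia. }
      set (u := (q ^ (N - S l))%C) in *. set (v := (q ^ (N + S l + 1))%C) in *.
      set (b := qbin N (S l)) in *. set (bm := qbin N l) in *. set (bp := qbin N (S (S l))) in *.
      set (t := (q ^ triangular (S l))%C) in *. set (sg := ((-1) ^ l)%C).
      change ((-1) ^ S (S l))%C with (-1 * (-1 * sg))%C. change ((-1) ^ S l)%C with (-1 * sg)%C.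
      transitivity (-1 * sg * t * (qbin (S N) (S l) * ((1 - q * u) * (1 - q * v))))%C; [ring|].
      rewrite U.
      transitivity ((1 + q * (u * v)) * (-1 * sg * b * t) * ((1 - q * u) * (1 - q * v))
        - (-1 * (-1 * sg)) * (q ^ (N + 1) * q ^ triangular (S (S l))) * (1 - q * u) * (bp * (1 - q * v))
        - sg * (q ^ (N + 1) * q ^ triangular l) * (1 - q * v) * (bm * (1 - q * u)))%C; [|ring].
      rewrite EN', ET, X, <- Y. ring.
Qed.

Lemma coef_beyond (N l : nat) : (N < l)%nat -> coef N l = 0%C.
Proof. intros H. unfold coef, qbin. destruct (le_dec l N); [lia|ring]. Qed.

(** The new pair of factors equals 1 + q^(2N+2) - q^(N+1)(x^2 + x^(-2)); after the index shift of
    [summation_by_parts] its action on the expansion is exactly [coef_rec]. *)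
Lemma finite_triple_product (N : nat) :
  (spow 0 * (qpoch_partial (x * x * q) q N * qpoch_partial (xi * xi * q) q N))%C =
  csum (fun l => coef N l * spow l)%C (S N).
Proof.
  induction N as [|N IH].
  - assert (E : coef 0 0 = 1%C) by (unfold coef; rewrite qbin_diag;
      change ((-1) ^ 0)%C with (RtoC 1); change (q ^ triangular 0)%C with (RtoC 1); ring).
    cbn [csum qpoch_partial]. rewrite E. ring.
  - assert (Ext : forall M, csum (fun l => coef N l * spow l)%C (S N + M) = csum (fun l => coef N l * spow l)%C (S N)).
    { induction M as [|M IHM]; [rewrite Nat.add_0_r; reflexivity|].
      rewrite Nat.add_succ_r.
      change (csum (fun l => coef N l * spow l)%C (S N + M) + coef N (S N + M) * spow (S N + M) =
        csum (fun l => coef N l * spow l)%C (S N))%C.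
      rewrite IHM, (coef_beyond N (S N + M)) by lia. ring. }
    specialize (Ext 1%nat). rewrite Nat.add_1_r in Ext.
    simpl qpoch_partial.
    transitivity ((spow 0 * (qpoch_partial (x * x * q) q N * qpoch_partial (xi * xi * q) q N)) *
      ((1 - x * x * q * q ^ N) * (1 - xi * xi * q * q ^ N)))%C; [ring|].
    rewrite IH, <- Ext.
    assert (F : ((1 - x * x * q * q ^ N) * (1 - xi * xi * q * q ^ N) =
       (1 + q ^ (2 * N + 2)) - q ^ (N + 1) * (x * x + xi * xi))%C).
    { replace (2 * N + 2)%nat with ((N + 1) + (N + 1))%nat by lia. rewrite pow_add_C, Nat.add_1_r. simpl Cpow.
      transitivity (1 + (x * xi) * (x * xi) * (q * q ^ N * (q * q ^ N)) - q * q ^ N * (x * x + xi * xi))%C; [ring|].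
      rewrite Hx. ring. }
    rewrite F.
    transitivity ((1 + q ^ (2 * N + 2)) * csum (fun l => coef N l * spow l) (S (S N))
       - q ^ (N + 1) * csum (fun l => (x * x + xi * xi) * (coef N l * spow l)) (S (S N)))%C.
    + assert (Sc : forall k u M, (k * csum u M = csum (fun l => k * u l) M)%C).
      { intros k u M. induction M as [|M IHM]; cbn [csum]; [ring|]. rewrite <- IHM. ring. }
      rewrite <- (Sc (x * x + xi * xi)%C). ring.
    + rewrite summation_by_parts.
      rewrite (coef_beyond N (S (S N))) by lia.
      unfold pred_coef at 2. rewrite (coef_beyond N (S N)) by lia.
      replace (csum (fun l => (coef N (S l) + pred_coef (coef N) l) * spow l) (S (S N)) + 0 * spow (S (S N))
         - 0 * pred_spow (S (S N)))%C with (csum (fun l => (coef N (S l) + pred_coef (coef N) l) * spow l)%C (S (S N))) by ring.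
      assert (Lin : forall k j u w M, (k * csum u M - j * csum w M = csum (fun l => k * u l - j * w l) M)%C).
      { intros k j u w M. induction M as [|M IHM]; cbn [csum]; [ring|]. rewrite <- IHM. ring. }
      rewrite Lin. apply csum_ext. intros l Hl. rewrite coef_rec by lia. ring.
Qed.

End finite_triple_product.

(** * Passage to the limit in the triple product *)

Lemma climit_inv {T : Type} (F : (T -> Prop) -> Prop) {FF : Filter F} (f : T -> C) (l : C) :
  l <> 0%C -> climit F f l -> climit F (fun t => / f t)%C (/ l)%C.
Proof.
  intros Hl Hf eps He.
  destruct (Cdiff_inv l Hl 1 Rlt_0_1) as [d [Hd D]].
  set (M := Cmod (- / (l * l)) + 1).
  assert (HM : 0 < M) by (unfold M; pose proof (Cmod_ge_0 (- / (l * l))%C); lra).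
  assert (He2 : 0 < Rmin (d / 2) (eps / M)) by (apply Rmin_pos; [lra|apply Rdiv_lt_0_compat; lra]).
  generalize (Hf _ He2). apply filter_imp. intros t Ht.
  assert (H1 : Cmod (f t - l) < d) by (pose proof (Rmin_l (d / 2) (eps / M)); lra).
  assert (H2 : Cmod (f t - l) <= eps / M) by (pose proof (Rmin_r (d / 2) (eps / M)); lra).
  specialize (D _ H1). replace (l + (f t - l))%C with (f t) in D by ring.
  replace (/ f t - / l)%C with ((/ f t - / l - - / (l * l) * (f t - l)) + - / (l * l) * (f t - l))%C by ring.
  eapply Rle_trans; [apply Cmod_triangle|]. rewrite (Cmod_mult (- / (l * l))).
  apply Rle_trans with (M * Cmod (f t - l)); [unfold M; lra|].
  apply Rle_trans with (M * (eps / M)); [apply Rmult_le_compat_l; lra|right; field; lra].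
Qed.

Lemma climit_subseq (u : nat -> C) (l : C) (f : nat -> nat) :
  (forall n, (n <= f n)%nat) -> climit eventually u l -> climit eventually (fun n => u (f n)) l.
Proof.
  intros Hf Hu eps He. destruct (Hu eps He) as [N HN]. exists N. intros n Hn. apply HN.
  specialize (Hf n). lia.
Qed.

Lemma climit_shift (u : nat -> C) (l : C) (k : nat) :
  climit eventually u l -> climit eventually (fun n => u (n - k)%nat) l.
Proof. intros Hu eps He. destruct (Hu eps He) as [N HN]. exists (N + k)%nat. intros n Hn. apply HN. lia. Qed.

Lemma Cmod_e2pi_1 (tau : C) : 0 < Im tau -> Cmod (e2pi tau 1) < 1.
Proof.
  intros H. unfold e2pi. rewrite Cmod_Cexp.
  replace (Re _) with (- (2 * PI * Im tau)) by (unfold Re, Im; simpl; ring).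
  rewrite <- exp_0. apply exp_increasing. pose proof PI_RGT_0. nra.
Qed.

Lemma one_minus_neq_0 (q : C) (n : nat) : Cmod q < 1 -> (1 - q * q ^ n)%C <> 0%C.
Proof.
  intros Hq Z.
  assert (E : (q * q ^ n)%C = 1%C) by (replace (q * q ^ n)%C with (1 - (1 - q * q ^ n))%C by ring; rewrite Z; ring).
  apply (f_equal Cmod) in E. rewrite Cmod_mult, Cmod_pow, Cmod_1 in E.
  pose proof (Cmod_ge_0 q) as H0. pose proof (pow_le (Cmod q) n H0).
  assert (Cmod q ^ n <= 1) by (rewrite <- (pow1 n); apply pow_incr; lra). nra.
Qed.

(** In [finite_triple_product] the Gaussian binomials tend to the inverse of the infinite product of
    all 1 - q^n and are bounded uniformly in N and l, so dominated convergence applies with a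
    multiple of the theta series as majorant. *)
Theorem jacobi_triple_product (z tau : C) : 0 < Im tau ->
  let q := e2pi tau 1 in
  vartheta z tau = (Ci * Cexp (PI * Ci * tau / 4) * (Cexp (PI * Ci * z) - Cexp (- (PI * Ci * z))) *
    qpoch q q * (qpoch (e2pi z 1 * q) q * qpoch (e2pi z (-1) * q) q))%C.
Proof.
  intros H q.
  assert (Hq : Cmod q < 1) by (apply Cmod_e2pi_1; exact H).
  rewrite vartheta_CSeries by exact H.
  set (x := Cexp (PI * Ci * z)). set (xi := Cexp (- (PI * Ci * z))).
  set (w := Cexp (PI * Ci * tau / 4)). set (Pinf := qpoch q q).
  assert (HP : Pinf <> 0%C) by (apply qpoch_self_neq_0; exact Hq).
  assert (Hw : w <> 0%C) by apply Cexp_neq_0.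
  assert (Hx : (x * xi = 1)%C).
  { unfold x, xi. rewrite <- Cexp_plus, <- Cexp_0. f_equal. ring. }
  assert (Hne : forall n, (1 - q * q ^ n)%C <> 0%C) by (intros n; apply one_minus_neq_0; exact Hq).
  assert (Ex : (x * x)%C = e2pi z 1).
  { unfold x, e2pi. rewrite <- Cexp_plus. f_equal. ring. }
  assert (Exi : (xi * xi)%C = e2pi z (-1)).
  { unfold xi, e2pi. rewrite <- Cexp_plus. f_equal. ring. }
  rewrite <- Ex, <- Exi.
  assert (Term : forall l, half_term (theta_term z tau) l =
      (w * ((-1) ^ l * (q ^ triangular l * spow x xi l)))%C).
  { intros l.
    assert (K : forall (s : C) (h : R), (h ^ 2 = half l ^ 2) ->
       theta_term z tau h = (w * q ^ triangular l * Cexp (2 * PI * Ci * z * h))%C).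
    { intros _ h Hh. unfold theta_term, w, q, e2pi. rewrite <- Cexp_INR, <- !Cexp_plus. f_equal. f_equal.
      rewrite <- RtoC_pow, Hh.
      replace (half l ^ 2) with (2 * INR (triangular l) + / 4) by (rewrite triangular_INR; unfold half; field).
      rewrite RtoC_plus, RtoC_mult, RtoC_inv by lra. field. }
    unfold half_term, spow.
    assert (S1 : (x ^ (2 * l + 1))%C = Cexp (2 * PI * Ci * z * half l)).
    { unfold x. rewrite <- Cexp_INR. f_equal. rewrite plus_INR, mult_INR. unfold half. simpl (INR 2). simpl (INR 1).
      rewrite !RtoC_plus, RtoC_mult, RtoC_inv by lra. rewrite RtoC_plus. field. }
    assert (S2 : (xi ^ (2 * l + 1))%C = Cexp (2 * PI * Ci * z * (- half l)%R)).
    { unfold xi. rewrite <- Cexp_INR. f_equal. rewrite plus_INR, mult_INR. unfold half. simpl (INR 2). simpl (INR 1).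
      rewrite RtoC_opp, !RtoC_plus, RtoC_mult, RtoC_inv by lra. rewrite RtoC_plus. field. }
    rewrite (K 0%C (half l)), (K 0%C (- half l)), S1, S2 by ring. ring. }
  assert (Summ : csummable (fun l => q ^ triangular l * spow x xi l)%C).
  { pose proof (csummable_scal (/ w) _ (half_term_summable _ (theta_term_summable z tau H))) as S.
    revert S. apply ex_series_ext. intros n. rewrite Term, Cmult_assoc, Cinv_l, Cmult_1_l by exact Hw.
    rewrite Cmod_mult, Cmod_sign. apply Rmult_1_l. }
  destruct (qpoch_self_lower q Hq) as [c [Hc Hlow]].
  destruct (qpoch_partial_bound q q Hq) as [B [HB Hup]].
  pose proof (qpoch_climit q q Hq) as LP. fold Pinf in LP.
  assert (Lim1 : climit eventually (fun N => CSeries (fun l => coef q N l * spow x xi l)%C)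
     (CSeries (fun l => / Pinf * ((-1) ^ l * (q ^ triangular l * spow x xi l)))%C)).
  { assert (Hbin : forall N l, Cmod (qbin q N l) <= B / (c * c)).
    { intros N l. unfold qbin. destruct (le_dec l N).
      - rewrite Cmod_div by (apply Cmult_neq_0; apply (qpoch_self_partial_neq_0 q Hne)).
        rewrite Cmod_mult. unfold Rdiv. apply Rmult_le_compat; [apply Cmod_ge_0| |apply Hup|].
        + left. apply Rinv_0_lt_compat. pose proof (Hlow (N - l)%nat). pose proof (Hlow (N + l + 1)%nat). nra.
        + apply Rinv_le_contravar; [nra|]. apply Rmult_le_compat; try lra; apply Hlow.
      - rewrite Cmod_0. apply Rdiv_le_0_compat; nra. }
    assert (HbinL : forall l, climit eventually (fun N => qbin q N l) (/ Pinf)%C).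
    { intros l. apply (climit_ext eventually) with
        (fun N => qpoch_partial q q (2 * N + 1) * (/ qpoch_partial q q (N - l) * / qpoch_partial q q (N + l + 1)))%C.
      - exists l. intros N HN. unfold qbin. destruct (le_dec l N); [|lia].
        field. split; apply (qpoch_self_partial_neq_0 q Hne).
      - replace (/ Pinf)%C with (Pinf * (/ Pinf * / Pinf))%C by (field; exact HP).
        apply (climit_mult eventually); [|apply (climit_mult eventually); apply climit_inv; try exact HP; try typeclasses eauto].
        + apply (climit_subseq _ _ (fun N => (2 * N + 1)%nat)); [intros; lia|exact LP].
        + apply climit_shift, LP.
        + apply (climit_subseq _ _ (fun N => (N + l + 1)%nat)); [intros; lia|exact LP]. }
    apply (climit_CSeries eventually) with (fun l => B / (c * c) * Cmod (q ^ triangular l * spow x xi l)).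
    - apply ex_series_scal_R, Summ.
    - intros l. rewrite !Cmod_mult, Cmod_sign, Rmult_1_l. rewrite <- Cmod_mult.
      apply Rmult_le_compat_r; [apply Cmod_ge_0|].
      pose proof (HbinL l) as L. apply Rnot_lt_le. intros Hlt.
      destruct (L ((Cmod (/ Pinf) - B / (c * c)) / 2)) as [N HN]; [lra|].
      specialize (HN N (Nat.le_refl _)). pose proof (Hbin N l).
      pose proof (Cmod_triangle_inv (/ Pinf) (/ Pinf - qbin q N l)) as T.
      replace (/ Pinf - (/ Pinf - qbin q N l))%C with (qbin q N l) in T by ring.
      rewrite (Cmod_minus_sym (/ Pinf)) in T. lra.
    - apply filter_forall. intros N l. unfold coef.
      replace ((-1) ^ l * qbin q N l * q ^ triangular l * spow x xi l)%C
        with ((-1) ^ l * (qbin q N l * (q ^ triangular l * spow x xi l)))%C by ring.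
      rewrite Cmod_mult, Cmod_sign, Rmult_1_l, (Cmod_mult (qbin q N l)).
      apply Rmult_le_compat_r; [apply Cmod_ge_0|apply Hbin].
    - intros l. unfold coef.
      apply (climit_ext eventually) with (fun N => ((-1) ^ l * q ^ triangular l * spow x xi l) * qbin q N l)%C.
      + apply filter_forall. intros N. ring.
      + replace (/ Pinf * ((-1) ^ l * (q ^ triangular l * spow x xi l)))%C
          with (((-1) ^ l * q ^ triangular l * spow x xi l) * / Pinf)%C by ring.
        apply (climit_scal eventually), HbinL. }
  assert (Lim2 : climit eventually (fun N => CSeries (fun l => coef q N l * spow x xi l)%C)
     (spow x xi 0 * (qpoch (x * x * q) q * qpoch (xi * xi * q) q))%C).
  { apply (climit_ext eventually) with
      (fun N => spow x xi 0 * (qpoch_partial (x * x * q) q N * qpoch_partial (xi * xi * q) q N))%C.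
    - apply filter_forall. intros N. rewrite (finite_triple_product q x xi Hx Hne).
      symmetry. apply CSeries_finite. intros l Hl. rewrite coef_beyond by lia. ring.
    - apply (climit_scal eventually), (climit_mult eventually); apply qpoch_climit; exact Hq. }
  pose proof (climit_unique eventually _ _ _ Lim1 Lim2) as E.
  assert (Summ2 : csummable (fun l => (-1) ^ l * (q ^ triangular l * spow x xi l))%C).
  { revert Summ. apply ex_series_ext. intros n. rewrite (Cmod_mult ((-1) ^ n)), Cmod_sign. symmetry; apply Rmult_1_l. }
  rewrite CSeries_scal in E by exact Summ2.
  rewrite (CSeries_ext _ _ Term), CSeries_scal by exact Summ2.
  set (S := CSeries _) in *.
  replace (x - xi)%C with (spow x xi 0) by (unfold spow; simpl; ring).
  transitivity (Ci * w * Pinf * (spow x xi 0 * (qpoch (x * x * q) q * qpoch (xi * xi * q) q)))%C; [|ring].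
  rewrite <- E. field. exact HP.
Qed.

(** * The eta function *)

(** The pentagonal number identity: for nome q^3 and zeta = q the three products of the triple
    product run through the residue classes modulo 3. The class of 1 starts at q^4, and its missing
    factor 1 - q is supplied by the sine factor. *)
Lemma eta_as_theta (tau : C) : 0 < Im tau ->
  vartheta tau (3 * tau) = (- Ci * e2pi tau (- / 6)%R * eta tau)%C.
Proof.
  intros H. assert (H3 : 0 < Im (3 * tau)%C) by (unfold Im in *; simpl; lra).
  rewrite jacobi_triple_product by exact H3. cbv zeta.
  set (q := e2pi tau 1). pose proof (Cmod_e2pi_1 _ H) as Hq. fold q in Hq.
  assert (E3 : e2pi (3 * tau) 1 = (q * q * q)%C).
  { unfold q, e2pi. rewrite <- !Cexp_plus. f_equal. ring. }
  assert (Em : e2pi tau (-1) = (/ q)%C).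
  { unfold q, e2pi. rewrite <- Cexp_opp. f_equal. ring. }
  assert (Hq0 : q <> 0%C) by apply Cexp_neq_0.
  rewrite E3, Em. replace (/ q * (q * q * q))%C with (q * q)%C by (field; exact Hq0).
  set (q3 := (q * q * q)%C).
  assert (Hq3 : Cmod q3 < 1).
  { unfold q3. rewrite !Cmod_mult. pose proof (Cmod_ge_0 q). nra. }
  assert (Part : forall N, qpoch_partial q q (3 * N + 1) =
    ((1 - q) * (qpoch_partial q3 q3 N * (qpoch_partial (q * q3) q3 N * qpoch_partial (q * q) q3 N)))%C).
  { induction N as [|N IH]; [simpl; ring|].
    replace (3 * S N + 1)%nat with (S (S (S (3 * N + 1)))) by lia.
    cbn [qpoch_partial]. rewrite IH.
    assert (EP : (q ^ (3 * N + 1) = q * q3 ^ N)%C).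
    { rewrite Nat.add_1_r. simpl Cpow. f_equal. clear. induction N as [|N IH]; [reflexivity|].
      replace (S N + (S N + (S N + 0)))%nat with (S (S (S (N + (N + (N + 0)))))) by lia.
      simpl Cpow. rewrite IH. unfold q3. ring. }
    change (q ^ S (S (3 * N + 1)))%C with (q * (q * q ^ (3 * N + 1)))%C.
    change (q ^ S (3 * N + 1))%C with (q * q ^ (3 * N + 1))%C. rewrite EP. unfold q3 at 2 4 6. unfold q3.
    set (t := ((q * q * q) ^ N)%C). ring. }
  assert (EQ : qpoch q q = ((1 - q) * (qpoch q3 q3 * (qpoch (q * q3) q3 * qpoch (q * q) q3)))%C).
  { apply (climit_unique eventually (fun N => qpoch_partial q q (3 * N + 1))).
    - apply (climit_subseq _ _ (fun N => (3 * N + 1)%nat)); [intros; lia|apply qpoch_climit, Hq].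
    - apply (climit_ext eventually) with (fun N => (1 - q) * (qpoch_partial q3 q3 N *
         (qpoch_partial (q * q3) q3 N * qpoch_partial (q * q) q3 N)))%C.
      + apply filter_forall. intros N. symmetry; apply Part.
      + apply (climit_scal eventually), (climit_mult eventually);
          [|apply (climit_mult eventually)]; apply qpoch_climit, Hq3. }
  unfold eta. fold q. rewrite EQ.
  set (R3 := (qpoch q3 q3 * (qpoch (q * q3) q3 * qpoch (q * q) q3))%C).
  transitivity (- Ci * ((1 - q) * (Cexp (PI * Ci * (3 * tau) / 4) * Cexp (- (PI * Ci * tau)))) * R3)%C.
  - assert (EX : q = (Cexp (PI * Ci * tau) * Cexp (PI * Ci * tau))%C).
    { unfold q, e2pi. rewrite <- Cexp_plus. f_equal. ring. }
    assert (E1q : (1 - q)%C = (1 - Cexp (PI * Ci * tau) * Cexp (PI * Ci * tau))%C) by (rewrite EX; reflexivity).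
    rewrite E1q. rewrite Cexp_opp.
    transitivity (Ci * Cexp (PI * Ci * (3 * tau) / 4) * (Cexp (PI * Ci * tau) - / Cexp (PI * Ci * tau)) * R3)%C;
      [unfold R3; ring|field; apply Cexp_neq_0].
  - unfold e2pi. rewrite <- Cexp_plus.
    transitivity (- Ci * ((Cexp (2 * PI * Ci * (- / 6)%R * tau) * Cexp (2 * PI * Ci * (/ 24)%R * tau)) * (1 - q)) * R3)%C;
      [|ring].
    rewrite <- Cexp_plus.
    replace (PI * Ci * (3 * tau) / 4 + - (PI * Ci * tau))%C with
      (2 * PI * Ci * (- / 6)%R * tau + 2 * PI * Ci * (/ 24)%R * tau)%C; [ring|].
    rewrite RtoC_opp, !RtoC_inv by lra. field; repeat split; intros Z; apply RtoC_inj in Z; lra.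
Qed.

(** (1 - t)(1 - om t)(1 - om' t) = 1 - t^3 for the primitive cube roots of unity, applied to every
    factor of the triple product. *)
Lemma theta_at_third (tau : C) : 0 < Im tau ->
  vartheta (/ 3)%R tau = (- sqrt 3 * eta (3 * tau))%C.
Proof.
  intros H. rewrite jacobi_triple_product by exact H. cbv zeta.
  set (q := e2pi tau 1). pose proof (Cmod_e2pi_1 _ H) as Hq. fold q in Hq.
  assert (E3 : e2pi (3 * tau) 1 = (q * q * q)%C).
  { unfold q, e2pi. rewrite <- !Cexp_plus. f_equal. ring. }
  unfold eta. rewrite E3.
  set (q3 := (q * q * q)%C).
  assert (Hq3 : Cmod q3 < 1).
  { unfold q3. rewrite !Cmod_mult. pose proof (Cmod_ge_0 q). nra. }
  set (om := e2pi (/ 3)%R 1). set (om' := e2pi (/ 3)%R (-1)).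
  assert (H3 : (sqrt 3 * sqrt 3 = 3)%R) by (apply sqrt_sqrt; lra).
  assert (Vom : om = (- (1 / 2), sqrt 3 / 2) /\ om' = (- (1 / 2), - (sqrt 3 / 2))).
  { assert (C3 : cos (2 * PI / 3) = - (1 / 2)).
    { replace (2 * PI / 3) with (PI - PI / 3) by field. rewrite cos_minus, cos_PI, sin_PI, cos_PI3. field. }
    assert (S3 : sin (2 * PI / 3) = sqrt 3 / 2).
    { replace (2 * PI / 3) with (PI - PI / 3) by field. rewrite sin_minus, cos_PI, sin_PI, sin_PI3. field. }
    split; unfold om, om', e2pi.
    - replace (2 * PI * Ci * 1 * (/ 3)%R)%C with (0, 2 * PI / 3)%R by (Ccomp; field).
      unfold Cexp; simpl. rewrite exp_0, C3, S3, !Rmult_1_l. reflexivity.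
    - replace (2 * PI * Ci * (-1) * (/ 3)%R)%C with (0, - (2 * PI / 3))%R by (Ccomp; field).
      unfold Cexp; simpl. rewrite exp_0, cos_neg, sin_neg, C3, S3, !Rmult_1_l. reflexivity. }
  destruct Vom as [V1 V2].
  assert (Cub : forall t : C, ((1 - t) * ((1 - om * t) * (1 - om' * t)) = 1 - t * t * t)%C).
  { intros t. rewrite V1, V2.
    transitivity ((1 - t) * (1 + t + ((1 + 3) / 4)%R * t * t))%C.
    - f_equal. destruct t as [u v]. Ccomp.
      + transitivity (1 + u + ((1 + (sqrt 3 * sqrt 3)) / 4) * (u * u - v * v)); [field|rewrite H3; field].
      + transitivity (v + ((1 + (sqrt 3 * sqrt 3)) / 4) * (2 * u * v)); [field|rewrite H3; field].
    - replace ((1 + 3) / 4) with 1 by field. ring. }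
  assert (EQ : (qpoch q q * (qpoch (om * q) q * qpoch (om' * q) q) = qpoch q3 q3)%C).
  { symmetry. apply (climit_unique eventually (fun N => qpoch_partial q3 q3 N)); [apply qpoch_climit, Hq3|].
    apply (climit_ext eventually) with (fun N => qpoch_partial q q N *
         (qpoch_partial (om * q) q N * qpoch_partial (om' * q) q N))%C.
    - apply filter_forall. induction x as [|N IH]; [simpl; ring|].
      cbn [qpoch_partial]. rewrite <- IH.
      assert (EP : (q3 ^ N = q ^ N * q ^ N * q ^ N)%C).
      { unfold q3. clear. induction N as [|N IH]; simpl; [ring|rewrite IH; ring]. }
      rewrite EP. replace (q3 * (q ^ N * q ^ N * q ^ N))%C with ((q * q ^ N) * (q * q ^ N) * (q * q ^ N))%C
        by (unfold q3; ring).
      rewrite <- Cub. ring.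
    - apply (climit_mult eventually); [|apply (climit_mult eventually)]; apply qpoch_climit, Hq. }
  rewrite <- EQ.
  assert (Sn : (Cexp (PI * Ci * (/ 3)%R) - Cexp (- (PI * Ci * (/ 3)%R)) = Ci * sqrt 3)%C).
  { replace (PI * Ci * (/ 3)%R)%C with (0, PI / 3)%R by (Ccomp; field).
    unfold Cexp; simpl. rewrite Ropp_0, exp_0, cos_neg, sin_neg, sin_PI3. Ccomp. field. }
  rewrite Sn.
  assert (EE : e2pi (3 * tau) (/ 24)%R = Cexp (PI * Ci * tau / 4)).
  { unfold e2pi. f_equal. rewrite RtoC_inv by lra. field; repeat split; intros Z; apply RtoC_inj in Z; lra. }
  rewrite EE. assert (EC : (Ci * Ci = -(1))%C) by Ccomp.
  transitivity (Ci * Ci * sqrt 3 * Cexp (PI * Ci * tau / 4) * (qpoch q q * (qpoch (om * q) q * qpoch (om' * q) q)))%C;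
    [ring|rewrite EC; ring].
Qed.

Theorem eta_translation (tau : C) : eta (tau + 1) = (Cexp (PI * Ci / 12) * eta tau)%C.
Proof.
  unfold eta. assert (E : e2pi (tau + 1) 1 = e2pi tau 1).
  { unfold e2pi. replace (2 * PI * Ci * 1 * (tau + 1))%C with (2 * PI * Ci * IZR 1 + 2 * PI * Ci * 1 * tau)%C by ring.
    rewrite Cexp_plus, Cexp_2PI_IZR. ring. }
  rewrite E. rewrite Cmult_assoc. f_equal. unfold e2pi. rewrite <- Cexp_plus. f_equal.
  rewrite RtoC_inv by lra. field; repeat split; intros Z; apply RtoC_inj in Z; lra.
Qed.

(** Theta inversion at t0 = tau/3 and z = -1/3: one side is [theta_at_third], the other is
    [eta_as_theta] at -1/tau, so eta inherits its inversion from theta. *)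
Theorem eta_inversion (tau : C) : 0 < Im tau -> eta (- / tau) = (Csqrt tau / zeta8 * eta tau)%C.
Proof.
  intros H. pose proof (upper_neq_0 _ H) as Ht. pose proof (Im_opp_inv_pos _ H) as H'.
  assert (N3 : RtoC 3 <> 0%C) by (intros Z; apply RtoC_inj in Z; lra).
  assert (N6 : RtoC 6 <> 0%C) by (intros Z; apply RtoC_inj in Z; lra).
  assert (Hi : Ci <> 0%C) by (apply upper_neq_0; simpl; lra).
  set (t0 := (tau / 3)%C).
  assert (H0 : 0 < Im t0).
  { unfold t0. replace (tau / 3)%C with (tau * (/ 3)%R)%C by (rewrite RtoC_inv by lra; reflexivity).
    unfold Im in *; simpl. lra. }
  pose proof (upper_neq_0 _ H0) as Ht0.
  pose proof (eta_as_theta _ H') as A.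
  pose proof (vartheta_inversion (- (/ 3)%R) t0 H0) as B.
  pose proof (theta_at_third t0 H0) as D.
  assert (E1 : (3 * - / tau)%C = (- / t0)%C) by (unfold t0; field; repeat split; assumption).
  assert (E2 : (- (/ 3)%R / t0)%C = (- / tau)%C) by (unfold t0; rewrite RtoC_inv by lra; field; repeat split; assumption).
  assert (E3 : (3 * t0)%C = tau) by (unfold t0; field; exact N3).
  rewrite E1 in A. rewrite E2 in B. rewrite E3 in D.
  assert (Dm : vartheta (- (/ 3)%R) t0 = (sqrt 3 * eta tau)%C).
  { rewrite vartheta_CSeries, theta_sum_opp by exact H0. rewrite vartheta_CSeries in D by exact H0.
    transitivity (- (Ci * CSeries (half_term (theta_term (/ 3)%R t0))))%C; [ring|]. rewrite D. ring. }
  rewrite Dm, A in B.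
  assert (Q : (Csqrt t0 * sqrt 3)%C = Csqrt tau).
  { assert (P3 : 0 < sqrt 3) by (apply sqrt_lt_R0; lra).
    destruct (Csqrt_upper t0 H0) as [R0 _]. apply Csqrt_unique.
    - replace (Re (Csqrt t0 * sqrt 3)%C) with (Re (Csqrt t0) * sqrt 3) by (rewrite Re_mult; simpl; ring). nra.
    - transitivity ((Csqrt t0 * Csqrt t0) * (sqrt 3 * sqrt 3)%R)%C; [rewrite RtoC_mult; ring|].
      rewrite Csqrt_sqr, sqrt_sqrt by (exact Ht0 || lra). rewrite Cmult_comm. exact E3. }
  assert (EE : Cexp (PI * Ci * - (/ 3)%R * - (/ 3)%R / t0) = e2pi (- / tau) (- / 6)%R).
  { unfold e2pi, t0. f_equal. rewrite RtoC_opp, !RtoC_inv by lra.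
    replace (RtoC 6) with (2 * 3)%C by (rewrite <- RtoC_mult; f_equal; ring).
    field; repeat split; assumption. }
  rewrite EE in B.
  assert (B2 : (- Ci * eta (- / tau))%C = (Csqrt tau / (zeta8 * zeta8 * zeta8) * eta tau)%C).
  { rewrite <- Q. apply (Cmult_cancel_r _ _ (e2pi (- / tau) (- / 6)%R)); [apply Cexp_neq_0|].
    transitivity (- Ci * e2pi (- / tau) (- / 6)%R * eta (- / tau))%C; [ring|]. rewrite B. field. exact zeta8_neq_0. }
  assert (EC : (Ci * Ci = -(1))%C) by Ccomp.
  transitivity (Ci * (- Ci * eta (- / tau)))%C; [transitivity (- (Ci * Ci) * eta (- / tau))%C; [rewrite EC|]; ring|].
  rewrite B2, zeta8_sqr. field. split; [exact zeta8_neq_0|exact Hi].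
Qed.

(** * The multiplier system *)

(** The eta multiplier takes its values among these roots of unity; identities between them become
    congruences modulo 24. *)
Definition root24 (n : Z) : C := Cexp (PI * Ci / 12 * IZR n).

Lemma root24_plus (m n : Z) : root24 (m + n) = (root24 m * root24 n)%C.
Proof. unfold root24. rewrite <- Cexp_plus, plus_IZR, RtoC_plus. f_equal. ring. Qed.

Lemma root24_mod (n t : Z) : root24 (n + 24 * t) = root24 n.
Proof.
  unfold root24. replace (PI * Ci / 12 * IZR (n + 24 * t))%C with (PI * Ci / 12 * IZR n + 2 * PI * Ci * IZR t)%C.
  - rewrite Cexp_plus, Cexp_2PI_IZR. ring.
  - rewrite plus_IZR, mult_IZR, RtoC_plus, RtoC_mult. field.
Qed.

Lemma root24_cong (m n : Z) : (24 | m - n)%Z -> root24 m = root24 n.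
Proof. intros [t Ht]. replace m with (n + 24 * t)%Z by lia. apply root24_mod. Qed.

Lemma root24_0 : root24 0 = 1%C.
Proof. unfold root24. rewrite <- Cexp_0. f_equal. ring. Qed.

Lemma root24_3 : root24 3 = zeta8.
Proof. unfold root24, zeta8. f_equal. field. Qed.

Lemma root24_6 : root24 6 = Ci.
Proof. replace 6%Z with (3 + 3)%Z by lia. rewrite root24_plus, root24_3. apply zeta8_sqr. Qed.

Lemma root24_12 : root24 12 = (-(1))%C.
Proof. replace 12%Z with (6 + 6)%Z by lia. rewrite root24_plus, root24_6. Ccomp. Qed.

Lemma root24_opp (n : Z) : root24 (- n) = (/ root24 n)%C.
Proof. symmetry. apply Cinv_unique. rewrite <- root24_plus. replace (n + - n)%Z with 0%Z by lia. exact root24_0. Qed.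

Lemma eta_translation_Z (tau : C) (n : Z) : eta (tau + IZR n) = (root24 n * eta tau)%C.
Proof.
  assert (N : forall (m : nat) (t : C), eta (t + INR m) = (root24 (Z.of_nat m) * eta t)%C).
  { induction m as [|m IH]; intros t.
    - simpl INR. replace (t + 0)%C with t by ring. simpl Z.of_nat. rewrite root24_0. ring.
    - rewrite S_INR, RtoC_plus, Cplus_assoc, eta_translation, IH, Nat2Z.inj_succ.
      replace (Z.succ (Z.of_nat m)) with (1 + Z.of_nat m)%Z by lia. rewrite root24_plus.
      unfold root24 at 2. rewrite Cmult_1_r. ring. }
  destruct (Z_le_dec 0 n) as [H|H].
  - rewrite <- (Z2Nat.id n H), <- INR_IZR_INZ. apply N.
  - pose proof (N (Z.to_nat (- n)) (tau + IZR n)%C) as K.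
    rewrite INR_IZR_INZ, Z2Nat.id in K by lia.
    replace (tau + IZR n + IZR (- n))%C with tau in K by (rewrite opp_IZR, RtoC_opp; ring).
    rewrite K, Cmult_assoc, <- root24_plus. replace (n + - n)%Z with 0%Z by lia. rewrite root24_0. ring.
Qed.

Lemma Im_plus_R (t : C) (x : R) : Im (t + x)%C = Im t.
Proof. unfold Im; simpl. ring. Qed.

Lemma vartheta_translation_Z (z tau : C) (n : Z) : 0 < Im tau ->
  vartheta z (tau + IZR n) = (root24 (3 * n) * vartheta z tau)%C.
Proof.
  assert (N : forall (m : nat) (t : C), 0 < Im t ->
     vartheta z (t + INR m) = (root24 (3 * Z.of_nat m) * vartheta z t)%C).
  { induction m as [|m IH]; intros t Ht.
    - simpl INR. replace (t + 0)%C with t by ring. simpl Z.of_nat. rewrite Z.mul_0_r, root24_0. ring.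
    - rewrite S_INR, RtoC_plus, Cplus_assoc, vartheta_translation by (rewrite Im_plus_R; exact Ht).
      rewrite IH, Nat2Z.inj_succ by exact Ht.
      replace (3 * Z.succ (Z.of_nat m))%Z with (3 + 3 * Z.of_nat m)%Z by lia.
      rewrite root24_plus, root24_3. ring. }
  intros H0. destruct (Z_le_dec 0 n) as [H|H].
  - rewrite <- (Z2Nat.id n H), <- INR_IZR_INZ. apply N, H0.
  - pose proof (N (Z.to_nat (- n)) (tau + IZR n)%C ltac:(rewrite Im_plus_R; exact H0)) as K.
    rewrite INR_IZR_INZ, Z2Nat.id in K by lia.
    replace (tau + IZR n + IZR (- n))%C with tau in K by (rewrite opp_IZR, RtoC_opp; ring).
    rewrite K, Cmult_assoc, <- root24_plus. replace (3 * n + 3 * - n)%Z with 0%Z by lia. rewrite root24_0. ring.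
Qed.

Lemma vartheta_opp (z tau : C) : 0 < Im tau -> vartheta (- z) tau = (- vartheta z tau)%C.
Proof. intros H. rewrite !vartheta_CSeries, theta_sum_opp by exact H. ring. Qed.

(** Eta and theta are carried together with one constant X, because theta, a Jacobi form of weight
    and index 1/2, has the cube of the eta multiplier. The identification of X with [chi] is a
    separate step. *)
Definition has_multiplier (a b c d : Z) (X : C) : Prop :=
  forall tau, 0 < Im tau ->
    eta ((IZR a * tau + IZR b) / (IZR c * tau + IZR d)) = (X * Csqrt (IZR c * tau + IZR d) * eta tau)%C /\
    forall z, vartheta (z / (IZR c * tau + IZR d)) ((IZR a * tau + IZR b) / (IZR c * tau + IZR d)) =
      (X * X * X * Csqrt (IZR c * tau + IZR d) * Cexp (PI * Ci * IZR c * z * z / (IZR c * tau + IZR d))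
        * vartheta z tau)%C.

Lemma Im_linear (c : Z) (x : R) (tau : C) : (0 < c)%Z -> 0 < Im tau -> 0 < Im (IZR c * tau + x)%C.
Proof.
  intros Hc Ht. rewrite Im_plus_R. replace (Im (IZR c * tau)%C) with (IZR c * Im tau) by (unfold Im, Re; simpl; ring).
  apply Rmult_lt_0_compat; [apply IZR_lt, Hc|exact Ht].
Qed.

(** As b = a d - 1, the matrix is T^a S T^d: two translations around one inversion, whose 1/zeta8
    accounts for the -3. *)
Lemma multiplier_base (a b d : Z) : (a * d - b = 1)%Z -> has_multiplier a b 1 d (root24 (a + d - 3)).
Proof.
  intros Hdet tau Ht.
  assert (Ht1 : 0 < Im (tau + IZR d)%C) by (rewrite Im_plus_R; exact Ht).
  pose proof (upper_neq_0 _ Ht1) as N1.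
  assert (E0 : (IZR 1 * tau + IZR d)%C = (tau + IZR d)%C) by ring.
  rewrite E0.
  assert (E1 : ((IZR a * tau + IZR b) / (tau + IZR d))%C = (- / (tau + IZR d) + IZR a)%C).
  { replace b with (a * d - 1)%Z by lia. rewrite minus_IZR, mult_IZR, RtoC_minus, RtoC_mult. field. exact N1. }
  rewrite E1.
  assert (R1 : root24 (a + d - 3) = (root24 a * root24 d / zeta8)%C).
  { unfold Z.sub. rewrite !root24_plus, root24_opp, root24_3. reflexivity. }
  assert (R3 : forall n, root24 (3 * n) = (root24 n * root24 n * root24 n)%C).
  { intros n. rewrite <- !root24_plus. f_equal. lia. }
  split.
  - rewrite eta_translation_Z, eta_inversion, eta_translation_Z, R1 by exact Ht1. field. exact zeta8_neq_0.
  - intros z. rewrite vartheta_translation_Z by (apply Im_opp_inv_pos, Ht1).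
    rewrite vartheta_inversion, vartheta_translation_Z, R1, !R3 by assumption.
    replace (PI * Ci * IZR 1 * z * z / (tau + IZR d))%C with (PI * Ci * z * z / (tau + IZR d))%C by (field; exact N1).
    field. exact zeta8_neq_0.
Qed.

Lemma multiplier_shift (a b c d j : Z) (X : C) : has_multiplier a b c d X ->
  has_multiplier a (b + j * a) c (d + j * c) (X * root24 j).
Proof.
  intros H tau Ht.
  assert (Ht1 : 0 < Im (tau + IZR j)%C) by (rewrite Im_plus_R; exact Ht).
  destruct (H _ Ht1) as [H1 H2].
  assert (E1 : (IZR c * (tau + IZR j) + IZR d)%C = (IZR c * tau + IZR (d + j * c))%C)
    by (rewrite plus_IZR, mult_IZR, RtoC_plus, RtoC_mult; ring).
  assert (E2 : (IZR a * (tau + IZR j) + IZR b)%C = (IZR a * tau + IZR (b + j * a))%C)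
    by (rewrite plus_IZR, mult_IZR, RtoC_plus, RtoC_mult; ring).
  rewrite E1, E2 in H1, H2. split.
  - rewrite H1, eta_translation_Z. ring.
  - intros z. rewrite H2, vartheta_translation_Z by exact Ht.
    replace (3 * j)%Z with (j + j + j)%Z by lia. rewrite !root24_plus. ring.
Qed.

Lemma Csqrt_unique_upper (s w : C) : 0 < Im s -> 0 < Im w -> (s * s)%C = w -> s = Csqrt w.
Proof.
  intros Hs Hw E. apply Csqrt_unique; [|exact E].
  rewrite <- E, Im_mult in Hw. nra.
Qed.

(** Principal roots of points of the upper half-plane lie in the open first quadrant, so their
    product has positive imaginary part, as has the principal root of u v. *)
Lemma Csqrt_mult_upper (u v : C) : 0 < Im u -> 0 < Im v -> 0 < Im (u * v)%C ->
  (Csqrt u * Csqrt v)%C = Csqrt (u * v).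
Proof.
  intros Hu Hv Huv. destruct (Csqrt_upper u Hu) as [A B]. destruct (Csqrt_upper v Hv) as [A' B'].
  apply Csqrt_unique_upper; [rewrite Im_mult; nra|exact Huv|].
  transitivity ((Csqrt u * Csqrt u) * (Csqrt v * Csqrt v))%C; [ring|].
  rewrite !Csqrt_sqr by (apply upper_neq_0; assumption). reflexivity.
Qed.

(** Here u v lies in the lower half-plane and the product of the roots is minus its principal root;
    the form i sqrt(-u v) keeps to roots of points of the upper half-plane. *)
Lemma Csqrt_mult_upper_opp (u v : C) : 0 < Im u -> 0 < Im v -> 0 < Im (- (u * v))%C ->
  (Csqrt u * Csqrt v)%C = (Ci * Csqrt (- (u * v)))%C.
Proof.
  intros Hu Hv Huv. destruct (Csqrt_upper u Hu) as [A B]. destruct (Csqrt_upper v Hv) as [A' B'].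
  assert (E : (- Ci * (Csqrt u * Csqrt v))%C = Csqrt (- (u * v))).
  { apply Csqrt_unique.
    - replace (Re (- Ci * (Csqrt u * Csqrt v))%C) with (Im (Csqrt u * Csqrt v)%C) by (unfold Re, Im; simpl; ring).
      rewrite Im_mult; nra.
    - transitivity ((Ci * Ci) * ((Csqrt u * Csqrt u) * (Csqrt v * Csqrt v)))%C; [ring|].
      rewrite !Csqrt_sqr by (apply upper_neq_0; assumption). Ccomp. }
  rewrite <- E. transitivity (- (Ci * Ci) * (Csqrt u * Csqrt v))%C; [|ring].
  replace (Ci * Ci)%C with (- (1))%C by Ccomp. ring.
Qed.

(** The matrix is (-b, a; -d, c) times S, with positive lower left entry -d. Both automorphy factors
    lie in the upper half-plane, so their roots multiply without a sign, and -3 is the 1/zeta8 of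
    the inversion. *)
Lemma multiplier_inversion_neg (a b c d : Z) (X : C) : (0 < c)%Z -> (d < 0)%Z ->
  has_multiplier (- b) a (- d) c X -> has_multiplier a b c d (X * root24 (-3)).
Proof.
  intros Hc Hd H tau Ht. pose proof (upper_neq_0 _ Ht) as Nt.
  pose proof (Im_opp_inv_pos _ Ht) as Ht'.
  pose proof (Im_linear c (IZR d) tau Hc Ht) as Hl. pose proof (upper_neq_0 _ Hl) as Nl.
  destruct (H _ Ht') as [H1 H2].
  set (l := (IZR c * tau + IZR d)%C) in *.
  pose proof (Im_linear (- d) (IZR c) (- / tau)%C ltac:(lia) Ht') as Hu.
  assert (E1 : (IZR (- d) * - / tau + IZR c)%C = (l / tau)%C)
    by (unfold l; rewrite opp_IZR, RtoC_opp; field; exact Nt).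
  rewrite E1 in H1, H2, Hu.
  assert (E2 : ((IZR (- b) * - / tau + IZR a) / (l / tau))%C = ((IZR a * tau + IZR b) / l)%C)
    by (rewrite opp_IZR, RtoC_opp; field; split; assumption).
  rewrite E2 in H1, H2.
  assert (ES : (Csqrt (l / tau) * Csqrt tau)%C = Csqrt l).
  { replace l with (l / tau * tau)%C at 2 by (field; exact Nt).
    apply Csqrt_mult_upper; [exact Hu|exact Ht|].
    replace (l / tau * tau)%C with l by (field; exact Nt). exact Hl. }
  change (-3)%Z with (- (3))%Z. rewrite root24_opp, root24_3.
  split.
  - rewrite H1, eta_inversion, <- ES by exact Ht. field. exact zeta8_neq_0.
  - intros z. specialize (H2 (z / tau)%C).
    replace (z / tau / (l / tau))%C with (z / l)%C in H2 by (field; split; assumption).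
    rewrite H2, vartheta_inversion, <- ES by exact Ht.
    replace (PI * Ci * IZR c * z * z / l)%C with
      (PI * Ci * IZR (- d) * (z / tau) * (z / tau) / (l / tau) + PI * Ci * z * z / tau)%C.
    + rewrite Cexp_plus. field. exact zeta8_neq_0.
    + rewrite opp_IZR, RtoC_opp.
      transitivity (PI * Ci * z * z / tau * ((l - IZR d) / l))%C; [field; split; assumption|].
      unfold l at 1. field. split; assumption.
Qed.

(** For d > 0 the opposite representative (b, -a; d, -c) keeps the lower left entry positive. The
    square roots now combine with a factor i, turning 1/zeta8 into zeta8, and z changes sign, which
    is where the oddness of theta enters. *)
Lemma multiplier_inversion_pos (a b c d : Z) (X : C) : (0 < c)%Z -> (0 < d)%Z ->
  has_multiplier b (- a) d (- c) X -> has_multiplier a b c d (X * root24 3).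
Proof.
  intros Hc Hd H tau Ht. pose proof (upper_neq_0 _ Ht) as Nt.
  pose proof (Im_opp_inv_pos _ Ht) as Ht'.
  pose proof (Im_linear c (IZR d) tau Hc Ht) as Hl. pose proof (upper_neq_0 _ Hl) as Nl.
  destruct (H _ Ht') as [H1 H2].
  set (l := (IZR c * tau + IZR d)%C) in *.
  pose proof (Im_linear d (IZR (- c)) (- / tau)%C ltac:(lia) Ht') as Hu.
  assert (E1 : (IZR d * - / tau + IZR (- c))%C = (- (l / tau))%C)
    by (unfold l; rewrite opp_IZR, RtoC_opp; field; exact Nt).
  rewrite E1 in H1, H2, Hu.
  assert (E2 : ((IZR b * - / tau + IZR (- a)) / (- (l / tau)))%C = ((IZR a * tau + IZR b) / l)%C).
  { rewrite opp_IZR, RtoC_opp.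
    transitivity ((IZR b * - / tau + - IZR a) * - (tau / l))%C; [|field; split; assumption].
    unfold Cdiv. f_equal. apply Cinv_unique. field. split; assumption. }
  rewrite E2 in H1, H2.
  assert (ES : (Csqrt (- (l / tau)) * Csqrt tau)%C = (Ci * Csqrt l)%C).
  { assert (El : (- (- (l / tau) * tau))%C = l) by (field; exact Nt).
    rewrite <- El at 2. apply Csqrt_mult_upper_opp; [exact Hu|exact Ht|]. rewrite El. exact Hl. }
  rewrite root24_3.
  assert (EZ : (Ci = zeta8 * zeta8)%C) by (symmetry; exact zeta8_sqr).
  assert (E8 : (zeta8 * zeta8 * zeta8 * zeta8 = - (1))%C).
  { transitivity (Ci * Ci)%C; [rewrite EZ; ring|Ccomp]. }
  split.
  - rewrite H1, eta_inversion by exact Ht.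
    transitivity (X * (Csqrt (- (l / tau)) * Csqrt tau) / zeta8 * eta tau)%C; [field; exact zeta8_neq_0|].
    rewrite ES, EZ. field. exact zeta8_neq_0.
  - intros z. specialize (H2 (- (z / tau))%C).
    assert (E3 : (- (z / tau) / - (l / tau))%C = (z / l)%C).
    { transitivity (- (z / tau) * - (tau / l))%C; [|field; split; assumption].
      unfold Cdiv at 1. f_equal. apply Cinv_unique. field. split; assumption. }
    rewrite E3, vartheta_opp in H2 by exact Ht'.
    rewrite H2, vartheta_inversion by exact Ht.
    assert (EI : (/ - (l / tau))%C = (- (tau / l))%C) by (apply Cinv_unique; field; split; assumption).
    assert (EE : (PI * Ci * IZR c * z * z / l)%C =
      (PI * Ci * IZR d * - (z / tau) * - (z / tau) / - (l / tau) + PI * Ci * z * z / tau)%C).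
    { transitivity (PI * Ci * IZR d * - (z / tau) * - (z / tau) * - (tau / l) + PI * Ci * z * z / tau)%C.
      - transitivity (PI * Ci * z * z / tau * ((l - IZR d) / l))%C; [|field; split; assumption].
        unfold l at 2. field. split; assumption.
      - f_equal. rewrite <- EI. reflexivity. }
    rewrite EE, Cexp_plus.
    set (e1 := Cexp (PI * Ci * IZR d * - (z / tau) * - (z / tau) / - (l / tau))).
    set (e2 := Cexp (PI * Ci * z * z / tau)).
    transitivity (- (X * X * X * (Csqrt (- (l / tau)) * Csqrt tau) * (e1 * e2) / (zeta8 * zeta8 * zeta8) * vartheta z tau))%C;
      [field; exact zeta8_neq_0|].
    rewrite ES. transitivity ((zeta8 * zeta8 * zeta8 * zeta8) * (X * X * X * (zeta8 * zeta8) * Csqrt l * (e1 * e2)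
       / (zeta8 * zeta8 * zeta8) * vartheta z tau))%C; [rewrite E8, EZ; field; exact zeta8_neq_0|].
    field. exact zeta8_neq_0.
Qed.

(** * The eta multiplier along the Euclidean algorithm *)

Lemma chi_odd (a b c d : Z) : (0 < c)%Z -> Z.odd c = true ->
  chi (Mat2 a b c d) = (IZR (jacobi d (Z.abs_nat c)) * root24 ((a + d) * c - b * d * (c ^ 2 - 1) - 3 * c))%C.
Proof.
  intros Hc Ho. unfold chi. rewrite Ho. unfold kronecker.
  rewrite Z.abs_eq by lia. replace (Z.ltb c 0) with false by (symmetry; apply Z.ltb_ge; lia).
  rewrite Bool.andb_false_r, Z.mul_1_l. reflexivity.
Qed.

Lemma chi_even (a b c d : Z) : (0 < c)%Z -> Z.odd c = false ->
  chi (Mat2 a b c d) = (IZR (jacobi c (Z.abs_nat d)) * root24 (a * c * (1 - d ^ 2) + d * (b - c + 3) - 3))%C.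
Proof.
  intros Hc Ho. unfold chi. rewrite Ho. unfold kronecker.
  replace (Z.ltb c 0) with false by (symmetry; apply Z.ltb_ge; lia).
  rewrite Bool.andb_false_l, Z.mul_1_l. reflexivity.
Qed.

(** Among c - 1, c, c + 1 one is divisible by 3, and for odd c the outer two are consecutive even
    numbers. The proof checks the twelve odd residues modulo 24. *)
Lemma odd_cube_minus_dvd (c : Z) : Z.odd c = true -> (24 | c * (c ^ 2 - 1))%Z.
Proof.
  intros Ho.
  assert (E : (c = 24 * (c / 24) + c mod 24)%Z) by (apply Z.div_mod; lia).
  pose proof (Z.mod_pos_bound c 24 ltac:(lia)) as B.
  set (q := (c / 24)%Z) in *. set (r := (c mod 24)%Z) in *.
  assert (Hr : Z.odd r = true).
  { rewrite E in Ho. replace (24 * q + r)%Z with (r + 2 * (12 * q))%Z in Ho by ring.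
    rewrite Z.odd_add_mul_2 in Ho. exact Ho. }
  assert (K : (24 | r * (r ^ 2 - 1))%Z).
  { clear - B Hr.
    assert (r = 1 \/ r = 3 \/ r = 5 \/ r = 7 \/ r = 9 \/ r = 11 \/ r = 13 \/ r = 15 \/ r = 17 \/ r = 19
      \/ r = 21 \/ r = 23)%Z as H.
    { apply Zodd_bool_iff, Zodd_ex in Hr. destruct Hr as [m Hm]. lia. }
    repeat (destruct H as [H|H]); rewrite H;
    match goal with |- (24 | ?x)%Z => exists (x / 24)%Z; reflexivity end. }
  destruct K as [t Ht]. exists (t + 24 * q * q * 24 * q + 3 * 24 * q * q * r + 3 * q * r * r - q)%Z.
  rewrite E. transitivity (r * (r ^ 2 - 1) + 24 * (24 * q * q * 24 * q + 3 * 24 * q * q * r + 3 * q * r * r - q))%Z;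
    [ring|rewrite Ht; ring].
Qed.

(** The Jacobi symbol has period c in d, and by [odd_cube_minus_dvd] and the determinant the
    exponents differ by j modulo 24. *)
Lemma chi_shift (a b c d j : Z) : (0 < c)%Z -> Z.odd c = true -> (a * d - b * c = 1)%Z ->
  chi (Mat2 a (b + j * a) c (d + j * c)) = (chi (Mat2 a b c d) * root24 j)%C.
Proof.
  intros Hc Ho Hdet. rewrite !chi_odd by assumption. rewrite jacobi_periodic by exact Hc.
  rewrite <- Cmult_assoc, <- root24_plus. f_equal. apply root24_cong.
  destruct (odd_cube_minus_dvd c Ho) as [t Ht]. exists (- t * j * (2 * b + j * a))%Z.
  transitivity (- (c * (c ^ 2 - 1)) * j * (2 * b + j * a) - j * (c ^ 2 - 1) * (a * d - b * c - 1))%Z; [ring|].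
  rewrite Ht, Hdet. ring.
Qed.

(** The reciprocity sign (-1)^((c-1)(d-1)/4) as a 24th root of unity, so that it can be merged with
    the exponent in [chi]. *)
Lemma sign_root24 (c d : Z) (s : bool) : Z.odd c = true -> Z.odd d = true ->
  (s = true <-> (c mod 4 = 3 /\ d mod 4 = 3)%Z) ->
  root24 (3 * (c - 1) * (d - 1)) = RtoC (IZR (if s then -1 else 1)).
Proof.
  intros Hc Hd Hs.
  apply Zodd_bool_iff, Zodd_ex in Hc. destruct Hc as [u ->].
  apply Zodd_bool_iff, Zodd_ex in Hd. destruct Hd as [v ->].
  replace (3 * (2 * u + 1 - 1) * (2 * v + 1 - 1))%Z with (12 * (u * v))%Z by ring.
  assert (M : forall w, ((2 * w + 1) mod 4 = 3)%Z <-> Z.odd w = true).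
  { intros w. destruct (Z.odd w) eqn:E.
    - apply Zodd_bool_iff, Zodd_ex in E. destruct E as [x ->]. split; [trivial|intros _].
      replace (2 * (2 * x + 1) + 1)%Z with (3 + x * 4)%Z by ring. rewrite Z_mod_plus_full. reflexivity.
    - split; [|discriminate]. intros K. exfalso.
      assert (Ev : Z.even w = true) by (rewrite <- Z.negb_odd, E; reflexivity).
      apply Zeven_bool_iff, Zeven_ex in Ev. destruct Ev as [x ->].
      replace (2 * (2 * x) + 1)%Z with (1 + x * 4)%Z in K by ring. rewrite Z_mod_plus_full in K. discriminate. }
  rewrite !M in Hs.
  destruct (Z.odd u && Z.odd v)%bool eqn:E.
  - apply andb_prop in E. replace s with true by (symmetry; apply Hs, E).
    destruct E as [Eu Ev]. apply Zodd_bool_iff, Zodd_ex in Eu. apply Zodd_bool_iff, Zodd_ex in Ev.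
    destruct Eu as [x ->], Ev as [y ->].
    replace (12 * ((2 * x + 1) * (2 * y + 1)))%Z with (12 + 24 * (2 * x * y + x + y))%Z by ring.
    rewrite root24_mod, root24_12. Ccomp.
  - replace s with false.
    2: { symmetry. apply Bool.not_true_is_false. intros K. apply Hs in K. destruct K as [K1 K2].
         rewrite K1, K2 in E. discriminate. }
    assert (Z.even (u * v) = true) as Ev.
    { rewrite <- Z.negb_odd, Z.odd_mul, E. reflexivity. }
    apply Zeven_bool_iff, Zeven_ex in Ev. destruct Ev as [x ->].
    replace (12 * (2 * x))%Z with (0 + 24 * x)%Z by ring. rewrite root24_mod. apply root24_0.
Qed.

Lemma mod4_opp (h : Z) : Z.odd h = true -> ((- h) mod 4 = 3)%Z <-> (h mod 4 <> 3)%Z.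
Proof.
  intros Ho. pose proof (Z.div_mod h 4 ltac:(lia)). pose proof (Z.mod_pos_bound h 4 ltac:(lia)).
  apply Zodd_bool_iff, Zodd_ex in Ho. destruct Ho as [m Hm].
  set (q := (h / 4)%Z) in *. set (r := (h mod 4)%Z) in *.
  assert (Hr : (r = 1 \/ r = 3)%Z) by lia.
  destruct Hr as [Hr|Hr]; rewrite Hr in *.
  - replace (- h)%Z with (3 + (- q - 1) * 4)%Z by lia. rewrite Z_mod_plus_full. split; [lia|reflexivity].
  - replace (- h)%Z with (1 + (- q - 1) * 4)%Z by lia. rewrite Z_mod_plus_full. split; [discriminate|lia].
Qed.

Lemma IZR_sign (s : bool) : IZR (if s then -1 else 1) * IZR (if s then -1 else 1) = 1.
Proof. destruct s; simpl; ring. Qed.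

Lemma det_gcd (a b c d : Z) : (a * d - b * c = 1)%Z -> Z.gcd c d = 1%Z.
Proof.
  intros H. apply Z.bezout_1_gcd. exists (- b)%Z, a. lia.
Qed.

(** Counterpart of [multiplier_inversion_neg]: reciprocity and the symbol of -1 exchange c and -d,
    and by the determinant the exponents differ by 3(c-1)(d-1), which is the resulting sign. *)
Lemma chi_inversion_neg (a b c d : Z) : (0 < c)%Z -> Z.odd c = true -> (d < 0)%Z -> Z.odd d = true ->
  (a * d - b * c = 1)%Z ->
  chi (Mat2 a b c d) = (chi (Mat2 (- b) a (- d) c) * root24 (-3))%C.
Proof.
  intros Hc Hco Hd Hdo Hdet.
  assert (Hho : Z.odd (- d) = true) by (rewrite Z.odd_opp; exact Hdo).
  rewrite !chi_odd by (assumption || lia).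
  set (h := (- d)%Z) in *. assert (Ed : d = (- h)%Z) by lia. assert (Hh0 : (0 < h)%Z) by lia.
  assert (G : Z.gcd h c = 1%Z).
  { unfold h. rewrite Z.gcd_opp_l, Z.gcd_comm. apply (det_gcd a b c d Hdet). }
  rewrite Ed at 1. rewrite (jacobi_opp h Hc Hco).
  rewrite (jacobi_reciprocity Hc Hco Hh0 Hho G).
  set (s := (c mod 4 =? 3)%Z). set (s2 := ((h mod 4 =? 3)%Z && s)%bool).
  set (J := jacobi c (Z.abs_nat h)).
  rewrite <- Cmult_assoc, <- root24_plus.
  replace ((a + d) * c - b * d * (c ^ 2 - 1) - 3 * c)%Z with
    (3 * (c - 1) * (d - 1) + ((- b + c) * h - a * c * (h ^ 2 - 1) - 3 * h + -3))%Z.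
  2: { symmetry. unfold h. transitivity (3 * (c - 1) * (d - 1) + ((- b + c) * (- d) - a * c * (d ^ 2 - 1) + 3 * d - 3)
         + c * d * (a * d - b * c - 1))%Z; [ring|]. rewrite Hdet. ring. }
  rewrite root24_plus, (sign_root24 c d (xorb s s2) Hco Hdo).
  - rewrite !mult_IZR, !RtoC_mult.
    assert (Sg : (IZR (if s then -1 else 1) * IZR (if s2 then -1 else 1) = IZR (if xorb s s2 then -1 else 1))%R)
      by (destruct s, s2; simpl; ring).
    transitivity ((IZR (if s then -1 else 1) * IZR (if s2 then -1 else 1))%R * IZR (if xorb s s2 then -1 else 1)
       * (IZR J * root24 ((- b + c) * h - a * c * (h ^ 2 - 1) - 3 * h + -3)))%C; [rewrite RtoC_mult; ring|].
    rewrite Sg, <- RtoC_mult, IZR_sign. ring.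
  - pose proof (mod4_opp h Hho) as M. rewrite <- Ed in M. rewrite M.
    unfold s2, s. destruct (c mod 4 =? 3)%Z eqn:E1; destruct (h mod 4 =? 3)%Z eqn:E2; simpl;
    rewrite ?Z.eqb_eq, ?Z.eqb_neq in *; intuition (try discriminate; try congruence).
Qed.

(** Counterpart of [multiplier_inversion_pos], by reciprocity for the pair c, d together with the
    symbol of -1 modulo d. *)
Lemma chi_inversion_pos (a b c d : Z) : (0 < c)%Z -> Z.odd c = true -> (0 < d)%Z -> Z.odd d = true ->
  (a * d - b * c = 1)%Z ->
  chi (Mat2 a b c d) = (chi (Mat2 b (- a) d (- c)) * root24 3)%C.
Proof.
  intros Hc Hco Hd Hdo Hdet.
  rewrite !chi_odd by assumption.
  assert (G : Z.gcd d c = 1%Z) by (rewrite Z.gcd_comm; apply (det_gcd a b c d Hdet)).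
  rewrite (jacobi_opp c Hd Hdo).
  rewrite (jacobi_reciprocity Hc Hco Hd Hdo G).
  set (s := (d mod 4 =? 3)%Z). set (s2 := (s && (c mod 4 =? 3)%Z)%bool).
  set (J := jacobi c (Z.abs_nat d)).
  rewrite <- Cmult_assoc, <- root24_plus.
  replace ((a + d) * c - b * d * (c ^ 2 - 1) - 3 * c)%Z with
    (3 * ((- c) - 1) * (d - 1) + 24 * (0) + 6 * (c + 1) * (d - 1) + ((b - c) * d - - a * - c * (d ^ 2 - 1) - 3 * d + 3))%Z.
  2: { symmetry. transitivity (3 * (c + 1) * (d - 1) + ((b - c) * d - a * c * (d ^ 2 - 1) - 3 * d + 3)
         + c * d * (a * d - b * c - 1))%Z; [ring|]. rewrite Hdet. ring. }
  (* Changes the sign of 3(c + 1)(d - 1): the difference 6(c + 1)(d - 1) is divisible by 24 for odd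
     c and d. *)
  rewrite (root24_cong _ (3 * ((- c) - 1) * (d - 1) + ((b + - c) * d - - a * - c * (d ^ 2 - 1) - 3 * d + 3))).
  2: { apply Zodd_bool_iff, Zodd_ex in Hco. destruct Hco as [u Hu].
       apply Zodd_bool_iff, Zodd_ex in Hdo. destruct Hdo as [v Hv].
       exists ((u + 1) * v)%Z. rewrite Hu, Hv. ring. }
  assert (Hcm : Z.odd (- c) = true) by (rewrite Z.odd_opp; exact Hco).
  rewrite root24_plus, (sign_root24 (- c) d (xorb s s2) Hcm Hdo).
  - rewrite !mult_IZR, !RtoC_mult.
    assert (Sg : (IZR (if s2 then -1 else 1) * IZR (if xorb s s2 then -1 else 1) = IZR (if s then -1 else 1))%R)
      by (destruct s, s2; simpl; ring).
    rewrite <- Sg, RtoC_mult. ring.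
  - rewrite (mod4_opp c Hco).
    unfold s2, s. destruct (c mod 4 =? 3)%Z eqn:E1; destruct (d mod 4 =? 3)%Z eqn:E2; simpl;
    rewrite ?Z.eqb_eq, ?Z.eqb_neq in *; intuition (try discriminate; try congruence).
Qed.

(* Euclidean descent on the lower row, through odd entries only: the remainder d' of d modulo c is taken
   odd and of absolute value less than c. *)
Theorem multiplier_odd (c a b d : Z) : (0 < c)%Z -> Z.odd c = true -> (a * d - b * c = 1)%Z ->
  has_multiplier a b c d (chi (Mat2 a b c d)).
Proof.
  intros Hc. revert a b d.
  assert (Hc0 : (0 <= c)%Z) by lia. revert Hc. revert c Hc0.
  apply (Zlt_0_ind (fun c => (0 < c)%Z -> forall a b d, Z.odd c = true -> (a * d - b * c = 1)%Z ->
    has_multiplier a b c d (chi (Mat2 a b c d)))).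
  intros c IH _ Hc a b d Ho Hdet.
  destruct (Z.eq_dec c 1) as [->|Hc1].
  { rewrite chi_odd by (reflexivity || lia).
    replace (jacobi d (Z.abs_nat 1)) with 1%Z by reflexivity.
    replace ((a + d) * 1 - b * d * (1 ^ 2 - 1) - 3 * 1)%Z with (a + d - 3)%Z by ring.
    rewrite Cmult_1_l. apply multiplier_base. lia. }
  assert (R : exists d' j, (d = d' + j * c)%Z /\ Z.odd d' = true /\ (- c < d' < c)%Z).
  { pose proof (Z.div_mod d c ltac:(lia)) as E. pose proof (Z.mod_pos_bound d c Hc) as B.
    destruct (Z.odd (d mod c)) eqn:Er.
    - exists (d mod c)%Z, (d / c)%Z. repeat split; [lia|exact Er|lia|lia].
    - assert (Hr : (d mod c <> 0)%Z).
      { intros K. rewrite K in E. assert (D : (c | 1)%Z) by (exists (a * (d / c) - b)%Z; lia).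
        apply Z.divide_1_r in D. lia. }
      exists (d mod c - c)%Z, (d / c + 1)%Z. repeat split; [lia| |lia|lia].
      rewrite Z.odd_sub, Er, Ho. reflexivity. }
  destruct R as [d' [j [Ed [Hod Bd]]]].
  set (b' := (b - j * a)%Z).
  assert (Hdet' : (a * d' - b' * c = 1)%Z) by (unfold b'; rewrite <- Hdet, Ed; ring).
  replace b with (b' + j * a)%Z by (unfold b'; ring). rewrite Ed.
  rewrite chi_shift by assumption. apply multiplier_shift.
  assert (Hd0 : d' <> 0%Z) by (intros ->; discriminate).
  destruct (Z_lt_dec d' 0) as [Hn|Hn].
  - rewrite chi_inversion_neg by assumption. apply multiplier_inversion_neg; [lia|exact Hn|].
    apply IH; [lia|lia|rewrite Z.odd_opp; exact Hod|lia].
  - rewrite chi_inversion_pos by (assumption || lia). apply multiplier_inversion_pos; [lia|lia|].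
    apply IH; [lia|lia|exact Hod|lia].
Qed.

(** An even c forces d to be odd, so one inversion leads to the odd case with lower left entry -d;
    the two formulas for [chi] match along it exactly, symbol included. *)
Theorem multiplier_even (c a b d : Z) : (0 < c)%Z -> Z.odd c = false -> (d < 0)%Z -> (a * d - b * c = 1)%Z ->
  has_multiplier a b c d (chi (Mat2 a b c d)).
Proof.
  intros Hc Ho Hd Hdet.
  assert (Hdo : Z.odd (- d) = true).
  { rewrite Z.odd_opp. assert (K : Z.odd (a * d - b * c) = true) by (rewrite Hdet; reflexivity).
    rewrite Z.odd_sub, !Z.odd_mul, Ho, Bool.andb_false_r, Bool.xorb_false_r in K.
    apply andb_prop in K. apply K. }
  assert (E : chi (Mat2 a b c d) = (chi (Mat2 (- b) a (- d) c) * root24 (-3))%C).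
  { rewrite chi_even, chi_odd by (assumption || lia).
    replace (Z.abs_nat (- d)) with (Z.abs_nat d) by lia.
    rewrite <- Cmult_assoc, <- root24_plus. do 2 f_equal. ring. }
  rewrite E. apply multiplier_inversion_neg; [exact Hc|exact Hd|].
  apply multiplier_odd; [lia|exact Hdo|lia].
Qed.

(** * Transformation between the points tau and tau' *)

Lemma eta_neq_0 (tau : C) : 0 < Im tau -> eta tau <> 0%C.
Proof.
  intros H. apply Cmult_neq_0; [apply Cexp_neq_0|]. apply qpoch_self_neq_0, Cmod_e2pi_1, H.
Qed.

Lemma is_neg_inv_det (k h h' : Z) : (1 <= k)%Z -> is_neg_inv h k h' ->
  (h' * - h - - ((h * h' + 1) / k) * k = 1)%Z.
Proof.
  intros Hk [_ [t Ht]]. replace (h * h' + 1)%Z with ((- t) * k)%Z by lia.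
  rewrite Z.div_mul by lia. lia.
Qed.

Theorem multiplier_Mhk (k h h' : Z) : (1 <= k)%Z -> (0 <= h < k)%Z -> is_neg_inv h k h' ->
  has_multiplier h' (- ((h * h' + 1) / k)) k (- h) (chi (Mhk h k h')).
Proof.
  intros Hk Hh Hi. pose proof (is_neg_inv_det k h h' Hk Hi) as Hdet.
  destruct (Z.odd k) eqn:Ho.
  - apply multiplier_odd; [lia|exact Ho|exact Hdet].
  - apply multiplier_even; [lia|exact Ho| |exact Hdet].
    (* For even k the value h = 0 would make k divide 1; hence the entry -h is negative, as
       [multiplier_even] demands. *)
    assert (h <> 0%Z); [|lia]. intros ->. rewrite Z.mul_0_r in Hdet.
    assert (D : (k | 1)%Z) by (exists ((0 * h' + 1) / k)%Z; lia).
    apply Z.divide_1_r in D. destruct D; subst k; discriminate || lia.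
Qed.

Lemma cusp_points (k h : Z) (Z0 : C) : (1 <= k)%Z -> 0 < Re Z0 ->
  0 < Im (IZR h / IZR k + Ci * Z0 / IZR k)%C /\ 0 < Im (IZR h / IZR k + Ci / (IZR k * Z0))%C.
Proof.
  intros Hk HZ. assert (Hk0 : 0 < IZR k) by (apply IZR_lt; lia).
  assert (HZ0 : Z0 <> 0%C) by (apply slit_neq_0, Re_pos_slit, HZ).
  assert (Nk : RtoC (IZR k) <> 0%C) by (intros K; apply RtoC_inj in K; lra).
  pose proof (Re_inv_pos Z0 HZ) as HI. pose proof (Rinv_0_lt_compat _ Hk0) as Hki.
  split.
  - replace (Im _) with (Re Z0 * / IZR k).
    + apply Rmult_lt_0_compat; assumption.
    + unfold Cdiv. rewrite <- !RtoC_inv by lra. unfold Re, Im; simpl. ring.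
  - replace (Ci / (IZR k * Z0))%C with (Ci * / Z0 * / IZR k)%C by (field; split; assumption).
    replace (Im _) with (Re (/ Z0)%C * / IZR k).
    + apply Rmult_lt_0_compat; assumption.
    + unfold Cdiv. rewrite <- !RtoC_inv by lra. unfold Re, Im; simpl. ring.
Qed.

(** The automorphy factor k tau - h of [Mhk] is i Z0 and the image of tau is tau'; this rewrites
    [multiplier_Mhk] in the coordinates of the theorem. *)
Theorem cusp_transformation (k h h' : Z) (Z0 : C) :
  (1 <= k)%Z -> (0 <= h < k)%Z -> is_neg_inv h k h' -> 0 < Re Z0 ->
  let tau := (IZR h / IZR k + Ci * Z0 / IZR k)%C in
  let tau' := (IZR h' / IZR k + Ci / (IZR k * Z0))%C in
  let X := chi (Mhk h k h') in
  X <> 0%C /\ eta tau' = (X * Csqrt (Ci * Z0) * eta tau)%C /\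
  forall z, vartheta (z / (Ci * Z0)) tau' =
    (X * X * X * Csqrt (Ci * Z0) * Cexp (PI * IZR k * (z * z) / Z0) * vartheta z tau)%C.
Proof.
  intros Hk Hh Hi HZ tau tau' X.
  destruct (cusp_points k h Z0 Hk HZ) as [Ht _]. destruct (cusp_points k h' Z0 Hk HZ) as [_ Ht'].
  fold tau in Ht. fold tau' in Ht'.
  assert (HZ0 : Z0 <> 0%C) by (apply slit_neq_0, Re_pos_slit, HZ).
  assert (Nk : RtoC (IZR k) <> 0%C) by (intros K; apply RtoC_inj in K; apply eq_IZR in K; lia).
  assert (Ni : Ci <> 0%C) by (apply upper_neq_0; simpl; lra).
  destruct (multiplier_Mhk k h h' Hk Hh Hi tau Ht) as [H1 H2].
  assert (E1 : (IZR k * tau + IZR (- h))%C = (Ci * Z0)%C).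
  { unfold tau. rewrite opp_IZR, RtoC_opp. field. exact Nk. }
  assert (EC : (Ci * Ci = -(1))%C) by Ccomp.
  assert (E2 : ((IZR h' * tau + IZR (- ((h * h' + 1) / k))) / (Ci * Z0))%C = tau').
  { assert (E3 : (IZR (- ((h * h' + 1) / k)) * IZR k = - (IZR h * IZR h' + 1))%C).
    { pose proof (is_neg_inv_det k h h' Hk Hi) as Hdet.
      rewrite <- RtoC_mult, <- mult_IZR.
      replace (- ((h * h' + 1) / k) * k)%Z with (- (h * h' + 1))%Z by lia.
      rewrite opp_IZR, plus_IZR, mult_IZR, RtoC_opp, RtoC_plus, RtoC_mult. reflexivity. }
    transitivity ((IZR h' * (IZR h + Ci * Z0) + IZR (- ((h * h' + 1) / k)) * IZR k) / (Ci * Z0 * IZR k))%C.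
    - unfold tau. field. repeat split; assumption.
    - rewrite E3. unfold tau'.
      transitivity ((IZR h' * Ci * Z0 + Ci * Ci) / (Ci * Z0 * IZR k))%C; [rewrite EC|]; field; repeat split; assumption. }
  rewrite E1, E2 in H1, H2. fold X in H1, H2.
  split; [|split].
  - intros Z. apply (eta_neq_0 tau' Ht'). rewrite H1, Z. ring.
  - exact H1.
  - intros z. rewrite H2. do 2 f_equal. f_equal. field. split; assumption.
Qed.

(** * The Eichler integral *)

(** Crude, but sharp enough in the exponent: a Gaussian times this bound is a sum of two Gaussians,
    one with its parameter shifted. *)
Lemma Erf_bound (w : C) : Cmod (Erf w) <= 2 * Cmod w * (1 + exp (- PI * Re (w * w)%C)).
Proof.
  assert (K : Cmod (Erf (0 + 1%R * w) - Erf (0 + 0%R * w) - (1%R - 0%R) * 0) <=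
    2 * (Cmod w * (1 + exp (- PI * Re (w * w)%C))) * (1 - 0)).
  { apply (cderiv_mvt (fun t => Erf (0 + t * w)) (fun t => w * Cexp (- PI * ((0 + t * w) * (0 + t * w))))%C); [lra| |].
    - intros t _. apply cderiv_Erf_line.
    - intros t Ht. rewrite Cminus_0_r, Cmod_mult. apply Rmult_le_compat_l; [apply Cmod_ge_0|].
      rewrite Cmod_Cexp.
      replace (Re (- PI * ((0 + t * w) * (0 + t * w)))%C) with (t ^ 2 * (- PI * Re (w * w)%C))
        by (unfold Re, Im; simpl; ring).
      set (x := - PI * Re (w * w)%C). pose proof (exp_pos x).
      destruct (Rle_dec x 0) as [Hx|Hx].
      + assert (t ^ 2 * x <= 0) by (pose proof (pow2_ge_0 t); nra).
        pose proof (exp_le_mono _ _ H0) as E. rewrite exp_0 in E. lra.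
      + assert (t ^ 2 * x <= x) by (assert (t ^ 2 <= 1) by nra; nra).
        pose proof (exp_le_mono _ _ H0) as E. lra. }
  replace (Erf w) with (Erf (0 + 1%R * w) - Erf (0 + 0%R * w) - (1%R - 0%R) * 0)%C.
  - eapply Rle_trans; [exact K|]. right; ring.
  - replace (0 + 1%R * w)%C with w by ring. replace (0 + 0%R * w)%C with (RtoC 0) by ring. rewrite Erf_0. ring.
Qed.

Lemma Re_near (y0 y : C) (eps : R) : Cmod (y - y0) <= eps -> Re y0 - eps <= Re y /\ Cmod y <= Cmod y0 + eps.
Proof.
  intros H. split.
  - pose proof (re_le_Cmod (y - y0)%C) as K. apply Rabs_le_between in K.
    change (Re (y - y0)%C) with (Re y - Re y0) in K. lra.
  - replace y with ((y - y0) + y0)%C by ring. eapply Rle_trans; [apply Cmod_triangle|]. lra.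
Qed.

Lemma climit_continuous (J : R -> C) (t : R) : climit (locally t) J (J t) ->
  continuous (fun s => Re (J s)) t /\ continuous (fun s => Im (J s)) t.
Proof.
  intros HJ. split; intros P [eps HP];
  (assert (He : 0 < eps / 2) by (destruct eps; simpl; lra));
  unfold filtermap; generalize (HJ _ He); apply filter_imp; intros s Hs; apply HP;
  destruct eps as [e Hpos]; simpl in *.
  - change (Rabs (Re (J s) - Re (J t)) < e). apply Rle_lt_trans with (e / 2); [|lra].
    eapply Rle_trans; [|exact Hs]. exact (re_le_Cmod (J s - J t)%C).
  - change (Rabs (Im (J s) - Im (J t)) < e). apply Rle_lt_trans with (e / 2); [|lra].
    eapply Rle_trans; [|exact Hs]. exact (im_le_Cmod (J s - J t)%C).
Qed.

(** Both improper ends are absorbed in limits of a primitive, so the convergence of the integral is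
    part of the conclusion. *)
Lemma improper_integral (J H : R -> C) (a b : C) :
  (forall t, 0 < t -> cderiv H t (J t)) -> (forall t, 0 < t -> climit (locally t) J (J t)) ->
  climit (at_right 0) H a -> climit (Rbar_locally p_infty) H b ->
  RInt_gen (V := C_R_CompleteNormedModule) J (at_right 0) (Rbar_locally p_infty) = (b - a)%C.
Proof.
  intros DH CJ La Lb.
  apply is_RInt_gen_unique.
  intros P [eps HP].
  assert (He : 0 < eps / 4) by (destruct eps; simpl; lra).
  exists (fun x => 0 < x /\ Cmod (H x - a) <= eps / 4) (fun y => 0 < y /\ Cmod (H y - b) <= eps / 4).
  - apply filter_and; [|exact (La _ He)]. exists (mkposreal 1 Rlt_0_1). intros y _ Hy; exact Hy.
  - apply filter_and; [exists 0; auto|exact (Lb _ He)].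
  - intros x y [Hx Bx] [Hy By]. simpl. exists (H y - H x)%C. split.
    + assert (Hm : forall z, Rmin x y <= z -> 0 < z).
      { intros z Hz. eapply Rlt_le_trans; [|exact Hz]. apply Rmin_pos; assumption. }
      apply (is_RInt_fct_extend_pair (U := R_NormedModule) (V := R_NormedModule) J x y (Re (H y) - Re (H x)) (Im (H y) - Im (H x))).
      * apply (is_RInt_derive (fun t => Re (H t)) (fun t => Re (J t))); intros z [Hz _].
        -- exact (proj1 (DH z (Hm z Hz))).
        -- exact (proj1 (climit_continuous J z (CJ z (Hm z Hz)))).
      * apply (is_RInt_derive (fun t => Im (H t)) (fun t => Im (J t))); intros z [Hz _].
        -- exact (proj2 (DH z (Hm z Hz))).
        -- exact (proj2 (climit_continuous J z (CJ z (Hm z Hz)))).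
    + apply HP, C_NormedModule_mixin_compat1.
      change (Cmod ((H y - H x) - (b - a)) < eps).
      replace ((H y - H x) - (b - a))%C with ((H y - b) - (H x - a))%C by ring.
      pose proof (Cmod_triangle_minus (H y - b) (H x - a)). destruct eps; simpl in *; lra.
Qed.

(** * Error-function sums and their duality *)

Section eichler.

Variables (kk : R) (kap : C) (c0 d0 : R -> C).
Hypothesis Hkk : 0 < kk.
Hypothesis Hc0 : forall m, Cmod (c0 m) = 1.
Hypothesis Hd0 : forall m, Cmod (d0 m) = 1.

(* The summands of the theta series at the two cusps; in the application kk is k, and the phases c0 and
   d0 come from h/k and h'/k. *)
Definition dterm (y : C) (w m : R) : C := (d0 m * Cexp (- PI * y * ((m - kk * w) * (m - kk * w))))%C.
Definition cterm (v : C) (w m : R) : C := (c0 m * Cexp (- PI * v * m ^ 2 + 2 * PI * Ci * w * m))%C.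

(** For y = 1/(k Z0) the dual parameter is Z0/k, so h/k + i dual(y) is tau while h'/k + i y is
    tau'. *)
Definition dual (y : C) : C := (/ (kk ^ 2 * y))%C.

(** Weight 1/2 inversion between the two cusps with an unspecified constant [kap]: the only modular
    information entering this section. *)
Hypothesis theta_dual : forall y w, 0 < Re y ->
  CSeries (half_term (dterm y w)) = (kap / Csqrt y * CSeries (half_term (cterm (dual y) w)))%C.

Lemma dterm_majorant (delta B W : R) : 0 < delta -> exists A, ex_series A /\
  forall y w n m, delta <= Re y -> Cmod y <= B -> Rabs w <= W -> INR n <= Rabs m <= INR n + 1 ->
    (1 + Rabs m) ^ 2 * Cmod (dterm y w m) <= A n.
Proof.
  intros Hd. pose proof PI_RGT_0 as Hpi.
  destruct (gauss_family_majorant (PI * delta) (2 * PI * B * (kk * W)) 0) as [A [HA H]]; [nra|].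
  exists A; split; [exact HA|]. intros y w n m H1 H2 H3 Hm.
  unfold dterm. rewrite Cmod_mult, Hd0, Rmult_1_l.
  replace (- PI * y * ((m - kk * w) * (m - kk * w)))%C with
    (- (PI * y) * m ^ 2 + (2 * PI * y * (kk * w)) * m + - (PI * y * ((kk * w) * (kk * w))))%C by ring.
  apply H; [| | |exact Hm].
  - replace (Re (PI * y)%C) with (PI * Re y) by (unfold Re, Im; simpl; ring). nra.
  - eapply Rle_trans; [apply re_le_Cmod|]. rewrite !Cmod_mult, !Cmod_R, (Rabs_right 2), (Rabs_right PI), (Rabs_right kk) by lra.
    pose proof (Cmod_ge_0 y). pose proof (Rabs_pos w).
    apply Rmult_le_compat; nra.
  - replace (Re (- (PI * y * ((kk * w) * (kk * w))))%C) with (- (PI * Re y * (kk * w) ^ 2))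
      by (unfold Re, Im; simpl; ring).
    pose proof (pow2_ge_0 (kk * w)). assert (0 <= PI * Re y) by nra. nra.
Qed.

Lemma cterm_majorant (delta : R) : 0 < delta -> exists A, ex_series A /\
  forall v w n m, delta <= Re v -> INR n <= Rabs m <= INR n + 1 ->
    (1 + Rabs m) ^ 2 * Cmod (cterm v w m) <= A n.
Proof.
  intros Hd. pose proof PI_RGT_0 as Hpi.
  destruct (gauss_family_majorant (PI * delta) 0 0) as [A [HA H]]; [nra|].
  exists A; split; [exact HA|]. intros v w n m H1 Hm.
  unfold cterm. rewrite Cmod_mult, Hc0, Rmult_1_l.
  replace (- PI * v * m ^ 2 + 2 * PI * Ci * w * m)%C with (- (PI * v) * m ^ 2 + (2 * PI * Ci * w) * m + 0)%C by ring.
  apply H; [| | |exact Hm].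
  - replace (Re (PI * v)%C) with (PI * Re v) by (unfold Re, Im; simpl; ring). nra.
  - replace (Re (2 * PI * Ci * w)%C) with 0 by (unfold Re, Im; simpl; ring). rewrite Rabs_R0. lra.
  - simpl; lra.
Qed.

Lemma one_le_sqr_weight (m : R) : 1 <= (1 + Rabs m) ^ 2 /\ Rabs m <= (1 + Rabs m) ^ 2.
Proof. pose proof (Rabs_pos m). split; nra. Qed.

Lemma weighted_summable (u : R -> C) (p : R -> C) (K : R) (A : nat -> R) : ex_series A ->
  (forall m, Cmod (p m) <= K * (1 + Rabs m) ^ 2) ->
  (forall n m, INR n <= Rabs m <= INR n + 1 -> (1 + Rabs m) ^ 2 * Cmod (u m) <= A n) ->
  half_summable (fun m => p m * u m)%C.
Proof.
  intros HA Hp H. apply half_summable_le with (fun n => K * A n); [apply ex_series_scal_R, HA|].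
  intros n m Hm. rewrite Cmod_mult.
  assert (HK : 0 <= K).
  { pose proof (Hp 0) as H0. rewrite Rabs_R0 in H0. pose proof (Cmod_ge_0 (p 0)). lra. }
  apply Rle_trans with (K * ((1 + Rabs m) ^ 2 * Cmod (u m))).
  - rewrite <- Rmult_assoc. apply Rmult_le_compat_r; [apply Cmod_ge_0|apply Hp].
  - apply Rmult_le_compat_l; [exact HK|apply H, Hm].
Qed.

Lemma dterm_summable (y : C) (w : R) (p : R -> C) (K : R) : 0 < Re y ->
  (forall m, Cmod (p m) <= K * (1 + Rabs m) ^ 2) -> half_summable (fun m => p m * dterm y w m)%C.
Proof.
  intros Hy Hp. destruct (dterm_majorant (Re y) (Cmod y) (Rabs w) Hy) as [A [HA H]].
  apply (weighted_summable _ _ K A HA Hp). intros n m Hm. apply H; try apply Rle_refl; exact Hm.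
Qed.

Lemma cterm_summable (v : C) (w : R) (p : R -> C) (K : R) : 0 < Re v ->
  (forall m, Cmod (p m) <= K * (1 + Rabs m) ^ 2) -> half_summable (fun m => p m * cterm v w m)%C.
Proof.
  intros Hv Hp. destruct (cterm_majorant (Re v) Hv) as [A [HA H]].
  apply (weighted_summable _ _ K A HA Hp). intros n m Hm. apply H; try apply Rle_refl; exact Hm.
Qed.

Lemma shift_weight (w m : R) : Cmod (m - kk * w)%C <= (1 + kk * Rabs w) * (1 + Rabs m) ^ 2.
Proof.
  rewrite <- RtoC_mult, <- RtoC_minus, Cmod_R.
  eapply Rle_trans; [apply Rabs_triang|]. rewrite Rabs_Ropp, Rabs_mult, (Rabs_right kk) by lra.
  destruct (one_le_sqr_weight m). pose proof (Rabs_pos w).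
  assert (0 <= kk * Rabs w) by nra. nra.
Qed.

Lemma dual_Re (y : C) : 0 < Re y -> 0 < Re (dual y).
Proof.
  intros Hy. unfold dual. apply Re_inv_pos.
  replace (Re (kk ^ 2 * y)%C) with (kk ^ 2 * Re y) by (unfold Re, Im; simpl; ring).
  apply Rmult_lt_0_compat; [nra|exact Hy].
Qed.

(** Differentiation in w turns the weight 1/2 inversion into the weight 3/2 inversion of the theta
    series with a linear factor, the series in the integrand of E. *)
Lemma theta_dual_deriv (y : C) (w : R) : 0 < Re y ->
  CSeries (half_term (fun m => (m - kk * w) * dterm y w m)%C) =
  (Ci * kap / (kk * y * Csqrt y) * CSeries (half_term (fun m => m * cterm (dual y) w m)%C))%C.
Proof.
  intros Hy. pose proof (slit_neq_0 _ (Re_pos_slit _ Hy)) as Ny.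
  pose proof (slit_neq_0 _ (Re_pos_slit _ (Csqrt_Re_pos _ (Re_pos_slit _ Hy)))) as Ns.
  pose proof (dual_Re y Hy) as Hv. set (v := dual y) in *.
  pose proof PI_RGT_0 as Hpi.
  assert (Nk : RtoC kk <> 0%C) by (intros K; apply RtoC_inj in K; lra).
  assert (N2 : RtoC 2 <> 0%C) by (intros K; apply RtoC_inj in K; lra).
  assert (Np : RtoC PI <> 0%C) by (intros K; apply RtoC_inj in K; lra).
  destruct (dterm_majorant (Re y) (Cmod y) (Rabs w + 1) Hy) as [A [HA MA]].
  destruct (cterm_majorant (Re v) Hv) as [B [HB MB]].
  set (K := 2 * PI * kk * Cmod y * (1 + kk * (Rabs w + 1))).
  assert (Sd : half_summable (fun m => (m - kk * w) * dterm y w m)%C)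
    by (apply (dterm_summable y w _ (1 + kk * Rabs w) Hy), shift_weight).
  assert (Sc : half_summable (fun m => m * cterm v w m)%C).
  { apply (cterm_summable v w _ 1 Hv). intros m. rewrite Cmod_R. destruct (one_le_sqr_weight m). lra. }
  assert (D1 : cderiv (fun t => CSeries (half_term (dterm y t))) w
    (CSeries (half_term (fun m => 2 * PI * kk * y * ((m - kk * w) * dterm y w m))%C))).
  { apply (cderiv_half_sum (fun t m => dterm y t m) (fun t m => 2 * PI * kk * y * ((m - kk * t) * dterm y t m))%C
      (fun n => K * A n) w 1); [lra|apply ex_series_scal_R, HA| |].
    - apply half_summable_ext with (fun m => 1 * dterm y w m)%C; [intros; ring|].
      apply (dterm_summable y w _ 1 Hy). intros m. rewrite Cmod_1. destruct (one_le_sqr_weight m). lra.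
    - intros t Ht n m Hm.
      assert (Htw : Rabs t <= Rabs w + 1).
      { replace t with ((t - w) + w) by ring. eapply Rle_trans; [apply Rabs_triang|]. lra. }
      split.
      + assert (L : cderiv (fun t => m - kk * t)%C t (- kk)%C).
        { apply cderiv_eq with (0 - kk * 1)%C; [ring|].
          apply cderiv_minus; [apply cderiv_const|apply cderiv_scal, cderiv_id]. }
        eapply cderiv_eq; [|apply cderiv_scal, cderiv_exp, cderiv_scal, (cderiv_mult _ _ _ _ _ L L)].
        unfold dterm. cbv beta. ring.
      + rewrite !Cmod_mult, !Cmod_R, (Rabs_right 2), (Rabs_right PI), (Rabs_right kk) by lra.
        pose proof (MA y t n m (Rle_refl _) (Rle_refl _) Htw Hm) as M1.
        pose proof (shift_weight t m) as S1.
        pose proof (Cmod_ge_0 (dterm y t m)). pose proof (Cmod_ge_0 y). pose proof (Cmod_ge_0 (m - kk * t)).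
        apply Rle_trans with (2 * PI * kk * Cmod y * ((1 + kk * (Rabs w + 1)) * ((1 + Rabs m) ^ 2 * Cmod (dterm y t m)))).
        * apply Rmult_le_compat_l; [apply Rmult_le_pos; [nra|assumption]|].
          rewrite <- Rmult_assoc. apply Rmult_le_compat_r; [assumption|].
          eapply Rle_trans; [exact S1|]. apply Rmult_le_compat_r; [apply pow2_ge_0|]. nra.
        * unfold K. replace (2 * PI * kk * Cmod y * (1 + kk * (Rabs w + 1)) * A n) with
            (2 * PI * kk * Cmod y * ((1 + kk * (Rabs w + 1)) * A n)) by ring.
          apply Rmult_le_compat_l; [apply Rmult_le_pos; [nra|assumption]|].
          apply Rmult_le_compat_l; [pose proof (Rabs_pos w); nra|exact M1]. }
  assert (D2 : cderiv (fun t => CSeries (half_term (cterm v t))) w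
    (CSeries (half_term (fun m => 2 * PI * Ci * (m * cterm v w m))%C))).
  { apply (cderiv_half_sum (fun t m => cterm v t m) (fun t m => 2 * PI * Ci * (m * cterm v t m))%C
      (fun n => 2 * PI * B n) w 1); [lra|apply ex_series_scal_R, HB| |].
    - apply half_summable_ext with (fun m => 1 * cterm v w m)%C; [intros; ring|].
      apply (cterm_summable v w _ 1 Hv). intros m. rewrite Cmod_1. destruct (one_le_sqr_weight m). lra.
    - intros t Ht n m Hm. split.
      + eapply cderiv_eq; [|apply cderiv_scal, cderiv_exp, cderiv_plus; [apply cderiv_const|]].
        2: { apply (cderiv_ext (fun t => 2 * PI * Ci * m * t)%C); [intros; ring|]. apply cderiv_scal, cderiv_id. }
        unfold cterm. cbv beta. ring.
      + rewrite !Cmod_mult, !Cmod_R, Cmod_Ci, (Rabs_right 2), (Rabs_right PI) by lra.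
        pose proof (MB v t n m (Rle_refl _) Hm) as M1. destruct (one_le_sqr_weight m) as [_ W2].
        rewrite Rmult_1_r. apply Rmult_le_compat_l; [nra|].
        eapply Rle_trans; [|exact M1]. apply Rmult_le_compat_r; [apply Cmod_ge_0|exact W2]. }
  assert (E : CSeries (half_term (fun m => 2 * PI * kk * y * ((m - kk * w) * dterm y w m))%C) =
     (kap / Csqrt y * CSeries (half_term (fun m => 2 * PI * Ci * (m * cterm v w m))))%C).
  { apply (cderiv_unique (fun t => CSeries (half_term (dterm y t))) w); [exact D1|].
    apply (cderiv_ext (fun t => kap / Csqrt y * CSeries (half_term (cterm v t)))%C).
    - intros t. symmetry. apply theta_dual, Hy.
    - apply cderiv_scal, D2. }
  assert (Sca : forall c u, half_summable u -> CSeries (half_term (fun m => c * u m)%C) = (c * CSeries (half_term u))%C).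
  { intros c u Hu. rewrite <- CSeries_scal by (apply half_term_summable, Hu). apply CSeries_ext.
    intros n. unfold half_term. ring. }
  rewrite (Sca _ _ Sd), (Sca _ _ Sc) in E.
  apply (Cmult_cancel_r _ _ (2 * PI * kk * y)%C); [repeat apply Cmult_neq_0; assumption|].
  rewrite Cmult_comm, E. field. repeat split; assumption.
Qed.

Variables (w : R) (tp : C).
Hypothesis Hw : Rabs (kk * w) < 1 / 2.
Hypothesis Htp : 0 < Re tp.

(** Here sgn is replaced by an error function at i(m - k w)s. Its s-derivative turns the Gaussian of
    parameter tp into the one of parameter tp - s^2, so s moves the modular parameter along the
    path. *)
Definition derf (s : C) (m : R) : C :=
  (d0 m * Cexp (- PI * tp * ((m - kk * w) * (m - kk * w))) * Erf (Ci * (m - kk * w) * s))%C.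

(** The counterpart of [derf] over the dual variable: the parameter moves to dual tp + q^2. *)
Definition cerf (q : C) (m : R) : C :=
  (c0 m * Cexp (- PI * dual tp * m ^ 2 + 2 * PI * Ci * w * m) * Erf (m * q))%C.

Lemma derf_bound (s : C) (m : R) :
  Cmod (derf s m) <= 2 * Cmod s * (Cmod (m - kk * w) * (Cmod (dterm tp w m) + Cmod (dterm (tp - s * s) w m))).
Proof.
  unfold derf. change (d0 m * Cexp (- PI * tp * ((m - kk * w) * (m - kk * w))))%C with (dterm tp w m).
  rewrite Cmod_mult.
  pose proof (Erf_bound (Ci * (m - kk * w) * s)) as B. rewrite !Cmod_mult, Cmod_Ci, Rmult_1_l in B.
  pose proof (Cmod_ge_0 (dterm tp w m)) as H0.
  apply (Rmult_le_compat_l _ _ _ H0) in B. eapply Rle_trans; [exact B|].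
  right.
  assert (E : Cmod (dterm (tp - s * s) w m) = Cmod (dterm tp w m) *
     exp (- PI * Re (Ci * (m - kk * w) * s * (Ci * (m - kk * w) * s))%C)).
  { unfold dterm. rewrite !Cmod_mult, Hd0, !Rmult_1_l, !Cmod_Cexp, <- exp_plus. f_equal.
    unfold Re, Im; simpl; ring. }
  rewrite E. ring.
Qed.

Lemma cerf_bound (q : C) (m : R) :
  Cmod (cerf q m) <= 2 * Cmod q * (Rabs m * (Cmod (cterm (dual tp) w m) + Cmod (cterm (dual tp + q * q) w m))).
Proof.
  unfold cerf. change (c0 m * Cexp (- PI * dual tp * m ^ 2 + 2 * PI * Ci * w * m))%C with (cterm (dual tp) w m).
  rewrite Cmod_mult.
  pose proof (Erf_bound (m * q)) as B. rewrite !Cmod_mult, Cmod_R in B.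
  pose proof (Cmod_ge_0 (cterm (dual tp) w m)) as H0.
  apply (Rmult_le_compat_l _ _ _ H0) in B. eapply Rle_trans; [exact B|].
  right.
  assert (E : Cmod (cterm (dual tp + q * q) w m) = Cmod (cterm (dual tp) w m) *
     exp (- PI * Re (m * q * (m * q))%C)).
  { unfold cterm. rewrite !Cmod_mult, Hc0, !Rmult_1_l, !Cmod_Cexp, <- exp_plus. f_equal.
    unfold Re, Im; simpl; ring. }
  rewrite E. ring.
Qed.

Lemma derf_summable (s : C) : 0 < Re (tp - s * s)%C -> half_summable (derf s).
Proof.
  intros Hs.
  destruct (dterm_majorant (Re tp) (Cmod tp) (Rabs w) Htp) as [A [HA MA]].
  destruct (dterm_majorant (Re (tp - s * s)%C) (Cmod (tp - s * s)) (Rabs w) Hs) as [B [HB MB]].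
  apply half_summable_le with (fun n => 2 * Cmod s * (1 + kk * Rabs w) * (A n + B n)).
  - apply ex_series_scal_R. apply (ex_series_plus (V := R_NormedModule) _ _ HA HB).
  - intros n m Hm. eapply Rle_trans; [apply derf_bound|].
    replace (2 * Cmod s * (1 + kk * Rabs w) * (A n + B n)) with (2 * Cmod s * ((1 + kk * Rabs w) * (A n + B n))) by ring.
    apply Rmult_le_compat_l; [pose proof (Cmod_ge_0 s); lra|].
    pose proof (MA tp w n m (Rle_refl _) (Rle_refl _) (Rle_refl _) Hm) as M1.
    pose proof (MB _ w n m (Rle_refl _) (Rle_refl _) (Rle_refl _) Hm) as M2.
    pose proof (shift_weight w m) as Sw. pose proof (Rabs_pos w).
    pose proof (Cmod_ge_0 (dterm tp w m)). pose proof (Cmod_ge_0 (dterm (tp - s * s) w m)).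
    apply Rle_trans with ((1 + kk * Rabs w) * (1 + Rabs m) ^ 2 * (Cmod (dterm tp w m) + Cmod (dterm (tp - s * s) w m))).
    + apply Rmult_le_compat_r; [lra|exact Sw].
    + rewrite Rmult_assoc. apply Rmult_le_compat_l; [nra|]. lra.
Qed.

Lemma cerf_summable (q : C) : 0 < Re (dual tp + q * q)%C -> half_summable (cerf q).
Proof.
  intros Hq. pose proof (dual_Re tp Htp) as Hv.
  destruct (cterm_majorant (Re (dual tp)) Hv) as [A [HA MA]].
  destruct (cterm_majorant (Re (dual tp + q * q)%C) Hq) as [B [HB MB]].
  apply half_summable_le with (fun n => 2 * Cmod q * (A n + B n)).
  - apply ex_series_scal_R. apply (ex_series_plus (V := R_NormedModule) _ _ HA HB).
  - intros n m Hm. eapply Rle_trans; [apply cerf_bound|].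
    apply Rmult_le_compat_l; [pose proof (Cmod_ge_0 q); lra|].
    pose proof (MA (dual tp) w n m (Rle_refl _) Hm) as M1.
    pose proof (MB _ w n m (Rle_refl _) Hm) as M2.
    destruct (one_le_sqr_weight m) as [_ W2].
    pose proof (Cmod_ge_0 (cterm (dual tp) w m)). pose proof (Cmod_ge_0 (cterm (dual tp + q * q) w m)).
    apply Rle_trans with ((1 + Rabs m) ^ 2 * (Cmod (cterm (dual tp) w m) + Cmod (cterm (dual tp + q * q) w m))).
    + apply Rmult_le_compat_r; [lra|exact W2].
    + lra.
Qed.

Lemma cderiv_derf (sf : R -> C) (x : R) (sp : C) (m : R) : cderiv sf x sp ->
  cderiv (fun t => derf (sf t) m) x (Ci * sp * ((m - kk * w) * dterm (tp - sf x * sf x) w m))%C.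
Proof.
  intros H. unfold derf.
  eapply cderiv_eq; [|apply cderiv_scal, cderiv_Erf, cderiv_scal, H].
  unfold dterm.
  replace (- PI * (tp - sf x * sf x) * ((m - kk * w) * (m - kk * w)))%C with
    (- PI * tp * ((m - kk * w) * (m - kk * w)) + - PI * (Ci * (m - kk * w) * sf x * (Ci * (m - kk * w) * sf x)))%C.
  - rewrite Cexp_plus. ring.
  - assert (EC : (Ci * Ci = -(1))%C) by Ccomp.
    transitivity (- PI * tp * ((m - kk * w) * (m - kk * w)) + - PI * (Ci * Ci) * ((m - kk * w) * sf x * ((m - kk * w) * sf x)))%C;
      [ring|rewrite EC; ring].
Qed.

Lemma cderiv_cerf (qf : R -> C) (x : R) (qp : C) (m : R) : cderiv qf x qp ->
  cderiv (fun t => cerf (qf t) m) x (qp * (m * cterm (dual tp + qf x * qf x) w m))%C.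
Proof.
  intros H. unfold cerf.
  eapply cderiv_eq; [|apply cderiv_scal, cderiv_Erf, cderiv_scal, H].
  unfold cterm.
  replace (- PI * (dual tp + qf x * qf x) * m ^ 2 + 2 * PI * Ci * w * m)%C with
    (- PI * dual tp * m ^ 2 + 2 * PI * Ci * w * m + - PI * (m * qf x * (m * qf x)))%C by ring.
  cbv beta. rewrite !Cexp_plus. ring.
Qed.

Lemma half_sum_scal (c : C) (u : R -> C) : half_summable u ->
  CSeries (half_term (fun m => c * u m)%C) = (c * CSeries (half_term u))%C.
Proof.
  intros Hu. rewrite <- CSeries_scal by (apply half_term_summable, Hu). apply CSeries_ext.
  intros n. unfold half_term. ring.
Qed.

Lemma half_weighted_summable_d (y : C) : 0 < Re y -> half_summable (fun m => (m - kk * w) * dterm y w m)%C.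
Proof. intros Hy. apply (dterm_summable y w _ (1 + kk * Rabs w) Hy), shift_weight. Qed.

Lemma half_weighted_summable_c (v : C) : 0 < Re v -> half_summable (fun m => m * cterm v w m)%C.
Proof.
  intros Hv. apply (cterm_summable v w _ 1 Hv). intros m. rewrite Cmod_R. destruct (one_le_sqr_weight m). lra.
Qed.

Lemma cderiv_sum_derf (sf sp : R -> C) (x r B : R) : 0 < r ->
  0 < Re (tp - sf x * sf x)%C ->
  (forall t, Rabs (t - x) < r -> cderiv sf t (sp t) /\ Cmod (sp t) <= B) ->
  cderiv (fun t => CSeries (half_term (derf (sf t)))) x
    (Ci * sp x * CSeries (half_term (fun m => (m - kk * w) * dterm (tp - sf x * sf x) w m)%C))%C.
Proof.
  intros Hr Hy D.
  assert (Hxr : Rabs (x - x) < r) by (rewrite Rminus_diag, Rabs_R0; lra).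
  destruct (D x Hxr) as [Dx Bx].
  set (y := fun t => (tp - sf t * sf t)%C) in *.
  assert (Dy : cderiv y x (0 - (sp x * sf x + sf x * sp x))%C).
  { apply cderiv_minus; [apply cderiv_const|]. apply (cderiv_mult _ _ _ _ _ Dx Dx). }
  destruct (cderiv_continuous y x _ Dy (Re (y x) / 2)) as [r2 [Hr2 N]]; [unfold y; lra|].
  destruct (dterm_majorant (Re (y x) / 2) (Cmod (y x) + Re (y x) / 2) (Rabs w)) as [A [HA MA]]; [unfold y; lra|].
  rewrite <- half_sum_scal by (apply half_weighted_summable_d, Hy).
  apply (cderiv_half_sum (fun t m => derf (sf t) m) (fun t m => Ci * sp t * ((m - kk * w) * dterm (y t) w m))%C
    (fun n => B * (1 + kk * Rabs w) * A n) x (Rmin r r2)).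
  - apply Rmin_pos; assumption.
  - apply ex_series_scal_R, HA.
  - apply derf_summable, Hy.
  - intros t Ht n m Hm.
    assert (T1 : Rabs (t - x) < r) by (eapply Rlt_le_trans; [exact Ht|apply Rmin_l]).
    assert (T2 : Rabs (t - x) < r2) by (eapply Rlt_le_trans; [exact Ht|apply Rmin_r]).
    destruct (D t T1) as [Dt Bt]. split; [apply cderiv_derf, Dt|].
    destruct (Re_near _ _ _ (N t T2)) as [R1 R2].
    pose proof (MA (y t) w n m ltac:(lra) R2 (Rle_refl _) Hm) as M1.
    rewrite !Cmod_mult, Cmod_Ci, Rmult_1_l.
    replace (B * (1 + kk * Rabs w) * A n) with (B * ((1 + kk * Rabs w) * A n)) by ring.
    apply Rmult_le_compat; [apply Cmod_ge_0|apply Rmult_le_pos; apply Cmod_ge_0|exact Bt|].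
    apply Rle_trans with ((1 + kk * Rabs w) * (1 + Rabs m) ^ 2 * Cmod (dterm (y t) w m)).
    + apply Rmult_le_compat_r; [apply Cmod_ge_0|apply shift_weight].
    + rewrite Rmult_assoc. apply Rmult_le_compat_l; [pose proof (Rabs_pos w); nra|exact M1].
Qed.

Lemma cderiv_sum_cerf (qf qp : R -> C) (x r B : R) : 0 < r ->
  0 < Re (dual tp + qf x * qf x)%C ->
  (forall t, Rabs (t - x) < r -> cderiv qf t (qp t) /\ Cmod (qp t) <= B) ->
  cderiv (fun t => CSeries (half_term (cerf (qf t)))) x
    (qp x * CSeries (half_term (fun m => m * cterm (dual tp + qf x * qf x) w m)%C))%C.
Proof.
  intros Hr Hy D.
  assert (Hxr : Rabs (x - x) < r) by (rewrite Rminus_diag, Rabs_R0; lra).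
  destruct (D x Hxr) as [Dx Bx].
  set (y := fun t => (dual tp + qf t * qf t)%C) in *.
  assert (Dy : cderiv y x (0 + (qp x * qf x + qf x * qp x))%C).
  { apply cderiv_plus; [apply cderiv_const|]. apply (cderiv_mult _ _ _ _ _ Dx Dx). }
  destruct (cderiv_continuous y x _ Dy (Re (y x) / 2)) as [r2 [Hr2 N]]; [unfold y; lra|].
  destruct (cterm_majorant (Re (y x) / 2)) as [A [HA MA]]; [unfold y; lra|].
  rewrite <- half_sum_scal by (apply half_weighted_summable_c, Hy).
  apply (cderiv_half_sum (fun t m => cerf (qf t) m) (fun t m => qp t * (m * cterm (y t) w m))%C
    (fun n => B * A n) x (Rmin r r2)).
  - apply Rmin_pos; assumption.
  - apply ex_series_scal_R, HA.
  - apply cerf_summable, Hy.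
  - intros t Ht n m Hm.
    assert (T1 : Rabs (t - x) < r) by (eapply Rlt_le_trans; [exact Ht|apply Rmin_l]).
    assert (T2 : Rabs (t - x) < r2) by (eapply Rlt_le_trans; [exact Ht|apply Rmin_r]).
    destruct (D t T1) as [Dt Bt]. split; [apply cderiv_cerf, Dt|].
    destruct (Re_near _ _ _ (N t T2)) as [R1 R2].
    pose proof (MA (y t) w n m ltac:(lra) Hm) as M1.
    rewrite !Cmod_mult, Cmod_R.
    apply Rmult_le_compat; [apply Cmod_ge_0|apply Rmult_le_pos; [apply Rabs_pos|apply Cmod_ge_0]|exact Bt|].
    eapply Rle_trans; [|exact M1]. apply Rmult_le_compat_r; [apply Cmod_ge_0|]. apply one_le_sqr_weight.
Qed.

(* Along the segment from 0 to [s] both sides have the same derivative, by [theta_dual_deriv]. *)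
Lemma derf_cerf_duality (s : C) : 0 < Re (tp - s * s)%C ->
  CSeries (half_term (derf s)) =
  (- (kap / Csqrt tp) * CSeries (half_term (cerf (s / (kk * Csqrt tp * Csqrt (tp - s * s))))))%C.
Proof.
  intros Hs.
  set (y := fun l : R => (tp - (l * s) * (l * s))%C).
  assert (Hy : forall l, 0 <= l <= 1 -> 0 < Re (y l)).
  { intros l Hl. unfold y.
    replace (Re (tp - l * s * (l * s))%C) with ((1 - l ^ 2) * Re tp + l ^ 2 * Re (tp - s * s)%C)
      by (unfold Re, Im; simpl; ring).
    destruct (Req_dec l 0) as [->|Hl0]; [replace ((1 - 0 ^ 2) * Re tp + 0 ^ 2 * Re (tp - s * s)%C) with (Re tp) by ring; exact Htp|].
    assert (0 < l ^ 2 <= 1) by nra. nra. }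
  pose proof (slit_neq_0 _ (Re_pos_slit _ Htp)) as Nt.
  pose proof (Csqrt_Re_pos _ (Re_pos_slit _ Htp)) as Hst.
  pose proof (slit_neq_0 _ (Re_pos_slit _ Hst)) as Nst.
  pose proof (Csqrt_sqr tp Nt) as Est.
  assert (Nk : RtoC kk <> 0%C) by (intros K; apply RtoC_inj in K; lra).
  set (st := Csqrt tp) in *.
  (* Chosen so that dual tp + q^2 is the dual of tp - (l s)^2; the two derivatives then contain
     theta series at mutually dual parameters. *)
  set (q := fun l : R => (l * s / (kk * st * Csqrt (y l)))%C).
  set (qp := fun l : R => (s * tp / (kk * st * (y l * Csqrt (y l))))%C).
  assert (Dq : forall l, 0 < Re (y l) -> cderiv q l (qp l)).
  { intros l Hyl. pose proof (slit_neq_0 _ (Re_pos_slit _ Hyl)) as Ny.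
    pose proof (slit_neq_0 _ (Re_pos_slit _ (Csqrt_Re_pos _ (Re_pos_slit _ Hyl)))) as Nsy.
    pose proof (Csqrt_sqr _ Ny) as Esy.
    assert (Dy : cderiv y l (- (2 * l * s * s))%C).
    { eapply cderiv_eq; [|apply cderiv_minus; [apply cderiv_const|
        apply (cderiv_mult _ _ _ _ _ (cderiv_scal_id s l) (cderiv_scal_id s l))]]. ring. }
    pose proof (cderiv_comp _ _ _ _ _ (Cdiff_Csqrt _ (Re_pos_slit _ Hyl)) Dy) as Dsq.
    set (R := Csqrt (y l)) in *.
    assert (ND : (kk * st * R)%C <> 0%C) by (repeat apply Cmult_neq_0; assumption).
    pose proof (cderiv_mult _ _ _ _ _ (cderiv_scal_id s l)
      (cderiv_inv (fun l => kk * st * Csqrt (y l))%C l _ ND (cderiv_scal (kk * st) _ _ _ Dsq))) as Dfin.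
    apply cderiv_eq with (2 := Dfin). cbv beta. fold R. unfold qp. fold R.
    replace tp with (y l + (l * s) * (l * s))%C by (unfold y; ring).
    rewrite <- Esy. field. repeat split; try assumption. }
  assert (Eq : forall l, 0 < Re (y l) -> (dual tp + q l * q l)%C = dual (y l)).
  { intros l Hyl. pose proof (slit_neq_0 _ (Re_pos_slit _ Hyl)) as Ny.
    pose proof (slit_neq_0 _ (Re_pos_slit _ (Csqrt_Re_pos _ (Re_pos_slit _ Hyl)))) as Nsy.
    pose proof (Csqrt_sqr _ Ny) as Esy. unfold q, dual.
    transitivity (/ (kk ^ 2 * tp) + (l * s) * (l * s) / (kk ^ 2 * (st * st) * (Csqrt (y l) * Csqrt (y l))))%C.
    - simpl. field. repeat split; assumption.
    - rewrite Est, Esy. replace ((l * s) * (l * s))%C with (tp - y l)%C by (unfold y; ring). field. repeat split; assumption. }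
  set (Phi := fun l : R => (CSeries (half_term (derf (l * s))) + kap / st * CSeries (half_term (cerf (q l))))%C).
  assert (DPhi : forall l, 0 <= l <= 1 -> cderiv Phi l 0%C).
  { intros l Hl. pose proof (Hy l Hl) as Hyl.
    pose proof (slit_neq_0 _ (Re_pos_slit _ Hyl)) as Ny.
    pose proof (slit_neq_0 _ (Re_pos_slit _ (Csqrt_Re_pos _ (Re_pos_slit _ Hyl)))) as Nsy.
    assert (Dy : cderiv y l (- (2 * l * s * s))%C).
    { eapply cderiv_eq; [|apply cderiv_minus; [apply cderiv_const|
        apply (cderiv_mult _ _ _ _ _ (cderiv_scal_id s l) (cderiv_scal_id s l))]]. ring. }
    assert (Dqp : exists m, cderiv qp l m).
    { eexists. apply cderiv_scal. apply cderiv_inv.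
      - repeat apply Cmult_neq_0; assumption.
      - apply cderiv_scal. apply cderiv_mult; [exact Dy|].
        exact (cderiv_comp _ _ _ _ _ (Cdiff_Csqrt _ (Re_pos_slit _ Hyl)) Dy). }
    destruct Dqp as [m Dqp].
    destruct (cderiv_continuous qp l m Dqp 1 Rlt_0_1) as [r1 [Hr1 N1]].
    destruct (cderiv_continuous y l _ Dy (Re (y l) / 2)) as [r2 [Hr2 N2]]; [lra|].
    pose proof (cderiv_sum_derf (fun t => t * s)%C (fun _ => s) l 1 (Cmod s) Rlt_0_1 Hyl
      (fun t _ => conj (cderiv_scal_id s t) (Rle_refl _))) as D1.
    assert (D2 : cderiv (fun t => CSeries (half_term (cerf (q t)))) l
      (qp l * CSeries (half_term (fun m => m * cterm (dual tp + q l * q l) w m)))%C).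
    { apply (cderiv_sum_cerf q qp l (Rmin r1 r2) (Cmod (qp l) + 1)).
      - apply Rmin_pos; assumption.
      - rewrite Eq by exact Hyl. apply dual_Re, Hyl.
      - intros t Ht.
        assert (T1 : Rabs (t - l) < r1) by (eapply Rlt_le_trans; [exact Ht|apply Rmin_l]).
        assert (T2 : Rabs (t - l) < r2) by (eapply Rlt_le_trans; [exact Ht|apply Rmin_r]).
        destruct (Re_near _ _ _ (N2 t T2)) as [R1 _]. split; [apply Dq; lra|].
        apply (Re_near _ _ _ (N1 t T1)). }
    apply cderiv_eq with (2 := cderiv_plus _ _ _ _ _ D1 (cderiv_scal (kap / st) _ _ _ D2)).
    rewrite Eq by exact Hyl. cbv beta. fold (y l). rewrite theta_dual_deriv by exact Hyl.
    unfold qp. set (S := CSeries _). set (R := Csqrt (y l)) in *.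
    assert (EC : (Ci * Ci = -(1))%C) by Ccomp.
    transitivity ((Ci * Ci + tp / (st * st)) * (s * kap * S / (kk * y l * R)))%C.
    - field. repeat split; assumption.
    - rewrite EC, Est. field. repeat split; assumption. }
  pose proof (cderiv_zero_const Phi 0 1 Rle_0_1 DPhi) as E.
  unfold Phi in E.
  assert (Z1 : CSeries (half_term (derf (0 * s))) = 0%C).
  { replace (0 * s)%C with (RtoC 0) by ring.
    destruct (CSeries_finite (half_term (derf 0)) 0) as [_ ->]; [|reflexivity].
    intros n _. unfold half_term, derf. rewrite !Cmult_0_r, Erf_0. ring. }
  assert (Z2 : CSeries (half_term (cerf (q 0))) = 0%C).
  { replace (q 0) with (RtoC 0) by (unfold q, Cdiv; rewrite Cmult_0_l, Cmult_0_l; reflexivity).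
    destruct (CSeries_finite (half_term (cerf 0)) 0) as [_ ->]; [|reflexivity].
    intros n _. unfold half_term, cerf. rewrite !Cmult_0_r, Erf_0. ring. }
  rewrite Z1, Z2 in E.
  assert (Eq1 : q 1 = (s / (kk * st * Csqrt (tp - s * s)))%C).
  { unfold q, y. rewrite Cmult_1_l. reflexivity. }
  rewrite Cmult_1_l, Eq1 in E.
  match type of E with (?a + ?b)%C = _ => transitivity (a + b - b)%C; [ring|] end.
  rewrite E. ring.
Qed.

Lemma sector_scale (delta : R) (v : C) (n : R) : 0 < n -> sector delta v -> sector delta (n * v).
Proof.
  intros Hn [H1 H2]. split.
  - replace (Re (n * v)%C) with (n * Re v) by (unfold Re, Im; simpl; ring). apply Rmult_lt_0_compat; assumption.
  - rewrite Cmod_mult, Cmod_R, Rabs_right by lra.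
    replace (Re (n * v * (n * v))%C) with (n ^ 2 * Re (v * v)%C) by (unfold Re, Im; simpl; ring).
    replace (delta * (n * Cmod v) ^ 2) with (n ^ 2 * (delta * Cmod v ^ 2)) by ring.
    apply Rmult_le_compat_l; [apply pow2_ge_0|exact H2].
Qed.

(** Oddness extends the sector limit to negative multiples, with limit sgn(n)/2; the threshold
    involves n and v only through |n| |v|. *)
Lemma Erf_far (delta eps : R) : 0 < delta -> 0 < eps -> exists X, forall (v : C) (n : R),
  sector delta v -> n <> 0 -> X <= Rabs n * Cmod v -> Cmod (Erf (n * v) - (sign n / 2)%R) <= eps.
Proof.
  intros Hd He. destruct (Erf_sector_half delta eps Hd He) as [X HX]. exists X. intros v n Hv Hn HXn.
  destruct (Rlt_dec 0 n) as [P|P].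
  - rewrite sign_eq_1 by exact P. replace (1 / 2) with (/ 2) by field.
    apply HX; [apply sector_scale; assumption|]. rewrite Cmod_mult, Cmod_R. exact HXn.
  - assert (P' : 0 < - n) by lra. rewrite sign_eq_m1 by lra.
    replace (n * v)%C with (- ((- n)%R * v))%C by (rewrite RtoC_opp; ring). rewrite Erf_opp.
    replace (-1 / 2) with (- / 2) by field. rewrite (RtoC_opp (/ 2)).
    replace (- Erf ((- n)%R * v) - - (/ 2)%R)%C with (- (Erf ((- n)%R * v) - (/ 2)%R))%C by ring.
    rewrite Cmod_opp. apply HX; [apply sector_scale; assumption|].
    rewrite Cmod_mult, Cmod_R, Rabs_Ropp. exact HXn.
Qed.

Lemma half_term_bound_half (f : R -> C) (a : nat -> R) :
  (forall n, Cmod (f (half n)) <= a n /\ Cmod (f (- half n)) <= a n) ->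
  forall n, Cmod (half_term f n) <= 2 * a n.
Proof.
  intros H n. unfold half_term. rewrite Cmod_mult, Cmod_sign, Rmult_1_l.
  eapply Rle_trans; [apply Cmod_triangle_minus|]. destruct (H n). lra.
Qed.

Lemma half_ge (n : nat) : 1 / 2 <= half n.
Proof. unfold half. pose proof (pos_INR n). lra. Qed.

(** With |k w| < 1/2 <= |m| the shift cannot cross 0, and the lower bound makes (m - k w)v escape to
    infinity uniformly in m. *)
Lemma shifted_sign (m : R) : 1 / 2 <= Rabs m ->
  1 / 2 - Rabs (kk * w) <= Rabs (m - kk * w) /\ sign (m - kk * w) = sign m.
Proof.
  intros Hm. split.
  - pose proof (Rabs_triang_inv m (kk * w)). lra.
  - destruct (Rabs_def2 _ _ Hw) as [A B].
    destruct (Rle_dec 0 m) as [P|P].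
    + rewrite Rabs_right in Hm by lra. rewrite !sign_eq_1 by lra. reflexivity.
    + rewrite Rabs_left in Hm by lra. rewrite !sign_eq_m1 by lra. reflexivity.
Qed.

Definition signed_d : C := CSeries (half_term (fun m => sign m * dterm tp w m)%C).
Definition signed_c : C := CSeries (half_term (fun m => sign m * cterm (dual tp) w m)%C).

Lemma sign_le_1 (m : R) : Rabs (sign m) <= 1.
Proof.
  destruct (Rtotal_order m 0) as [H|[H|H]].
  - rewrite sign_eq_m1 by exact H. rewrite Rabs_left by lra. lra.
  - rewrite H, sign_0, Rabs_R0. lra.
  - rewrite sign_eq_1 by exact H. rewrite Rabs_R1. lra.
Qed.

(* Both ends of the path are handled by the same dominated convergence argument: the arguments of
   the error functions move to infinity inside a sector, uniformly in the summation index. *)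
Lemma climit_erf_sum {T : Type} (F : (T -> Prop) -> Prop) {FF : Filter F}
  (g : R -> C) (A : nat -> R) (eta0 : R) (nu : R -> R) (v : T -> C) (delta sg : R) :
  ex_series A -> 0 < delta -> 0 < eta0 -> Rabs sg = 1 ->
  (forall n m, INR n <= Rabs m <= INR n + 1 -> Cmod (g m) <= A n) ->
  (forall m, 1 / 2 <= Rabs m -> eta0 <= Rabs (nu m) /\ sign (nu m) = sign m) ->
  F (fun t => sector delta (v t)) ->
  (forall X, F (fun t => X <= Cmod (v t))) ->
  climit F (fun t => CSeries (half_term (fun m => g m * (sg * Erf (nu m * v t)))%C))
    (sg / 2 * CSeries (half_term (fun m => sign m * g m)%C))%C.
Proof.
  intros HA Hd He Hsg HB Hnu Hs Hinf.
  assert (Hsgc : Cmod sg = 1) by (rewrite Cmod_R; exact Hsg).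
  assert (Hlim : forall eps, 0 < eps -> F (fun t => forall m, 1 / 2 <= Rabs m ->
     Cmod (g m * (sg * Erf (nu m * v t)) - sg / 2 * (sign m * g m)) <= eps * Cmod (g m))).
  { intros eps Hep. destruct (Erf_far delta eps Hd Hep) as [X HX].
    generalize (filter_and _ _ Hs (Hinf (Rabs X / eta0))). apply filter_imp. intros t [H1 H2] m Hm.
    destruct (Hnu m Hm) as [N1 N2].
    assert (N0 : nu m <> 0) by (intros Z; rewrite Z, Rabs_R0 in N1; lra).
    assert (HXn : X <= Rabs (nu m) * Cmod (v t)).
    { apply Rle_trans with (Rabs X); [apply Rle_abs|].
      replace (Rabs X) with (eta0 * (Rabs X / eta0)) by (field; lra).
      apply Rmult_le_compat; [lra|apply Rdiv_le_0_compat; [apply Rabs_pos|lra]|exact N1|exact H2]. }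
    pose proof (HX (v t) (nu m) H1 N0 HXn) as K. rewrite N2 in K.
    replace (g m * (sg * Erf (nu m * v t)) - sg / 2 * (sign m * g m))%C
      with (sg * (g m * (Erf (nu m * v t) - (sign m / 2)%R)))%C
      by (rewrite RtoC_div by lra; field).
    rewrite !Cmod_mult, Hsgc, Rmult_1_l, Rmult_comm. apply Rmult_le_compat_r; [apply Cmod_ge_0|exact K]. }
  assert (Sg : half_summable (fun m => sign m * g m)%C).
  { apply half_summable_le with A; [exact HA|]. intros n m Hm. rewrite Cmod_mult, Cmod_R.
    pose proof (sign_le_1 m). pose proof (Cmod_ge_0 (g m)). pose proof (HB n m Hm). pose proof (Rabs_pos (sign m)). nra. }
  assert (Hh : forall n, 1 / 2 <= Rabs (half n) /\ 1 / 2 <= Rabs (- half n) /\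
     INR n <= Rabs (half n) <= INR n + 1 /\ INR n <= Rabs (- half n) <= INR n + 1).
  { intros n. pose proof (half_ge n). rewrite Rabs_Ropp, Rabs_right by lra. unfold half in *. repeat split; lra. }
  rewrite <- CSeries_scal by (apply half_term_summable, Sg).
  apply (climit_CSeries F) with (fun n => 2 * (2 * A n)).
  - apply ex_series_scal_R, ex_series_scal_R, HA.
  - intros n. rewrite Cmod_mult, Cmod_div by (intros Z; apply RtoC_inj in Z; lra).
    rewrite Hsgc, Cmod_R, Rabs_right by lra.
    assert (K : Cmod (half_term (fun m => sign m * g m)%C n) <= 2 * A n).
    { apply half_term_bound. intros k m Hm. rewrite Cmod_mult, Cmod_R.
      pose proof (sign_le_1 m). pose proof (Cmod_ge_0 (g m)). pose proof (HB k m Hm). pose proof (Rabs_pos (sign m)). nra. }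
    pose proof (Cmod_ge_0 (half_term (fun m => sign m * g m)%C n)). lra.
  - generalize (Hlim 1 Rlt_0_1). apply filter_imp. intros t H.
    apply half_term_bound_half. intros n. destruct (Hh n) as [P1 [P2 [P3 P4]]].
    assert (K : forall m, 1 / 2 <= Rabs m -> INR n <= Rabs m <= INR n + 1 -> Cmod (g m * (sg * Erf (nu m * v t))) <= 2 * A n).
    { intros m Q1 Q2. pose proof (H m Q1) as K. pose proof (HB n m Q2) as B. pose proof (Cmod_ge_0 (g m)) as G0.
      replace (g m * (sg * Erf (nu m * v t)))%C with
        ((g m * (sg * Erf (nu m * v t)) - sg / 2 * (sign m * g m)) + sg / 2 * (sign m * g m))%C by ring.
      eapply Rle_trans; [apply Cmod_triangle|].
      assert (Cmod (sg / 2 * (sign m * g m)) <= Cmod (g m)).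
      { rewrite !Cmod_mult, Cmod_div by (intros Z; apply RtoC_inj in Z; lra).
        rewrite Hsgc, !Cmod_R, (Rabs_right 2) by lra. pose proof (sign_le_1 m). pose proof (Rabs_pos (sign m)). nra. }
      lra. }
    split; apply K; assumption.
  - intros n eps Hep. destruct (Hh n) as [P1 [P2 [P3 P4]]].
    pose proof (HB n _ P3) as B1. pose proof (HB n _ P4) as B2.
    pose proof (Cmod_ge_0 (g (half n))). pose proof (Cmod_ge_0 (g (- half n))).
    assert (Hep2 : 0 < eps / (2 * (A n + 1))) by (apply Rdiv_lt_0_compat; lra).
    generalize (Hlim _ Hep2). apply filter_imp. intros t H1.
    pose proof (H1 _ P1) as Q1. pose proof (H1 _ P2) as Q2. unfold half_term.
    assert (Ring : forall e a b c d k : C, (e * (a - b) - k * (e * (c - d)) = e * ((a - k * c) - (b - k * d)))%C)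
      by (intros; ring).
    rewrite Ring.
    rewrite Cmod_mult, Cmod_sign, Rmult_1_l.
    eapply Rle_trans; [apply Cmod_triangle_minus|].
    apply Rle_trans with (eps / (2 * (A n + 1)) * (A n + 1) + eps / (2 * (A n + 1)) * (A n + 1));
      [|right; field; lra].
    apply Rplus_le_compat; (eapply Rle_trans; [eassumption|apply Rmult_le_compat_l; lra]).
Qed.

(** * The integral along a path and its two end limits *)

Variables u u' : R -> C.
Hypothesis Hu : forall t, 0 < t -> cderiv u t (u' t).
Hypothesis Hu' : forall t, 0 < t -> climit (locally t) u' (u' t).
Hypothesis Hupper : forall t, 0 < t -> 0 < Im (u t).
Hypothesis Hslit : forall t, 0 < t -> slit (tp + Ci * u t).

(* With [u] the path relative to the cusp, [path_sqrt] is the square root in the denominator of the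
   integrand of E, and [path_form] is that integrand up to a constant factor. *)
Definition path_sqrt (t : R) : C := Csqrt (tp + Ci * u t).

Definition path_form (t : R) : C :=
  (CSeries (half_term (fun m => (m - kk * w) * dterm (- Ci * u t) w m)%C) / path_sqrt t * u' t)%C.

Lemma path_sqrt_sqr (t : R) : 0 < t ->
  path_sqrt t <> 0%C /\ (tp - path_sqrt t * path_sqrt t)%C = (- Ci * u t)%C /\ 0 < Re (- Ci * u t)%C.
Proof.
  intros Ht. pose proof (Hslit t Ht) as Hs. split; [|split].
  - apply slit_neq_0, Re_pos_slit, Csqrt_Re_pos, Hs.
  - unfold path_sqrt. rewrite Csqrt_sqr by (apply slit_neq_0, Hs). ring.
  - replace (Re (- Ci * u t)%C) with (Im (u t)) by (unfold Re, Im; simpl; ring). apply Hupper, Ht.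
Qed.

Lemma cderiv_path_sqrt (t : R) : 0 < t -> cderiv path_sqrt t (Ci * u' t / (2 * path_sqrt t))%C.
Proof.
  intros Ht. unfold path_sqrt.
  assert (D : cderiv (fun t => tp + Ci * u t)%C t (Ci * u' t)%C).
  { apply cderiv_eq with (0 + Ci * u' t)%C; [ring|].
    apply cderiv_plus; [apply cderiv_const|apply cderiv_scal, Hu, Ht]. }
  eapply cderiv_eq; [|exact (cderiv_comp _ _ _ _ _ (Cdiff_Csqrt _ (Hslit t Ht)) D)].
  unfold Cdiv. ring.
Qed.

Lemma cderiv_climit (f : R -> C) (x : R) (l : C) : cderiv f x l -> climit (locally x) f (f x).
Proof.
  intros D eps He. destruct (cderiv_continuous f x l D eps He) as [d [Hd N]].
  exists (mkposreal d Hd). intros t Ht. apply N, Ht.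
Qed.

Lemma climit_path_inv_sqrt (t : R) : 0 < t -> climit (locally t) (fun x => / path_sqrt x)%C (/ path_sqrt t)%C.
Proof.
  intros Ht. destruct (path_sqrt_sqr t Ht) as [N _].
  apply (cderiv_climit (fun x => / path_sqrt x)%C t _ (cderiv_inv _ _ _ N (cderiv_path_sqrt t Ht))).
Qed.

Lemma locally_Rabs (x : R) (P : R -> Prop) : locally x P -> exists r, 0 < r /\ forall t, Rabs (t - x) < r -> P t.
Proof. intros [r H]. exists r. split; [apply cond_pos|exact H]. Qed.

Lemma locally_pos (t : R) : 0 < t -> locally t (fun x => 0 < x).
Proof. intros Ht. exact (open_gt 0 t Ht). Qed.

(** The derivative i u'/(2s) of the root meets the factor i of [cderiv_derf]; the factor -2 turns
    the product -1/2 into 1. *)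
Lemma cderiv_path_primitive (t : R) : 0 < t ->
  cderiv (fun t => - (2) * CSeries (half_term (derf (path_sqrt t))))%C t (path_form t).
Proof.
  intros Ht. destruct (path_sqrt_sqr t Ht) as [N [E P]].
  assert (L : climit (locally t) (fun x => Ci / 2 * (/ path_sqrt x * u' x))%C (Ci / 2 * (/ path_sqrt t * u' t))%C).
  { apply climit_scal; [apply _|]. apply climit_mult; [apply _|apply climit_path_inv_sqrt, Ht|apply Hu', Ht]. }
  destruct (locally_Rabs t _ (filter_and _ _ (locally_pos t Ht) (climit_bounded _ _ _ L))) as [r [Hr D]].
  assert (Half : forall x, 0 < x -> (Ci * u' x / (2 * path_sqrt x))%C = (Ci / 2 * (/ path_sqrt x * u' x))%C).
  { intros x Hx. destruct (path_sqrt_sqr x Hx) as [Nx _]. field. exact Nx. }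
  pose proof (cderiv_sum_derf path_sqrt (fun x => Ci / 2 * (/ path_sqrt x * u' x))%C t r
    (Cmod (Ci / 2 * (/ path_sqrt t * u' t)) + 1) Hr
    ltac:(rewrite E; exact P)
    (fun x Hx => conj (cderiv_eq _ _ _ _ (Half x (proj1 (D x Hx))) (cderiv_path_sqrt x (proj1 (D x Hx)))) (proj2 (D x Hx)))) as K.
  rewrite E in K. eapply cderiv_eq; [|apply cderiv_scal, K]. unfold path_form.
  assert (EC : (Ci * Ci = -(1))%C) by Ccomp. set (S := CSeries _).
  transitivity (- (Ci * Ci) * (S / path_sqrt t * u' t))%C; [field; exact N|rewrite EC; ring].
Qed.

(** Continuity of the integrand, as the fundamental theorem of calculus demands. *)
Lemma climit_path_form (t : R) : 0 < t -> climit (locally t) path_form (path_form t).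
Proof.
  intros Ht. destruct (path_sqrt_sqr t Ht) as [N [_ P]]. set (y := fun x => (- Ci * u x)%C). change (0 < Re (y t)) in P.
  apply climit_mult; [apply _| |apply Hu', Ht].
  apply climit_mult; [apply _| |apply climit_path_inv_sqrt, Ht].
  change (climit (locally t) (fun x => CSeries (half_term (fun m => (m - kk * w) * dterm (y x) w m)%C))
    (CSeries (half_term (fun m => (m - kk * w) * dterm (y t) w m)%C))).
  assert (Ly : cderiv y t (- Ci * u' t)%C) by (apply cderiv_scal, Hu, Ht).
  destruct (dterm_majorant (Re (y t) / 2) (Cmod (y t) + Re (y t) / 2) (Rabs w)) as [A [HA MA]]; [lra|].
  assert (B : forall x, Cmod (y x - y t) <= Re (y t) / 2 -> forall n m, INR n <= Rabs m <= INR n + 1 ->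
    Cmod ((m - kk * w) * dterm (y x) w m) <= (1 + kk * Rabs w) * A n).
  { intros x Hx n m Hm. destruct (Re_near _ _ _ Hx) as [R1 R2].
    pose proof (MA (y x) w n m ltac:(lra) R2 (Rle_refl _) Hm) as M1. rewrite Cmod_mult.
    apply Rle_trans with ((1 + kk * Rabs w) * (1 + Rabs m) ^ 2 * Cmod (dterm (y x) w m)).
    + apply Rmult_le_compat_r; [apply Cmod_ge_0|apply shift_weight].
    + rewrite Rmult_assoc. apply Rmult_le_compat_l; [pose proof (Rabs_pos w); nra|exact M1]. }
  apply (climit_CSeries (locally t)) with (fun n => 2 * ((1 + kk * Rabs w) * A n)).
  - apply ex_series_scal_R, ex_series_scal_R, HA.
  - apply half_term_bound. apply B. unfold Cminus; rewrite Cplus_opp_r, Cmod_0. lra.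
  - assert (He : 0 < Re (y t) / 2) by lra.
    generalize (cderiv_climit _ _ _ Ly _ He). apply filter_imp. intros x Hx. apply half_term_bound, B, Hx.
  - intros n.
    assert (T : forall m : R, climit (locally t) (fun x => (m - kk * w) * dterm (y x) w m)%C ((m - kk * w) * dterm (y t) w m)%C).
    { intros m. apply climit_scal; [apply _|]. apply climit_scal; [apply _|].
      eapply cderiv_climit. apply cderiv_exp.
      apply (cderiv_ext (fun x => - PI * ((m - kk * w) * (m - kk * w)) * y x)%C); [intros; ring|].
      apply cderiv_scal, Ly. }
    unfold half_term. apply climit_scal; [apply _|].
    apply (climit_ext (locally t) (fun x => (half n - kk * w) * dterm (y x) w (half n)
      + - (1) * (((- half n)%R - kk * w) * dterm (y x) w (- half n)))%C).
    + apply filter_forall. intros x. ring.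
    + match goal with |- climit _ _ (?a - ?b)%C => replace (a - b)%C with (a + - (1) * b)%C by ring end.
      apply climit_plus; [apply _|apply T|]. apply climit_scal; [apply _|apply T].
Qed.

(** On the final vertical line s^2 = tp + i u has constant imaginary part e > 0 and real part
    tending to -infinity, so -i s runs to infinity close to the positive real axis. The positive e
    selects the side of the cut, and with it the sign -1. *)
Lemma climit_path_end (e : R) : 0 < e ->
  Rbar_locally p_infty (fun t => Im (tp + Ci * u t)%C = e) ->
  (forall X, Rbar_locally p_infty (fun t => X <= Im (u t))) ->
  climit (Rbar_locally p_infty) (fun t => CSeries (half_term (derf (path_sqrt t)))) (RtoC (-1) / 2 * signed_d)%C.
Proof.
  intros He Hline Hup.
  assert (Far : forall X, Rbar_locally p_infty (fun t => exists a, X <= a /\ e <= a /\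
     0 < Re (- Ci * path_sqrt t)%C /\ (- Ci * path_sqrt t * (- Ci * path_sqrt t))%C = (a, - e))).
  { intros X.
    assert (Pos : Rbar_locally p_infty (fun t => 0 < t)) by (exists 0; auto).
    generalize (filter_and _ _ Pos (filter_and _ _ Hline (Hup (Rmax X e + Re tp)))). apply filter_imp.
    intros t [Ht [Hl Hx]]. exists (Im (u t) - Re tp).
    pose proof (Rmax_l X e). pose proof (Rmax_r X e).
    split; [lra|split; [lra|]].
    pose proof (Csqrt_Re_pos _ (Hslit t Ht)) as Hs.
    pose proof (Csqrt_sqr _ (slit_neq_0 _ (Hslit t Ht))) as Es. fold (path_sqrt t) in Hs, Es.
    set (s := path_sqrt t) in *.
    assert (Hi : Im (s * s)%C = e) by (rewrite Es; exact Hl).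
    rewrite Im_mult in Hi.
    split.
    - replace (Re (- Ci * s)%C) with (Im s) by (unfold Re, Im; simpl; ring).
      destruct (Rlt_dec 0 (Im s)); [assumption|nra].
    - assert (EC : (Ci * Ci = -(1))%C) by Ccomp.
      transitivity (Ci * Ci * (s * s))%C; [ring|]. rewrite EC, Es. apply C_ext.
      + unfold Re, Im; simpl; ring.
      + rewrite <- Hl. unfold Re, Im; simpl; ring. }
  destruct (dterm_majorant (Re tp) (Cmod tp) (Rabs w) Htp) as [A [HA MA]].
  apply (climit_ext (Rbar_locally p_infty)
    (fun t => CSeries (half_term (fun m => dterm tp w m * (RtoC (-1) * Erf ((m - kk * w)%R * (- Ci * path_sqrt t))))%C))).
  - apply filter_forall. intros t. apply CSeries_ext. intros n. apply half_term_ext. intros m.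
    unfold derf. fold (dterm tp w m).
    replace (Ci * (m - kk * w) * path_sqrt t)%C with (- ((m - kk * w)%R * (- Ci * path_sqrt t)))%C
      by (rewrite RtoC_minus, RtoC_mult; ring).
    rewrite Erf_opp. ring.
  (* Sector constant 1/2: the square of -i s is a - i e with 0 < e <= a, hence of modulus at most
     2a. *)
  - apply (climit_erf_sum (Rbar_locally p_infty) (dterm tp w) A (1 / 2 - Rabs (kk * w))
      (fun m => m - kk * w) (fun t => - Ci * path_sqrt t)%C (/ 2) (-1) HA).
    + lra.
    + lra.
    + rewrite Rabs_left by lra. lra.
    + intros n m Hm. eapply Rle_trans; [|apply (MA tp w n m (Rle_refl _) (Rle_refl _) (Rle_refl _) Hm)].
      destruct (one_le_sqr_weight m) as [W1 _]. pose proof (Cmod_ge_0 (dterm tp w m)). nra.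
    + apply shifted_sign.
    + generalize (Far 0). apply filter_imp. intros t [a [_ [Ha [H1 H2]]]]. split; [exact H1|].
      rewrite H2. change (Re (a, - e)) with a.
      replace (Cmod (- Ci * path_sqrt t) ^ 2) with (Cmod (- Ci * path_sqrt t * (- Ci * path_sqrt t))%C)
        by (rewrite Cmod_mult; ring).
      rewrite H2. pose proof (Cmod_le_Rabs_plus (a, - e)) as K. change (Re (a, - e)) with a in K. change (Im (a, - e)) with (- e) in K.
      rewrite Rabs_Ropp, !Rabs_right in K by lra. lra.
    + intros X. generalize (Far (X ^ 2)). apply filter_imp. intros t [a [Ha [_ [H1 H2]]]].
      pose proof (Re_le_Cmod (- Ci * path_sqrt t * (- Ci * path_sqrt t))%C) as K. rewrite H2 in K at 1.
      change (Re (a, - e)) with a in K. rewrite Cmod_mult in K.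
      pose proof (Cmod_ge_0 (- Ci * path_sqrt t)%C). nra.
Qed.

(** |arg sg| < pi/4 and |arg rho| <= pi/6, so the arguments add up to less than pi/2. *)
Lemma Re_mult_near_1 (rho sg : C) : Cmod (rho - 1) <= 1 / 2 -> 0 < Re sg -> 0 < Re (sg * sg)%C -> 0 < Re (rho * sg)%C.
Proof.
  intros Hr H1 H2.
  rewrite Re_mult in H2.
  assert (Hm : Cmod sg < 2 * Re sg).
  { pose proof (Cmod_sqr sg) as E. pose proof (Cmod_ge_0 sg). nra. }
  pose proof (re_le_Cmod ((rho - 1) * sg)%C) as B. rewrite Cmod_mult in B.
  apply Rabs_le_between in B. pose proof (Cmod_ge_0 sg).
  replace (Re (rho * sg)%C) with (Re sg + Re ((rho - 1) * sg)%C) by (unfold Re, Im; simpl; ring).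
  nra.
Qed.

Lemma Re_Cinv (v : C) : Re (/ v)%C = Re v / Cmod v ^ 2.
Proof. rewrite Cmod_sqr. reflexivity. Qed.

(** At the cusp y = -i u tends to 0 and its dual to infinity. Duality replaces the sum by one with
    an unchanging Gaussian factor and argument q, where q^2 = dual y - dual tp. *)
Lemma climit_path_cusp (K : R) :
  at_right 0 (fun t => Cmod (u t) <= K * Im (u t)) -> climit (at_right 0) u 0%C ->
  climit (at_right 0) (fun t => CSeries (half_term (derf (path_sqrt t)))) (- (kap / Csqrt tp) * (1 / 2 * signed_c))%C.
Proof.
  intros Hcone H0.
  pose proof (slit_neq_0 _ (Re_pos_slit _ Htp)) as Nt.
  pose proof (Csqrt_Re_pos _ (Re_pos_slit _ Htp)) as Hst.
  pose proof (slit_neq_0 _ (Re_pos_slit _ Hst)) as Nst.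
  pose proof (Csqrt_sqr tp Nt) as Est.
  assert (Nk : RtoC kk <> 0%C) by (intros Z; apply RtoC_inj in Z; lra).
  set (st := Csqrt tp) in *.
  set (y := fun t => (- Ci * u t)%C).
  set (q := fun t => (path_sqrt t / (kk * st * Csqrt (y t)))%C).
  assert (Pos : at_right 0 (fun t => 0 < t)) by (exists (mkposreal 1 Rlt_0_1); auto).
  assert (HK : 0 < K).
  { destruct (filter_ex _ (filter_and _ _ Pos Hcone)) as [t [Ht Hc]].
    pose proof (Hupper t Ht). pose proof (im_le_Cmod (u t)) as B. rewrite Rabs_right in B by lra. nra. }
  assert (Ls : climit (at_right 0) path_sqrt st).
  { intros eps He. pose proof (Cdiff_Csqrt _ (Re_pos_slit _ Htp)) as D. fold st in D.
    destruct (D 1 Rlt_0_1) as [d [Hd HD]]. set (L := (/ (2 * st))%C) in *.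
    pose proof (Cmod_ge_0 L).
    assert (He2 : 0 < Rmin (d / 2) (eps / (1 + Cmod L))) by (apply Rmin_pos; [lra|apply Rdiv_lt_0_compat; lra]).
    generalize (H0 _ He2). apply filter_imp. intros t Ht.
    rewrite Cminus_0_r in Ht.
    assert (T : Cmod (Ci * u t) = Cmod (u t)) by (rewrite Cmod_mult, Cmod_Ci; ring).
    pose proof (Rmin_l (d / 2) (eps / (1 + Cmod L))). pose proof (Rmin_r (d / 2) (eps / (1 + Cmod L))).
    specialize (HD (Ci * u t)%C ltac:(lra)). unfold path_sqrt.
    replace (Csqrt (tp + Ci * u t) - st)%C with ((Csqrt (tp + Ci * u t) - st - L * (Ci * u t)) + L * (Ci * u t))%C by ring.
    eapply Rle_trans; [apply Cmod_triangle|].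
    fold st in HD. rewrite (Cmod_mult L), T in *.
    apply Rle_trans with ((1 + Cmod L) * (eps / (1 + Cmod L))); [|right; field; lra].
    apply Rle_trans with ((1 + Cmod L) * Cmod (u t)); [lra|apply Rmult_le_compat_l; lra]. }
  set (c := Cmod (dual tp)).
  assert (Hc0' : 0 <= c) by apply Cmod_ge_0.
  assert (Near : forall X, at_right 0 (fun t => 0 < t /\ Cmod (u t) <= K * Im (u t) /\
     Cmod (path_sqrt t / st - 1) <= 1 / 2 /\ X <= / (kk ^ 2 * Cmod (u t)))).
  { intros X.
    assert (E1 : 0 < Cmod st / 2) by (apply Cmod_gt_0 in Nst; lra).
    pose proof (Rabs_pos X).
    assert (Hk2 : 0 < kk ^ 2) by nra.
    assert (E2 : 0 < / (kk ^ 2 * (Rabs X + 1))) by (apply Rinv_0_lt_compat; nra).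
    generalize (filter_and _ _ (filter_and _ _ Pos Hcone) (filter_and _ _ (Ls _ E1) (H0 _ E2))).
    apply filter_imp. intros t [[Ht Hc] [Hs Hx]]. rewrite Cminus_0_r in Hx.
    split; [exact Ht|split; [exact Hc|split]].
    - replace (path_sqrt t / st - 1)%C with ((path_sqrt t - st) * / st)%C by (field; exact Nst).
      rewrite Cmod_mult, Cmod_inv by exact Nst. apply Cmod_gt_0 in Nst.
      apply Rle_trans with (Cmod st / 2 * / Cmod st); [|right; field; lra].
      apply Rmult_le_compat_r; [left; apply Rinv_0_lt_compat; lra|exact Hs].
    - assert (Hup : 0 < Cmod (u t)).
      { pose proof (Hupper t Ht). pose proof (im_le_Cmod (u t)) as B. rewrite Rabs_right in B by lra. lra. }
      apply Rle_trans with (Rabs X + 1); [pose proof (Rle_abs X); lra|].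
      replace (Rabs X + 1) with (/ (kk ^ 2 * (/ (kk ^ 2 * (Rabs X + 1))))) by (field; split; lra).
      apply Rinv_le_contravar; [apply Rmult_lt_0_compat; lra|]. apply Rmult_le_compat_l; lra. }
  (* D = 1/(k^2 |u|) is the modulus of dual y, and the cone condition gives Re(dual y) >= D/K. Once
     D >= 2Kc and D >= c, this yields Re(q^2) >= D/(2K) and |q|^2 <= 2D, hence the sector constant
     1/(4K). *)
  assert (Sec : forall t, 0 < t -> Cmod (u t) <= K * Im (u t) -> Cmod (path_sqrt t / st - 1) <= 1 / 2 ->
     2 * K * c <= / (kk ^ 2 * Cmod (u t)) -> c <= / (kk ^ 2 * Cmod (u t)) ->
     sector (/ (4 * K)) (q t) /\ / (kk ^ 2 * Cmod (u t)) <= 2 * K * Cmod (q t) ^ 2).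
  { intros t Ht Hc Hs Hb Hb'.
    destruct (path_sqrt_sqr t Ht) as [N [E P]]. fold (y t) in E, P.
    pose proof (slit_neq_0 _ (Re_pos_slit _ P)) as Ny.
    pose proof (Csqrt_Re_pos _ (Re_pos_slit _ P)) as Hsy.
    pose proof (slit_neq_0 _ (Re_pos_slit _ Hsy)) as Nsy.
    pose proof (Csqrt_sqr _ Ny) as Esy.
    pose proof (Hupper t Ht) as Hi.
    assert (Eq : (q t * q t)%C = (dual (y t) - dual tp)%C).
    { unfold q, dual.
      transitivity ((path_sqrt t * path_sqrt t) / (kk ^ 2 * (st * st) * (Csqrt (y t) * Csqrt (y t))))%C.
      - simpl. field. repeat split; assumption.
      - rewrite Est, Esy. replace (path_sqrt t * path_sqrt t)%C with (tp - y t)%C by (rewrite <- E; ring).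
        field. repeat split; assumption. }
    assert (My : Cmod (y t) = Cmod (u t)).
    { unfold y. rewrite Cmod_mult, Cmod_opp, Cmod_Ci. ring. }
    set (D := / (kk ^ 2 * Cmod (u t))) in *.
    assert (HDd : Cmod (dual (y t)) = D).
    { unfold dual. rewrite Cmod_inv by (apply Cmult_neq_0; [simpl; repeat apply Cmult_neq_0; try assumption; apply C1_nz|exact Ny]).
      rewrite Cmod_mult, My. unfold D. f_equal. f_equal.
      rewrite <- RtoC_pow, Cmod_R, Rabs_right; [reflexivity|]. apply Rle_ge, pow2_ge_0. }
    assert (Hup : 0 < Cmod (u t)) by (rewrite <- My; apply Cmod_gt_0, Ny).
    assert (Hk2 : 0 < kk ^ 2) by nra.
    assert (HD0 : 0 < D) by (apply Rinv_0_lt_compat; nra).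
    assert (HDr : D / K <= Re (dual (y t))).
    { unfold dual. rewrite Re_Cinv, Cmod_mult, My.
      rewrite <- RtoC_pow, Cmod_R, (Rabs_right (kk ^ 2)) by lra.
      replace (Re ((kk ^ 2)%R * y t)%C) with (kk ^ 2 * Im (u t)) by (unfold y, Re, Im; simpl; ring).
      replace (D / K) with (kk ^ 2 * (Cmod (u t) / K) / (kk ^ 2 * Cmod (u t)) ^ 2)
        by (unfold D; field; repeat split; lra).
      unfold Rdiv at 1 3. apply Rmult_le_compat_r; [left; apply Rinv_0_lt_compat, pow_lt; nra|].
      apply Rmult_le_compat_l; [lra|]. apply Rmult_le_reg_r with K; [exact HK|].
      replace (Cmod (u t) / K * K) with (Cmod (u t)) by (field; lra). lra. }
    assert (Cq : Cmod (q t) ^ 2 = Cmod (q t * q t)%C) by (rewrite Cmod_mult; ring).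
    assert (HRe : D / (2 * K) <= Re (q t * q t)%C).
    { rewrite Eq. change (Re (dual (y t) - dual tp)%C) with (Re (dual (y t)) - Re (dual tp)).
      pose proof (Re_le_Cmod (dual tp)) as Bc. fold c in Bc.
      assert (c <= D / (2 * K)).
      { apply Rmult_le_reg_r with (2 * K); [lra|]. replace (D / (2 * K) * (2 * K)) with D by (field; lra). lra. }
      replace (D / K) with (D / (2 * K) + D / (2 * K)) in HDr by (field; lra). lra. }
    assert (HMod : Cmod (q t) ^ 2 <= 2 * D).
    { rewrite Cq, Eq. eapply Rle_trans; [apply Cmod_triangle_minus|]. rewrite HDd. fold c. lra. }
    split; [split|].
    (* Near the cusp the root divided by [st] is close to 1, so the sign of Re q is decided by
       1/sqrt(y), whose square has positive real part. *)
    - replace (q t) with (/ kk * (path_sqrt t / st * / Csqrt (y t)))%C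
        by (unfold q; field; repeat split; assumption).
      rewrite <- RtoC_inv by lra.
      replace (Re ((/ kk)%R * (path_sqrt t / st * / Csqrt (y t)))%C) with (/ kk * Re (path_sqrt t / st * / Csqrt (y t))%C)
        by (rewrite (Re_mult (RtoC (/ kk))); change (Re (RtoC (/ kk))) with (/ kk); change (Im (RtoC (/ kk))) with 0; ring).
      apply Rmult_lt_0_compat; [apply Rinv_0_lt_compat, Hkk|].
      apply Re_mult_near_1; [exact Hs|apply Re_inv_pos, Hsy|].
      replace (/ Csqrt (y t) * / Csqrt (y t))%C with (/ y t)%C by (rewrite <- Esy at 1; field; exact Nsy).
      apply Re_inv_pos, P.
    - eapply Rle_trans; [|exact HRe]. replace (D / (2 * K)) with (/ (4 * K) * (2 * D)) by (field; lra).
      apply Rmult_le_compat_l; [left; apply Rinv_0_lt_compat; lra|exact HMod].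
    - rewrite Cq. pose proof (Re_le_Cmod (q t * q t)%C) as B.
      apply Rle_trans with (2 * K * (D / (2 * K))); [right; field; lra|]. apply Rmult_le_compat_l; lra. }
  assert (Lc : climit (at_right 0) (fun t => CSeries (half_term (fun m => cterm (dual tp) w m * (1 * Erf (m * q t)))%C)) (1 / 2 * signed_c)%C).
  { destruct (cterm_majorant (Re (dual tp)) (dual_Re _ Htp)) as [A [HA MA]].
    apply (climit_erf_sum (at_right 0) (cterm (dual tp) w) A (1 / 2) (fun m => m) q (/ (4 * K)) 1 HA).
    - apply Rinv_0_lt_compat; lra.
    - lra.
    - apply Rabs_R1.
    - intros n m Hm. eapply Rle_trans; [|apply (MA (dual tp) w n m (Rle_refl _) Hm)].
      destruct (one_le_sqr_weight m) as [W1 _]. pose proof (Cmod_ge_0 (cterm (dual tp) w m)). nra.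
    - intros m Hm. split; [exact Hm|reflexivity].
    - generalize (Near (Rmax (2 * K * c) c)). apply filter_imp. intros t [N1 [N2 [N3 N4]]].
      pose proof (Rmax_l (2 * K * c) c). pose proof (Rmax_r (2 * K * c) c).
      apply Sec; try assumption; lra.
    - intros X. generalize (Near (Rmax (2 * K * X ^ 2) (Rmax (2 * K * c) c))). apply filter_imp. intros t [N1 [N2 [N3 N4]]].
      pose proof (Rmax_l (2 * K * c) c). pose proof (Rmax_r (2 * K * c) c).
      pose proof (Rmax_l (2 * K * X ^ 2) (Rmax (2 * K * c) c)). pose proof (Rmax_r (2 * K * X ^ 2) (Rmax (2 * K * c) c)).
      destruct (Sec t) as [_ B]; try assumption; try lra.
      pose proof (Cmod_ge_0 (q t)).
      assert (X ^ 2 <= Cmod (q t) ^ 2) by (apply Rmult_le_reg_l with (2 * K); lra). nra. }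
  apply (climit_ext (at_right 0) (fun t => - (kap / st) * CSeries (half_term (fun m => cterm (dual tp) w m * (1 * Erf (m * q t)))))%C).
  - revert Pos. apply filter_imp. intros t Ht.
    destruct (path_sqrt_sqr t Ht) as [N [E P]].
    rewrite derf_cerf_duality by (rewrite E; exact P). rewrite E. fold st. fold (y t). f_equal.
    apply CSeries_ext. intros n. apply half_term_ext. intros m. unfold cerf. fold (cterm (dual tp) w m). fold (q t). ring.
  - apply climit_scal; [apply _|exact Lc].
Qed.

(** Difference of the end limits of the primitive: the normalisation -2 meets -1/2 at i infinity and
    -(kap/sqrt tp)/2 at the cusp, and the latter is subtracted. *)
Theorem eichler_path_integral (J : R -> C) (a : C) (K e : R) :
  (forall t, 0 < t -> J t = (a * path_form t)%C) ->
  at_right 0 (fun t => Cmod (u t) <= K * Im (u t)) -> climit (at_right 0) u 0%C -> 0 < e ->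
  Rbar_locally p_infty (fun t => Im (tp + Ci * u t)%C = e) ->
  (forall X, Rbar_locally p_infty (fun t => X <= Im (u t))) ->
  RInt_gen (V := C_R_CompleteNormedModule) J (at_right 0) (Rbar_locally p_infty) =
  (a * (signed_d - kap / Csqrt tp * signed_c))%C.
Proof.
  intros HJ Hcone H0 He Hline Hup.
  rewrite (improper_integral J (fun t => a * (- (2) * CSeries (half_term (derf (path_sqrt t)))))%C
    (a * (- (2) * (- (kap / Csqrt tp) * (1 / 2 * signed_c))))%C (a * (- (2) * (RtoC (-1) / 2 * signed_d)))%C).
  - replace (RtoC (-1)) with (- (1))%C by (rewrite <- RtoC_opp; reflexivity).
    match goal with |- ?l = ?r => change (@eq C l r) end. field.
    apply slit_neq_0, Re_pos_slit, Csqrt_Re_pos, Re_pos_slit, Htp.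
  - intros t Ht. rewrite HJ by exact Ht. apply cderiv_scal, cderiv_path_primitive, Ht.
  - intros t Ht. rewrite HJ by exact Ht.
    apply (climit_ext (locally t) (fun t => a * path_form t)%C).
    + generalize (locally_pos t Ht). apply filter_imp. intros x Hx. symmetry. apply HJ, Hx.
    + apply climit_scal; [apply _|]. apply climit_path_form, Ht.
  - apply climit_scal; [apply _|]. apply climit_scal; [apply _|]. exact (climit_path_cusp K Hcone H0).
  - apply climit_scal; [apply _|]. apply climit_scal; [apply _|]. exact (climit_path_end e He Hline Hup).
Qed.

End eichler.

(** * The two expansions of U_1 and the value of E *)

Definition cusp_phase (k a : Z) (m : R) : C := Cexp (PI * Ci * m ^ 2 * (IZR a / IZR k)).

Lemma Cmod_cusp_phase (k a : Z) (m : R) : (1 <= k)%Z -> Cmod (cusp_phase k a m) = 1.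
Proof.
  intros Hk. assert (Hk0 : 0 < IZR k) by (apply IZR_lt; lia).
  unfold cusp_phase. rewrite Cmod_Cexp, <- exp_0. f_equal.
  rewrite <- RtoC_div by lra. unfold Re, Im; simpl; ring.
Qed.

(** The constant [kap] of the Eichler section; the factor zeta8/sqrt(k) converts sqrt(1/(k Z0)) into
    sqrt(i Z0), see [cusp_const_eq]. *)
Definition cusp_const (k h h' : Z) : C := (chi (Mhk h k h') ^ 3 * zeta8 / sqrt (IZR k))%C.

Lemma Ci_neq_0 : Ci <> 0%C.
Proof. intros K. apply (f_equal Im) in K. simpl in K. lra. Qed.

Lemma Csqrt_Ci_mult (y : C) : 0 < Re y -> Csqrt (Ci * y) = (zeta8 * Csqrt y)%C.
Proof.
  intros Hy. assert (H : 0 < Im (Ci * y)%C) by (unfold Re, Im in *; simpl; lra).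
  pose proof (Csqrt_rotate _ H) as E.
  replace (- Ci * (Ci * y))%C with y in E
    by (assert (EC : (Ci * Ci = -(1))%C) by Ccomp; transitivity (- (Ci * Ci) * y)%C; [rewrite EC|]; ring).
  rewrite E. field. exact zeta8_neq_0.
Qed.

Lemma Csqrt_inv_scal (k : R) (y : C) : 0 < k -> 0 < Re y -> Csqrt (/ (k * y)) = (/ (sqrt k * Csqrt y))%C.
Proof.
  intros Hk Hy. pose proof (sqrt_lt_R0 k Hk) as Hs.
  pose proof (slit_neq_0 _ (Re_pos_slit _ Hy)) as Ny.
  pose proof (Csqrt_Re_pos _ (Re_pos_slit _ Hy)) as Hsy.
  pose proof (slit_neq_0 _ (Re_pos_slit _ Hsy)) as Nsy.
  assert (Ns : RtoC (sqrt k) <> 0%C) by (intros K; apply RtoC_inj in K; lra).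
  symmetry. apply Csqrt_unique.
  - apply Re_inv_pos. rewrite Re_mult. change (Re (RtoC (sqrt k))) with (sqrt k). change (Im (RtoC (sqrt k))) with 0. nra.
  - rewrite <- (Csqrt_sqr y Ny) at 3. rewrite <- (sqrt_sqrt k) at 3 by lra. rewrite RtoC_mult.
    field. split; assumption.
Qed.

(** Completing the square turns the elliptic variable w/(i Z0) into the real shift m - k w, at the
    price of a Gaussian factor in w. *)
Lemma theta_term_dual_cusp (k a : Z) (Z0 : C) (w m : R) : (1 <= k)%Z -> Z0 <> 0%C ->
  theta_term (w / (Ci * Z0)) (IZR a / IZR k + Ci / (IZR k * Z0)) m =
  (Cexp (PI * IZR k * (w * w) / Z0) * dterm (IZR k) (cusp_phase k a) (/ (IZR k * Z0)) w m)%C.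
Proof.
  intros Hk NZ. assert (Hk0 : 0 < IZR k) by (apply IZR_lt; lia).
  assert (Nk : RtoC (IZR k) <> 0%C) by (intros K; apply RtoC_inj in K; lra).
  assert (EC : (Ci * Ci = -(1))%C) by Ccomp.
  unfold theta_term, dterm, cusp_phase. rewrite <- !Cexp_plus. f_equal.
  replace (w / (Ci * Z0))%C with (- Ci * (w / Z0))%C.
  2: { transitivity (- (Ci * Ci) * (w / Z0) / Ci)%C; [|rewrite EC]; field; split; try assumption; exact Ci_neq_0. }
  transitivity (PI * Ci * m ^ 2 * (IZR a / IZR k) + (Ci * Ci) * (PI * m ^ 2 / (IZR k * Z0)) - (Ci * Ci) * (2 * PI * w * m / Z0))%C.
  - simpl. field. repeat split; assumption.
  - rewrite EC. simpl. field. split; assumption.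
Qed.

Lemma theta_term_cusp (k a : Z) (Z0 : C) (w m : R) : (1 <= k)%Z -> Z0 <> 0%C ->
  theta_term w (IZR a / IZR k + Ci * Z0 / IZR k) m =
  cterm (cusp_phase k a) (dual (IZR k) (/ (IZR k * Z0))) w m.
Proof.
  intros Hk NZ. assert (Hk0 : 0 < IZR k) by (apply IZR_lt; lia).
  assert (Nk : RtoC (IZR k) <> 0%C) by (intros K; apply RtoC_inj in K; lra).
  assert (EC : (Ci * Ci = -(1))%C) by Ccomp.
  unfold theta_term, cterm, cusp_phase, dual. rewrite <- Cexp_plus. f_equal.
  transitivity (PI * Ci * m ^ 2 * (IZR a / IZR k) + (Ci * Ci) * (PI * m ^ 2 * Z0 / IZR k) + 2 * PI * Ci * w * m)%C.
  - simpl. field. assumption.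
  - rewrite EC. simpl. field. split; assumption.
Qed.

Lemma cusp_const_eq (k h h' : Z) (Z0 : C) : (1 <= k)%Z -> 0 < Re Z0 ->
  (cusp_const k h h' / Csqrt (/ (IZR k * Z0)))%C = (chi (Mhk h k h') ^ 3 * Csqrt (Ci * Z0))%C.
Proof.
  intros Hk HZ. assert (Hk0 : 0 < IZR k) by (apply IZR_lt; lia).
  pose proof (sqrt_lt_R0 _ Hk0) as Hs.
  assert (Ns : RtoC (sqrt (IZR k)) <> 0%C) by (intros K; apply RtoC_inj in K; lra).
  rewrite Csqrt_inv_scal, Csqrt_Ci_mult by assumption. unfold cusp_const. field.
  split; [|exact Ns]. apply slit_neq_0, Re_pos_slit, Csqrt_Re_pos, Re_pos_slit, HZ.
Qed.

(** Every y with positive real part is 1/(k Z0) for some Z0 of positive real part, so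
    [cusp_transformation] covers all parameters met along the path. *)
Lemma cusp_theta_dual (k h h' : Z) : (1 <= k)%Z -> (0 <= h < k)%Z -> is_neg_inv h k h' ->
  forall y w, 0 < Re y ->
  CSeries (half_term (dterm (IZR k) (cusp_phase k h') y w)) =
  (cusp_const k h h' / Csqrt y * CSeries (half_term (cterm (cusp_phase k h) (dual (IZR k) y) w)))%C.
Proof.
  intros Hk Hh Hi y w Hy. assert (Hk0 : 0 < IZR k) by (apply IZR_lt; lia).
  assert (Nk : RtoC (IZR k) <> 0%C) by (intros K; apply RtoC_inj in K; lra).
  pose proof (slit_neq_0 _ (Re_pos_slit _ Hy)) as Ny.
  pose proof (Csqrt_Re_pos _ (Re_pos_slit _ Hy)) as Hsy.
  pose proof (slit_neq_0 _ (Re_pos_slit _ Hsy)) as Nsy.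
  pose proof (sqrt_lt_R0 _ Hk0) as Hs.
  assert (Ns : RtoC (sqrt (IZR k)) <> 0%C) by (intros K; apply RtoC_inj in K; lra).
  set (Z0 := (/ (IZR k * y))%C).
  assert (HZ : 0 < Re Z0).
  { apply Re_inv_pos. rewrite Re_mult. change (Re (RtoC (IZR k))) with (IZR k). change (Im (RtoC (IZR k))) with 0. nra. }
  assert (NZ : Z0 <> 0%C) by (apply slit_neq_0, Re_pos_slit, HZ).
  destruct (cusp_transformation k h h' Z0 Hk Hh Hi HZ) as [NX [_ T]].
  destruct (cusp_points k h Z0 Hk HZ) as [Ht _]. destruct (cusp_points k h' Z0 Hk HZ) as [_ Ht'].
  cbv zeta in *.
  set (tau := (IZR h / IZR k + Ci * Z0 / IZR k)%C) in *. set (tau' := (IZR h' / IZR k + Ci / (IZR k * Z0))%C) in *.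
  specialize (T w). rewrite !vartheta_CSeries in T by assumption.
  assert (ES : Csqrt (Ci * Z0) = (zeta8 * / (sqrt (IZR k) * Csqrt y))%C)
    by (rewrite Csqrt_Ci_mult by exact HZ; f_equal; apply Csqrt_inv_scal; assumption).
  rewrite ES in T.
  assert (Ey : (/ (IZR k * Z0))%C = y) by (unfold Z0; field; split; assumption).
  assert (E1 : CSeries (half_term (theta_term (w / (Ci * Z0)) tau')) =
    (Cexp (PI * IZR k * (w * w) / Z0) * CSeries (half_term (dterm (IZR k) (cusp_phase k h') y w)))%C).
  { rewrite <- half_sum_scal.
    - apply CSeries_ext. intros n. apply half_term_ext. intros m. rewrite <- Ey.
      apply theta_term_dual_cusp; assumption.
    - apply half_summable_ext with (fun m => 1 * dterm (IZR k) (cusp_phase k h') y w m)%C; [intros; ring|].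
      apply (dterm_summable (IZR k) (cusp_phase k h') Hk0 (fun m => Cmod_cusp_phase k h' m Hk) y w _ 1 Hy).
      intros m. rewrite Cmod_1. destruct (one_le_sqr_weight m). lra. }
  assert (E2 : CSeries (half_term (theta_term w tau)) = CSeries (half_term (cterm (cusp_phase k h) (dual (IZR k) y) w))).
  { apply CSeries_ext. intros n. apply half_term_ext. intros m. rewrite <- Ey. apply theta_term_cusp; assumption. }
  rewrite E1, E2 in T. unfold cusp_const.
  set (S1 := CSeries _) in *. set (S2 := CSeries (half_term (cterm _ _ _))) in *. set (G := Cexp _) in *.
  assert (NG : G <> 0%C) by apply Cexp_neq_0.
  apply (Cmult_cancel_r _ _ (Ci * G)%C); [apply Cmult_neq_0; [exact Ci_neq_0|assumption]|].
  transitivity (Ci * (G * S1))%C; [ring|]. rewrite T. simpl. field. split; assumption.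
Qed.

(** * The quotient of Cstar by eta *)

Lemma Cinv_0 : (/ 0)%C = 0%C.
Proof. unfold Cinv, RtoC. simpl. f_equal; unfold Rdiv; ring. Qed.

(** The reciprocal of [Cstar] over [eta], and at the same time theta stripped of its sine factor and
    of one eta; through it the transformation of theta passes to the quotient. *)
Definition theta_product (z tau : C) : C :=
  let q := e2pi tau 1 in (e2pi tau (/ 12)%R * (qpoch (e2pi z 1 * q) q * qpoch (e2pi z (-1) * q) q))%C.

Lemma e2pi_plus (x : C) (a b : R) : e2pi x (a + b) = (e2pi x a * e2pi x b)%C.
Proof. unfold e2pi. rewrite <- Cexp_plus, RtoC_plus. f_equal. ring. Qed.

Lemma e2pi_opp (x : C) (a : R) : e2pi x (- a) = (/ e2pi x a)%C.
Proof. unfold e2pi. rewrite <- Cexp_opp, RtoC_opp. f_equal. ring. Qed.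

(* The zeros of the product are no exception, as [/ 0 = 0]. *)
Lemma Cstar_over_eta (z tau : C) : 0 < Im tau -> (Cstar z tau / eta tau)%C = (/ theta_product z tau)%C.
Proof.
  intros H. pose proof (qpoch_self_neq_0 _ (Cmod_e2pi_1 _ H)) as Nq.
  unfold Cstar, eta, theta_product. set (q := e2pi tau 1) in *.
  replace (/ 12) with (/ 24 + / 24) by field. rewrite e2pi_plus, e2pi_opp.
  assert (N24 : e2pi tau (/ 24) <> 0%C) by apply Cexp_neq_0.
  set (P := (qpoch (e2pi z 1 * q) q * qpoch (e2pi z (-1) * q) q)%C).
  destruct (Ceq_dec P 0) as [E|E].
  - rewrite E, Cmult_0_r. unfold Cdiv. rewrite Cinv_0. ring.
  - field. repeat split; assumption.
Qed.

Lemma vartheta_product (z tau : C) : 0 < Im tau ->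
  vartheta z tau = (Ci * (Cexp (PI * Ci * z) - Cexp (- (PI * Ci * z))) * eta tau * theta_product z tau)%C.
Proof.
  intros H. rewrite jacobi_triple_product by exact H. cbv zeta. unfold eta, theta_product.
  replace (Cexp (PI * Ci * tau / 4)) with (e2pi tau (/ 24) * e2pi tau (/ 12))%C.
  - ring.
  - rewrite <- e2pi_plus. unfold e2pi. f_equal. replace (/ 24 + / 12) with (/ 8) by field. rewrite RtoC_inv by lra. field.
Qed.

Lemma Cexp_pm_neq_0 (w : C) : Re w <> 0 -> (Cexp w - Cexp (- w))%C <> 0%C.
Proof.
  intros H E. assert (K : Cexp w = Cexp (- w)) by (transitivity (Cexp w - Cexp (- w) + Cexp (- w))%C; [ring|rewrite E; ring]).
  apply (f_equal Cmod) in K. rewrite !Cmod_Cexp in K. apply exp_inv in K.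
  change (Re (- w)%C) with (- Re w) in K. lra.
Qed.

Lemma sinh_product_neq_0 (z : R) (Z0 : C) : 0 < Re Z0 -> z <> 0 ->
  (Cexp (PI * z / Z0) - Cexp (- (PI * z / Z0)))%C <> 0%C.
Proof.
  intros HZ Nz. apply Cexp_pm_neq_0. pose proof (Re_inv_pos _ HZ) as HI. pose proof PI_RGT_0.
  replace (Re (PI * z / Z0)%C) with (PI * z * Re (/ Z0)%C) by (unfold Cdiv, Re, Im; simpl; ring).
  apply Rmult_integral_contrapositive_currified; [|lra]. apply Rmult_integral_contrapositive_currified; lra.
Qed.

Lemma sin_product_neq_0 (z : R) : z <> 0 -> Rabs z < 1 -> (Cexp (PI * Ci * z) - Cexp (- (PI * Ci * z)))%C <> 0%C.
Proof.
  intros Hz H1 E. apply (f_equal Im) in E. unfold Cexp in E. simpl in E.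
  replace (PI * 0 - 0 * 1) with 0 in E by ring.
  assert (S : sin (PI * z) <> 0).
  { pose proof PI_RGT_0. destruct (Rabs_def2 _ _ H1).
    destruct (Rlt_dec 0 z).
    - apply Rgt_not_eq, sin_gt_0; nra.
    - replace (PI * z) with (- (PI * - z)) by ring. rewrite sin_neg.
      apply Ropp_neq_0_compat, Rgt_not_eq, sin_gt_0; nra. }
  apply S.
  revert E. repeat match goal with |- context [sin ?x] => lazymatch x with PI * z => fail | - (PI * z) => fail | _ =>
    first [replace x with (PI * z) by ring | replace x with (- (PI * z)) by ring] end end.
  repeat match goal with |- context [exp ?x] => lazymatch x with 0 => fail | _ => replace x with 0 by ring end end.
  rewrite sin_neg, exp_0. lra.
Qed.

(** Dividing the theta transformation by that of eta leaves sine over sinh and an exponential, which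
    is [f_nu]. The two products vanish together, so the convention / 0 = 0 respects the identity. *)
Lemma Cstar_transformation (k h h' : Z) (Z0 : C) (z : R) :
  (1 <= k)%Z -> (0 <= h < k)%Z -> is_neg_inv h k h' -> 0 < Re Z0 -> Rabs (IZR k * z) < 1 / 4 ->
  let tau := (IZR h / IZR k + Ci * Z0 / IZR k)%C in
  let tau' := (IZR h' / IZR k + Ci / (IZR k * Z0))%C in
  let z' := (z / (Ci * Z0))%C in
  (Cstar z tau / eta tau)%C =
  (Ci * chi (Mhk h k h') ^ 2 * f_nu (IZR k) z Z0 * (Cstar z' tau' / eta tau'))%C.
Proof.
  intros Hk Hh Hi HZ Hz tau tau' z'.
  assert (Hk0 : 1 <= IZR k) by (apply IZR_le; lia).
  destruct (cusp_transformation k h h' Z0 Hk Hh Hi HZ) as [NX [Te T]].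
  destruct (cusp_points k h Z0 Hk HZ) as [Ht _]. destruct (cusp_points k h' Z0 Hk HZ) as [_ Ht'].
  cbv zeta in NX, T, Te. fold tau in Ht, T, Te. fold tau' in Ht', T, Te. specialize (T z). fold z' in T.
  set (X := chi (Mhk h k h')) in *. change (X <> 0%C) in NX.
  assert (NZ : Z0 <> 0%C) by (apply slit_neq_0, Re_pos_slit, HZ).
  assert (NCi : Ci <> 0%C) by (intros K; apply (f_equal Im) in K; simpl in K; lra).
  assert (NCZ : (Ci * Z0)%C <> 0%C) by (apply Cmult_neq_0; assumption).
  pose proof (Csqrt_sqr _ NCZ) as Es. set (s := Csqrt (Ci * Z0)) in *.
  assert (Ns : s <> 0%C) by (intros K; apply NCZ; rewrite <- Es, K; ring).
  pose proof (eta_neq_0 _ Ht) as Ne. pose proof (eta_neq_0 _ Ht') as Ne'.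
  rewrite !Cstar_over_eta by assumption.
  unfold f_nu. destruct (Ceq_dec z 0) as [E|E].
  (* At z = 0 sine and sinh vanish. The product degenerates to eta^2, and the value Z0 of [f_nu]
     comes from the factor i Z0 in the squared eta transformation. *)
  - assert (P0 : forall t, 0 < Im t -> theta_product 0 t = (eta t * eta t)%C).
    { intros t _. unfold theta_product, eta. replace (/ 12) with (/ 24 + / 24) by field. rewrite e2pi_plus.
      assert (E0 : forall r, e2pi 0 r = 1%C) by (intros r; unfold e2pi; rewrite Cmult_0_r; apply Cexp_0).
      rewrite !E0, !Cmult_1_l. ring. }
    assert (Ez' : z' = 0%C) by (unfold z'; rewrite E; unfold Cdiv; ring).
    rewrite Ez', E, !P0, Te by assumption.
    transitivity (/ (eta tau * eta tau) * ((Ci * Z0) / (s * s)))%C; [rewrite Es; field; repeat split; assumption|].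
    simpl. field. repeat split; assumption.
  - assert (Nz : z <> 0) by (intros K; apply E; rewrite K; reflexivity).
    assert (Hz1 : Rabs z < 1).
    { rewrite Rabs_mult, (Rabs_right (IZR k)) in Hz by lra. pose proof (Rabs_pos z). nra. }
    rewrite !vartheta_product, Te in T by assumption.
    pose proof (sin_product_neq_0 z Nz Hz1) as ND.
    pose proof (sinh_product_neq_0 z Z0 HZ Nz) as NE.
    replace (PI * Ci * z')%C with (PI * z / Z0)%C in T by (unfold z'; field; split; assumption).
    unfold Csin, Csinh. replace (Ci * (PI * z))%C with (PI * Ci * z)%C by ring.
    set (D := (Cexp (PI * Ci * z) - Cexp (- (PI * Ci * z)))%C) in *.
    set (F := (Cexp (PI * z / Z0) - Cexp (- (PI * z / Z0)))%C) in *.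
    set (G := Cexp (PI * IZR k * (z * z) / Z0)) in *. assert (NG : G <> 0%C) by apply Cexp_neq_0.
    set (Q := theta_product z tau) in *. set (Q' := theta_product z' tau') in *.
    assert (EQ : (F * Q')%C = (X * X * G * D * Q)%C).
    { apply (Cmult_cancel_r _ _ (Ci * X * s * eta tau)%C); [apply Cmult_neq_0; [repeat apply Cmult_neq_0|]; assumption|].
      transitivity (Ci * F * (X * s * eta tau) * Q')%C; [ring|]. rewrite T. ring. }
    destruct (Ceq_dec Q 0) as [EQ0|NQ].
    + assert (Q0' : Q' = 0%C).
      { apply (Cmult_cancel_r _ _ F NE). rewrite Cmult_comm, EQ, EQ0. ring. }
      rewrite EQ0, Q0', Cinv_0. ring.
    + assert (NQ' : Q' <> 0%C).
      { intros K. rewrite K, Cmult_0_r in EQ. symmetry in EQ. revert EQ. apply Cmult_neq_0; [repeat apply Cmult_neq_0|]; assumption. }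
      replace Q with (F * Q' / (X * X * G * D))%C by (rewrite EQ; field; repeat split; assumption).
      simpl. field. repeat split; assumption.
Qed.

(** The sign comes from the oddness of sinh, and the exponents combine as -3 + 4 = 1, where 4 is due
    to the doubled argument 2z of the theta series. This explains the index 3k beside k in the
    theorem. *)
Lemma f_nu_neg (nu : R) (z : R) (Z0 : C) : 0 < Re Z0 ->
  (f_nu (3 * nu) z (- Z0) * Cexp (PI * nu * ((2 * z)%R * (2 * z)%R) / Z0))%C = (- f_nu nu z Z0)%C.
Proof.
  intros HZ. assert (NZ : Z0 <> 0%C) by (apply slit_neq_0, Re_pos_slit, HZ).
  unfold f_nu. destruct (Ceq_dec z 0) as [E|E].
  - apply RtoC_inj in E. rewrite E, Rmult_0_r.
    replace (PI * nu * (0 * 0) / Z0)%C with (RtoC 0) by (field; exact NZ). rewrite Cexp_0. ring.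
  - assert (Nz : z <> 0) by (intros K; apply E; rewrite K; reflexivity).
    pose proof (sinh_product_neq_0 z Z0 HZ Nz) as NE.
    replace (PI * z / - Z0)%C with (- (PI * z / Z0))%C by (field; exact NZ).
    unfold Csinh. replace (- - (PI * z / Z0))%C with (PI * z / Z0)%C by ring.
    set (a := Cexp (PI * z / Z0)) in *. set (b := Cexp (- (PI * z / Z0))) in *.
    assert (EG : (Cexp (PI * nu * (z * z) / Z0))%C =
      (Cexp (PI * (3 * nu)%R * (z * z) / - Z0) * Cexp (PI * nu * ((2 * z)%R * (2 * z)%R) / Z0))%C).
    { rewrite <- Cexp_plus. f_equal. rewrite !RtoC_mult. field. exact NZ. }
    rewrite EG. replace (b - a)%C with (- (a - b))%C by ring.
    set (c := (a - b)%C) in *. field. exact NE.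
Qed.

Lemma half_summable_sign (s : R -> R) (u : R -> C) : half_summable u ->
  half_summable (fun m => sign (s m) * u m)%C.
Proof.
  assert (B : forall m, Cmod (sign (s m) * u m) <= Cmod (u m)).
  { intros m. rewrite Cmod_mult, Cmod_R. pose proof (sign_le_1 (s m)). pose proof (Cmod_ge_0 (u m)). nra. }
  intros [H1 H2]. split; [exact (csummable_le _ _ (fun n => B _) H1)|exact (csummable_le _ _ (fun n => B _) H2)].
Qed.

Lemma half_summable_scal (c : C) (u : R -> C) : half_summable u -> half_summable (fun m => c * u m)%C.
Proof. intros [H1 H2]. split; apply csummable_scal; assumption. Qed.

Lemma psi_CSeries (z tau : C) : 0 < Im tau ->
  psi z tau = (Ci * CSeries (half_term (fun m => sign (m + Im z / Im tau)%R * theta_term z tau m)%C))%C.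
Proof.
  intros H. unfold psi. f_equal.
  assert (E : forall m, (sign (m + Im z / Im tau)%R * theta_term z tau m)%C =
    (sign (m + Im z / Im tau)%R * e2pi tau (m ^ 2 / 2) * e2pi z m)%C).
  { intros m. rewrite <- Cmult_assoc. f_equal. unfold theta_term, e2pi. rewrite <- Cexp_plus. f_equal.
    rewrite RtoC_div, RtoC_pow by lra. field. }
  rewrite alt_half_sum_CSeries.
  - apply CSeries_ext. intros n. apply half_term_ext. intros m. symmetry. apply E.
  - apply half_summable_ext with (1 := E). apply half_summable_sign, theta_term_summable, H.
Qed.

Lemma U1_CSeries (z tau : C) : 0 < Im tau ->
  U1 z tau = (Cstar z tau / eta tau / 2 * (CSeries (half_term (theta_term (2 * z) tau)) +
    CSeries (half_term (fun m => sign (m + Im (2 * z)%C / Im tau)%R * theta_term (2 * z) tau m)%C)))%C.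
Proof.
  intros H. unfold U1. rewrite vartheta_CSeries, psi_CSeries by exact H.
  assert (EC : (Ci * Ci = -(1))%C) by Ccomp.
  set (S1 := CSeries _). set (S2 := CSeries (half_term (fun m => _))).
  transitivity (- (Ci * Ci) * (Cstar z tau / eta tau / 2 * (S1 + S2)))%C.
  - field. apply eta_neq_0, H.
  - rewrite EC. ring.
Qed.

Lemma continuous_climit (f : R -> C) (t : R) :
  continuous (fun s => Re (f s)) t -> continuous (fun s => Im (f s)) t -> climit (locally t) f (f t).
Proof.
  intros H1 H2 eps He. assert (He2 : 0 < eps / 2) by lra.
  pose proof (proj1 (filterlim_locally _ _) H1 (mkposreal _ He2)) as K1.
  pose proof (proj1 (filterlim_locally _ _) H2 (mkposreal _ He2)) as K2.
  generalize (filter_and _ _ K1 K2). apply filter_imp. intros s [A B].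
  change (Rabs (Re (f s - f t)%C) < eps / 2) in A. change (Rabs (Im (f s - f t)%C) < eps / 2) in B.
  pose proof (Cmod_le_Rabs_plus (f s - f t)). lra.
Qed.

Lemma filterlim_climit (F : (R -> Prop) -> Prop) {FF : Filter F} (f : R -> C) (l : C) :
  filterlim f F (locally l) -> climit F f l.
Proof.
  intros H eps He. assert (He2 : 0 < eps / 2) by lra.
  pose proof (proj1 (filterlim_locally _ _) H (mkposreal _ He2)) as K.
  revert K. apply filter_imp. intros s K.
  apply C_NormedModule_mixin_compat2 in K. change (minus (f s) l) with (f s - l)%C in K. simpl in K.
  (* Neighbourhoods of C are compared with the modulus at the cost of a factor sqrt 2, which eps/2
     absorbs. *)
  assert (sqrt 2 < 2) by (rewrite <- (sqrt_square 2) at 2 by lra; apply sqrt_lt_1; lra).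
  nra.
Qed.

(** * U1 and E in terms of signed theta series *)

Section cusp.

Variables (k h h' : Z) (Z0 : C) (z : R).
Hypothesis Hk : (1 <= k)%Z.
Hypothesis Hh : (0 <= h < k)%Z.
Hypothesis Hi : is_neg_inv h k h'.
Hypothesis HZ : 0 < Re Z0.
Hypothesis Hz : Rabs (IZR k * z) < 1 / 4.

Let tau := (IZR h / IZR k + Ci * Z0 / IZR k)%C.
Let tau' := (IZR h' / IZR k + Ci / (IZR k * Z0))%C.
Let w := 2 * z.
Let tp := (/ (IZR k * Z0))%C.
Let z2 := (2 * z / (Ci * Z0))%C.

Lemma cusp_facts : 0 < IZR k /\ RtoC (IZR k) <> 0%C /\ Z0 <> 0%C /\ 0 < Re tp /\ tau' = (IZR h' / IZR k + Ci * tp)%C.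
Proof.
  assert (Hk0 : 0 < IZR k) by (apply IZR_lt; lia).
  assert (Nk : RtoC (IZR k) <> 0%C) by (intros K; apply RtoC_inj in K; lra).
  split; [exact Hk0|split; [exact Nk|split; [apply slit_neq_0, Re_pos_slit, HZ|split; [|reflexivity]]]].
  apply Re_inv_pos. rewrite Re_mult. change (Re (RtoC (IZR k))) with (IZR k). change (Im (RtoC (IZR k))) with 0. nra.
Qed.

Lemma z2_eq : z2 = (w / (Ci * Z0))%C.
Proof. unfold z2, w. rewrite RtoC_mult. reflexivity. Qed.

(** z2 is -k w times i tp, and tau' differs from i tp by a real number, so the imaginary parts are
    proportional. *)
Lemma cusp_shift : Im z2 / Im tau' = - (IZR k * w).
Proof.
  destruct cusp_facts as [Hk0 [Nk [NZ [Ht Et]]]].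
  assert (E : z2 = ((- w)%R * (IZR k * (Ci * tp)))%C).
  { rewrite z2_eq. unfold tp.
    assert (EC : (Ci * Ci = -(1))%C) by Ccomp. rewrite RtoC_opp.
    transitivity (- (Ci * Ci) * w / (Ci * Z0))%C; [rewrite EC|]; field; repeat split; try assumption; exact Ci_neq_0. }
  rewrite E, Et.
  assert (Hx : Re tp <> 0) by lra. set (t := tp) in *.
  rewrite <- RtoC_div by lra.
  replace (Im ((- w)%R * (IZR k * (Ci * t)))%C) with (- (IZR k * w) * Re t) by (unfold Re, Im; simpl; ring).
  replace (Im ((IZR h' / IZR k)%R + Ci * t)%C) with (Re t) by (unfold Re, Im; simpl; ring).
  field. exact Hx.
Qed.

Lemma U1_cusp : U1 z tau = (Cstar z tau / eta tau / 2 *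
  (CSeries (half_term (cterm (cusp_phase k h) (dual (IZR k) tp) w)) + signed_c (IZR k) (cusp_phase k h) w tp))%C.
Proof.
  destruct cusp_facts as [Hk0 [Nk [NZ [Ht Et]]]].
  destruct (cusp_points k h Z0 Hk HZ) as [Hti _]. fold tau in Hti.
  rewrite U1_CSeries by exact Hti.
  assert (E : forall m, theta_term (2 * z) tau m = cterm (cusp_phase k h) (dual (IZR k) tp) w m).
  { intros m. rewrite <- RtoC_mult. apply theta_term_cusp; assumption. }
  f_equal. f_equal.
  - apply CSeries_ext. intros n. apply half_term_ext, E.
  - apply CSeries_ext. intros n. apply half_term_ext. intros m. rewrite E.
    replace (m + Im (2 * z)%C / Im tau) with m; [reflexivity|].
    replace (Im (2 * z)%C) with 0 by (unfold Im; simpl; ring). unfold Rdiv. ring.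
Qed.

Lemma U1_dual_cusp : U1 (z / (Ci * Z0)) tau' = (Cstar (z / (Ci * Z0)) tau' / eta tau' / 2 *
  Cexp (PI * IZR k * (w * w) / Z0) *
  (CSeries (half_term (dterm (IZR k) (cusp_phase k h') tp w)) + signed_d (IZR k) (cusp_phase k h') w tp))%C.
Proof.
  destruct cusp_facts as [Hk0 [Nk [NZ [Ht Et]]]].
  destruct (cusp_points k h' Z0 Hk HZ) as [_ Hti]. fold tau' in Hti.
  rewrite U1_CSeries by exact Hti.
  replace (2 * (z / (Ci * Z0)))%C with z2 by (unfold z2, Cdiv; ring).
  rewrite cusp_shift.
  assert (E : forall m, theta_term z2 tau' m = (Cexp (PI * IZR k * (w * w) / Z0) * dterm (IZR k) (cusp_phase k h') tp w m)%C).
  { intros m. rewrite z2_eq. apply theta_term_dual_cusp; assumption. }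
  set (G := Cexp _) in *.
  assert (S0 : half_summable (dterm (IZR k) (cusp_phase k h') tp w)).
  { apply half_summable_ext with (fun m => 1 * dterm (IZR k) (cusp_phase k h') tp w m)%C; [intros; ring|].
    apply (dterm_summable (IZR k) (cusp_phase k h') Hk0 (fun m => Cmod_cusp_phase k h' m Hk) tp w _ 1 Ht).
    intros m. rewrite Cmod_1. destruct (one_le_sqr_weight m). lra. }
  rewrite <- Cmult_assoc. f_equal. rewrite Cmult_plus_distr_l. f_equal.
  - rewrite <- half_sum_scal by exact S0.
    apply CSeries_ext. intros n. apply half_term_ext, E.
  - unfold signed_d. rewrite <- half_sum_scal.
    + apply CSeries_ext; intros n.
      unfold half_term; pose proof (half_ge n) as Hn.
      (* The bound on k z enters here: [psi] at tau' carries the sign of m - k w, which agrees with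
         that of m. *)
      assert (W : Rabs (IZR k * w) < 1 / 2)
        by (unfold w; replace (IZR k * (2 * z)) with (2 * (IZR k * z)) by ring;
            rewrite Rabs_mult, (Rabs_right 2) by lra; lra).
      destruct (shifted_sign (IZR k) w W (half n)) as [_ N1]; [rewrite Rabs_right by lra; lra|].
      destruct (shifted_sign (IZR k) w W (- half n)) as [_ N2]; [rewrite Rabs_Ropp, Rabs_right by lra; lra|].
      unfold Rminus in N1, N2; rewrite N1, N2, !E; ring.
    + apply (half_summable_sign (fun m => m)), S0.
Qed.

Lemma cusp_window : Rabs (IZR k * w) < 1 / 2.
Proof.
  unfold w. replace (IZR k * (2 * z)) with (2 * (IZR k * z)) by ring. rewrite Rabs_mult, (Rabs_right 2) by lra. lra.
Qed.

Variable gamma : R -> C.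
Hypothesis Hgamma : is_E_path (IZR h' / IZR k) tau' gamma.

Let x0 := IZR h' / IZR k.
Let u := fun t => (gamma t - x0)%C.
Let u' := fun t => (Derive (fun s => Re (gamma s)) t, Derive (fun s => Im (gamma s)) t) : C.

(** With u = gamma - h'/k the integrand of E is a constant times [path_form]; the constant is
    inverse to the exponential in front of the integral. *)
Lemma E_cusp_signed : E_cusp h' k gamma z2 tau' =
  (signed_d (IZR k) (cusp_phase k h') w tp -
   cusp_const k h h' / Csqrt tp * signed_c (IZR k) (cusp_phase k h) w tp)%C.
Proof.
  destruct cusp_facts as [Hk0 [Nk [NZ [Ht Et]]]].
  destruct Hgamma as [L0 [[K Hcone] [Hd [Hup [Hcut [[e [T [He Hline]]] Hinf]]]]]].
  assert (EC : (Ci * Ci = -(1))%C) by Ccomp.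
  assert (Eu : forall t, (tp + Ci * u t)%C = (Ci * (gamma t - tau'))%C).
  { intros t. unfold u, x0. rewrite Et, RtoC_div by lra.
    transitivity (- (Ci * Ci) * tp + Ci * (gamma t - IZR h' / IZR k))%C; [rewrite EC|]; ring. }
  assert (Im_u : forall t, Im (u t) = Im (gamma t)) by (intros t; unfold u, Im; simpl; ring).
  assert (Hupu : forall t, 0 < t -> 0 < Im (u t)) by (intros t Ht0; rewrite Im_u; apply Hup, Ht0).
  (* A value off [slit] would place gamma on the excluded ray tau' + i [0, infinity). *)
  assert (Hslit : forall t, 0 < t -> slit (tp + Ci * u t)).
  { intros t Ht0 [S1 S2]. rewrite Eu in S1, S2. apply (Hcut t Ht0).
    change (gamma t - tau')%C with (gamma t + - tau')%C in *. unfold Re, Im in *. simpl in *. split; lra. }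
  unfold E_cusp, path_integral. rewrite cusp_shift. set (r := (- (IZR k * w))%R).
  rewrite (eichler_path_integral (IZR k) (cusp_const k h h') (cusp_phase k h) (cusp_phase k h') Hk0
    (fun m => Cmod_cusp_phase k h m Hk) (fun m => Cmod_cusp_phase k h' m Hk)
    (cusp_theta_dual k h h' Hk Hh Hi) w tp cusp_window Ht u u') with (a := Cexp (PI * Ci * (IZR h' / IZR k) * r ^ 2)) (K := K) (e := e).
  - rewrite Cmult_assoc, <- Cexp_plus.
    replace (- (PI * Ci * (IZR h' / IZR k) * r ^ 2) + PI * Ci * (IZR h' / IZR k) * r ^ 2)%C with (RtoC 0) by ring.
    rewrite Cexp_0. ring.
  - intros t Ht0. destruct (Hd t Ht0) as [D1 [D2 _]].
    apply cderiv_eq with (u' t - 0)%C; [ring|]. apply cderiv_minus; [|apply cderiv_const].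
    split; apply Derive_correct; assumption.
  - intros t Ht0. destruct (Hd t Ht0) as [_ [_ [D1 D2]]]. apply continuous_climit; assumption.
  - exact Hupu.
  - exact Hslit.
  - intros t Ht0. unfold E_integrand. rewrite cusp_shift. fold r. rewrite <- Eu.
    (* Completing the square in m gives (m - k w) times [dterm]; the surplus exponential in gamma is
       inverse to the one in [E_integrand], up to the constant phase at h'/k. *)
    assert (Term : forall m, (RtoC (m + r)%R * Cexp (PI * Ci * (m ^ 2 * gamma t + 2 * m * (z2 + (gamma t - tau') * r))))%C =
      (Cexp (PI * Ci * (IZR h' / IZR k) * r ^ 2) * Cexp (- (PI * Ci * r ^ 2 * gamma t)) *
        ((m - IZR k * w) * dterm (IZR k) (cusp_phase k h') (- Ci * u t) w m))%C).
    { intros m. replace (RtoC (m + r)) with (m - IZR k * w)%C by (unfold r; rewrite RtoC_plus, RtoC_opp, RtoC_mult; ring).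
      transitivity ((m - IZR k * w) * (Cexp (PI * Ci * (IZR h' / IZR k) * r ^ 2) * Cexp (- (PI * Ci * r ^ 2 * gamma t)) *
         dterm (IZR k) (cusp_phase k h') (- Ci * u t) w m))%C; [|ring].
      f_equal. unfold dterm, cusp_phase. rewrite <- !Cexp_plus.
      replace (gamma t) with (IZR h' / IZR k + u t)%C by (unfold u, x0; rewrite RtoC_div by lra; ring).
      rewrite z2_eq, Et. unfold r. rewrite RtoC_opp, RtoC_mult. unfold tp. f_equal.
      replace (w / (Ci * Z0))%C with (- Ci * (w / Z0))%C.
      2: { transitivity (- (Ci * Ci) * (w / Z0) / Ci)%C; [|rewrite EC]; field; split; try assumption; exact Ci_neq_0. }
      simpl. field. split; assumption. }
    destruct (path_sqrt_sqr tp u Hupu Hslit t Ht0) as [N [_ P]].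
    assert (Sd := dterm_summable (IZR k) (cusp_phase k h') Hk0 (fun m => Cmod_cusp_phase k h' m Hk) (- Ci * u t) w
      (fun m => (m - IZR k * w)%C) (1 + IZR k * Rabs w) P (shift_weight (IZR k) Hk0 w)).
    rewrite alt_half_sum_CSeries.
    2: { apply half_summable_ext with (1 := fun m => eq_sym (Term m)).
         apply half_summable_scal, Sd. }
    rewrite (CSeries_ext _ _ (fun n => half_term_ext _ _ n Term)), half_sum_scal by exact Sd.
    unfold path_form, path_sqrt. fold (u' t). set (S := CSeries _).
    assert (EX : (Cexp (PI * Ci * r ^ 2 * gamma t) * Cexp (- (PI * Ci * r ^ 2 * gamma t)))%C = 1%C)
      by (rewrite <- Cexp_plus, Cplus_opp_r; apply Cexp_0).
    fold (path_sqrt tp u t). unfold Cdiv.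
    match type of EX with (?a * ?b)%C = _ =>
      match goal with |- (a * (?c * b * S * ?d) * ?f)%C = _ =>
      transitivity ((a * b) * (c * (S * d * f)))%C; [ring|rewrite EX; ring] end end.
  - revert Hcone. apply filter_imp. intros t H. rewrite Im_u. exact H.
  - intros eps Heps. generalize (filterlim_climit _ _ _ L0 eps Heps). apply filter_imp.
    intros t H. rewrite Cminus_0_r. exact H.
  - exact He.
  - exists T. intros t HT. rewrite Eu. replace (Im (Ci * (gamma t - tau'))%C) with (Re (gamma t) - Re tau')
      by (unfold Re, Im; simpl; ring). rewrite Hline by lra. ring.
  - intros X. destruct (Hinf (fun y => X <= y)) as [M HM]; [exists X; intros; lra|].
    exists M. intros t HT. rewrite Im_u. apply HM, HT.
Qed.

End cusp.

Theorem theorem3p3 (k h h' : Z) (Z0 : C) (z : R) (gamma : R -> C)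
  (hk : (1 <= k)%Z) (hh : (0 <= h < k)%Z) (hgcd : Z.gcd h k = 1%Z)
  (hh' : is_neg_inv h k h')
  (hZ : 0 < Re Z0) (hz : Rabs (IZR k * z) < 1 / 4) :
  let tau' : C := (IZR h' / IZR k + Ci / (IZR k * Z0))%C in
  let z' : C := (z / (Ci * Z0))%C in
  is_E_path (IZR h' / IZR k) tau' gamma ->
  U1 z (IZR h / IZR k + Ci * Z0 / IZR k)%C =
  (- Ci * / chi (Mhk h k h') * Cpower (Ci * Z0) (- / 2)%R *
   (f_nu (3 * IZR k)%R z (- Z0) * U1 z' tau' +
    / 2 * f_nu (IZR k) z Z0 * (Cstar z' tau' / eta tau') *
      E_cusp h' k gamma (2 * z / (Ci * Z0)) tau'))%C.
Proof.
  intros tau' z' Hg.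
  destruct (cusp_transformation k h h' Z0 hk hh hh' hZ) as [NX [_ _]]. cbv zeta in NX.
  assert (NCZ : (Ci * Z0)%C <> 0%C) by (apply Cmult_neq_0; [exact Ci_neq_0|apply slit_neq_0, Re_pos_slit, hZ]).
  pose proof (Csqrt_sqr _ NCZ) as Es.
  assert (Ep : Cpower (Ci * Z0) (- / 2)%R = (/ Csqrt (Ci * Z0))%C)
    by (unfold Csqrt; rewrite <- Cpower_opp, RtoC_opp; reflexivity).
  assert (Ns : Csqrt (Ci * Z0) <> 0%C) by (intros K; apply NCZ; rewrite <- Es, K; ring).
  pose proof (E_cusp_signed k h h' Z0 z hk hh hh' hZ hz gamma Hg) as EE.
  pose proof (U1_dual_cusp k h' Z0 z hk hZ hz) as EU. fold tau' in EE, EU. fold z' in EU.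
  rewrite Ep, EE, EU, (U1_cusp k h h' Z0 z hk hZ).
  pose proof (Cstar_transformation k h h' Z0 z hk hh hh' hZ hz) as EC. cbv zeta in EC.
  fold tau' z' in EC |- *. rewrite EC.
  destruct (cusp_facts k h' Z0 hk hZ) as [_ [_ [_ [Ht _]]]].
  rewrite (cusp_theta_dual k h h' hk hh hh' _ (2 * z) Ht).
  rewrite cusp_const_eq by assumption.
  set (S1 := CSeries _). set (S2 := signed_c _ _ _ _). set (S3 := signed_d _ _ _ _).
  set (X := chi (Mhk h k h')) in *. set (s := Csqrt (Ci * Z0)) in *.
  set (P := (Cstar z' tau' / eta tau')%C).
  pose proof (f_nu_neg (IZR k) z Z0 hZ) as EF.
  set (F := f_nu (IZR k) z Z0) in *. set (F3 := f_nu (3 * IZR k) z (- Z0)) in *. set (G := Cexp _) in *.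
  (* With [f_nu_neg] the signed series S3 at tau' occurs with opposite signs in the two summands and
     cancels; what remains is the transformed theta series S1 and the signed series S2 at tau. *)
  transitivity (- Ci * / X * / s * (P / 2 * ((F3 * G) * (X ^ 3 * s * S1 + S3) + F * (S3 - X ^ 3 * s * S2))))%C.
  - rewrite EF. simpl. field. split; assumption.
  - simpl. field. split; assumption.
Qed.
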